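(* Let $L\in\mathcal L$ be an oriented Lagrangian torus (homeomorphic to $T^n$) with a spin structure such that every $\beta\in H_2(X,L;\mathbb Z)$ with $\beta\neq0$ and $\mathscr M_1(L;\beta)\ne\emptyset$ satisfies $\mu_L(\beta)\ge2$. Let $b$ be a Maurer–Cartan element corresponding to a non-degenerate critical point of the potential function $W_L$. Then there exists an idempotent $e_b\in QH^\bullet(X)$ (the idempotent corresponding to $b$, lying in the image of $\mathfrak p$ restricted to the Hochschild homology of the full subcategory with the single object $(L,b)$) such that $QH^\bullet(X)\,e_b\cong\Lambda$. Moreover, if $b'\neq b$ is another non-degenerate critical point of $W_L$ and $e_{b'}$ is the idempotent corresponding to it, then $e_b*e_{b'}=0$.
   Context: **Setting.** $(X,\omega)$ is a compact symplectic manifold of real dimension $2n$ with a compatible almost complex structure. $\Lambda=\{\sum_{i\ge0}a_iT^{\lambda_i}\mid a_i\in\mathbb C,\lambda_i\in\mathbb R,\lambda_i\to\infty\}$ is the universal Novikov field, $\Lambda_0$ its valuation ring, $\Lambda_+$ the maximal ideal. Everything is $\mathbb Z/2$-graded; $|x|'=|x|-1$. $QH^\bullet(X)=H^\bullet(X;\Lambda)$ with quantum product $*$: $\langle x_1*x_2,x_3\rangle_X=\sum_{\alpha\in H_2(X;\mathbb Z)}T^{\omega(\alpha)/2\pi}\mathrm{GW}_3(\alpha;x_1,x_2,x_3)$ (genus $0$ Gromov–Witten invariants), $\langle x,y\rangle_X=\int_Xx\cup y$, unit $1_X$. **Disk operators.** For a compact oriented spin Lagrangian $L$ with Maslov class $\mu_L\in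 H^2(X,L;\mathbb Z)$ one is given the Fukaya–Oh–Ohta–Ono maps $m_{s,\beta}:H^\bullet(L;\mathbb C)^{\otimes s}\to H^\bullet(L;\mathbb C)$, $\beta\in H_2(X,L;\mathbb Z)$, built from moduli spaces $\mathscr M_{s+1}(L;\beta)$ of stable disks of class $\beta$ with $s+1$ boundary marked points, with: (i) degree $2-s-\mu_L(\beta)$; (ii) $m_{s,\beta}\neq0$ implies $\beta=\beta_1+\cdots+\beta_m$ with $\mathscr M_{s+1}(L;\beta_i)\ne\emptyset$; (iii) $m_{0,0}=m_{1,0}=0$, $m_{2,0}(x_1,x_2)=(-1)^{|x_1||x_2|+|x_1|}x_1\cup x_2$; (iv) $\sum_{s_1+s_2=s+1,\,\beta_1+\beta_2=\beta}(-1)^{|x_1|'+\cdots+|x_i|'}m_{s_1,\beta_1}(x_1,\dots,x_i,m_{s_2,\beta_2}(x_{i+1},\dots),\dots,x_s)=0$; (v) $m_{s,\beta}(\dots,1_L,\dots)=0$ if $\beta\ne0$ or $s\ge3$; (vi) $\langle m_{s,\beta}(x_1,\dots,x_s),x_0\rangle_{\rm cyc}=(-1)^{|x_0|'(|x_1|'+\cdots+|x_s|')}\langle m_{s,\beta}(x_0,\dots,x_{s-1}),x_s\rangle_{\rm cyc}$ for $\langle x_1,x_2\rangle_{\rm cyc}=(-1)^{|x_1||x_2|+|x_1|}\int_Lx_1\cup x_2$. A Maurer–Cartan element is a pair $b=(\rho,b_+)$, $\rho:\pi_1(L)\to\mathbb C^\times$, $b_+\in H^{\rm odd}(L;\Lambda_+)$,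 with $\sum_{s,\beta}\rho(\partial\beta)T^{\omega(\beta)/2\pi}m_{s,\beta}(b_+,\dots,b_+)=W_{L,b}\cdot1_L$ for some $W_{L,b}\in\Lambda$; $L$ is weakly unobstructed if one exists. **Fukaya category (standing assumption).** $\mathcal L$ is a finite set of weakly unobstructed, pairwise transverse, compact oriented spin Lagrangians. There is an $n$-cyclic strictly unital $A_\infty$ category $\mathrm{Fuk}(X)^{\mathcal L}$ over $\Lambda$ (finite-dimensional hom spaces, non-degenerate degree-$n$ pairings $\langle\,,\rangle_{\rm cyc}:\hom(A,B)\otimes\hom(B,A)\to\Lambda$ with $\langle m_{s-1}(x_1,\dots,x_{s-1}),x_s\rangle_{\rm cyc}=(-1)^{|x_s|'(|x_1|'+\cdots+|x_{s-1}|')}\langle m_{s-1}(x_s,x_1,\dots,x_{s-2}),x_{s-1}\rangle_{\rm cyc}$). Objects: pairs $(L,b)$ with $L\in\mathcal L$, $b$ a Maurer–Cartan element of $L$. $\hom((L_1,b_1),(L_2,b_2))$ is $0$ if $W_{L_1,b_1}\ne W_{L_2,b_2}$; otherwise $H^\bullet(L_1;\mathscr Hom(\rho_1,\rho_2))\otimes\Lambda$ if $L_1=L_2$ (local system $\rho_2\rho_1^{-1}$), and $\bigoplus_{p\in L_1\cap L_2}\Lambda\langle p\rangle$ if $L_1\neq L_2$. For objects $(L,b_i)$, $b_i=(\rho,b_{i,+})$, with the same $L,\rho,W$: $m_s(x_1,\dots,x_s)=\sum_{l_i\ge0,\beta}\rho(\partial\beta)T^{\omega(\beta)/2\pi}m_{s+l_0+\cdots+l_s,\beta}(b_{0,+}^{\otimes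 l_0},x_1,b_{1,+}^{\otimes l_1},\dots,x_s,b_{s,+}^{\otimes l_s})$, unit $1_L$, pairing as in (vi). $HF^\bullet(L,b)=H^\bullet\hom((L,b),(L,b))$ is a ring with $x\cdot y=(-1)^{|x||y|+|x|}[m_2](x,y)$. **Open-closed maps (standing assumption).** $HH^\bullet$, $HH_\bullet$ are Hochschild cohomology (a unital ring) and homology (a module over it by cap product), $\langle\,,\rangle_{\rm Muk}$ the Mukai pairing on $HH_\bullet$; on length-$0$ classes $x_0\in H^\bullet\hom(A,A)$, $x_0'\in H^\bullet\hom(A',A')$ it is $\mathrm{str}(x''\mapsto(-1)^{|x_0||x''|+|x_0||x_0'|}x_0\cdot x''\cdot x_0')$ on $H^\bullet\hom(A,A')$. The cyclic structure gives $\langle\varphi,x_0[x_1|\cdots|x_s]\rangle_{\rm cyc}=(-1)^{|x_0|'(|x_1|'+\cdots+|x_s|')}\langle\varphi_s(x_1,\dots,x_s),x_0\rangle_{\rm cyc}$ on $HH^\bullet\otimes HH_\bullet$. There is $\mathfrak q:QH^\bullet(X)\to HH^\bullet(\mathrm{Fuk}(X)^{\mathcal L})$; $\mathfrak p:HH_\bullet(\mathrm{Fuk}(X)^{\mathcal L})\to QH^{\bullet+n}(X)$ is defined by $\langle x,\mathfrak p(\mathbb X)\rangle_X=(-1)^{n|\mathbb X|}\langle\mathfrak q(x),\mathbb X\rangle_{\rm cyc}$. They satisfy: (1) $\mathfrak q$ is a unital ring homomorphism; (2) for $\eta\in H^2_c(X\setminus L;\mathbb C)$ the length-$0$ component of $\mathfrak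 q(\eta)$ at $(L,b)$ is $\sum_{\beta,s}\langle\eta,\beta\rangle\rho(\partial\beta)T^{\omega(\beta)/2\pi}m_{s,\beta}(b_+,\dots,b_+)$; (3) $\langle\mathfrak p(\mathbb X),\mathfrak p(\mathbb X')\rangle_X=(-1)^{n(n+1)/2+\sigma}\langle\mathbb X,\mathbb X'\rangle_{\rm Muk}$ with $\sigma$ depending only on the parities of $n$ and $|\mathbb X|$; (4) $\mathfrak p(1_L)=[L]$, where $\int_Lx|_L=\int_X[L]\cup x$. **Potential function.** Under the index condition in the claim, $m_{0,\beta}(1)=n_\beta1_L$ with $n_\beta\in\mathbb Q$, $m_{s,\beta}(b_+,\dots,b_+)=\frac{\langle\partial\beta,b_+\rangle^s}{s!}m_{0,\beta}(1)$ for $b_+\in H^1$, and all pairs $(\rho,b_+)$ with $b_+\in H^1(L;\Lambda_+)$ are Maurer–Cartan elements. Via $(\rho,b_+)\mapsto\rho\,e^{b_+}$ they are identified with $H^1(L;\Lambda_{=0}):=\mathrm{Hom}(H_1(L;\mathbb Z),\Lambda_0^* )$. The potential is $W_L=\sum_{\mu_L(\beta)=2}n_\beta T^{\omega(\beta)/2\pi}y^{\partial\beta}$, a function on $H^1(L;\Lambda_{=0})$ with $W_L(b)=W_{L,b}$. With $y_i=y^{e_i}$ for a basis $e_i$ of $H_1(L;\mathbb Z)$, $b$ is a critical point if $y_i\,\partial W_L/\partial y_i(b)=0$ for all $i$, non-degenerate if $\det\big[y_iy_j\,\partial^2W_L/\partial y_i\partial y_j(b)\big]\neq0$. *)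

(* Defs.v *)
From HB Require Import structures.
From mathcomp Require Import all_boot all_order all_algebra.
From mathcomp Require Import finmap.
From mathcomp Require Import all_classical all_reals.
From mathcomp Require Import topology normedtype derive trigo.
From mathcomp Require Import measure lebesgue_measure lebesgue_integral.
From mathcomp Require Import complex.
From mathcomp Require Import lra.

Set Implicit Arguments.
Unset Strict Implicit.
Unset Printing Implicit Defensive.

Import Order.TTheory GRing.Theory Num.Theory.
Import numFieldNormedType.Exports.

Local Open Scope classical_set_scope.
Local Open Scope ring_scope.

Section Novikov.
Variables (R : realType) (K : fieldType).

Record nov := Nov {
  ncoef :> R -> K;
  ncoefP : forall E : R, finite_set [set l | l <= E /\ ncoef l != 0] }.

HB.instance Definition _ := gen_eqMixin nov.
HB.instance Definition _ := gen_choiceMixin nov.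

Lemma novP (f g : nov) : (forall l, f l = g l) -> f = g.
Proof.
case: f g => [f Pf] [g Pg] /= fg; have {}fg : f = g by apply/funext.
by rewrite -fg in Pg *; congr Nov; exact: Prop_irrelevance.
Qed.

Fact nov0_subproof (E : R) : finite_set [set l | l <= E /\ (0 : K) != 0].
Proof. by apply: sub_finite_set (finite_set0 R) => l [_ /eqP]. Qed.

Definition nov0 := @Nov (fun=> 0) nov0_subproof.

(* c T^a *)
Fact nmon_subproof (c : K) (a E : R) :
  finite_set [set l | l <= E /\ (if l == a then c else 0) != 0].
Proof.
apply: (@sub_finite_set _ _ [set a]); last exact: finite_set1.
by move=> l [_] /=; case: (eqVneq l a) => [->|_ /eqP].
Qed.

Definition nmon (c : K) (a : R) := Nov (nmon_subproof c a).

Fact nopp_subproof (f : nov) (E : R) :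
  finite_set [set l | l <= E /\ - f l != 0].
Proof.
by apply: sub_finite_set (ncoefP f E) => l [lE]; rewrite oppr_eq0; split.
Qed.

Definition nopp f := Nov (nopp_subproof f).

Fact nadd_subproof (f g : nov) (E : R) :
  finite_set [set l | l <= E /\ f l + g l != 0].
Proof.
have : finite_set ([set l | l <= E /\ f l != 0] `|` [set l | l <= E /\ g l != 0]).
  by rewrite finite_setU; split; exact: ncoefP.
apply: sub_finite_set => l [lE fg]; case: (eqVneq (f l) 0) => f0.
  by right; split=> //; rewrite f0 add0r in fg.
by left.
Qed.

Definition nadd f g := Nov (nadd_subproof f g).

Fact naddA : associative nadd.
Proof. by move=> f g h; apply: novP => l /=; rewrite addrA. Qed.
Fact naddC : commutative nadd.
Proof. by move=> f g; apply: novP => l /=; rewrite addrC. Qed.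
Fact nadd0 : left_id nov0 nadd.
Proof. by move=> f; apply: novP => l /=; rewrite add0r. Qed.
Fact naddN : left_inverse nov0 nopp nadd.
Proof. by move=> f; apply: novP => l /=; rewrite addNr. Qed.

HB.instance Definition _ := GRing.isZmodule.Build nov naddA naddC nadd0 naddN.

Let lmin (d : R) (s : seq R) := foldr Order.min d s.

Let lmin_le d s : lmin d s <= d.
Proof. by elim: s => //= x s IHs; rewrite ge_min IHs orbT. Qed.

Let lmin_mem d s x : x \in s -> lmin d s <= x.
Proof.
elim: s => //= y s IHs; rewrite inE ge_min => /predU1P[->|/IHs->].
  by rewrite lexx.
by rewrite orbT.
Qed.

Let lmin_ind (P : R -> Prop) d s : P d -> (forall x, x \in s -> P x) ->
  P (lmin d s).
Proof.
move=> Pd; elim: s => //= x s IHs Ps.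
have Px := Ps x (mem_head _ _).
have {IHs}Pl : P (lmin d s) by apply: IHs => y ys; apply: Ps; rewrite inE ys orbT.
by case: leP.
Qed.

(* f \in T^E Lambda_0 *)
Definition nval_ge (E : R) (f : nov) := forall l, l < E -> f l = 0.

Fact nov_lb (f : nov) : exists a, nval_ge a f.
Proof.
pose S := fset_set [set l | l <= 0 /\ f l != 0].
exists (lmin 0 S) => l ltl.
apply/eqP/negPn/negP => fl.
have l0 : l <= 0.
  exact/ltW/(lt_le_trans ltl)/lmin_le.
have lS : l \in S by rewrite in_fset_set ?inE //; exact: ncoefP.
by move: ltl; rewrite ltNge lmin_mem.
Qed.

Definition nmulf (f g : nov) (l : R) : K :=
  \sum_(m \in [set: R]) f m * g (l - m).

Fact nmulfE (f g : nov) a l (S : {fset R}) : nval_ge a g ->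
  (forall m, m <= l - a -> f m != 0 -> m \in S) ->
  nmulf f g l = \sum_(m <- S) f m * g (l - m).
Proof.
move=> ga HS; apply: fsbigTE => m mS; case: (lerP m (l - a)) => [ml|ml].
  by case: (eqVneq (f m) 0) => [->|/(HS _ ml)]; rewrite ?mul0r // (negPf mS).
by rewrite ga ?mulr0 // ltrBlDr -ltrBlDl.
Qed.

Fact nmulfC (f g : nov) l : nmulf f g l = nmulf g f l.
Proof.
rewrite /nmulf (reindex_fsbigT (fun m => l - m)).
  by apply: eq_fsbigr => m _; rewrite subKr mulrC.
by exists (fun m => l - m) => m; rewrite subKr.
Qed.

Fact nmulf_neq0 (f g : nov) l : nmulf f g l != 0 ->
  exists m, f m != 0 /\ g (l - m) != 0.
Proof.
move=> fg; apply: contrapT => H; case/eqP: fg; apply: fsbig1 => m _.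
apply/eqP/negPn/negP; rewrite mulf_eq0 negb_or => /andP[fm gm].
by apply: H; exists m.
Qed.

Fact nval_lt a (f : nov) m : nval_ge a f -> f m != 0 -> a <= m.
Proof. by move=> fa; rewrite leNgt; apply: contra => /fa ->. Qed.

Fact nmul_subproof (f g : nov) (E : R) : finite_set [set l | l <= E /\ nmulf f g l != 0].
Proof.
have [a fa] := nov_lb f; have [b gb] := nov_lb g.
apply: (@sub_finite_set _ _ ((fun p : R * R => p.1 + p.2) @`
  ([set l | l <= E - b /\ f l != 0] `*` [set l | l <= E - a /\ g l != 0]))).
  move=> l [lE /nmulf_neq0[m [fm gm]]]; exists (m, l - m); last first.
    by rewrite /= addrC subrK.
  by move: (nval_lt fa fm) (nval_lt gb gm) => ? ?; split; split=> //=; lra.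
by apply/finite_image/finite_setX; exact: ncoefP.
Qed.

Definition nmul f g := Nov (nmul_subproof f g).

Fact nval_geM a b (f g : nov) : nval_ge a f -> nval_ge b g -> nval_ge (a + b) (nmul f g).
Proof.
move=> fa gb l lab; apply/eqP/negPn/negP => /nmulf_neq0[m [fm gm]].
by move: (nval_lt fa fm) (nval_lt gb gm); lra.
Qed.

Fact nmulC : commutative nmul.
Proof. by move=> f g; apply: novP => l; exact: nmulfC. Qed.

Fact nmulA : associative nmul.
Proof.
move=> f g h; rewrite [RHS]nmulC; apply: novP => l /=.
have [a fa] := nov_lb f; have [b gb] := nov_lb g; have [c hc] := nov_lb h.
pose S (k : nov) E := fset_set [set l | l <= E /\ k l != 0].
have inS (k : nov) E m : m <= E -> k m != 0 -> m \in S k E.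
  by move=> mE km; rewrite in_fset_set ?inE //; exact: ncoefP.
have SP (k : nov) E m : m \in S k E -> k m != 0.
  by rewrite in_fset_set ?inE => [[]//|]; exact: ncoefP.
rewrite (@nmulfE _ (nmul g h) (b + c) _ (S f (l - (b + c)))); last first.
- by move=> m; exact: inS.
- exact: nval_geM.
rewrite (@nmulfE _ (nmul f g) (a + b) _ (S h (l - (a + b)))); last first.
- by move=> m; exact: inS.
- exact: nval_geM.
transitivity (\sum_(k <- S f (l - (b + c))) \sum_(p <- S h (l - (a + b)))
    f k * (h p * g (l - k - p))).
  rewrite !big_seq; apply: eq_bigr => k kS; rewrite /= nmulfC -mulr_sumr.
  congr (_ * _); apply: (nmulfE gb) => p pl; apply: inS.
  by move: (nval_lt fa (SP _ _ _ kS)); lra.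
rewrite exchange_big /= !big_seq; apply: eq_bigr => p pS /=.
rewrite (@nmulfE _ _ b _ (S f (l - (b + c)))) //; last first.
  by move=> k kl; apply: inS; move: (nval_lt hc (SP _ _ _ pS)); lra.
rewrite mulr_sumr; apply: eq_bigr => k _; rewrite mulrCA.
by congr (_ * (_ * g _)); rewrite addrAC.
Qed.

Fact nmul1 : left_id (nmon 1 0) nmul.
Proof.
move=> f; apply: novP => l /=; rewrite /nmulf (fsbigTE [fset 0]%fset).
  by rewrite big_seq_fset1 /= eqxx mul1r subr0.
by move=> m; rewrite inE /= => /negPf ->; rewrite mul0r.
Qed.

Fact nmulDl : left_distributive nmul nadd.
Proof.
move=> f g h; apply: novP => l /=.
have [c hc] := nov_lb h.
pose S := fset_set ([set m | m <= l - c /\ f m != 0] `|`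
                    [set m | m <= l - c /\ g m != 0]).
have Sf : finite_set ([set m | m <= l - c /\ f m != 0] `|`
                    [set m | m <= l - c /\ g m != 0]).
  by rewrite finite_setU; split; exact: ncoefP.
rewrite !(@nmulfE _ h c _ S) //.
- by rewrite -big_split; apply: eq_bigr => m _; rewrite mulrDl.
- by move=> m ml gm; rewrite in_fset_set // inE; right.
- by move=> m ml fm; rewrite in_fset_set // inE; left.
move=> m ml; rewrite in_fset_set // inE /=.
case: (eqVneq (f m) 0) => [->|fm _]; last by left.
by rewrite add0r; right.
Qed.

Fact nov1_neq0 : nmon 1 0 != 0 :> nov.
Proof.
apply/eqP => /(congr1 (fun f : nov => f 0)) /eqP /=.
by rewrite eqxx oner_eq0.
Qed.

HB.instance Definition _ :=
  GRing.Zmodule_isComNzRing.Build nov nmulA nmulC nmul1 nmulDl nov1_neq0.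

Fact novD (f g : nov) l : (f + g) l = f l + g l. Proof. by []. Qed.
Fact novN (f : nov) l : (- f) l = - f l. Proof. by []. Qed.
Fact novM (f g : nov) l : (f * g) l = nmulf f g l. Proof. by []. Qed.
Fact nov1E l : (1 : nov) l = if l == 0 then 1 else 0. Proof. by []. Qed.
Fact nov_sumE I (r : seq I) (F : I -> nov) l :
  (\sum_(i <- r) F i) l = \sum_(i <- r) F i l.
Proof. by apply: (big_morph (fun f : nov => f l)). Qed.

Fact nmonM c d a b : nmon c a * nmon d b = nmon (c * d) (a + b) :> nov.
Proof.
apply: novP => l; rewrite novM /nmulf (fsbigTE [fset a]%fset).
  rewrite big_seq_fset1 /= eqxx; have -> : (l - a == b) = (l == a + b).
    by rewrite subr_eq addrC.
  by case: ifP; rewrite ?mulr0.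
by move=> m; rewrite inE /= => /negPf ->; rewrite mul0r.
Qed.

Fact nval_geX d (u : nov) n : nval_ge d u -> nval_ge (n%:R * d) (u ^+ n).
Proof.
move=> ud; elim: n => [|n IHn].
  by rewrite mul0r expr0 => l l0; rewrite nov1E lt_eqF.
by rewrite exprS -natr1 mulrDl mul1r addrC; exact: nval_geM.
Qed.

Fact ngeom_subproof (u : nov) d : 0 < d -> nval_ge d u ->
  exists g : nov, g * (1 - u) = 1.
Proof.
move=> d0 ud; pose N (l : R) := (Num.truncn (l / d)).+1.
have NP l : l < (N l)%:R * d.
  rewrite -ltr_pdivrMr //; apply: real_truncnS_gt; exact: num_real.
pose gs n : nov := \sum_(i < n) u ^+ i.
have gsE n l : l < n%:R * d -> forall m, (n <= m)%N -> gs m l = gs n l.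
  move=> nl m /subnK <-; elim: (m - n)%N => // k IHk.
  rewrite addSn /gs big_ord_recr novD -/(gs _) IHk (nval_geX ud) ?addr0 //.
  by apply: (lt_le_trans nl); rewrite ler_pM2r // ler_nat leq_addl.
pose gf l := gs (N l) l.
have gfE n l : l < n%:R * d -> gs n l = gf l.
  move=> nl; have [h|h] := leqP n (N l); first by rewrite /gf (gsE n).
  by rewrite /gf (gsE (N l)) // ltnW.
have gP E : finite_set [set l | l <= E /\ gf l != 0].
  apply: sub_finite_set (ncoefP (gs (N E)) E) => l [lE gl]; split=> //.
  by rewrite gfE //; exact: (le_lt_trans lE).
exists (Nov gP); rewrite mulrC.
apply: novP => l; rewrite novM.
transitivity (((1 - u) * gs (N l)) l).
  rewrite novM; apply: eq_fsbigr => m _; case: (ltrP m 0) => m0.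
    rewrite (_ : (1 - u) m = 0) ?mul0r // novD novN nov1E lt_eqF // ud ?subr0 //.
    exact: lt_trans d0.
  by congr (_ * _); rewrite /= gfE //; apply: le_lt_trans (NP l); lra.
have -> : (1 - u) * gs (N l) = 1 - u ^+ N l.
  by rewrite -(opprB u 1) mulNr -subrX1 opprB.
by rewrite novD novN (nval_geX ud) // subr0.
Qed.

Fact nov_unit_subproof (f : nov) : f != 0 -> exists g : nov, g * f = 1.
Proof.
move=> f0; have [l fl] : exists l, f l != 0.
  apply: contrapT => H; case/eqP: f0; apply: novP => l /=.
  by apply/eqP/negPn/negP => fl; apply: H; exists l.
pose S E := fset_set [set l | l <= E /\ f l != 0].
have inS E m : (m \in S E) = (m <= E) && (f m != 0).
  rewrite in_fset_set; last exact: ncoefP.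
  by apply/idP/andP; rewrite inE.
(* a is the smallest exponent; there is none in ]a, b[ *)
pose a := lmin l (S l).
have [aS aP] : a \in S l /\ nval_ge a f.
  split; last first.
    move=> m ma; apply/eqP/negPn/negP => fm.
    have ml : m <= l.
      exact/ltW/(lt_le_trans ma)/lmin_le.
    have mS : m \in S l by rewrite inS ml.
    by move: ma; rewrite ltNge lmin_mem.
  by apply: (lmin_ind (P := fun x => x \in S l)) => //; rewrite inS lexx.
have fa : f a != 0 by move: aS; rewrite inS => /andP[].
pose S' := [fset m in S (a + 1)%R | (a < m)%R]%fset.
pose b := lmin (a + 1) S'.
have ab : a < b.
  apply: (lmin_ind (P := fun x => a < x)) => [|m]; first by rewrite ltrDl.
  by rewrite !inE => /andP[].
have bP m : a < m -> m < b -> f m = 0.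
  move=> am mb; apply/eqP/negPn/negP => fm.
  have m1 : m <= a + 1.
    exact/ltW/(lt_le_trans mb)/lmin_le.
  have mS : m \in S' by rewrite !inE inS m1 fm.
  by move: mb; rewrite ltNge lmin_mem.
pose u := 1 - nmon (f a)^-1 (- a) * f.
have uE m : (nmon (f a)^-1 (- a) * f) m = (f a)^-1 * f (m + a).
  rewrite novM /nmulf (fsbigTE [fset (- a)]%fset).
    by rewrite big_seq_fset1 /= eqxx opprK.
  by move=> k; rewrite inE /= => /negPf ->; rewrite mul0r.
have [|m mb|g gE] := @ngeom_subproof u (b - a); first by rewrite subr_gt0.
  rewrite /u novD novN uE nov1E; case: eqP => [->|/eqP m0].
    by rewrite add0r mulVf // subrr.
  case: (ltrP m 0) => [m0'|m0']; first by rewrite (aP (m + a)) ?mulr0 ?subr0 // gtrDr.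
  have {m0 m0'} m0 : 0 < m by rewrite lt0r m0.
  by rewrite (bP (m + a)) ?mulr0 ?subr0 // ?ltrDr // -ltrBrDr.
exists (g * nmon (f a)^-1 (- a)).
by rewrite -mulrA -[RHS]gE /u opprB addrCA subrr addr0.
Qed.

Definition ninv (f : nov) : nov :=
  if pselect (exists g : nov, g * f = 1) is left h then projT1 (cid h) else f.

Fact nmulVf (f : nov) : f != 0 -> ninv f * f = 1.
Proof.
move=> /nov_unit_subproof h; rewrite /ninv; case: pselect => // h'.
by case: cid.
Qed.

Fact ninv0 : ninv 0 = 0.
Proof.
rewrite /ninv; case: pselect => // h; case: cid => g /= /eqP.
by rewrite mulr0 eq_sym oner_eq0.
Qed.

HB.instance Definition _ := GRing.ComNzRing_isField.Build nov nmulVf ninv0.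


(* Lambda_+ *)
Definition nval_gt0 (f : nov) := forall l, l <= 0 -> f l = 0.

(* T-adic sum of a family: all but finitely many terms lie in T^E Lambda_0,
   for every E, and the coefficients add up. *)
Definition nsums (I : choiceType) (F : I -> nov) (S : nov) :=
  (forall E, finite_set [set i | ~ nval_ge E (F i)]) /\
  (forall l, S l = \sum_(i \in [set: I]) F i l).

(* Total version, 0 when the family is not summable. *)
Definition nsum (I : choiceType) (F : I -> nov) : nov := xget 0 (nsums F).

Definition nconst (c : K) := nmon c 0.
Definition nT (a : R) := nmon 1 a.

Definition nexp (a : nov) : nov :=
  nsum (fun k : nat => (k`!%:R)^-1 * a ^+ k).

End Novikov.

Arguments nov : clear implicits.

(* Multilinear maps are given by their values on words in a basis I;
   mlext f [:: x_1; ..; x_s] is the value at (x_1, .., x_s). *)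
Fixpoint mlext (A : pzRingType) (I : finType) (f : seq I -> A)
    (xs : seq (I -> A)) : A :=
  if xs is x :: xs' then \sum_i x i * mlext (fun w => f (i :: w)) xs'
  else f [::].

(* All (w1, w2, w3) with w = w1 ++ w2 ++ w3. *)
Definition split3 (T : Type) (w : seq T) : seq (seq T * seq T * seq T) :=
  [seq (take i w, drop i (take j w), drop j w) |
    i <- iota 0 (size w).+1, j <- iota i ((size w).+1 - i)].

(* |x_1|' + .. + |x_s|' mod 2, where |x|' = |x| - 1 and p x = |x| mod 2. *)
Definition shpar (T : Type) (p : T -> bool) (w : seq T) : nat :=
  count (fun x => ~~ p x) w.

Definition character (R : realType) (M : zmodType) (chi : M -> R[i]) :=
  chi 0 = 1 /\ forall x y, chi (x + y) = chi x * chi y.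

Record zbasis (M : zmodType) (n : nat) := ZBasis {
  zb :> 'I_n -> M;
  zcoord : M -> 'I_n -> int;
  zbK : forall x, x = \sum_i zb i *~ zcoord x i;
  zcoordK : forall (k : 'I_n -> int) j, zcoord (\sum_i zb i *~ k i) j = k j }.

Definition homeomorphic (X Y : topologicalType) (A : set X) (B : set Y) :=
  exists (f : X -> Y) (g : Y -> X),
    [/\ f @` A `<=` B /\ g @` B `<=` A,
        {in A, cancel f g} /\ {in B, cancel g f},
        {within A, continuous f} & {within B, continuous g}].

Definition torus (R : realType) (n : nat) : set 'M[R]_(n, 2) :=
  [set z | forall i, z i 0 ^+ 2 + z i 1 ^+ 2 = 1].

Arguments torus : clear implicits.

Section Smooth.
Variable R : realType.

Definition pderiv m (i : 'I_m) (g : 'rV[R]_m -> R) (x : 'rV[R]_m) : R :=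
  derive1 (fun t : R => g (x + t *: delta_mx 0 i)) 0.

Fixpoint Ck (k m : nat) (U : set 'rV[R]_m) (g : 'rV[R]_m -> R) : Prop :=
  (forall x, U x -> {for x, continuous g}) /\
  if k is k'.+1 then forall i : 'I_m,
    (forall x, U x -> derivable (fun t : R => g (x + t *: delta_mx 0 i)) 0 1) /\
    Ck k' U (pderiv i g)
  else True.

Definition smooth_fun m (U : set 'rV[R]_m) (g : 'rV[R]_m -> R) : Prop :=
  forall k, Ck k U g.

Definition smooth m d (U : set 'rV[R]_m) (f : 'rV[R]_m -> 'rV[R]_d) : Prop :=
  forall j, smooth_fun U (fun x => f x 0 j).

(* df_x (v) = v *m jac f x *)
Definition jac m d (f : 'rV[R]_m -> 'rV[R]_d) (x : 'rV[R]_m) : 'M[R]_(m, d) :=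
  \matrix_(i, j) pderiv i (fun y => f y 0 j) x.

(* A smooth d-manifold with a symplectic form omega (v, w) = v *m sform *m w^T
   and a compatible almost complex structure v |-> v *m acs, in charts. *)
Record symplectic (X : topologicalType) (d : nat) := Symplectic {
  chart : Type;
  chdom : chart -> set X;
  chmap : chart -> X -> 'rV[R]_d;
  chinv : chart -> 'rV[R]_d -> X;
  chdom_open : forall c, open (chdom c);
  chcover : forall p, exists c, chdom c p;
  chmap_open : forall c, open (chmap c @` chdom c);
  chmapK : forall c p, chdom c p -> chinv c (chmap c p) = p;
  chmap_continuous : forall c, {within chdom c, continuous (chmap c)};
  chinv_continuous : forall c,
    {within chmap c @` chdom c, continuous (chinv c)};
  chtrans_smooth : forall c c',
    smooth (chmap c @` (chdom c `&` chdom c')) (chmap c' \o chinv c);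
  sform : chart -> 'rV[R]_d -> 'M[R]_d;
  sform_smooth : forall c i j,
    smooth_fun (chmap c @` chdom c) (fun x => sform c x i j);
  sform_trans : forall c c' x, (chmap c @` (chdom c `&` chdom c')) x ->
    let tau := chmap c' \o chinv c in
    sform c x = jac tau x *m sform c' (tau x) *m (jac tau x)^T;
  sform_alt : forall c x, (chmap c @` chdom c) x ->
    (sform c x)^T = - sform c x;
  sform_nondeg : forall c x, (chmap c @` chdom c) x -> sform c x \in unitmx;
  sform_closed : forall c x i j k, (chmap c @` chdom c) x ->
    pderiv i (fun y => sform c y j k) x + pderiv j (fun y => sform c y k i) x +
    pderiv k (fun y => sform c y i j) x = 0;
  acs : chart -> 'rV[R]_d -> 'M[R]_d;
  acs_smooth : forall c i j,
    smooth_fun (chmap c @` chdom c) (fun x => acs c x i j);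
  acs_trans : forall c c' x, (chmap c @` (chdom c `&` chdom c')) x ->
    let tau := chmap c' \o chinv c in
    acs c x *m jac tau x = jac tau x *m acs c' (tau x);
  acs2 : forall c x, (chmap c @` chdom c) x -> acs c x *m acs c x = - 1%:M;
  acs_compat : forall c x, (chmap c @` chdom c) x ->
    acs c x *m sform c x *m (acs c x)^T = sform c x /\
    forall v : 'rV[R]_d, v != 0 ->
      0 < (v *m sform c x *m (v *m acs c x)^T) 0 0 }.

Variables (X : topologicalType) (d : nat) (S : symplectic X d).

(* gamma parametrizes the piece L `&` W of L, inside the chart c, as an embedded
   n-dimensional submanifold on which omega vanishes. *)
Definition lag_param (n : nat) (L : set X) (c : chart S) (W : set X)
    (U : set 'rV[R]_n) (gamma : 'rV[R]_n -> 'rV[R]_d) : Prop :=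
  [/\ open W /\ W `<=` chdom c, open U /\ smooth U gamma,
      gamma @` U = chmap c @` (L `&` W),
      exists2 g : 'rV[R]_d -> 'rV[R]_n, {in U, cancel gamma g} &
        {within gamma @` U, continuous g} &
      forall u, U u -> row_free (jac gamma u) /\
        jac gamma u *m sform c (gamma u) *m (jac gamma u)^T = 0].

Definition is_lagrangian (n : nat) (L : set X) : Prop :=
  forall p, L p -> exists c W (U : set 'rV[R]_n) gamma,
    W p /\ lag_param L c W U gamma.

Definition transverse (n : nat) (L L' : set X) : Prop :=
  forall p c W W' (U U' : set 'rV[R]_n) gamma gamma' u u',
    W p -> W' p -> lag_param L c W U gamma -> lag_param L' c W' U' gamma' ->
    U u -> U' u' -> gamma u = chmap c p -> gamma' u' = chmap c p ->
    row_full (col_mx (jac gamma u) (jac gamma' u')).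

Definition unit_square : set 'rV[R]_2 := [set z | forall i, 0 <= z 0 i <= 1].

Definition square_boundary : set 'rV[R]_2 :=
  [set z | unit_square z /\ exists i, z 0 i = 0 \/ z 0 i = 1].

Definition smooth_square (u : 'rV[R]_2 -> X) : Prop :=
  forall z, unit_square z -> exists (c : chart S) V,
    [/\ open V, V z, u @` V `<=` chdom c & smooth V (chmap c \o u)].

(* a is the density of the pullback of omega by u *)
Definition pullback (u : 'rV[R]_2 -> X) (a : 'rV[R]_2 -> R) : Prop :=
  forall z (c : chart S), unit_square z -> chdom c (u z) ->
    let j := jac (chmap c \o u) z in
    a z = (j *m sform c (chmap c (u z)) *m j^T) 0 1.

Definition square_integral (a : 'rV[R]_2 -> R) : R :=
  Rintegral lebesgue_measure `[0, 1] (fun s =>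
    Rintegral lebesgue_measure `[0, 1] (fun t =>
      a (\row_i (if i == 0 then s else t)))).

End Smooth.

(* H^*(M; C) for a closed oriented d-manifold M, in a homogeneous basis. *)
Record cohomology (R : realType) (d : nat) := Cohomology {
  cb : finType;
  cdeg : cb -> nat;
  ccup : cb -> cb -> {ffun cb -> R[i]};
  cone : {ffun cb -> R[i]};
  cint : cb -> R[i];
  ccup_deg : forall i j k, ccup i j k != 0 -> cdeg k = (cdeg i + cdeg j)%N;
  ccupA : forall i j k m,
    \sum_l ccup i j l * ccup l k m = \sum_l ccup j k l * ccup i l m;
  ccupC : forall i j k, ccup i j k = (-1) ^+ (cdeg i * cdeg j) * ccup j i k;
  cone_deg : forall i, cone i != 0 -> cdeg i = 0%N;
  ccup1 : forall j k, \sum_i cone i * ccup i j k = (j == k)%:R;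
  cint_deg : forall i, cint i != 0 -> cdeg i = d;
  (* Poincare duality *)
  cpd : forall x : {ffun cb -> R[i]},
    (forall j, \sum_i x i * \sum_k ccup i j k * cint k = 0) -> x = 0 }.

Definition cpair (R : realType) d (H : cohomology R d) (i j : cb H) : R[i] :=
  \sum_k ccup i j k * cint k.

Definition cpar (R : realType) d (H : cohomology R d) (i : cb H) : bool :=
  odd (cdeg i).

(* (-1)^(|x||y|+|x|) int x u y *)
Definition ccyc (R : realType) d (H : cohomology R d) (i j : cb H) : R[i] :=
  (-1) ^+ (cdeg i * cdeg j + cdeg i) * cpair i j.

(* x_1 u .. u x_s *)
Fixpoint cupprod (R : realType) d (H : cohomology R d)
    (xs : seq {ffun cb H -> R[i]}) : {ffun cb H -> R[i]} :=
  if xs is x :: xs' then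
    [ffun k => \sum_i \sum_j x i * cupprod xs' j * ccup i j k]
  else cone H.

Section Ambient.
Variables (R : realType) (n : nat).
Local Notation C := R[i].
Local Notation Lam := (nov R R[i]).

(* exponent omega / 2 pi *)
Definition nTarea (a : R) : Lam := nT R[i] (a / (2 * pi)).

(* X, its homology, its genus 0 three-point invariants and quantum product. *)
Record ambient := Ambient {
  aX : topologicalType;
  aX_compact : compact [set: aX];
  aX_hausdorff : hausdorff_space aX;
  aS : symplectic R aX n.*2;
  aH : cohomology R n.*2;
  aH2 : zmodType;                                       (* H_2(X; Z) *)
  aev : {additive aH2 -> {ffun cb aH -> C}};            (* <alpha, x> *)
  aev_deg : forall alpha i, aev alpha i != 0 -> cdeg i = 2%N;
  aom : {additive aH2 -> R};
  (* class of a smooth square with constant boundary *)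
  asphere : ('rV[R]_2 -> aX) -> aH2;
  aom_area : forall (u : 'rV[R]_2 -> aX) a p, smooth_square aS u ->
    (forall z, square_boundary z -> u z = p) -> pullback aS u a ->
    aom (asphere u) = square_integral a;
  ac1 : {additive aH2 -> int};
  gw : aH2 -> cb aH -> cb aH -> cb aH -> C;
  gw_deg : forall alpha i j k, gw alpha i j k != 0 ->
    (cdeg i + cdeg j + cdeg k)%:Z = n.*2%:Z + ac1 alpha *+ 2;
  gw_symm12 : forall alpha i j k,
    gw alpha i j k = (-1) ^+ (cdeg i * cdeg j) * gw alpha j i k;
  gw_symm23 : forall alpha i j k,
    gw alpha i j k = (-1) ^+ (cdeg j * cdeg k) * gw alpha i k j;
  gw_energy : forall alpha i j k, gw alpha i j k != 0 ->
    alpha = 0 \/ 0 < aom alpha;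
  gw_compact : forall E, finite_set [set alpha | aom alpha <= E /\
    exists i j k, gw alpha i j k != 0];
  gw_classical : forall i j k, gw 0 i j k = \sum_l ccup i j l * cpair l k;
  gw_unit : forall alpha j k, alpha != 0 ->
    \sum_i cone aH i * gw alpha i j k = 0;
  aqm : cb aH -> cb aH -> {ffun cb aH -> Lam};          (* e_i * e_j *)
  aqmE : forall i j k,
    nsums (fun alpha => nTarea (aom alpha) * nconst R (gw alpha i j k))
          (\sum_l aqm i j l * nconst R (cpair l k));
  aqmA : forall i j k m,                                (* WDVV *)
    \sum_l aqm i j l * aqm l k m = \sum_l aqm j k l * aqm i l m }.

Variable X : ambient.

Definition QH : Type := {ffun cb (aH X) -> Lam^o}.

Definition qone : QH := [ffun i => nconst R (cone (aH X) i)].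
Definition qmul (x y : QH) : QH :=
  [ffun k => \sum_i \sum_j (x i : Lam) * y j * aqm i j k].
Definition qpair (x y : QH) : Lam :=
  \sum_i \sum_j (x i : Lam) * y j * nconst R (cpair i j).
Definition qhomog (p : bool) (x : QH) := forall i, x i != 0 -> cpar i = p.

End Ambient.

Section Lagrangian.
Variables (R : realType) (n : nat) (X : ambient R n).
Local Notation C := R[i].
Local Notation Lam := (nov R R[i]).

(* A compact oriented spin Lagrangian L, its topology, and its disk operators.
   lm beta w is m_{s,beta} on the basis word w of length s. *)
Record lagrangian := Lagrangian {
  lset : set (aX X);
  lset_compact : compact lset;
  lset_lagrangian : is_lagrangian (aS X) n lset;
  lH : cohomology R n;
  lres : cb (aH X) -> {ffun cb lH -> C};                (* x |-> x|_L *)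
  lres_deg : forall i k, lres i k != 0 -> cdeg k = cdeg i;
  lresM : forall i j m, \sum_k ccup i j k * lres k m =
    \sum_p \sum_q lres i p * lres j q * ccup p q m;
  lres1 : forall m, \sum_i cone (aH X) i * lres i m = cone lH m;
  lH1 : zmodType;                                       (* H_1(L; Z) *)
  lev : {additive lH1 -> {ffun cb lH -> C}};            (* <gamma, x> *)
  lev_deg : forall gamma i, lev gamma i != 0 -> cdeg i = 1%N;
  (* H^1(L; C) = Hom (H_1(L; Z), C) *)
  lev_dual : forall phi : {additive lH1 -> C},
    exists! x : {ffun cb lH -> C}, (forall i, x i != 0 -> cdeg i = 1%N) /\
      forall gamma, phi gamma = \sum_i lev gamma i * x i;
  (* homogeneous basis of H^*(L; chi), chi a rank one local system *)
  lloc : (lH1 -> C) -> finType;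
  lloc_deg : forall chi, lloc chi -> nat;
  lloc_triv : exists2 f : cb lH -> lloc (fun=> 1), bijective f &
    forall i, lloc_deg (f i) = cdeg i;
  lH2 : zmodType;                                       (* H_2(X, L; Z) *)
  lj : {additive aH2 X -> lH2};
  lbd : {additive lH2 -> lH1};
  lbd_j : forall alpha, lbd (lj alpha) = 0;
  lom : {additive lH2 -> R};
  (* class of a smooth square with boundary on L *)
  ldisk : ('rV[R]_2 -> aX X) -> lH2;
  lom_area : forall (u : 'rV[R]_2 -> aX X) a, smooth_square (aS X) u ->
    (forall z, square_boundary z -> lset (u z)) -> pullback (aS X) u a ->
    lom (ldisk u) = square_integral a;
  lom_j : forall alpha, lom (lj alpha) = aom X alpha;
  lmu : {additive lH2 -> int};                          (* Maslov class *)
  lmu_j : forall alpha, lmu (lj alpha) = ac1 X alpha *+ 2;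
  lmu_even : forall beta, (2 %| lmu beta)%Z;
  lHc : lmodType C;                                     (* H^2_c(X \ L; C) *)
  lHcX : {linear lHc -> {ffun cb (aH X) -> C^o}};
  lHcX_deg : forall eta i, lHcX eta i != 0 -> cdeg i = 2%N;
  lHc_ev : lHc -> {additive lH2 -> C};                  (* <eta, beta> *)
  lHc_evD : forall a eta eta' beta,
    lHc_ev (a *: eta + eta') beta = a * lHc_ev eta beta + lHc_ev eta' beta;
  lHc_ev_j : forall eta alpha,
    lHc_ev eta (lj alpha) = \sum_i aev X alpha i * (lHcX eta i : C);
  (* moduli k beta : stable disks of class beta with k boundary marked points *)
  moduli : nat -> lH2 -> Type;
  moduli_forget : forall k beta, beta != 0 ->
    inhabited (moduli k beta) -> inhabited (moduli 1 beta);
  moduli_energy : forall k beta, inhabited (moduli k beta) ->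
    beta = 0 \/ 0 < lom beta;
  moduli_compact : forall E,
    finite_set [set beta | lom beta <= E /\ inhabited (moduli 1 beta)];
  lm : lH2 -> seq (cb lH) -> {ffun cb lH -> C};
  lm_deg : forall beta w k, lm beta w k != 0 ->
    (cdeg k)%:Z = \sum_(i <- w) (cdeg i)%:Z + 2 - (size w)%:Z - lmu beta;
  lm_eff : forall beta w, lm beta w != 0 ->
    exists2 bs : seq lH2, beta = \sum_(b <- bs) b &
      forall b, b \in bs -> inhabited (moduli (size w).+1 b);
  lm00 : lm 0 [::] = 0;
  lm10 : forall i, lm 0 [:: i] = 0;
  lm20 : forall i j k,
    lm 0 [:: i; j] k = (-1) ^+ (cdeg i * cdeg j + cdeg i) * ccup i j k;
  lm_ainf : forall beta w k,
    \sum_(t <- split3 w) \sum_(beta2 \in [set: lH2]) \sum_j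
      (-1) ^+ shpar (@cpar _ _ lH) t.1.1 * lm beta2 t.1.2 j *
      lm (beta - beta2) (t.1.1 ++ j :: t.2) k = 0;
  lm_unit : forall beta w1 w2 k, beta != 0 \/ (2 <= size w1 + size w2)%N ->
    \sum_i cone lH i * lm beta (w1 ++ i :: w2) k = 0;
  lm_cyclic : forall beta w xs x0,
    \sum_k lm beta (rcons w xs) k * ccyc k x0 =
    (-1) ^+ (shpar (@cpar _ _ lH) [:: x0] * shpar (@cpar _ _ lH) (rcons w xs)) *
    \sum_k lm beta (x0 :: w) k * ccyc k xs }.

Variable L : lagrangian.

Local Notation HL := {ffun cb (lH L) -> Lam}.

(* rho(d beta) T^(omega(beta)/2pi) m_{s,beta}(x_1, .., x_s), coefficient k *)
Definition mterm (rho : lH1 L -> C) (beta : lH2 L) (xs : seq HL)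
    (k : cb (lH L)) : Lam :=
  nconst R (rho (lbd L beta)) * nTarea (lom L beta) *
  mlext (fun w => nconst R (lm beta w k)) [seq (fun i => x i) | x : HL <- xs].

(* Maurer-Cartan elements; rho factors through H_1(L; Z), C^* being abelian. *)
Record mc := MC {
  mc_rho : lH1 L -> C;
  mc_rho_char : character mc_rho;
  mc_b : HL;
  mc_b_odd : forall i, mc_b i != 0 -> odd (cdeg i);
  mc_b_pos : forall i, nval_gt0 (mc_b i);
  mc_W : Lam;
  mc_eq : forall k, nsums
    (fun p : nat * lH2 L => mterm mc_rho p.2 (nseq p.1 mc_b) k)
    (mc_W * nconst R (cone (lH L) k)) }.

Definition same_rhoW (b b' : mc) : Prop :=
  mc_rho b = mc_rho b' /\ mc_W b = mc_W b'.

Definition hdelta_basis (i : cb (lH L)) : HL := [ffun j => (j == i)%:R].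

(* b_0^l0, x_1, b_1^l1, .., x_s, b_s^ls, for s = [:: (b_1, x_1); ..] *)
Fixpoint interleave (b : mc) (s : seq (mc * cb (lH L))) (ls : seq nat) :
    seq HL :=
  nseq (head 0%N ls) (mc_b b) ++
  if s is (b', i) :: s' then hdelta_basis i :: interleave b' s' (behead ls)
  else [::].

Definition mterm_deformed (b : mc) (s : seq (mc * cb (lH L)))
    (p : (size s).+1.-tuple nat * lH2 L) (k : cb (lH L)) : Lam :=
  mterm (mc_rho b) p.2 (interleave b s p.1) k.

Definition is_torus : Prop := homeomorphic (lset L) (torus R n).

Definition index_condition : Prop :=
  forall beta : lH2 L, beta != 0 -> inhabited (moduli 1 beta) ->
    2 <= lmu L beta.

Definition in_H1 (x : HL) := forall i, x i != 0 -> cdeg i = 1%N.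

(* <gamma, x> for x in H^1(L; Lambda) *)
Definition ev1 (gamma : lH1 L) (x : HL) : Lam :=
  \sum_i nconst R (lev L gamma i) * x i.

(* (rho, b_+) as the point rho e^{b_+} of Hom (H_1(L; Z), Lambda_0^* ) *)
Definition mc_point (b : mc) (gamma : lH1 L) : Lam :=
  nconst R (mc_rho b gamma) * nexp (ev1 gamma (mc_b b)).

(* Potential and its derivatives in the coordinates y_i = y^{e_i}, n_beta = nb
   beta; y is a homomorphism, so y^{d beta} / y_i = y (d beta - e_i). *)
Section Potential.
Variables (nb : lH2 L -> rat) (e : zbasis (lH1 L) n) (y : lH1 L -> Lam).

Definition pot_coef (beta : lH2 L) : Lam :=
  if lmu L beta == 2 then ratr (nb beta) * nTarea (lom L beta) else 0.

Definition potential : Lam :=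
  nsum (fun beta => pot_coef beta * y (lbd L beta)).

Definition d_potential (i : 'I_n) : Lam :=
  nsum (fun beta => pot_coef beta * (zcoord e (lbd L beta) i)%:~R *
                    y (lbd L beta - e i)).

Definition d2_potential (i j : 'I_n) : Lam :=
  nsum (fun beta => pot_coef beta *
    (zcoord e (lbd L beta) i * (zcoord e (lbd L beta) j - (i == j)%:R))%:~R *
    y (lbd L beta - e i - e j)).

Definition critical_point : Prop := forall i, y (e i) * d_potential i = 0.

Definition nondegenerate : Prop :=
  \det (\matrix_(i, j) (y (e i) * y (e j) * d2_potential i j)) != 0.

End Potential.

(* b corresponds to a non-degenerate critical point of the potential *)
Definition nondeg_critical (nb : lH2 L -> rat) (e : zbasis (lH1 L) n)
    (b : mc) : Prop :=
  [/\ in_H1 (mc_b b), critical_point nb e (mc_point b)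
    & nondegenerate nb e (mc_point b)].

End Lagrangian.

Section Ainf.
Variables (K : fieldType) (ob : Type).

(* A strictly unital Z/2-graded A_infinity category with finite-dimensional
   hom spaces and an n-cyclic structure, in homogeneous bases of the hom
   spaces: hom(A, B) has basis homset A B, and mu w g is the coefficient of g in
   m_s(x_1, .., x_s), where w = [:: x_1; ..; x_s]. *)
Record quiver := Quiver {
  gen : choiceType;
  src : gen -> ob;
  tgt : gen -> ob;
  par : gen -> bool }.

Definition homset (Q : quiver) (A B : ob) : set (gen Q) :=
  [set g | src g = A /\ tgt g = B].

Fixpoint composable (Q : quiver) (A : ob) (w : seq (gen Q)) (B : ob) : Prop :=
  if w is g :: w' then src g = A /\ composable (tgt g) w' B else A = B.

Definition hvec (Q : quiver) (A B : ob) (x : gen Q -> K) : Prop :=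
  forall g, x g != 0 -> homset A B g.

Definition hhomog (Q : quiver) (p : bool) (x : gen Q -> K) : Prop :=
  forall g, x g != 0 -> par g = p.

Record cyclic_ainf (n : nat) := CyclicAinf {
  aq :> quiver;
  hom_fin : forall A B, finite_set (homset A B : set (gen aq));
  mu : seq (gen aq) -> gen aq -> K;
  mu_hom : forall w g, mu w g != 0 -> composable (src g) w (tgt g);
  mu_deg : forall w g, mu w g != 0 -> par g = odd (shpar (@par aq) w);
  mu_nil : forall g, mu [::] g = 0;
  mu_rel : forall w g, \sum_(t <- split3 w) \sum_(h \in [set: gen aq])
    (-1) ^+ shpar (@par aq) t.1.1 * mu t.1.2 h * mu (t.1.1 ++ h :: t.2) g = 0;
  hunit : ob -> gen aq -> K;
  hunit_hom : forall A, hvec A A (hunit A);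
  hunit_deg : forall A, hhomog false (hunit A);
  mu_unit1 : forall A g, \sum_(h \in [set: gen aq]) hunit A h * mu [:: h] g = 0;
  mu_unitl : forall x g,
    \sum_(h \in [set: gen aq]) hunit (src x) h * mu [:: h; x] g = (x == g)%:R;
  mu_unitr : forall x g,
    \sum_(h \in [set: gen aq]) hunit (tgt x) h * mu [:: x; h] g =
    (-1) ^+ par x * (x == g)%:R;
  mu_unit : forall A w1 w2 g, (2 <= size w1 + size w2)%N ->
    \sum_(h \in [set: gen aq]) hunit A h * mu (w1 ++ h :: w2) g = 0;
  cyc : gen aq -> gen aq -> K;
  cyc_hom : forall g h, cyc g h != 0 -> src h = tgt g /\ tgt h = src g;
  cyc_deg : forall g h, cyc g h != 0 -> par g (+) par h = odd n;
  cyc_nondegl : forall A B x, hvec A B x ->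
    (forall h, \sum_(g \in [set: gen aq]) x g * cyc g h = 0) ->
    forall g, x g = 0;
  cyc_nondegr : forall A B x, hvec A B x ->
    (forall h, \sum_(g \in [set: gen aq]) x g * cyc h g = 0) ->
    forall g, x g = 0;
  cyc_mu : forall w x y,
    \sum_(h \in [set: gen aq]) mu (rcons w x) h * cyc h y =
    (-1) ^+ (shpar (@par aq) [:: y] * shpar (@par aq) (rcons w x)) *
    \sum_(h \in [set: gen aq]) mu (y :: w) h * cyc h x }.

Variables (n : nat) (A : cyclic_ainf n).
Local Notation G := (gen A).
Local Notation sh := (shpar (@par A)).

(* m_1, and x.y = (-1)^(|x||y|+|x|) m_2(x, y) *)
Definition mu1 (x : G -> K) (g : G) : K :=
  \sum_(h \in [set: G]) x h * mu [:: h] g.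

Definition hprod (x y : G -> K) (g : G) : K :=
  \sum_(h \in [set: G]) \sum_(k \in [set: G])
    (-1) ^+ (par h * par k + par h) * x h * y k * mu [:: h; k] g.

(* The classes of k_0, .., k_(r-1) form a homogeneous basis of H^* hom(P, Q). *)
Definition coh_basis (P Q : ob) (r : nat) (eps : 'I_r -> bool)
    (k : 'I_r -> G -> K) : Prop :=
  (forall i, [/\ hvec P Q (k i), hhomog (eps i) (k i)
               & forall g, mu1 (k i) g = 0]) /\
  (forall x, hvec P Q x -> (forall g, mu1 x g = 0) ->
    exists! c : {ffun 'I_r -> K}, exists2 y, hvec P Q y &
      forall g, x g = \sum_i c i * k i g + mu1 y g).

(* Hochschild cochains phi: phi w g is the coefficient of g in
   phi_s(x_1, .., x_s); the length 0 part at A is phi [::] on homset A A. *)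
Definition cochain := seq G -> G -> K.

Definition is_cochain (phi : cochain) : Prop :=
  forall w g, phi w g != 0 -> composable (src g) w (tgt g).

(* Cohomological degree mod 2 of the component of a cochain at (w, g). *)
Definition cpardeg (w : seq G) (g : G) : nat := par g + sh w.

Definition cohomog (p : bool) (phi : cochain) : Prop :=
  forall w g, phi w g != 0 -> odd (cpardeg w g) = p.

(* [m, phi] for the Gerstenhaber bracket *)
Definition cobd (phi : cochain) : cochain := fun w g =>
  \sum_(t <- split3 w) \sum_(h \in [set: G])
   ((-1) ^+ ((cpardeg t.1.2 h).+1 * sh t.1.1) *
      phi t.1.2 h * mu (t.1.1 ++ h :: t.2) g -
    (-1) ^+ ((cpardeg (t.1.1 ++ h :: t.2) g).+1 + sh t.1.1) *
      mu t.1.2 h * phi (t.1.1 ++ h :: t.2) g).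

Definition is_cocycle (phi : cochain) : Prop :=
  is_cochain phi /\ forall w g, cobd phi w g = 0.

(* Equality in HH^*. *)
Definition cohomologous (phi psi : cochain) : Prop :=
  exists2 eta, is_cochain eta & forall w g, phi w g - psi w g = cobd eta w g.

Definition cochain1 : cochain := fun w g =>
  if w is [::] then hunit (src g) g else 0.

(* (-1)^(|phi||psi|+|phi|) sum +- m(.., phi(..), .., psi(..), ..) *)
Definition cochain_mul (phi psi : cochain) : cochain := fun w g =>
  \sum_(t <- split3 w) \sum_(u <- split3 t.2)
  \sum_(h \in [set: G]) \sum_(k \in [set: G])
    let p := cpardeg t.1.2 h in let q := cpardeg u.1.2 k in
    (-1) ^+ (p * q + p + p.+1 * sh t.1.1 +
             q.+1 * (sh t.1.1 + sh t.1.2 + sh u.1.1)) *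
    phi t.1.2 h * psi u.1.2 k * mu (t.1.1 ++ h :: u.1.1 ++ k :: u.2) g.

(* Hochschild chains: c (x_0, [:: x_1; ..; x_s]) is the coefficient of
   x_0[x_1|..|x_s]. *)
Definition chain := (G * seq G)%type -> K.

Definition is_chain (c : chain) : Prop :=
  finite_set [set z | c z != 0] /\
  forall z, c z != 0 -> composable (tgt z.1) z.2 (src z.1).

Definition chdeg (z : G * seq G) : nat := par z.1 + sh z.2.

Definition chhomog (p : bool) (c : chain) : Prop :=
  forall z, c z != 0 -> odd (chdeg z) = p.

(* Coefficient of z' in the boundary of the basis chain z = x_0[w], with terms
   x_0[w1|m(w2)|w3] and m(w3, x_0, w1)[w2]. *)
Definition bd_coef (z z' : G * seq G) : K :=
  \sum_(t <- split3 z.2)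
   (\sum_(h \in [set: G]) (-1) ^+ (sh [:: z.1] + sh t.1.1) * mu t.1.2 h *
      (z' == (z.1, t.1.1 ++ h :: t.2))%:R +
    (-1) ^+ (sh t.2 * (sh [:: z.1] + sh t.1.1 + sh t.1.2)) *
      mu (t.2 ++ z.1 :: t.1.1) z'.1 * (z'.2 == t.1.2)%:R).

Definition bd (c : chain) : chain := fun z' =>
  \sum_(z \in [set: G * seq G]) c z * bd_coef z z'.

Definition is_cycle (c : chain) : Prop :=
  is_chain c /\ forall z, bd c z = 0.

(* Chains of the full subcategory with the single object P. *)
Definition chain_on (P : ob) (c : chain) : Prop :=
  forall z, c z != 0 -> forall g, g \in z.1 :: z.2 -> src g = P /\ tgt g = P.

Definition chain0 (x : G -> K) : chain := fun z =>
  if z.2 is [::] then x z.1 else 0.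

(* <phi, c>_cyc *)
Definition hpair (phi : cochain) (c : chain) : K :=
  \sum_(z \in [set: G * seq G]) c z * (-1) ^+ (sh [:: z.1] * sh z.2) *
    \sum_(g \in [set: G]) phi z.2 g * cyc g z.1.

End Ainf.

Section Setting.
Variables (R : realType) (n : nat).
Local Notation C := R[i].
Local Notation Lam := (nov R R[i]).

(* Objects (L, b) of the Fukaya category of a finite family of Lagrangians. *)
Definition fobj (X : ambient R n) (I : finType) (LL : I -> lagrangian X) :=
  {l : I & mc (LL l)}.

Definition fobj_W (X : ambient R n) (I : finType) (LL : I -> lagrangian X)
  (A : fobj LL) : Lam := mc_W (projT2 A).

Definition obj (X : ambient R n) (I : finType) (LL : I -> lagrangian X) (l : I)
  (b : mc (LL l)) : fobj LL := existT _ l b.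

(* The inputs x_1, .., x_s, x_i in hom(b_(i-1), b_i), for
   s = [:: (b_1, x_1); ..] and b_0 = b. *)
Fixpoint chain_word (T U V : Type) (f : T -> T -> U -> V) (b : T)
    (s : seq (T * U)) : seq V :=
  if s is (b', i) :: s' then f b b' i :: chain_word f b' s' else [::].

(* The open-closed map p determined by q:
   <x, p(c)>_X = (-1)^(n|c|) <q(x), c>_cyc. *)
Definition oc_map (X : ambient R n) (ob : Type) (A : cyclic_ainf Lam ob n)
    (q : QH X -> cochain A) (c : chain A) : QH X :=
  xget 0 [set v | forall x, qpair x v =
    hpair (q x) (fun z => (-1) ^+ (n * chdeg z) * c z)].

Record floer_setting := FloerSetting {
  fX : ambient R n;
  fI : finType;
  fL : fI -> lagrangian fX;
  f_unobstructed : forall l, inhabited (mc (fL l));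
  f_transverse : forall l l', l != l' ->
    transverse (aS fX) n (lset (fL l)) (lset (fL l'));

  (* Cohomology of a Lagrangian torus: H_1 = Z^n, H^* is the exterior algebra
     on H^1, and non-trivial rank one local systems are acyclic. *)
  f_torus_H1 : forall l, is_torus (fL l) ->
    inhabited (zbasis (lH1 (fL l)) n);
  f_torus_cup : forall l, is_torus (fL l) ->
    exists2 x : 'I_n -> {ffun cb (lH (fL l)) -> C},
      forall j i, x j i != 0 -> cdeg i = 1%N &
      forall v : {ffun cb (lH (fL l)) -> C}, exists! c : {ffun {set 'I_n} -> C},
        forall i, v i = \sum_(J : {set 'I_n}) c J *
          cupprod [seq x j | j <- enum J] i;
  f_torus_loc : forall l, is_torus (fL l) ->
    forall chi, character chi -> (exists gamma, chi gamma != 1) ->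
    #|@lloc R n fX (fL l) chi| = 0%N;
  (* Divisor axiom for Lagrangian tori bounding only disks of Maslov index
     at least 2; n_beta = f_nb beta. *)
  f_nb : forall l, lH2 (fL l) -> rat;
  f_nbE : forall l, is_torus (fL l) ->
    index_condition (fL l) -> forall beta i,
    lm beta [::] i = ratr (f_nb beta) * cone (lH (fL l)) i;
  f_divisor : forall l, is_torus (fL l) ->
    index_condition (fL l) ->
    forall (b : {ffun cb (lH (fL l)) -> Lam}) (s : nat) (beta : lH2 (fL l)) k,
    in_H1 b -> (forall i, nval_gt0 (b i)) ->
    mlext (fun w => nconst R (lm beta w k)) (nseq s (fun i => b i)) =
    ev1 (lbd (fL l) beta) b ^+ s / s`!%:R * nconst R (lm beta [::] k);

  (* The Fukaya category. *)
  fuk : cyclic_ainf Lam (fobj fL) n;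
  fuk_W : forall g : gen fuk, fobj_W (src g) = fobj_W (tgt g);
  (* L_1 = L_2, rho_1 = rho_2 : the basis of H^*(L) *)
  fgen : forall l (b b' : mc (fL l)), cb (lH (fL l)) -> gen fuk;
  fgen_hom : forall l (b b' : mc (fL l)), same_rhoW b b' ->
    set_bij setT (homset (obj b) (obj b')) (fgen b b');
  fgen_par : forall l (b b' : mc (fL l)), same_rhoW b b' ->
    forall i, par (fgen b b' i) = cpar i;
  (* L_1 = L_2 : H^*(L; rho_2 rho_1^-1) *)
  fuk_loc : forall l (b b' : mc (fL l)), mc_W b = mc_W b' ->
    exists2 f : lloc (fun gamma => mc_rho b' gamma / mc_rho b gamma) ->
                gen fuk,
      set_bij setT (homset (obj b) (obj b')) f &
      forall i, par (f i) = odd (lloc_deg i);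
  (* L_1 != L_2 : intersection points *)
  fuk_pts : forall l l' (b : mc (fL l)) (b' : mc (fL l')), l != l' ->
    mc_W b = mc_W b' -> exists f : aX fX -> gen fuk,
      set_bij (lset (fL l) `&` lset (fL l')) (homset (obj b) (obj b')) f;
  fuk_mu : forall l (b : mc (fL l)) (s : seq (mc (fL l) * cb (lH (fL l)))) k,
    (0 < size s)%N -> List.Forall (fun x => same_rhoW b x.1) s ->
    nsums (fun p => mterm_deformed b (s := s) p k)
      (mu (chain_word (@fgen l) b s) (fgen b (last b (unzip1 s)) k));
  fuk_unit : forall l (b : mc (fL l)) i,
    hunit (obj b) (fgen b b i) = nconst R (cone (lH (fL l)) i);
  fuk_cyc : forall l (b b' : mc (fL l)), same_rhoW b b' -> forall i j,
    cyc (fgen b b' i) (fgen b' b j) = nconst R (ccyc i j);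

  (* q, by cocycle representatives; it is a homomorphism QH -> HH^*. *)
  fq : QH fX -> cochain fuk;
  fq_cocycle : forall x, is_cocycle (fq x);
  fq_homog : forall p x, qhomog p x -> cohomog p (fq x);
  fq_linear : forall (a : Lam) x y, cohomologous (fq (a *: x + y))
    (fun w g => a * fq x w g + fq y w g);
  fq_one : cohomologous (fq (qone fX)) (@cochain1 _ _ _ fuk);
  fq_mul : forall x y, cohomologous (fq (qmul x y)) (cochain_mul (fq x) (fq y));
  fq_divisor : forall l (b : mc (fL l)) (eta : lHc (fL l)),
    exists (v : cb (lH (fL l)) -> Lam) (y : gen fuk -> Lam),
    [/\ forall k, nsums (fun p : nat * lH2 (fL l) =>
          nconst R (lHc_ev eta p.2) *
          mterm (mc_rho b) p.2 (nseq p.1 (mc_b b)) k) (v k),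
        hvec (obj b) (obj b) y &
        forall k, fq [ffun i => nconst R (lHcX (fL l) eta i)] [::] (fgen b b k)
                  = v k + mu1 y (fgen b b k)];

  (* The Mukai pairing on HH_*. *)
  muk : chain fuk -> chain fuk -> Lam;
  muk_linearl : forall a c c' d, is_cycle c -> is_cycle c' -> is_cycle d ->
    muk (fun z => a * c z + c' z) d = a * muk c d + muk c' d;
  muk_linearr : forall a c c' d, is_cycle c -> is_cycle c' -> is_cycle d ->
    muk d (fun z => a * c z + c' z) = a * muk d c + muk d c';
  muk_bd : forall c d, is_chain c -> is_cycle d ->
    muk (bd c) d = 0 /\ muk d (bd c) = 0;
  (* on classes of length 0, the supertrace on H^* hom(P, Q) of
     z |-> (-1)^(|x||z|+|x||x'|) x.z.x', with matrix M in the basis k *)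
  muk_length0 : forall (P Q : fobj fL) p p' (x x' : gen fuk -> Lam),
    hvec P P x -> hhomog p x -> (forall g, mu1 x g = 0) ->
    hvec Q Q x' -> hhomog p' x' -> (forall g, mu1 x' g = 0) ->
    forall r (eps : 'I_r -> bool) (k : 'I_r -> gen fuk -> Lam) (M : 'M[Lam]_r),
    coh_basis P Q eps k ->
    (forall i, exists2 y, hvec P Q y & forall g,
      (-1) ^+ (p * eps i + p * p') * hprod (hprod x (k i)) x' g =
      \sum_j M i j * k j g + mu1 y g) ->
    muk (chain0 x) (chain0 x') = \sum_i (-1) ^+ eps i * M i i;

  (* sigma(parity of n, |c|) *)
  fsigma : bool -> bool -> bool;
  fp_muk : forall p p' c c', is_cycle c -> is_cycle c' ->
    chhomog p c -> chhomog p' c' ->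
    qpair (oc_map fq c) (oc_map fq c') =
    (-1) ^+ ((n * n.+1)./2 + fsigma (odd n) p) * muk c c';
  (* p(1_L) = [L] *)
  fp_unit : forall l (b : mc (fL l)) (x : {ffun cb (aH fX) -> C}),
    qpair (oc_map fq (chain0 (hunit (obj b)))) [ffun i => nconst R (x i)] =
    nconst R (\sum_i x i * \sum_k lres (fL l) i k * cint k) }.

Variable F : floer_setting.
Variable l : fI F.

(* e lies in the image under p of HH_* of the subcategory with object (L, b) *)
Definition in_oc_image (b : mc (fL l)) (e : QH (fX F)) : Prop :=
  exists c : chain (fuk F),
    [/\ is_cycle c, chain_on (obj b) c & oc_map (@fq F) c = e].

Definition idempotent_of (b : mc (fL l)) (e : QH (fX F)) : Prop :=
  [/\ e != 0, qmul e e = e & in_oc_image b e].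

(* QH e is isomorphic to Lambda as a Lambda-algebra with unit e. *)
Definition summand_iso_Lambda (e : QH (fX F)) : Prop :=
  exists f : {linear Lam^o -> QH (fX F)},
    [/\ injective f, forall a a' : Lam, f (a * a') = qmul (f a) (f a'),
        f (1 : Lam) = e & range f = range (fun x => qmul x e)].

End Setting.

(* Main.v *)
(** For a non-degenerate critical point b, the divisor axiom turns the first
    derivatives of W into m_1 on H^1 and its Hessian into the symmetrization of
    m_2 on H^1.  Hence hom(b, b) has zero differential, and its product is a
    Clifford algebra over a non-degenerate form, with basis the products of a
    basis of H^1.  The length zero part of q(x) is supercentral, so it is a
    scalar chi_b(x), and chi_b is a character of QH.  Let Z_b represent chi_b
    for the Poincare pairing; then y * Z_b = chi_b(y) Z_b, and p maps every
    length zero chain at b to a multiple of Z_b.  The Mukai pairing of two such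
    chains is a supertrace on the Clifford algebra, which does not vanish for
    all of them; therefore chi_b(Z_b) <> 0 and Z_b / chi_b(Z_b) is idempotent.

    If b' <> b then HF(b, b') = 0: either its complex is zero, or the leading
    term of m_1 is the cup product with a nonzero class of degree one, which a
    contraction of the Clifford algebra makes null-homotopic.  So
    chi_b'(Z_b) = 0, and the two characters differ on some even class y.

    Finally let e be in the image of p at b.  The length zero part of
    q(y - chi_b(y)) vanishes, so multiplication by it raises the length of
    cochains, up to coboundaries, while a chain has bounded length.  Thus e is
    killed by a power of y - chi_b(y); and e_b * e_b' is killed by powers of
    both y - chi_b(y) and y - chi_b'(y), which forces it to vanish. *)
From HB Require Import structures.
Require Import Defs.
From mathcomp Require Import all_boot all_order all_algebra finmap.
From mathcomp Require Import all_classical all_reals.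
From mathcomp Require Import complex ring zify.

Set Implicit Arguments.
Unset Strict Implicit.
Unset Printing Implicit Defensive.

Import Order.TTheory GRing.Theory Num.Theory.

Local Open Scope classical_set_scope.
Local Open Scope ring_scope.

(** * Novikov series *)

(** The orthogonality concerns every idempotent in the image of [oc_map], not just the normalized
    Z_b, so chains with long words intervene, and it must be known that an even cocycle times a
    coboundary is a coboundary. Expanded over the cuts of a word this identity is unmanageable. The
    operations are therefore encoded as derivations on functions of words, and identities between
    them are checked on single letters ([op_eq0]). Statements over Lambda are reduced to C by one
    device: a non-zero finite family is divided by a power of T so that it becomes integral with a
    non-zero residue ([nov_factor]). The residue of the Floer product is the cup product, so
    independence of monomials and bijectivity of the homotopy operator are read off from residues.
    The divisor axiom is available only for equal inputs in Lambda_+. It is polarized, and then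
    determines the symmetrization of m_2 only, which is just what a Clifford relation asks for. *)

Lemma fsbig_inj_fin (V : nmodType) (T : finType) (G : choiceType) (f : T -> G)
    (F : G -> V) : injective f -> (forall g, (forall i, g <> f i) -> F g = 0) ->
  \sum_(g \in [set: G]) F g = \sum_i F (f i).
Proof.
move=> fi F0; rewrite (fsbigE [seq f i | i <- index_enum T]) //.
- by rewrite big_map; apply: eq_bigl => i; rewrite in_setT.
- by rewrite map_inj_uniq ?index_enum_uniq.
move=> g _ gf; apply: F0 => i gi; case/negP: gf.
by rewrite gi map_f // mem_index_enum.
Qed.

Section Valuation.
Variables (R : realType) (K : fieldType).
Local Notation Lam := (nov R K).
Implicit Types (f g : Lam).

Lemma nval_geD E f g : nval_ge E f -> nval_ge E g -> nval_ge E (f + g).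
Proof. by move=> fE gE l lE; rewrite novD fE // gE // addr0. Qed.

Lemma nval_geN E f : nval_ge E f -> nval_ge E (- f).
Proof. by move=> fE l lE; rewrite novN fE // oppr0. Qed.

Lemma nval_geB E f g : nval_ge E f -> nval_ge E g -> nval_ge E (f - g).
Proof. by move=> fE gE; apply: nval_geD => //; exact: nval_geN. Qed.

Lemma nval_ge_sum E (I : Type) (r : seq I) (P : pred I) (F : I -> Lam) :
  (forall i, P i -> nval_ge E (F i)) -> nval_ge E (\sum_(i <- r | P i) F i).
Proof. by move=> FE; elim/big_ind : _ => //; exact: nval_geD. Qed.

Lemma nval_ge_sumin E (I : choiceType) (r : {fset I}) (F : I -> Lam) :
  (forall i, i \in r -> nval_ge E (F i)) -> nval_ge E (\sum_(i <- r) F i).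
Proof. by move=> FE; rewrite big_seq; exact: nval_ge_sum. Qed.

Lemma nval_geW E E' f : E' <= E -> nval_ge E f -> nval_ge E' f.
Proof. by move=> EE fE l lE; apply: fE; exact: lt_le_trans EE. Qed.

Lemma nval_ge_eq0 f : (forall E, nval_ge E f) -> f = 0.
Proof. by move=> fE; apply: novP => l; apply: (fE (l + 1)); rewrite ltrDl. Qed.

Lemma nval_geMl E f g : nval_ge 0 f -> nval_ge E g -> nval_ge E (f * g).
Proof. by move=> f0 gE; rewrite -[E]add0r; exact: nval_geM. Qed.

Lemma nval_gt0_ge0 f : nval_gt0 f -> nval_ge 0 f.
Proof. by move=> f0 l l0; apply: f0; exact: ltW. Qed.

Lemma nval_gt0P f : nval_gt0 f <-> nval_ge 0 f /\ f 0 = 0.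
Proof.
split=> [f0|[f0 f00] l]; first by split; [exact: nval_gt0_ge0 | exact: f0].
by rewrite le_eqVlt => /predU1P[->//|]; exact: f0.
Qed.

Lemma nmon_ge a c : nval_ge a (nmon c a : Lam).
Proof. by move=> l la /=; rewrite lt_eqF. Qed.

(** Evaluation at exponent 0 is the residue map of Lambda_0: a negative exponent in f, or a positive
    one that forces g below 0, contributes nothing. *)
Lemma res_mul f g : nval_ge 0 f -> nval_ge 0 g -> (f * g) 0 = f 0 * g 0.
Proof.
move=> f0 g0; rewrite novM /nmulf (fsbigTE [fset (0 : R)]%fset).
  by rewrite big_seq_fset1 subr0.
move=> m; rewrite inE => m0; case: (ltrP m 0) => [/f0->|m0']; first by rewrite mul0r.
by rewrite (g0 (0 - m)) ?mulr0 // sub0r oppr_lt0 lt0r m0.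
Qed.

Lemma nval_gt0M f g : nval_ge 0 f -> nval_gt0 g -> nval_gt0 (f * g).
Proof.
move=> f0 /nval_gt0P[g0 g00]; apply/nval_gt0P; split; first exact: nval_geMl.
by rewrite res_mul // g00 mulr0.
Qed.

Lemma nval_gt0D f g : nval_gt0 f -> nval_gt0 g -> nval_gt0 (f + g).
Proof. by move=> f0 g0 l l0; rewrite novD f0 // g0 // addr0. Qed.

Lemma nval_gt0_sum (I : Type) (r : seq I) (P : pred I) (F : I -> Lam) :
  (forall i, P i -> nval_gt0 (F i)) -> nval_gt0 (\sum_(i <- r | P i) F i).
Proof. by move=> FE; elim/big_ind : _ => //; exact: nval_gt0D. Qed.

Lemma foldr_min_le (d : R) (s : seq R) x : x \in d :: s -> foldr Order.min d s <= x.
Proof.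
elim: s x => [|y s IH] x /=; first by rewrite inE => /eqP ->.
rewrite !inE ge_min => /or3P[/eqP->|/eqP->|xs]; rewrite ?lexx //.
  by rewrite IH ?orbT // mem_head.
by rewrite IH ?orbT // inE xs orbT.
Qed.

Lemma foldr_min_mem (d : R) (s : seq R) : foldr Order.min d s \in d :: s.
Proof.
elim: s => [|y s IH] /=; first by rewrite mem_head.
case: leP => _; first by rewrite !inE eqxx orbT.
by move: IH; rewrite !inE => /orP[->//|->]; rewrite !orbT.
Qed.

(** Only finitely many exponents lie below 1, so the least of them, or 1, is a uniform gap. The
    convergence of the exponential rests on it. *)
Lemma nval_gt0_pos f : nval_gt0 f -> exists2 d, 0 < d & nval_ge d f.
Proof.
move=> f0; have fP := ncoefP f 1.
pose S := fset_set [set l | l <= 1 /\ f l != 0].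
pose d := foldr Order.min 1 (S : seq R).
have dle x : x \in 1 :: (S : seq R) -> d <= x by exact: foldr_min_le.
exists d.
  have := foldr_min_mem 1 (S : seq R); rewrite -/d inE => /predU1P[->//|].
  rewrite in_fset_set // inE => -[_ fd]; rewrite ltNge.
  by apply: contra fd => /f0 ->.
move=> l ld; apply/eqP/negPn/negP => fl.
have lS : l \in S.
  rewrite in_fset_set // inE; split => //; apply: ltW.
  by apply: lt_le_trans ld (dle _ _); rewrite mem_head.
by move: ld; rewrite ltNge dle // inE lS orbT.
Qed.

Lemma res_nconst c : (nconst R c : Lam) 0 = c.
Proof. by rewrite /= eqxx. Qed.

Lemma nconst_ge0 c : nval_ge 0 (nconst R c : Lam).
Proof. exact: nmon_ge. Qed.

Lemma nconstM c d : nconst R (c * d) = nconst R c * nconst R d :> Lam.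
Proof. by rewrite /nconst nmonM addr0. Qed.

Lemma nconst0 : nconst R 0 = 0 :> Lam.
Proof. by apply: novP => l /=; case: ifP. Qed.

Lemma nconst1 : nconst R 1 = 1 :> Lam. Proof. by []. Qed.

Lemma nconstD c d : nconst R (c + d) = nconst R c + nconst R d :> Lam.
Proof. by apply: novP => l; rewrite novD /=; case: ifP; rewrite ?addr0. Qed.

Lemma nconstN c : nconst R (- c) = - nconst R c :> Lam.
Proof. by apply: novP => l; rewrite novN /=; case: ifP; rewrite ?oppr0. Qed.

Lemma nconst_sum (I : Type) (r : seq I) (P : pred I) (F : I -> K) :
  nconst R (\sum_(i <- r | P i) F i) = \sum_(i <- r | P i) (nconst R (F i) : Lam).
Proof. by apply: (big_morph (fun c => nconst R c : Lam) nconstD nconst0). Qed.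

Lemma nconst_inj : injective (fun c => nconst R c : Lam).
Proof. by move=> c d /(congr1 (fun f : Lam => f 0)); rewrite !res_nconst. Qed.

Lemma nconst_natr n : nconst R n%:R = n%:R :> Lam.
Proof.
elim: n => [|n IH]; first by rewrite nconst0.
by rewrite -[n.+1]addn1 !natrD nconstD IH nconst1.
Qed.

Lemma nconst_sign n : nconst R ((-1) ^+ n) = (-1) ^+ n :> Lam.
Proof. by elim: n => [//|n IH]; rewrite !exprS nconstM IH nconstN nconst1. Qed.

Lemma nconst_int (n : int) : nconst R n%:~R = n%:~R :> Lam.
Proof.
case: n => n; first exact: nconst_natr.
by rewrite NegzE !mulrNz nconstN; congr (- _); exact: nconst_natr.
Qed.

Lemma nconstV c : nconst R c^-1 = (nconst R c)^-1 :> Lam.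
Proof.
have [->|c0] := eqVneq c 0; first by rewrite invr0 nconst0 invr0.
have n0 : (nconst R c : Lam) != 0 by rewrite -nconst0 (inj_eq nconst_inj).
by apply: (mulfI n0); rewrite divff // -nconstM divff.
Qed.

Lemma nconstE c f l : (nconst R c * f) l = c * f l.
Proof.
rewrite novM /nmulf (fsbigTE [fset (0 : R)]%fset).
  by rewrite big_seq_fset1 /= eqxx subr0.
by move=> m; rewrite inE /= => /negPf ->; rewrite mul0r.
Qed.

Lemma nT_neq0 a : nT K a != 0 :> Lam.
Proof.
apply/eqP => /(congr1 (fun f : Lam => f a)) /eqP /=.
by rewrite eqxx oner_eq0.
Qed.

Lemma nTD a b : nT K (a + b) = nT K a * nT K b :> Lam.
Proof. by rewrite /nT nmonM mulr1. Qed.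

Lemma nT_ge a : nval_ge a (nT K a : Lam). Proof. exact: nmon_ge. Qed.

(** The least exponent occurring in the family is split off. Relations over Lambda thereby acquire a
    non-trivial residue, to which linear algebra over the coefficient field applies. *)
Lemma nov_factor (I : finType) (x : I -> Lam) : (exists i, x i != 0) ->
  exists a (y : I -> Lam), [/\ forall i, x i = nT K a * y i,
    forall i, nval_ge 0 (y i) & exists i, y i 0 != 0].
Proof.
move=> [i0 xi0]; have [l0 xl0] : exists l, x i0 l != 0.
  apply: contrapT => H; case/eqP: xi0; apply: novP => l /=.
  by apply/eqP/negPn/negP => fl; apply: H; exists l.
pose S := fset_set (\bigcup_i [set l | l <= l0 /\ x i l != 0]).
have Sf : finite_set (\bigcup_i [set l | l <= l0 /\ x i l != 0]).
  apply: bigcup_finite; first exact: finite_finset.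
  by move=> i _; exact: ncoefP.
have inS l : l \in S <-> exists2 i, l <= l0 & x i l != 0.
  rewrite in_fset_set // inE; split; first by move=> [i _ [? ?]]; exists i.
  by move=> [i ? ?]; exists i.
pose a := foldr Order.min l0 (S : seq R).
have ale l : l \in S -> a <= l by move=> lS; apply: foldr_min_le; rewrite inE lS orbT.
have aS : exists2 i, a <= l0 & x i a != 0.
  apply/inS; have := foldr_min_mem l0 (S : seq R).
  by rewrite -/a inE => /predU1P[->|//]; apply/inS; exists i0.
have [i1 al0 xa] := aS.
exists a, (fun i => nT K (- a) * x i); split.
- by move=> i; rewrite mulrA -nTD subrr mul1r.
- move=> i; rewrite -(addNr a); apply: nval_geM; first exact: nT_ge.
  move=> l la; apply/eqP/negPn/negP => xl.
  have : l \in S by apply/inS; exists i => //; exact/ltW/(lt_le_trans la).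
  by move/ale; rewrite leNgt la.
exists i1; rewrite novM /nmulf (fsbigTE [fset (- a)]%fset).
  by rewrite big_seq_fset1 /= eqxx mul1r sub0r opprK.
by move=> m; rewrite inE /= => /negPf ->; rewrite mul0r.
Qed.

End Valuation.

(** * Convergence and rearrangement of T-adic sums *)

Section NovikovSums.
Variables (R : realType) (K : fieldType).
Local Notation Lam := (nov R K).

(** Unconditional convergence along the net of finite subsets. It is equivalent to the
    coefficientwise [nsums] and better suited to estimates. *)
Definition nconv (I : choiceType) (F : I -> Lam) (S : Lam) :=
  forall E, exists X : {fset I}, forall Y : {fset I}, (X `<=` Y)%fset ->
    nval_ge E (S - \sum_(i <- Y) F i).

Lemma nsums_nconv (I : choiceType) (F : I -> Lam) S : nsums F S <-> nconv F S.
Proof.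
split=> [[fin val] E|conv].
  exists (fset_set [set i | ~ nval_ge E (F i)]) => Y XY l lE.
  rewrite novD novN nov_sumE val (fsbigTE Y) ?subrr // => i iY.
  have iX : i \notin fset_set [set i | ~ nval_ge E (F i)].
    by apply: contra iY; exact: (fsubsetP XY).
  suff /(_ l lE) : nval_ge E (F i) by [].
  apply: contrapT => Fi; case/negP: iX; rewrite in_fset_set ?inE //; exact: fin.
have out E : exists2 X : {fset I}, (forall i, i \notin X -> nval_ge E (F i)) &
    nval_ge E (S - \sum_(i <- X) F i).
  have [X HX] := conv E; exists X; last exact: HX.
  (* Adding to X one index i outside it changes the partial sum by F i, which is therefore a
     difference of two elements of T^E Lambda_0. *)
  move=> i iX; have := nval_geB (HX X (fsubset_refl _)) (HX (i |` X)%fset (fsubsetU1 _ _)).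
  rewrite big_fsetU1 //=; set s := \sum_(_ <- _) _.
  by have -> : S - s - (S - (F i + s)) = F i by ring.
split=> [E|l].
  have [X HX _] := out E; apply: (@sub_finite_set _ _ [set` X]); last exact: finite_fset.
  by move=> i Fi /=; apply/negPn/negP => /HX.
have [X HX HS] := out (l + 1).
have l1 : l < l + 1 by rewrite ltrDl.
have := HS _ l1; rewrite novD novN nov_sumE => /eqP; rewrite subr_eq0 => /eqP ->.
by rewrite (fsbigTE X) // => i /HX; apply.
Qed.

Lemma nsums_uniq (I : choiceType) (F : I -> Lam) S S' : nsums F S -> nsums F S' -> S = S'.
Proof. by move=> [_ H] [_ H']; apply: novP => l; rewrite H H'. Qed.

Lemma nsumE (I : choiceType) (F : I -> Lam) S : nsums F S -> nsum F = S.
Proof. by move=> FS; apply: xget_unique => // S' /nsums_uniq; exact. Qed.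

Lemma nsums_ext (I : choiceType) (F G : I -> Lam) S : F =1 G -> nsums F S -> nsums G S.
Proof. by move=> /funext ->. Qed.

Lemma nsumsD (I : choiceType) (F G : I -> Lam) S S' :
  nsums F S -> nsums G S' -> nsums (fun i => F i + G i) (S + S').
Proof.
move=> /nsums_nconv FS /nsums_nconv GS; apply/nsums_nconv => E.
have [X HX] := FS E; have [X' HX'] := GS E; exists (X `|` X')%fset => Y XY.
rewrite big_split /= opprD addrACA; apply: nval_geD.
  by apply: HX; apply: fsubset_trans XY; exact: fsubsetUl.
by apply: HX'; apply: fsubset_trans XY; exact: fsubsetUr.
Qed.

Lemma nsumsZ (I : choiceType) (F : I -> Lam) a S :
  nsums F S -> nsums (fun i => a * F i) (a * S).
Proof.
move=> /nsums_nconv FS; apply/nsums_nconv => E; have [c ac] := nov_lb a.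
have [X HX] := FS (E - c); exists X => Y XY.
by rewrite -mulr_sumr -mulrBr -(subrKC c E); apply: nval_geM => //; exact: HX.
Qed.

Lemma nsums_sum (I : choiceType) (J : Type) (r : seq J) (F : J -> I -> Lam) (S : J -> Lam) :
  (forall j, nsums (F j) (S j)) ->
  nsums (fun i => \sum_(j <- r) F j i) (\sum_(j <- r) S j).
Proof.
move=> FS; elim: r => [|j r IH]; last first.
  rewrite big_cons; apply: nsums_ext (nsumsD (FS j) IH) => i.
  by rewrite big_cons.
rewrite big_nil; apply/nsums_nconv => E; exists fset0 => Y _.
by rewrite big1 ?subrr // => i _; rewrite big_nil.
Qed.

Lemma nsums_ex (I : choiceType) (F : I -> Lam) :
  (forall E, finite_set [set i | ~ nval_ge E (F i)]) -> exists S, nsums F S.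
Proof.
move=> fin; pose X E := fset_set [set i | ~ nval_ge E (F i)].
have XP E i : i \notin X E -> nval_ge E (F i).
  move=> iX; apply: contrapT => Fi; case/negP: iX; rewrite in_fset_set ?inE //; exact: fin.
pose s l := \sum_(i \in [set: I]) F i l.
have sE E l : l < E -> s l = (\sum_(i <- X E) F i) l.
  by move=> lE; rewrite nov_sumE /s (fsbigTE (X E)) // => i /XP; apply.
have sP E : finite_set [set l | l <= E /\ s l != 0].
  apply: sub_finite_set (ncoefP (\sum_(i <- X (E + 1)) F i) E) => l [lE sl].
  by split=> //; rewrite -(sE (E + 1)) //; apply: le_lt_trans lE _; rewrite ltrDl.
by exists (Nov sP).
Qed.

(** Summation by fibres of g. Modulo T^E each fibre sum equals its part in the finite set X1, which
    contains all non-negligible terms, so any finite set of fibres containing the image of X1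
    computes S. *)
Lemma nsums_group (I J : choiceType) (g : I -> J) (F : I -> Lam) S : nsums F S ->
  exists G, (forall j, nsums (fun i => if g i == j then F i else 0) (G j)) /\ nsums G S.
Proof.
move=> FS; have sub j : exists S', nsums (fun i => if g i == j then F i else 0) S'.
  apply: nsums_ex => E; apply: sub_finite_set (FS.1 E) => i /=.
  by apply: contra_not => Fi; case: ifP.
pose G j := projT1 (cid (sub j)).
have GP j : nsums (fun i => if g i == j then F i else 0) (G j).
  by rewrite /G; case: cid.
exists G; split=> //.
have [fin _] := FS; move/nsums_nconv: FS => FS.
apply/nsums_nconv => E; have [X HX] := FS E.
pose X1 := (X `|` fset_set [set i | ~ nval_ge E (F i)])%fset.
exists (g @` X1)%fset => Y XY.
pose Z := [fset i in X1 | g i \in Y]%fset.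
have ZX : Z = X1.
  apply/fsetP => i; rewrite !inE /=; apply/andP/idP => [[]//|iX]; split=> //.
  by apply: (fsubsetP XY); apply: in_imfset; rewrite /= inE.
have GE j : nval_ge E (G j - \sum_(i <- X1) (if g i == j then F i else 0)).
  have /nsums_nconv /(_ E) [X' HX'] := GP j.
  have := HX' (X' `|` X1)%fset (fsubsetUl _ _).
  rewrite (big_fsetID _ (mem X1)) /= opprD addrA.
  set A := [fset i in X' `|` X1 | i \in mem X1]%fset.
  have -> : A = X1.
    apply/fsetP => i; rewrite /A !inE /=.
    by apply: andb_idl => ->; rewrite orbT.
  set B := \sum_(i <- [fset _ | _ in _ & _]%fset) _ => H.
  have BE : nval_ge E B.
    apply: nval_ge_sumin => i; rewrite !inE /= => /andP[_].
    rewrite negb_or => /andP[_ iN]; case: ifP => // _; apply: contrapT => Fi.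
    by case/negP: iN; rewrite in_fset_set ?inE //; exact: fin.
  by have := nval_geD H BE; rewrite subrK.
have := HX X1 (fsubsetUl _ _).
have -> : \sum_(i <- X1) F i = \sum_(j <- Y) \sum_(i <- X1) (if g i == j then F i else 0).
  rewrite exchange_big /= !big_seq; apply: eq_bigr => i iX1.
  rewrite (big_fsetD1 (g i)) /=; last first.
    by apply: (fsubsetP XY); exact: in_imfset.
  rewrite eqxx big_seq_cond big1 ?addr0 // => j /andP[].
  by rewrite !inE eq_sym => /andP[/negPf ->].
move=> H; have := nval_geB H (nval_ge_sumin (r := Y) (F := fun j => G j -
   \sum_(i <- X1) (if g i == j then F i else 0)) (fun j _ => GE j)).
by rewrite sumrB opprB addrA subrK.
Qed.

Lemma nsums_fin (I : choiceType) (X : {fset I}) (F : I -> Lam) :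
  (forall i, i \notin X -> F i = 0) -> nsums F (\sum_(i <- X) F i).
Proof.
move=> F0; apply/nsums_nconv => E; exists X => Y XY.
rewrite -(big_fset_incl _ XY) ?subrr // => i _ /F0 //.
Qed.

Lemma nsums_inj (I J : choiceType) (h : J -> I) (F : I -> Lam) S : injective h ->
  (forall i, (forall j, i <> h j) -> F i = 0) -> nsums F S -> nsums (F \o h) S.
Proof.
move=> hi F0 [fin val]; split=> [E|l].
  have := fin E; move/(finite_preimage (f := h)); apply=> x y _ _; exact: hi.
rewrite val; transitivity (\sum_(i \in h @` [set: J]) F i l).
  apply/esym/fsbig_widen => // i [_ hN] /=; rewrite F0 // => j ij; apply: hN.
  by exists j.
by rewrite fsbig_image // => x y _ _; exact: hi.
Qed.

Lemma nsums_bij (I J : choiceType) (h : J -> I) (F : I -> Lam) S : bijective h ->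
  nsums F S <-> nsums (F \o h) S.
Proof.
move=> hb; split; first apply: nsums_inj; first exact: bij_inj.
  by case: hb => h' hK h'K i /(_ (h' i)); rewrite h'K.
case: hb => h' hK h'K /(nsums_inj (h := h')) H.
have {}H : nsums ((F \o h) \o h') S.
  by apply: H; [exact: can_inj h'K|move=> j /(_ (h j)); rewrite hK].
by apply: nsums_ext H => i /=; rewrite h'K.
Qed.

Lemma nsums_ge E (I : choiceType) (F : I -> Lam) S : nsums F S ->
  (forall i, nval_ge E (F i)) -> nval_ge E S.
Proof. by move=> [_ val] FE l lE; rewrite val fsbig1 // => i _; apply: FE. Qed.

Lemma nsums_val_single (I : choiceType) (F : I -> Lam) S i0 l : nsums F S ->
  (forall i, i != i0 -> F i l = 0) -> S l = F i0 l.
Proof.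
move=> [_ ->] F0; rewrite (fsbigTE [fset i0]%fset) ?big_seq_fset1 //.
by move=> i; rewrite inE; exact: F0.
Qed.

Lemma nsums_lb (I : choiceType) (F : I -> Lam) S : nsums F S ->
  exists a, forall i, nval_ge a (F i).
Proof.
move=> FS; have [X HX] : exists X : {fset I}, forall i, i \notin X -> nval_ge 0 (F i).
  exists (fset_set [set i | ~ nval_ge 0 (F i)]) => i iX; apply: contrapT => Fi.
  case/negP: iX; rewrite in_fset_set ?inE //; exact: FS.1.
have : exists a, a <= 0 /\ forall i, i \in (X : seq I) -> nval_ge a (F i).
  elim: (X : seq I) => [|i s [a [a0 IH]]]; first by exists 0; split.
  have [c Fc] := nov_lb (F i); exists (Order.min a c).
  split; first by rewrite ge_min a0.
  move=> j; rewrite inE => /predU1P[->|/IH].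
    by move: Fc; apply: nval_geW; rewrite ge_min lexx orbT.
  by apply: nval_geW; rewrite ge_min lexx.
move=> [a [a0 Ha]]; exists a => i; case: (boolP (i \in X)) => [/Ha//|/HX].
exact: nval_geW.
Qed.

(** Rectangles are cofinal among the finite sets of pairs. The thresholds E - c and E - b0
    compensate for the valuations of the partial sums of G and of S, which may be negative. *)
Lemma nsums_mul (I J : choiceType) (F : I -> Lam) (G : J -> Lam) S S' :
  nsums F S -> nsums G S' -> nsums (fun p => F p.1 * G p.2) (S * S').
Proof.
move=> FS GS.
have [a Fa] := nsums_lb FS; have [c Gc] := nsums_lb GS.
have fin E : finite_set [set p : I * J | ~ nval_ge E (F p.1 * G p.2)].
  apply: (@sub_finite_set _ _ ([set i | ~ nval_ge (E - c) (F i)] `*`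
      [set j | ~ nval_ge (E - a) (G j)])).
    move=> [i j] /= H; split=> /= H'; apply: H.
      by rewrite -(subrK c E); exact: nval_geM.
    by rewrite -(subrKC a E); exact: nval_geM.
  by apply: finite_setX; [exact: FS.1|exact: GS.1].
have [S0 HS0] := nsums_ex fin.
suff -> : S * S' = S0 by [].
apply/eqP; rewrite -subr_eq0; apply/eqP/nval_ge_eq0 => E.
have [b0 Sb] := nov_lb S.
move/nsums_nconv/(_ E): (HS0) => [X HX].
move/nsums_nconv: FS => FS; move/nsums_nconv: GS => GS.
have [XF HXF] := FS (E - c); have [XG HXG] := GS (E - b0).
pose YF := (XF `|` [fset p.1 | p in X])%fset.
pose YG := (XG `|` [fset p.2 | p in X])%fset.
have XY : (X `<=` YF `*` YG)%fset.
  apply/fsubsetP => p pX; rewrite in_fsetM /YF /YG !in_fsetU.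
  by rewrite !in_imfset //= !orbT.
have := HX _ XY; rewrite big_imfset2 /=; last by move=> [x y] [x' y'] _ _ /= [-> ->].
have -> : \sum_(i <- YF) \sum_(j <- YG) F i * G j =
    (\sum_(i <- YF) F i) * (\sum_(j <- YG) G j).
  by rewrite mulr_suml; apply: eq_bigr => i _; rewrite mulr_sumr.
set f := \sum_(i <- YF) F i; set g := \sum_(j <- YG) G j => H.
have -> : S * S' - S0 = - (S0 - f * g) + (S * (S' - g) + (S - f) * g) by ring.
apply: nval_geD; first exact: nval_geN.
apply: nval_geD.
  by rewrite -(subrKC b0 E); apply: nval_geM => //; apply: HXG; exact: fsubsetUl.
rewrite -(subrK c E); apply: nval_geM; last exact: nval_ge_sum.
by apply: HXF; exact: fsubsetUl.
Qed.

End NovikovSums.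

(** * The exponential on Lambda_+ *)

Section NovikovExp.
Variables (R : realType) (K : numFieldType).
Local Notation Lam := (nov R K).
Implicit Types (a b : Lam).

Lemma nsums_finT (I : choiceType) (T : finType) (h : T -> I) (F : I -> Lam) :
  injective h -> (forall i, (forall t, i <> h t) -> F i = 0) ->
  nsums F (\sum_t F (h t)).
Proof.
move=> hi F0; have -> : \sum_t F (h t) = \sum_(i <- [fset h t | t in T]%fset) F i.
  rewrite big_imfset /=; last by move=> x y _ _; exact: hi.
  by rewrite big_enum.
apply: nsums_fin => i iN; apply: F0 => t it; case/negP: iN.
by rewrite it; apply: in_imfset.
Qed.

Lemma nov_natr_neq0 n : n.+1%:R != 0 :> Lam.
Proof. by rewrite -(@nconst_natr R K) -nconst0 (inj_eq (@nconst_inj _ _)) pnatr_eq0. Qed.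

Lemma nov_fact_neq0 n : n`!%:R != 0 :> Lam.
Proof. by rewrite -(prednK (fact_gt0 n)) nov_natr_neq0. Qed.

Lemma nval_ge_factV n : nval_ge 0 (n`!%:R^-1 : Lam).
Proof. by rewrite -(@nconst_natr R K) -nconstV; exact: nconst_ge0. Qed.

Lemma nexp_sums a : nval_gt0 a -> nsums (fun k : nat => (k`!%:R)^-1 * a ^+ k) (nexp a).
Proof.
move=> a0; have [d d0 ad] := nval_gt0_pos a0.
have [|S HS] := @nsums_ex R K nat (fun k : nat => (k`!%:R)^-1 * a ^+ k).
  move=> E; apply: (@sub_finite_set _ _ [set k | (k < (Num.truncn (E / d)).+1)%N]).
    move=> k /= H; rewrite ltnNge; apply/negP => kE; apply: H.
    apply: nval_geMl; first exact: nval_ge_factV.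
    apply: nval_geW (@nval_geX _ _ _ _ k ad); rewrite -ler_pdivrMr //.
    apply: ltW; apply: lt_le_trans (_ : (Num.truncn (E / d)).+1%:R <= _).
      by apply: real_truncnS_gt; exact: num_real.
    by rewrite ler_nat.
  exact: finite_II.
by rewrite /nexp (nsumE HS).
Qed.

Lemma nexp0 : nexp (0 : Lam) = 1.
Proof.
have /nexp_sums H : nval_gt0 (0 : Lam) by [].
rewrite (nsums_uniq H (nsums_finT (h := fun _ : unit => 0%N) _ _)).
- by rewrite big_const card_unit /= expr0 fact0 invr1 mulr1 addr0.
- by move=> [] [].
by move=> [/(_ tt)//|i _]; rewrite expr0n mulr0.
Qed.

(** The Cauchy product is regrouped by total degree; [h] enumerates the finite fibre of degree s,
    where the binomial formula applies. *)
Lemma nexpD a b : nval_gt0 a -> nval_gt0 b -> nexp (a + b) = nexp a * nexp b.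
Proof.
move=> a0 b0.
have := nsums_mul (nexp_sums a0) (nexp_sums b0).
move=> /(nsums_group (fun p : nat * nat => (p.1 + p.2)%N))[G [GE HG]].
apply: nsums_uniq (nexp_sums (nval_gt0D a0 b0)) _.
apply: nsums_ext HG => s; pose h (i : 'I_s.+1) : nat * nat := (s - i, i : nat)%N.
rewrite (nsums_uniq (GE s) (nsums_finT (h := h) _ _)).
- rewrite exprDn mulr_sumr; apply: eq_bigr => i _; rewrite /h /=.
  have le_is : (i <= s)%N by rewrite -ltnS.
  rewrite subnK // eqxx -mulr_natr -(bin_fact le_is) !natrM.
  have := nov_fact_neq0 i; have := nov_fact_neq0 (s - i).
  have : 'C(s, i)%:R != 0 :> Lam.
    by have := nov_natr_neq0 ('C(s, i)).-1; rewrite prednK // bin_gt0.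
  by move=> h1 h2 h3; field; rewrite h1 h2 h3.
- by move=> i j [_ /val_inj].
move=> [i j] /= H; case: eqP => // ijs.
have js : (j < s.+1)%N by rewrite ltnS -ijs leq_addl.
by case: (H (Ordinal js)); rewrite /h /= -ijs addnK.
Qed.

End NovikovExp.

(** * Clifford algebras *)

Section Clifford.
Variables (K : fieldType) (V : lmodType K) (n : nat).
Variables (mul : V -> V -> V) (one : V) (sg : V -> V).
Local Notation "x ** y" := (mul x y) (at level 40, left associativity).
Hypothesis mulPl : forall a x y z, (a *: x + y) ** z = a *: (x ** z) + y ** z.
Hypothesis mulPr : forall a x y z, z ** (a *: x + y) = a *: (z ** x) + z ** y.
Hypothesis mulA : forall x y z, x ** (y ** z) = x ** y ** z.
Hypothesis mul1 : forall x, one ** x = x.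
Hypothesis mulx1 : forall x, x ** one = x.
Hypothesis sgP : forall a x y, sg (a *: x + y) = a *: sg x + sg y.
Hypothesis sgM : forall x y, sg (x ** y) = sg x ** sg y.
Hypothesis sg1 : sg one = one.

Variables (v vu : 'I_n -> V).
Hypothesis sgv : forall i, sg (v i) = - v i.
Hypothesis sgvu : forall i, sg (vu i) = - vu i.
Hypothesis vu_v : forall i j, vu i ** v j + v j ** vu i = (i == j)%:R *: one.

Lemma lin0 (f : V -> V) : (forall a x y, f (a *: x + y) = a *: f x + f y) -> f 0 = 0.
Proof. by move=> fP; have := fP (-1) 0 0; rewrite scaleN1r oppr0 addr0 scaleN1r addNr. Qed.

Lemma linD (f : V -> V) : (forall a x y, f (a *: x + y) = a *: f x + f y) ->
  {morph f : x y / x + y}.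
Proof. by move=> fP x y; rewrite -[x in LHS]scale1r fP scale1r. Qed.

Lemma linZ (f : V -> V) : (forall a x y, f (a *: x + y) = a *: f x + f y) ->
  forall a, {morph f : x / a *: x}.
Proof. by move=> fP a x; rewrite -[a *: x in LHS]addr0 fP lin0 // addr0. Qed.

Lemma linN (f : V -> V) : (forall a x y, f (a *: x + y) = a *: f x + f y) ->
  {morph f : x / - x}.
Proof. by move=> fP x; rewrite -!scaleN1r linZ. Qed.

Let mull z := fun x => x ** z.
Let mullP z a x y : mull z (a *: x + y) = a *: mull z x + mull z y. Proof. exact: mulPl. Qed.
Let mulr z := fun x => z ** x.
Let mulrP z a x y : mulr z (a *: x + y) = a *: mulr z x + mulr z y. Proof. exact: mulPr. Qed.

Let mDl x y z : (x + y) ** z = x ** z + y ** z. Proof. exact: (linD (mullP z)). Qed.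
Let mDr x y z : z ** (x + y) = z ** x + z ** y. Proof. exact: (linD (mulrP z)). Qed.
Let mZl a x z : (a *: x) ** z = a *: (x ** z). Proof. exact: (linZ (mullP z)). Qed.
Let mZr a x z : z ** (a *: x) = a *: (z ** x). Proof. exact: (linZ (mulrP z)). Qed.
Let mNl x z : (- x) ** z = - (x ** z). Proof. exact: (linN (mullP z)). Qed.
Let mNr x z : z ** (- x) = - (z ** x). Proof. exact: (linN (mulrP z)). Qed.
Let m0l z : 0 ** z = 0. Proof. exact: (lin0 (mullP z)). Qed.
Let m0r z : z ** 0 = 0. Proof. exact: (lin0 (mulrP z)). Qed.
Let sgN x : sg (- x) = - sg x. Proof. exact: (linN sgP). Qed.

(* Contraction with the i-th coordinate. *)
Definition cdel (i : 'I_n) (x : V) : V := vu i ** x - sg x ** vu i.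

Lemma cdelP i a x y : cdel i (a *: x + y) = a *: cdel i x + cdel i y.
Proof.
by rewrite /cdel sgP mulPl mulPr opprD addrACA -scalerBr.
Qed.

Lemma cdel_one i : cdel i one = 0.
Proof. by rewrite /cdel sg1 mul1 mulx1 subrr. Qed.

Lemma cdelM i x y : cdel i (x ** y) = cdel i x ** y + sg x ** cdel i y.
Proof.
by rewrite /cdel sgM mDl mNl mDr mNr !mulA addrA addrNK.
Qed.

Lemma cdel_v i j : cdel i (v j) = (i == j)%:R *: one.
Proof. by rewrite /cdel sgv mNl opprK vu_v. Qed.

Lemma cdel_vM i j x : cdel i (v j ** x) = (i == j)%:R *: x - v j ** cdel i x.
Proof. by rewrite cdelM cdel_v mZl mul1 sgv mNl. Qed.

Definition vprod (s : seq 'I_n) : V := foldr (fun j x => v j ** x) one s.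

Lemma cdel_vprod_notin i s : i \notin s -> cdel i (vprod s) = 0.
Proof.
elim: s => [|j s IH] /=; first by rewrite cdel_one.
rewrite inE negb_or => /andP[/negPf ij /IH H].
by rewrite cdel_vM ij scale0r H m0r subr0.
Qed.

(** Only the vanishing of coefficients matters in the sequel, so the sign is left unspecified. *)
Lemma cdel_vprod_in i s : uniq s -> i \in s ->
  exists k, cdel i (vprod s) = (-1) ^+ k *: vprod (rem i s).
Proof.
elim: s => [//|j s IH] /= /andP[js us]; rewrite inE cdel_vM.
case: eqVneq => [->|ij] /= h.
  by exists 0%N; rewrite cdel_vprod_notin // m0r subr0 /= ?eqxx.
have [k ->] := IH us h; exists k.+1.
rewrite scale0r sub0r /= mZr exprS mulN1r scaleNr.
by [].
Qed.

Lemma rem_enum i (J : {set 'I_n}) : rem i (enum J) = enum (J :\ i).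
Proof.
rewrite rem_filter ?enum_uniq // /enum_mem -filter_predI.
by apply: eq_filter => j /=; rewrite !inE.
Qed.

Definition vset (J : {set 'I_n}) : V := vprod (enum J).

Lemma cdel_vset_notin i (J : {set 'I_n}) : i \notin J -> cdel i (vset J) = 0.
Proof. by move=> iJ; apply: cdel_vprod_notin; rewrite mem_enum. Qed.

Lemma cdel_vset_in i (J : {set 'I_n}) : i \in J ->
  exists k, cdel i (vset J) = (-1) ^+ k *: vset (J :\ i).
Proof.
move=> iJ; have [||k ->] := @cdel_vprod_in i (enum J); rewrite ?enum_uniq ?mem_enum //.
by exists k; rewrite rem_enum.
Qed.

Lemma sg_vset (J : {set 'I_n}) : sg (vset J) = (-1) ^+ #|J| *: vset J.
Proof.
rewrite /vset cardE; elim: (enum J) => [|j s IH] /=; first by rewrite sg1 scale1r.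
by rewrite sgM IH sgv mNl mZr exprS mulN1r scaleNr.
Qed.

Variable co : {set 'I_n} -> V -> K.
Hypothesis coP : forall J a x y, co J (a *: x + y) = a * co J x + co J y.
Hypothesis co_vset : forall J J', co J (vset J') = (J == J')%:R.
Hypothesis co_sum : forall x, x = \sum_J co J x *: vset J.

Lemma co0 J : co J 0 = 0.
Proof. by have := coP J (-1) 0 0; rewrite scaleN1r oppr0 addr0 mulN1r addNr. Qed.

Lemma coZ J a x : co J (a *: x) = a * co J x.
Proof. by rewrite -[a *: x]addr0 coP co0 addr0. Qed.

Lemma coD J x y : co J (x + y) = co J x + co J y.
Proof. by rewrite -[x in LHS]scale1r coP mul1r. Qed.

Lemma co_bigsum J (I : Type) (r : seq I) (P : pred I) (F : I -> V) :
  co J (\sum_(i <- r | P i) F i) = \sum_(i <- r | P i) co J (F i).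
Proof. by apply: big_morph => [x y|]; rewrite ?coD ?co0. Qed.

Lemma cdel_sum i (I : Type) (r : seq I) (P : pred I) (F : I -> V) :
  cdel i (\sum_(j <- r | P j) F j) = \sum_(j <- r | P j) cdel i (F j).
Proof. by apply: big_morph => [x y|]; rewrite ?(linD (cdelP i)) ?(lin0 (cdelP i)). Qed.

(** Contraction with i kills the monomials without i and sends the others, up to sign, to distinct
    monomials. The coefficient of J in x is thus, up to sign, that of J without i in the
    contraction. *)
Lemma cdel_coef i x (J : {set 'I_n}) : i \in J -> cdel i x = 0 -> co J x = 0.
Proof.
move=> iJ; rewrite [x in cdel i x]co_sum cdel_sum => /(congr1 (co (J :\ i))).
rewrite co0 co_bigsum (bigD1 J) //= (linZ (cdelP i)) coZ.
have [k ->] := cdel_vset_in iJ; rewrite coZ co_vset eqxx mulr1 big1 ?addr0.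
  by move/eqP; rewrite mulf_eq0 expf_eq0 oppr_eq0 oner_eq0 andbF orbF => /eqP.
move=> J' J'J; rewrite (linZ (cdelP i)) coZ.
have [iJ'|/cdel_vset_notin ->] := boolP (i \in J'); last by rewrite co0 mulr0.
have [k' ->] := cdel_vset_in iJ'; rewrite coZ co_vset.
case: eqVneq => [e|_]; last by rewrite !mulr0.
by case/eqP: J'J; rewrite -(finset.setD1K iJ') -e finset.setD1K.
Qed.

(** The hypothesis says that all contractions of x vanish, so no monomial with a non-empty index set
    occurs in x. *)
Lemma supercentral_scalar x : (forall i, vu i ** x = sg x ** vu i) ->
  x = co finset.set0 x *: one.
Proof.
move=> xc; rewrite {1}[x]co_sum (bigD1 finset.set0) //= big1 ?addr0.
  by rewrite /vset enum_set0.
move=> J /set0Pn[i iJ]; rewrite (@cdel_coef i) ?scale0r //.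
by rewrite /cdel xc subrr.
Qed.

Fixpoint cdels (s : seq 'I_n) (x : V) : V := if s is i :: s' then cdel i (cdels s' x) else x.

Lemma cdels_vset s (J : {set 'I_n}) : uniq s ->
  if [set i in s]%SET \subset J then exists k, cdels s (vset J) = (-1) ^+ k *: vset (J :\: [set i in s]%SET)
  else cdels s (vset J) = 0.
Proof.
elim: s => [_|i s IH] /=.
  rewrite (_ : [set i in [::]]%SET = finset.set0); last by apply/setP => i; rewrite !inE.
  by rewrite finset.sub0set; exists 0%N; rewrite finset.setD0 scale1r.
move=> /andP[is_ us]; have {IH} := IH us.
have -> : [set j in i :: s]%SET = i |: [set j in s]%SET by apply/setP => j; rewrite !inE.
rewrite finset.subUset finset.sub1set; case: ifP => [_ [k ->]|_ ->]; last first.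
  by rewrite andbF (lin0 (cdelP i)).
rewrite andbT (linZ (cdelP i)); case: ifP => iJ; last first.
  by rewrite cdel_vset_notin ?scaler0 // !inE iJ andbF.
have [|k' ->] := @cdel_vset_in i (J :\: [set j in s]%SET); first by rewrite !inE is_ iJ.
exists (k + k')%N; rewrite scalerA exprD; congr (_ *: vset _).
by apply/setP => j; rewrite !inE negb_or andbA.
Qed.

(* The rank one operator x |-> v_top * (d_1 .. d_n x) has supertrace +-1 and is
   a combination of the operators x |-> (-1)^(|c||x|) a x c. *)
Lemma supertrace_neq0 :
  ~ (forall (p : bool) a c, sg a = (-1) ^+ p *: a -> sg c = (-1) ^+ p *: c ->
     \sum_(J : {set 'I_n}) (-1) ^+ #|J| * co J ((-1) ^+ (p * #|J|) *: (a ** vset J ** c)) = 0).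
Proof.
move=> H.
(* Operators with contractions inserted are still combinations of operators x |-> (-1)^(|c||x|) a x
   c: a contraction is left minus signed right multiplication by [vu i], which can be absorbed into
   a or into c, changing its parity. So their supertraces vanish as well. *)
have red s : forall a c (p q : nat), odd (p + q + size s) = false ->
    sg a = (-1) ^+ p *: a -> sg c = (-1) ^+ q *: c ->
    \sum_(J : {set 'I_n}) (-1) ^+ #|J| *
      co J ((-1) ^+ (q * #|J|) *: (a ** cdels s (vset J) ** c)) = 0.
  elim: s => [|i s IH] a c p q pq sa sc.
    rewrite -[RHS](H (odd q) a c).
    - apply: eq_bigr => J _; congr (_ * co J (_ *: _)).
      by rewrite -signr_odd oddM -[RHS]signr_odd oddM oddb.
    - by move: pq; rewrite addn0 oddD sa -signr_odd; case: (odd p); case: (odd q).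
    by rewrite sc -signr_odd.
  have sgav : sg (a ** vu i) = (-1) ^+ p.+1 *: (a ** vu i).
    by rewrite sgM sa sgvu mNr mZl exprS mulN1r scaleNr.
  have sgvc : sg (vu i ** c) = (-1) ^+ q.+1 *: (vu i ** c).
    by rewrite sgM sc sgvu mNl mZr exprS mulN1r scaleNr.
  have sgd (J : {set 'I_n}) : sg (cdels s (vset J)) = (-1) ^+ (size s + #|J|) *: cdels s (vset J).
    elim: {IH pq}s => [|j s IH] /=; first exact: sg_vset.
    rewrite /cdel (linD sgP) sgN !sgM sgvu IH (linZ sgP) IH exprS mulN1r.
    by rewrite mNl !mZr !mNr !mZl !scaleNr scalerDr opprD scalerN.
  have pq1 : odd (p.+1 + q + size s) = false
    by move: pq; rewrite !oddD /=; case: (odd p); case: (odd q); case: (odd (size s)).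
  have pq2 : odd (p + q.+1 + size s) = false
    by move: pq; rewrite !oddD /=; case: (odd p); case: (odd q); case: (odd (size s)).
  have E1 := IH _ _ _ _ pq1 sgav sc; have E2 := IH _ _ _ _ pq2 sa sgvc.
  (* The coefficient comes from [sg] on the contracted monomial, of parity size s + #|J|; the factor
     (-1)^#|J| is already present in E2, whose right factor has parity q + 1. *)
  have E := congr2 (fun a b => a + (-1) ^+ (size s).+1 * b) E1 E2.
  rewrite /= mulr0 addr0 mulr_sumr -big_split /= in E.
  rewrite -[RHS]E; apply: eq_bigr => J _; rewrite !coZ.
  rewrite /= /cdel sgd mDr mNr mDl mNl coD -[- (a ** _ ** c)]scaleN1r coZ mZl mZr mZl coZ !mulA.
  set A := co J _; set B := co J _.
  rewrite !exprS mulSn !exprD; set e1 := (-1) ^+ #|J|; set e2 := (-1) ^+ (q * #|J|).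
  have e11 : e1 * e1 = 1 by rewrite -exprD addnn -signr_odd odd_double.
  by ring.
pose s := enum [set: 'I_n]%SET.
have us : uniq s by exact: enum_uniq.
have ss : [set i in s]%SET = finset.setT by apply/setP => i; rewrite !inE mem_enum inE.
(* All n contractions together kill every monomial but the top one, which becomes a sign times
   [one]. The parity condition holds because n + 0 + n is even. *)
have := red s (vset finset.setT) one n 0%N.
rewrite addn0 -cardE cardsT card_ord oddD addbb sg_vset cardsT card_ord sg1 expr0 scale1r.
move=> /(_ erefl erefl erefl).
rewrite (bigD1 finset.setT) //= big1 ?addr0.
  have := cdels_vset finset.setT us; rewrite ss subxx => -[k ->].
  rewrite finset.setDv /vset enum_set0 /= mulx1 mZr mulx1 !coZ co_vset eqxx mulr1 ?mul0n ?expr0 ?mul1r.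
  by move/eqP; rewrite mulf_eq0 !expf_eq0 oppr_eq0 oner_eq0 !andbF.
move=> J JT; have := cdels_vset J us; rewrite ss finset.subTset (negPf JT) => ->.
by rewrite m0r m0l scaler0 co0 mulr0.
Qed.

End Clifford.

(** * Cochains on the bar construction *)

Section Convolution.
Variables (K : fieldType) (T : finType) (par : T -> bool).
Local Notation Fun := (seq T -> K^o).
Local Notation sh := (shpar par).
Local Notation sx x := (nat_of_bool (~~ par x)).
Implicit Types (F G al be : Fun) (w : seq T) (phi psi : seq T -> T -> K).

Lemma sign_eq m n : odd m = odd n -> (-1) ^+ m = (-1) ^+ n :> K.
Proof. by rewrite -(signr_odd _ m) -(signr_odd _ n) => ->. Qed.

(* Functions on words are the dual of the bar construction, with product conv;
   a family phi of multilinear maps acts on them by the twisted derivation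
   der phi, and the A_infinity relations say that der m 1 squares to zero.
   der2 phi psi inserts phi to the left of psi. *)
Definition shift (x : T) F : Fun := fun w => F (x :: w).

Fixpoint conv (al be : Fun) (w : seq T) : K^o :=
  if w is x :: w' then al [::] * be w + conv (shift x al) be w' else al [::] * be [::].

Definition stw (b : nat) F : Fun := fun w => (-1) ^+ (b * sh w) * F w.

Definition tau (x : T) F : Fun := fun w => if w is y :: w' then (y == x)%:R * F w' else 0.

Definition one_nil : Fun := fun w => (w == [::])%:R.

(** Recursion on the place of insertion: phi takes a prefix of the word, or passes its first letter
    at the cost of a Koszul sign, a being the parity of phi for shifted degrees. *)
Fixpoint der (phi : seq T -> T -> K) (a : nat) (F : Fun) (w : seq T) : K^o :=
  (\sum_h conv (phi^~ h) (shift h F) w +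
   if w is x :: w' then (-1) ^+ (a * sx x) * der phi a (shift x F) w' else 0).

(** After phi has taken its letters, psi acts on what remains; the twist [stw b] records that psi,
    of parity b, has passed those letters. *)
Fixpoint der2 (phi psi : seq T -> T -> K) (a b : nat) (F : Fun) (w : seq T) : K^o :=
  (\sum_h conv (stw b (phi^~ h)) (der psi b (shift h F)) w +
   if w is x :: w' then (-1) ^+ ((a + b) * sx x) * der2 phi psi a b (shift x F) w' else 0).

Lemma convDl al al' be : conv (al + al') be = conv al be + conv al' be.
Proof.
apply/funext => w; elim: w al al' => [|x w IH] al al'; first exact: mulrDl.
change ((al [::] + al' [::]) * be (x :: w) + conv (shift x al + shift x al') be w =
  al [::] * be (x :: w) + conv (shift x al) be w +
  (al' [::] * be (x :: w) + conv (shift x al') be w)).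
by rewrite IH mulrDl addrACA.
Qed.

Lemma convZl c al be : conv (c *: al) be = c *: conv al be.
Proof.
apply/funext => w; elim: w al => [|x w IH] al.
  by change (c * al [::] * be [::] = c * (al [::] * be [::])); rewrite mulrA.
change (c * al [::] * be (x :: w) + conv (c *: shift x al) be w =
  c * (al [::] * be (x :: w) + conv (shift x al) be w)).
by rewrite IH mulrDr mulrA.
Qed.

Lemma convDr al be be' : conv al (be + be') = conv al be + conv al be'.
Proof.
apply/funext => w; elim: w al => [|x w IH] al; first exact: mulrDr.
change (al [::] * (be (x :: w) + be' (x :: w)) + conv (shift x al) (be + be') w =
  al [::] * be (x :: w) + conv (shift x al) be w +
  (al [::] * be' (x :: w) + conv (shift x al) be' w)).
by rewrite IH mulrDr addrACA.
Qed.

Lemma convZr c al be : conv al (c *: be) = c *: conv al be.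
Proof.
apply/funext => w; elim: w al => [|x w IH] al.
  by change (al [::] * (c * be [::]) = c * (al [::] * be [::])); rewrite mulrCA.
change (al [::] * (c * be (x :: w)) + conv (shift x al) (c *: be) w =
  c * (al [::] * be (x :: w) + conv (shift x al) be w)).
by rewrite IH mulrDr mulrCA.
Qed.

Lemma conv0l be : conv 0 be = 0.
Proof. by rewrite -[0 in LHS](scale0r (0 : Fun)) convZl scale0r. Qed.

Lemma conv0r al : conv al 0 = 0.
Proof. by rewrite -[0 in LHS](scale0r (0 : Fun)) convZr scale0r. Qed.

Lemma conv_suml (I : Type) (r : seq I) (A : I -> Fun) be :
  conv (\sum_(i <- r) A i) be = \sum_(i <- r) conv (A i) be.
Proof. by apply: (big_morph (conv^~ be)) => [x y|]; rewrite ?convDl ?conv0l. Qed.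

Lemma shiftD x F G : shift x (F + G) = shift x F + shift x G. Proof. by []. Qed.
Lemma shiftZ x c F : shift x (c *: F) = c *: shift x F. Proof. by []. Qed.

Lemma shift_conv x al be :
  shift x (conv al be) = al [::] *: shift x be + conv (shift x al) be.
Proof. by []. Qed.

Lemma twD b F G : stw b (F + G) = stw b F + stw b G.
Proof. by apply/funext => w; exact: mulrDr. Qed.

Lemma twZ b c F : stw b (c *: F) = c *: stw b F.
Proof.
apply/funext => w.
by change ((-1) ^+ (b * sh w) * (c * F w) = c * ((-1) ^+ (b * sh w) * F w)); rewrite mulrCA.
Qed.

Lemma shift_tw x b F : shift x (stw b F) = (-1) ^+ (b * sx x) *: stw b (shift x F).
Proof.
apply/funext => w; change ((-1) ^+ (b * (sx x + sh w)) * F (x :: w) =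
  (-1) ^+ (b * sx x) * ((-1) ^+ (b * sh w) * F (x :: w))).
by rewrite mulnDr exprD mulrA.
Qed.

Lemma tw_nil b F : stw b F [::] = F [::].
Proof. by rewrite /stw /= muln0 mul1r. Qed.

Lemma tw_conv b al be : stw b (conv al be) = conv (stw b al) (stw b be).
Proof.
apply/funext => w; elim: w al => [|x w IH] al.
  by rewrite /= !tw_nil.
rewrite /= -/(conv _ _) {1}/stw /= mulrDr tw_nil; congr (_ + _); first by rewrite mulrCA.
rewrite shift_tw convZl mulnDr exprD -mulrA.
by congr (_ * _); exact: IH.
Qed.

Lemma fun_sumE (I : Type) (r : seq I) (A : I -> Fun) w :
  (\sum_(i <- r) A i) w = \sum_(i <- r) A i w.
Proof. by elim/big_rec2 : _ => // i y1 y2 _ <-. Qed.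

Definition ins (phi : seq T -> T -> K) F : Fun := \sum_h conv (phi^~ h) (shift h F).

Lemma der_nil phi a F : der phi a F [::] = ins phi F [::].
Proof. by rewrite /= addr0 /ins fun_sumE. Qed.

Lemma der_cons phi a F x w : der phi a F (x :: w) =
  ins phi F (x :: w) + (-1) ^+ (a * sx x) * der phi a (shift x F) w.
Proof. by rewrite /ins fun_sumE. Qed.

Definition ins2 (phi psi : seq T -> T -> K) b F : Fun :=
  \sum_h conv (stw b (phi^~ h)) (der psi b (shift h F)).

Lemma der2_nil phi psi a b F : der2 phi psi a b F [::] = ins2 phi psi b F [::].
Proof. by rewrite /= addr0 /ins2 fun_sumE. Qed.

Lemma der2_cons phi psi a b F x w : der2 phi psi a b F (x :: w) =
  ins2 phi psi b F (x :: w) + (-1) ^+ ((a + b) * sx x) * der2 phi psi a b (shift x F) w.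
Proof. by rewrite /ins2 fun_sumE. Qed.

Lemma insD phi F G : ins phi (F + G) = ins phi F + ins phi G.
Proof. by rewrite /ins -big_split; apply: eq_bigr => h _; rewrite shiftD convDr. Qed.

Lemma insZ phi c F : ins phi (c *: F) = c *: ins phi F.
Proof. by rewrite /ins scaler_sumr; apply: eq_bigr => h _; rewrite shiftZ convZr. Qed.

Lemma derD phi a F G : der phi a (F + G) = der phi a F + der phi a G.
Proof.
apply/funext => w; change (der phi a (F + G) w = der phi a F w + der phi a G w).
elim: w F G => [|x w IH] F G; first by rewrite !der_nil insD.
rewrite !der_cons shiftD IH insD mulrDr.
by rewrite addrACA.
Qed.

Lemma derZ phi a c F : der phi a (c *: F) = c *: der phi a F.
Proof.
apply/funext => w; change (der phi a (c *: F) w = c * der phi a F w).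
elim: w F => [|x w IH] F; first by rewrite !der_nil insZ.
by rewrite !der_cons shiftZ IH insZ mulrDr mulrCA.
Qed.

Lemma ins2D phi psi b F G : ins2 phi psi b (F + G) = ins2 phi psi b F + ins2 phi psi b G.
Proof. by rewrite /ins2 -big_split; apply: eq_bigr => h _; rewrite shiftD derD convDr. Qed.

Lemma ins2Z phi psi b c F : ins2 phi psi b (c *: F) = c *: ins2 phi psi b F.
Proof. by rewrite /ins2 scaler_sumr; apply: eq_bigr => h _; rewrite shiftZ derZ convZr. Qed.

Lemma der2D phi psi a b F G :
  der2 phi psi a b (F + G) = der2 phi psi a b F + der2 phi psi a b G.
Proof.
apply/funext => w.
change (der2 phi psi a b (F + G) w = der2 phi psi a b F w + der2 phi psi a b G w).
elim: w F G => [|x w IH] F G; first by rewrite !der2_nil ins2D.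
rewrite !der2_cons shiftD IH ins2D mulrDr.
by rewrite addrACA.
Qed.

Lemma der2Z phi psi a b c F : der2 phi psi a b (c *: F) = c *: der2 phi psi a b F.
Proof.
apply/funext => w; change (der2 phi psi a b (c *: F) w = c * der2 phi psi a b F w).
elim: w F => [|x w IH] F; first by rewrite !der2_nil ins2Z.
by rewrite !der2_cons shiftZ IH ins2Z mulrDr mulrCA.
Qed.

Lemma convA al be ga : conv (conv al be) ga = conv al (conv be ga).
Proof.
apply/funext => w; elim: w al => [|x w IH] al /=; first by rewrite mulrA.
change (al [::] * be [::] * ga (x :: w) +
  conv (al [::] *: shift x be + conv (shift x al) be) ga w =
  al [::] * (be [::] * ga (x :: w) + conv (shift x be) ga w) +
  conv (shift x al) (conv be ga) w).
rewrite convDl convZl -IH mulrDr !addrA mulrA.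
by [].
Qed.

Lemma ins_conv phi al be : ins phi (conv al be) =
  conv (ins phi al) be + al [::] *: ins phi be.
Proof.
rewrite /ins conv_suml scaler_sumr -big_split; apply: eq_bigr => h _.
by rewrite shift_conv convDr convZr addrC convA.
Qed.

(** The insertion takes place in one of the two factors. In the second one phi has passed the whole
    first factor, hence the twist. *)
Lemma der_conv phi a al be : der phi a (conv al be) =
  conv (der phi a al) be + conv (stw a al) (der phi a be).
Proof.
apply/funext => w.
change (der phi a (conv al be) w = conv (der phi a al) be w + conv (stw a al) (der phi a be) w).
elim: w al be => [|x w IH] al be.
  rewrite der_nil ins_conv.
  change ((ins phi al [::] * be [::]) + al [::] * ins phi be [::] =
    der phi a al [::] * be [::] + stw a al [::] * der phi a be [::]).
  by rewrite !der_nil tw_nil.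
rewrite der_cons ins_conv shift_conv derD derZ.
change (conv (ins phi al) be (x :: w) + al [::] * ins phi be (x :: w) +
 (-1) ^+ (a * sx x) * (al [::] * der phi a (shift x be) w +
    der phi a (conv (shift x al) be) w) =
 (der phi a al [::] * be (x :: w) + conv (shift x (der phi a al)) be w) +
 (stw a al [::] * der phi a be (x :: w) + conv (shift x (stw a al)) (der phi a be) w)).
have -> : shift x (der phi a al) = shift x (ins phi al) +
    (-1) ^+ (a * sx x) *: der phi a (shift x al).
  by apply/funext => w'; rewrite {1}/shift der_cons.
rewrite IH der_nil der_cons tw_nil shift_tw convDl !convZl.
change (conv (ins phi al) be (x :: w)) with (ins phi al [::] * be (x :: w) +
  conv (shift x (ins phi al)) be w).
set A := conv (shift x (ins phi al)) be w.
set B := conv (der phi a (shift x al)) be w.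
set C := conv (stw a (shift x al)) (der phi a be) w.
change ((conv (shift x (ins phi al)) be +
  (-1) ^+ (a * sx x) *: conv (der phi a (shift x al)) be) w) with (A + (-1) ^+ (a * sx x) * B).
change (((-1) ^+ (a * sx x) *: conv (stw a (shift x al)) (der phi a be)) w) with
  ((-1) ^+ (a * sx x) * C).
by ring.
Qed.

Lemma ins2_conv phi psi b al be : ins2 phi psi b (conv al be) =
  conv (ins2 phi psi b al) be + conv (stw b (ins phi al)) (der psi b be)
  + al [::] *: ins2 phi psi b be.
Proof.
have twS (A : T -> Fun) : stw b (\sum_h A h) = \sum_h stw b (A h).
  apply: (big_morph (stw b)) => [F G|]; first exact: twD.
  by rewrite -[0 in LHS](scale0r (0 : Fun)) twZ scale0r.
rewrite /ins2 /ins twS !conv_suml scaler_sumr -!big_split; apply: eq_bigr => h _.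
rewrite shift_conv derD derZ convDr convZr der_conv convDr !convA tw_conv convA.
by rewrite addrC.
Qed.

(** Since phi stays to the left of psi, the only mixed term has phi in the first factor and psi in
    the second. *)
Lemma der2_conv phi psi a b al be : der2 phi psi a b (conv al be) =
  conv (der2 phi psi a b al) be + conv (stw b (der phi a al)) (der psi b be)
  + conv (stw (a + b) al) (der2 phi psi a b be).
Proof.
apply/funext => w.
change (der2 phi psi a b (conv al be) w = conv (der2 phi psi a b al) be w +
  conv (stw b (der phi a al)) (der psi b be) w +
  conv (stw (a + b) al) (der2 phi psi a b be) w).
elim: w al be => [|x w IH] al be.
  rewrite der2_nil ins2_conv.
  change ((ins2 phi psi b al [::] * be [::]) + stw b (ins phi al) [::] * der psi b be [::]
     + al [::] * ins2 phi psi b be [::] =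
    der2 phi psi a b al [::] * be [::] + stw b (der phi a al) [::] * der psi b be [::]
    + stw (a + b) al [::] * der2 phi psi a b be [::]).
  by rewrite !der2_nil !tw_nil !der_nil.
rewrite der2_cons ins2_conv shift_conv der2D der2Z.
pose d1 := shift x (der2 phi psi a b al); pose d2 := shift x (stw b (der phi a al)).
pose d3 := shift x (stw (a + b) al).
change ((ins2 phi psi b al [::] * be (x :: w) + conv (shift x (ins2 phi psi b al)) be w) +
 (stw b (ins phi al) [::] * der psi b be (x :: w) +
   conv (shift x (stw b (ins phi al))) (der psi b be) w) +
 al [::] * ins2 phi psi b be (x :: w) +
 (-1) ^+ ((a + b) * sx x) * (al [::] * der2 phi psi a b (shift x be) w +
    der2 phi psi a b (conv (shift x al) be) w) =
 (der2 phi psi a b al [::] * be (x :: w) + conv d1 be w) +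
 (stw b (der phi a al) [::] * der psi b be (x :: w) + conv d2 (der psi b be) w) +
 (stw (a + b) al [::] * der2 phi psi a b be (x :: w) + conv d3 (der2 phi psi a b be) w)).
have -> : d1 = shift x (ins2 phi psi b al) +
    (-1) ^+ ((a + b) * sx x) *: der2 phi psi a b (shift x al).
  by apply/funext => w'; rewrite {1}/d1 {1}/shift der2_cons.
have -> : d2 = shift x (stw b (ins phi al)) +
    (-1) ^+ ((a + b) * sx x) *: stw b (der phi a (shift x al)).
  rewrite /d2 !shift_tw.
  have -> : shift x (der phi a al) = shift x (ins phi al) +
      (-1) ^+ (a * sx x) *: der phi a (shift x al).
    by apply/funext => w'; rewrite {1}/shift der_cons.
  by rewrite twD twZ scalerDr scalerA -exprD -mulnDl (addnC b).
have -> : d3 = (-1) ^+ ((a + b) * sx x) *: stw (a + b) (shift x al) by rewrite /d3 shift_tw.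
rewrite IH !der2_nil !tw_nil der_nil der2_cons !convDl !convZl.
set e := (-1) ^+ _.
set A1 := conv (shift x (ins2 phi psi b al)) be.
set A2 := conv (shift x (stw b (ins phi al))) (der psi b be).
set B1 := conv (der2 phi psi a b (shift x al)) be.
set B2 := conv (stw b (der phi a (shift x al))) (der psi b be).
set B3 := conv (stw (a + b) (shift x al)) (der2 phi psi a b be).
change ((A1 + e *: B1) w) with (A1 w + e * B1 w).
change ((A2 + e *: B2) w) with (A2 w + e * B2 w).
change ((e *: B3) w) with (e * B3 w).
by ring.
Qed.

Lemma shift_tau y x G : shift y (tau x G) = (y == x)%:R *: G.
Proof. by []. Qed.

Lemma der_tau phi a x G :
  der phi a (tau x G) = conv (phi^~ x) G + (-1) ^+ (a * sx x) *: tau x (der phi a G).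
Proof.
have insE : ins phi (tau x G) = conv (phi^~ x) G.
  rewrite /ins (bigD1 x) //= shift_tau eqxx scale1r big1 ?addr0 // => h hx.
  by rewrite shift_tau (negPf hx) scale0r conv0r.
apply/funext => -[|y w].
  by rewrite der_nil insE; change (conv (phi^~ x) G [::] =
     conv (phi^~ x) G [::] + (-1) ^+ (a * sx x) * 0); rewrite mulr0 addr0.
rewrite der_cons insE shift_tau derZ.
change (conv (phi^~ x) G (y :: w) + (-1) ^+ (a * sx y) * ((y == x)%:R * der phi a G w) =
  conv (phi^~ x) G (y :: w) + (-1) ^+ (a * sx x) * ((y == x)%:R * der phi a G w)).
by case: eqP => [->//|_]; rewrite !mul0r !mulr0.
Qed.

Lemma der2_tau phi psi a b x G : der2 phi psi a b (tau x G) =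
  conv (stw b (phi^~ x)) (der psi b G) + (-1) ^+ ((a + b) * sx x) *: tau x (der2 phi psi a b G).
Proof.
have insE : ins2 phi psi b (tau x G) = conv (stw b (phi^~ x)) (der psi b G).
  rewrite /ins2 (bigD1 x) //= shift_tau eqxx scale1r big1 ?addr0 // => h hx.
  by rewrite shift_tau (negPf hx) derZ scale0r conv0r.
apply/funext => -[|y w].
  by rewrite der2_nil insE; change (conv (stw b (phi^~ x)) (der psi b G) [::] =
     conv (stw b (phi^~ x)) (der psi b G) [::] + (-1) ^+ ((a + b) * sx x) * 0);
  rewrite mulr0 addr0.
rewrite der2_cons insE shift_tau der2Z.
change (conv (stw b (phi^~ x)) (der psi b G) (y :: w) +
  (-1) ^+ ((a + b) * sx y) * ((y == x)%:R * der2 phi psi a b G w) =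
  conv (stw b (phi^~ x)) (der psi b G) (y :: w) +
  (-1) ^+ ((a + b) * sx x) * ((y == x)%:R * der2 phi psi a b G w)).
by case: eqP => [->//|_]; rewrite !mul0r !mulr0.
Qed.

Lemma der_one_nil phi a : der phi a one_nil = 0.
Proof.
have s0 y : shift y one_nil = 0 by [].
have i0 : ins phi one_nil = 0 by rewrite /ins big1 // => h _; rewrite s0 conv0r.
have d0 : der phi a 0 = 0 by rewrite -[0 in LHS](scale0r (0 : Fun)) derZ scale0r.
by apply/funext => -[|y w]; rewrite ?der_nil ?der_cons i0 ?s0 ?d0 // mulr0 addr0.
Qed.

Lemma der2_one_nil phi psi a b : der2 phi psi a b one_nil = 0.
Proof.
have s0 y : shift y one_nil = 0 by [].
have d0 : der psi b 0 = 0 by rewrite -[0 in LHS](scale0r (0 : Fun)) derZ scale0r.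
have i0 : ins2 phi psi b one_nil = 0 by rewrite /ins2 big1 // => h _; rewrite s0 d0 conv0r.
have d20 : der2 phi psi a b 0 = 0 by rewrite -[0 in LHS](scale0r (0 : Fun)) der2Z scale0r.
by apply/funext => -[|y w]; rewrite ?der2_nil ?der2_cons i0 ?s0 ?d20 // mulr0 addr0.
Qed.

Lemma tauD x F G : tau x (F + G) = tau x F + tau x G.
Proof.
apply/funext => -[|y w]; first exact: (esym (addr0 _)).
by change ((y == x)%:R * (F w + G w) = (y == x)%:R * F w + (y == x)%:R * G w); rewrite mulrDr.
Qed.

Lemma tauZ x c F : tau x (c *: F) = c *: tau x F.
Proof.
apply/funext => -[|y w]; first exact: (esym (mulr0 _)).
by change ((y == x)%:R * (c * F w) = c * ((y == x)%:R * F w)); rewrite mulrCA.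
Qed.

Lemma fun_tauE F : F = F [::] *: one_nil + \sum_x tau x (shift x F).
Proof.
apply/funext => w; change (F w = F [::] * one_nil w + (\sum_x tau x (shift x F)) w).
rewrite fun_sumE; case: w => [|y w]; first by rewrite mulr1 big1 // addr0.
rewrite mulr0 add0r (bigD1 y) //= eqxx mul1r big1 ?addr0 // => x /negPf xy.
by rewrite eq_sym xy mul0r.
Qed.

(** Induction on word length: every function on words is built from [one_nil] and the [tau x].
    Applied to the difference of two sides, it reduces an operator identity to a computation with
    one letter. *)
Lemma op_eq0 (X : Fun -> Fun) (c : T -> K) :
  (forall F G, X (F + G) = X F + X G) -> (forall d F, X (d *: F) = d *: X F) ->
  X one_nil = 0 -> (forall x G, X (tau x G) = c x *: tau x (X G)) -> forall F, X F = 0.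
Proof.
move=> XD XZ X1 Xt F; apply/funext => w.
have X0 : X 0 = 0 by rewrite -[0 in LHS](scale0r (0 : Fun)) XZ scale0r.
elim: w F => [|y w IH] F; rewrite [F]fun_tauE XD XZ X1 scaler0 add0r;
  rewrite (big_morph X XD X0) fun_sumE big1 // => x _; rewrite Xt.
  exact: mulr0.
change (c x * ((y == x)%:R * X (shift x F) w) = 0).
by rewrite IH !mulr0.
Qed.

End Convolution.

(** * The Leibniz rule for the product with an even cocycle *)

Section Leibniz.
Variables (K : fieldType) (T : finType) (par : T -> bool).
Local Notation Fun := (seq T -> K^o).
Local Notation sh := (shpar par).
Local Notation sx x := (nat_of_bool (~~ par x)).
Local Notation tw := (stw (K := K) par).
Local Notation der := (der (K := K) par).
Local Notation der2 := (der2 (K := K) par).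
Implicit Types (F G al be : Fun) (w : seq T) (phi psi : seq T -> T -> K).

Definition shhom (a : nat) phi := forall w h, phi w h != 0 -> odd (sh w + a) = ~~ par h.

Lemma signE n : (-1) ^+ n = (if odd n then -1 else 1) :> K.
Proof. by rewrite -signr_odd; case: odd. Qed.

Lemma funDE F G w : (F + G) w = F w + G w. Proof. by []. Qed.
Lemma funNE F w : (- F) w = - F w. Proof. by []. Qed.
Lemma funZE c F w : (c *: F) w = c * F w. Proof. by []. Qed.

Lemma tw_hom a phi b x : shhom a phi ->
  tw b (phi^~ x) = (-1) ^+ (b * (sx x + a)) *: (phi^~ x : Fun).
Proof.
move=> H; apply/funext => w; rewrite funZE /stw.
have [->|n0] := eqVneq (phi w x) 0; first by rewrite !mulr0.
congr (_ * _); apply: sign_eq; rewrite !oddM !oddD.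
by have := H _ _ n0; rewrite oddD => <-; rewrite oddb addbK.
Qed.

Lemma tw_tau c x G : tw c (tau x G) = (-1) ^+ (c * sx x) *: tau x (tw c G).
Proof.
apply/funext => -[|y w]; rewrite funZE /stw /=; first by rewrite !mulr0.
case: eqP => [->|_]; last by rewrite !mul0r !mulr0.
by rewrite !mul1r mulnDr exprD mulrA.
Qed.

Lemma tw_one_nil c : tw c (one_nil K (T := T)) = one_nil K (T := T).
Proof.
by apply/funext => -[|y w]; rewrite /stw /= ?muln0 ?mulr0 // mul1r.
Qed.

Lemma tw0 c : tw c 0 = 0.
Proof. by rewrite -[0 in LHS](scale0r (0 : Fun)) twZ scale0r. Qed.

Lemma tw_der a phi c F : shhom a phi ->
  tw c (der phi a F) = (-1) ^+ (c * a) *: der phi a (tw c F).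
Proof.
move=> H; apply/eqP; rewrite -subr_eq0; apply/eqP.
pose X F := tw c (der phi a F) - (-1) ^+ (c * a) *: der phi a (tw c F).
apply: (@op_eq0 _ _ X (fun x => (-1) ^+ ((a + c) * sx x))) => {F}.
- move=> F G; rewrite /X derD !twD derD scalerDr opprD.
  by rewrite addrACA.
- by move=> d F; rewrite /X derZ !twZ derZ scalerBr !scalerA mulrC.
- by rewrite /X tw_one_nil der_one_nil tw0 scaler0 subrr.
move=> x G; rewrite /X der_tau twD twZ tw_conv (tw_hom _ _ H) !tw_tau derZ der_tau.
rewrite convZl; apply/funext => w; rewrite !(funDE, funNE, funZE).
have tB : tau x (tw c (der phi a G) - (-1) ^+ (c * a) *: der phi a (tw c G)) w =
   tau x (tw c (der phi a G)) w - (-1) ^+ (c * a) * tau x (der phi a (tw c G)) w.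
  by rewrite tauD -scaleN1r tauZ tauZ !(funDE, funZE) mulN1r.
rewrite tB !signE !(oddM, oddD, oddb).
by case: (odd a); case: (odd c); case: (par x) => /=; ring.
Qed.

Variable m : seq T -> T -> K.
Hypothesis m_hom : shhom 1 m.

(** The supercommutator of the derivations of eta and of m, evaluated on letters: the Hochschild
    differential with signs that depend only on the parity b. *)
Definition cobd_sh (eta : seq T -> T -> K) (b : nat) : seq T -> T -> K :=
  fun w g => der eta b (m^~ g) w - (-1) ^+ b * der m 1 (eta^~ g) w.

Lemma tauB x F G : tau x (F - G) = tau x F - tau x G.
Proof. by rewrite tauD -scaleN1r tauZ scaleN1r. Qed.

Lemma tauN x F : tau x (- F) = - tau x F.
Proof. by rewrite -scaleN1r tauZ scaleN1r. Qed.

Lemma convBl al al' be : conv (al - al') be = conv al be - conv al' be.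
Proof. by rewrite convDl -[- al']scaleN1r convZl scaleN1r. Qed.

Lemma der0 phi a : der phi a 0 = 0.
Proof. by rewrite -[0 in LHS](scale0r (0 : Fun)) derZ scale0r. Qed.

Lemma der20 phi psi a b : der2 phi psi a b 0 = 0.
Proof. by rewrite -[0 in LHS](scale0r (0 : Fun)) der2Z scale0r. Qed.

Lemma cobd_shE eta b x :
  (cobd_sh eta b)^~ x = der eta b (m^~ x) - (-1) ^+ b *: der m 1 (eta^~ x) :> Fun.
Proof. by []. Qed.

(** The supercommutator of two derivations is a derivation, hence determined by its effect on
    letters, which is [cobd_sh]. *)
Lemma der_comm eta b F : shhom b eta ->
  der eta b (der m 1 F) = (-1) ^+ b *: der m 1 (der eta b F) + der (cobd_sh eta b) b.+1 F.
Proof.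
move=> H; apply/eqP; rewrite -subr_eq0; apply/eqP.
pose X F := der eta b (der m 1 F) -
  ((-1) ^+ b *: der m 1 (der eta b F) + der (cobd_sh eta b) b.+1 F).
apply: (@op_eq0 _ _ X (fun x => (-1) ^+ (b.+1 * sx x))) => {F}.
- move=> F G; rewrite /X !derD scalerDr !opprD.
  by apply/funext => w; rewrite !(funDE, funNE, funZE); ring.
- by move=> d F; rewrite /X !derZ; apply/funext => w; rewrite !(funDE, funNE, funZE); ring.
- by rewrite /X !der_one_nil !der0 scaler0 addr0 subr0.
move=> x G; rewrite /X !der_tau !derD !derZ !der_conv !der_tau.
rewrite (tw_hom _ _ m_hom) (tw_hom _ _ H) cobd_shE convBl !convZl tauB tauD tauZ.
apply/funext => w; rewrite !(funDE, funNE, funZE).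
rewrite !signE !(oddM, oddD, oddb) /=.
by case: (odd b); case: (par x) => /=; ring.
Qed.

Variables (phi eta : seq T -> T -> K) (b : nat).
Hypotheses (phi_hom : shhom 1 phi) (eta_hom : shhom b eta).
Hypothesis phi_cocycle : forall w g, cobd_sh phi 1 w g = 0.

Definition cup_sh : seq T -> T -> K := fun w g => der2 phi eta 1 b (m^~ g) w.

(** Moving [der m 1] across the double insertion produces m with both phi and eta inside, which is
    [cup_sh], and the commutator of m with each of them; the one with phi vanishes because phi is a
    cocycle. *)
Lemma der2_comm F : der2 phi eta 1 b (der m 1 F) =
  - ((-1) ^+ b *: der m 1 (der2 phi eta 1 b F)) + der cup_sh b F
  - der2 phi (cobd_sh eta b) 1 b.+1 F.
Proof.
apply/eqP; rewrite -subr_eq0; apply/eqP.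
pose X F := der2 phi eta 1 b (der m 1 F) -
  (- ((-1) ^+ b *: der m 1 (der2 phi eta 1 b F)) + der cup_sh b F
  - der2 phi (cobd_sh eta b) 1 b.+1 F).
apply: (@op_eq0 _ _ X (fun x => (-1) ^+ (b * sx x))) => {F}.
- move=> F G; rewrite /X !(derD, der2D).
  by apply/funext => w; rewrite !(funDE, funNE, funZE); ring.
- by move=> d F; rewrite /X !(derZ, der2Z, derZ); apply/funext => w; rewrite !(funDE, funNE, funZE); ring.
- by rewrite /X !(der_one_nil, der2_one_nil, der0, der20) scaler0 !(oppr0, addr0).
move=> x G; rewrite /X !(der_tau, der2_tau) !(derD, der2D, derZ, der2Z).
rewrite !der2_conv !der2_tau !der_conv !der_tau.
have c0 : der m 1 (phi^~ x) = - der phi 1 (m^~ x).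
  apply/funext => w; rewrite funNE; have := phi_cocycle w x; rewrite /cobd_sh expr1 mulN1r opprK.
  by move=> /eqP; rewrite addrC addr_eq0 => /eqP.
rewrite (tw_hom _ _ m_hom) !(tw_hom _ _ phi_hom) !twZ !(tw_hom _ _ phi_hom) !derZ.
rewrite !(tw_der _ _ phi_hom) (tw_hom _ _ m_hom) derZ c0.
have cupE : cup_sh^~ x = der2 phi eta 1 b (m^~ x) :> Fun by [].
rewrite cupE (der_comm _ eta_hom) !(convZl, convDr, convZr) -[- der phi 1 _]scaleN1r convZl.
rewrite !(tauD, tauN, tauZ).
apply/funext => w; rewrite !(funDE, funNE, funZE).
rewrite !signE !(oddM, oddD, oddb) /=.
by case: (odd b); case: (par x) => /=; ring.
Qed.

Hypothesis m_rel : forall w g, der m 1 (m^~ g) w = 0.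

(** The commutation rule is applied to the components of m, which [der m 1] kills by the A_infinity
    relations: the product of phi with a coboundary is a coboundary. *)
Lemma cup_cobd w g : der2 phi (cobd_sh eta b) 1 b.+1 (m^~ g) w = cobd_sh cup_sh b w g.
Proof.
have := der2_comm (m^~ g); have -> : der m 1 (m^~ g) = 0 by apply/funext.
rewrite der20 => /(congr1 (fun F : Fun => F w)); rewrite !(funDE, funNE, funZE).
rewrite /cobd_sh -/(cup_sh) => /eqP.
rewrite eq_sym subr_eq add0r => /eqP <-; rewrite addrC; congr (_ - _ * _).
Qed.

End Leibniz.

(** * Recursive insertions as explicit sums over the cuts of a word *)

Lemma iotaS m n : iota m.+1 n = [seq k.+1 | k <- iota m n].
Proof. exact: (iotaDl 1 m n). Qed.

Lemma big_split3_cons (V : nmodType) (T : Type) (x : T) w (G : seq T * seq T * seq T -> V) :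
  \sum_(t <- split3 (x :: w)) G t =
  \sum_(j <- iota 0 (size w).+2) G ([::], take j (x :: w), drop j (x :: w)) +
  \sum_(t <- split3 w) G (x :: t.1.1, t.1.2, t.2).
Proof.
rewrite /split3 !big_allpairs_dep.
change (iota 0 (size (x :: w)).+1) with (0%N :: iota 1 (size w).+1).
rewrite big_cons subn0; congr (_ + _).
  by apply: eq_bigr => j _; rewrite take0 drop0.
rewrite iotaS big_map; apply: eq_bigr => i _.
by rewrite [size _]/= subSS iotaS big_map.
Qed.

Lemma big_split3_nil (V : nmodType) (T : Type) (G : seq T * seq T * seq T -> V) :
  \sum_(t <- split3 [::]) G t = G ([::], [::], [::]).
Proof. by rewrite big_seq1. Qed.

Lemma split3P (T : eqType) (w : seq T) t : t \in split3 w -> w = t.1.1 ++ t.1.2 ++ t.2.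
Proof.
case/allpairsPdep => i [j [_ + ->]] /=; rewrite mem_iota => /andP[ij _].
have ti : take i w = take i (take j w) by rewrite take_takel.
by rewrite ti catA cat_take_drop cat_take_drop.
Qed.

Section SplitSums.
Variables (K : fieldType) (T : finType) (par : T -> bool).
Local Notation Fun := (seq T -> K^o).
Local Notation sh := (shpar par).
Implicit Types (F al be : Fun) (w : seq T) (phi psi : seq T -> T -> K).

Lemma conv_take al be w :
  conv al be w = \sum_(j <- iota 0 (size w).+1) al (take j w) * be (drop j w).
Proof.
elim: w al => [|x w IH] al; first by rewrite big_seq1.
change (iota 0 (size (x :: w)).+1) with (0%N :: iota 1 (size w).+1).
rewrite big_cons; congr (_ + _).
by rewrite iotaS big_map; exact: IH.
Qed.

Lemma der_split phi a F w : der par phi a F w =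
  \sum_(t <- split3 w) \sum_h (-1) ^+ (a * sh t.1.1) * phi t.1.2 h * F (t.1.1 ++ h :: t.2).
Proof.
elim: w F => [|x w IH] F.
  rewrite big_split3_nil der_nil /ins fun_sumE; apply: eq_bigr => h _.
  by rewrite /= muln0 mul1r.
rewrite big_split3_cons der_cons; congr (_ + _).
  rewrite /ins fun_sumE [RHS]exchange_big; apply: eq_bigr => h _; rewrite conv_take; apply: eq_bigr => j _.

  by rewrite muln0 mul1r.
rewrite IH mulr_sumr; apply: eq_bigr => t _.
rewrite mulr_sumr; apply: eq_bigr => h _.
by rewrite /= mulnDr exprD !mulrA.
Qed.

Lemma der2_split phi psi a b F w : der2 par phi psi a b F w =
  \sum_(t <- split3 w) \sum_(u <- split3 t.2) \sum_h \sum_k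
   (-1) ^+ (a * sh t.1.1 + b * (sh t.1.1 + sh t.1.2 + sh u.1.1)) *
     phi t.1.2 h * psi u.1.2 k * F (t.1.1 ++ h :: u.1.1 ++ k :: u.2).
Proof.
have step (w1 w2 : seq T) h (F' : Fun) :
  stw par b (phi^~ h) w1 * der par psi b (shift h F') w2 =
  \sum_(u <- split3 w2) \sum_k (-1) ^+ (b * (sh w1 + sh u.1.1)) *
    phi w1 h * psi u.1.2 k * F' (h :: u.1.1 ++ k :: u.2).
  rewrite der_split mulr_sumr; apply: eq_bigr => u _.
  rewrite mulr_sumr; apply: eq_bigr => k _.
  by rewrite /stw /shift mulnDr exprD; ring.
elim: w F => [|x w IH] F.
  rewrite big_split3_nil der2_nil /ins2 fun_sumE exchange_big /=; apply: eq_bigr => h _.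
  rewrite [LHS](step [::] [::]) big_split3_nil big_split3_nil; apply: eq_bigr => k _ /=.
  by rewrite muln0 add0n.
rewrite big_split3_cons der2_cons; congr (_ + _).
  rewrite /ins2 fun_sumE.
  under [RHS]eq_bigr => j _ do rewrite exchange_big /=.
  rewrite [RHS]exchange_big; apply: eq_bigr => h _.
  rewrite conv_take; apply: eq_bigr => j _; rewrite step.
  apply: eq_bigr => u _; apply: eq_bigr => k _.
  by rewrite muln0 add0n add0n.
rewrite IH mulr_sumr; apply: eq_bigr => t _.
rewrite mulr_sumr; apply: eq_bigr => u _.
rewrite mulr_sumr; apply: eq_bigr => h _.
rewrite mulr_sumr; apply: eq_bigr => k _.
rewrite !mulrA -exprD; congr (_ * _ * _ * _); apply: sign_eq.
by rewrite !(oddM, oddD); case: (odd a); case: (odd b); case: (par x);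
  case: (odd (sh t.1.1)); case: (odd (sh t.1.2)); case: (odd (sh u.1.1)).
Qed.

End SplitSums.

(** * The Hochschild differential and product over a finite alphabet *)

Section AinfAlgebra.
Variables (K : fieldType) (T : finType) (par : T -> bool).
Local Notation sh := (shpar par).
Local Notation sx x := (nat_of_bool (~~ par x)).
Local Notation coch := (seq T -> T -> K).
Variables (m : coch) (cyc : T -> T -> K).
Implicit Types (w : seq T) (phi psi eta : coch).

Definition cdeg_at w (g : T) : nat := par g + sh w.

(** The formula of [cobd] over a finite set of letters, meant for the generators of a single
    endomorphism space. *)
Definition cobdT eta : coch := fun w g =>
  \sum_(t <- split3 w) \sum_h
   ((-1) ^+ ((cdeg_at t.1.2 h).+1 * sh t.1.1) * eta t.1.2 h * m (t.1.1 ++ h :: t.2) g -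
    (-1) ^+ ((cdeg_at (t.1.1 ++ h :: t.2) g).+1 + sh t.1.1) *
      m t.1.2 h * eta (t.1.1 ++ h :: t.2) g).

Definition mulT phi psi : coch := fun w g =>
  \sum_(t <- split3 w) \sum_(u <- split3 t.2) \sum_h \sum_k
    (-1) ^+ (cdeg_at t.1.2 h * cdeg_at u.1.2 k + cdeg_at t.1.2 h +
             (cdeg_at t.1.2 h).+1 * sh t.1.1 +
             (cdeg_at u.1.2 k).+1 * (sh t.1.1 + sh t.1.2 + sh u.1.1)) *
    phi t.1.2 h * psi u.1.2 k * m (t.1.1 ++ h :: u.1.1 ++ k :: u.2) g.

Definition chom (p : bool) phi := forall w g, phi w g != 0 -> odd (cdeg_at w g) = p.

Hypothesis m_deg : forall w g, m w g != 0 -> par g = odd (sh w).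

Lemma sh_cat w1 w2 : sh (w1 ++ w2) = (sh w1 + sh w2)%N.
Proof. by rewrite /shpar count_cat. Qed.

Lemma sh_cons x w : sh (x :: w) = (sx x + sh w)%N. Proof. by []. Qed.

Lemma chom_shhom p phi : chom p phi -> shhom par (~~ p) phi.
Proof.
by move=> H w g /H; rewrite /cdeg_at !oddD !oddb => <-; case: (par g); case: odd.
Qed.

Lemma m_shhom : shhom par 1 m.
Proof. by move=> w g /m_deg ->; rewrite addn1. Qed.

Lemma cobdT_sh p eta w g : chom p eta -> cobdT eta w g = cobd_sh par m eta (~~ p) w g.
Proof.
move=> H; rewrite /cobd_sh !der_split mulr_sumr -sumrB; apply: eq_bigr => t _.
rewrite mulr_sumr -sumrB; apply: eq_bigr => h _; congr (_ - _).
  have [->|/H d] := eqVneq (eta t.1.2 h) 0; first by rewrite !(mulr0, mul0r).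
  by congr (_ * _ * _); apply: sign_eq; rewrite !oddM /= d oddb.
have [->|/H d] := eqVneq (eta (t.1.1 ++ h :: t.2) g) 0; first by rewrite !mulr0.
rewrite !mulrA -exprD; congr (_ * _ * _); apply: sign_eq.
by rewrite mul1n !oddD /= d oddb.
Qed.

Lemma mulT_sh p phi psi w g : chom false phi -> chom p psi ->
  mulT phi psi w g = der2 par phi psi 1 (~~ p) (m^~ g) w.
Proof.
move=> H1 H2; rewrite der2_split; apply: eq_bigr => t _; apply: eq_bigr => u _.
apply: eq_bigr => h _; apply: eq_bigr => k _.
have [->|/H1 d1] := eqVneq (phi t.1.2 h) 0; first by rewrite !(mulr0, mul0r).
have [->|/H2 d2] := eqVneq (psi u.1.2 k) 0; first by rewrite !(mulr0, mul0r).
congr (_ * _ * _ * _); apply: sign_eq.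
move: (cdeg_at t.1.2 h) (cdeg_at u.1.2 k) d1 d2 => p1 p2 d1 d2; by rewrite !(oddD, oddM) /= d1 d2 oddb.
Qed.

Lemma cobdT_hom p eta : chom p eta -> chom (~~ p) (cobdT eta).
Proof.
move=> H w g; apply: contraNeq => odd_w.
rewrite /cobdT big_seq big1 // => t /split3P wt; rewrite big1 // => h _.
have dw : odd (sh w) = odd (sh t.1.1) (+) odd (sh t.1.2) (+) odd (sh t.2).
  by rewrite wt !sh_cat !oddD addbA.
apply/eqP; rewrite subr_eq0; apply/eqP; transitivity (0 : K).
  have [->|/H d] := eqVneq (eta t.1.2 h) 0; first by rewrite !(mulr0, mul0r).
  have [->|/m_deg d2] := eqVneq (m (t.1.1 ++ h :: t.2) g) 0; first by rewrite !(mulr0, mul0r).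
  case/eqP: odd_w; move: d d2; rewrite /cdeg_at sh_cat sh_cons !oddD !oddb dw.
  move=> <- ->; case: (par h); case: (odd _); case: (odd _); case: (odd _) => //.
have [->|/H d] := eqVneq (eta (t.1.1 ++ h :: t.2) g) 0; first by rewrite !(mulr0, mul0r).
have [->|/m_deg d2] := eqVneq (m t.1.2 h) 0; first by rewrite !(mulr0, mul0r).
case/eqP: odd_w; move: d d2; rewrite /cdeg_at sh_cat sh_cons !oddD !oddb dw.
by move=> <- ->; case: (par g); case: (odd _); case: (odd _); case: (odd _).
Qed.

(** The signs of [cobdT] and [mulT] depend on the degree of each component and are constant only on
    homogeneous parts. A cochain eta of unknown degree is therefore split in two. *)
Definition hpart (p : bool) eta : coch := fun w g =>
  if odd (cdeg_at w g) == p then eta w g else 0.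

Lemma hpart_hom p eta : chom p (hpart p eta).
Proof. by move=> w g; rewrite /hpart; case: (eqVneq (odd (cdeg_at w g)) p) => [->//|_ /eqP]. Qed.

Lemma hpartE eta w g : eta w g = hpart false eta w g + hpart true eta w g.
Proof. by rewrite /hpart; case: (odd _); rewrite /= ?addr0 ?add0r. Qed.

Lemma cobdTD eta eta1 eta2 : (forall w g, eta w g = eta1 w g + eta2 w g) ->
  forall w g, cobdT eta w g = cobdT eta1 w g + cobdT eta2 w g.
Proof.
move=> H w g; rewrite /cobdT -big_split; apply: eq_bigr => t _.
by rewrite -big_split; apply: eq_bigr => h _; rewrite !H /=; ring.
Qed.

Lemma mulTD phi eta eta1 eta2 : (forall w g, eta w g = eta1 w g + eta2 w g) ->
  forall w g, mulT phi eta w g = mulT phi eta1 w g + mulT phi eta2 w g.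
Proof.
move=> H w g; rewrite /mulT -big_split; apply: eq_bigr => t _.
rewrite -big_split; apply: eq_bigr => u _; rewrite -big_split; apply: eq_bigr => h _.
by rewrite -big_split; apply: eq_bigr => k _; rewrite !H /=; ring.
Qed.

Hypothesis m_rel : forall w g, \sum_(t <- split3 w) \sum_h
  (-1) ^+ sh t.1.1 * m t.1.2 h * m (t.1.1 ++ h :: t.2) g = 0.

(** Both sides are additive in eta, so eta may be taken homogeneous; then both are instances of the
    operators with constant signs, and [cup_cobd] applies. *)
Lemma mulT_cobdT phi eta w g : chom false phi -> (forall w g, cobdT phi w g = 0) ->
  mulT phi (cobdT eta) w g = cobdT (mulT phi eta) w g.
Proof.
move=> ph pc.
have rel w' g' : der par m 1 (m^~ g') w' = 0.
  by rewrite der_split -[RHS](m_rel w' g'); apply: eq_bigr => t _; apply: eq_bigr => h _; rewrite mul1n.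
have hom p : mulT phi (cobdT (hpart p eta)) w g = cobdT (mulT phi (hpart p eta)) w g.
  have eh := @hpart_hom p eta.
  rewrite (mulT_sh _ _ ph (cobdT_hom eh)).
  have ceq : cobdT (hpart p eta) = cobd_sh par m (hpart p eta) (~~ p).
    by apply/funext => w'; apply/funext => g'; rewrite (cobdT_sh _ _ eh).
  have meq : mulT phi (hpart p eta) = cup_sh par m phi (hpart p eta) (~~ p).
    by apply/funext => w'; apply/funext => g'; rewrite (mulT_sh _ _ ph eh).
  (* The parity of the coboundary is [~~ ~~ p] here and [(~~ p).+1] in the Leibniz rule; only its
     class modulo 2 enters the signs. *)
  have b2 G : der2 par phi (cobd_sh par m (hpart p eta) (~~ p)) 1 (~~ ~~ p) G w =
     der2 par phi (cobd_sh par m (hpart p eta) (~~ p)) 1 (~~ p).+1 G w.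
    rewrite !der2_split; apply: eq_bigr => t _; apply: eq_bigr => u _.
    apply: eq_bigr => h _; apply: eq_bigr => k _; congr (_ * _ * _ * _).
    apply: sign_eq; rewrite !oddD !oddM /= !oddb !oddD; congr (_ (+) _); case: (~~ p) => /=; rewrite ?addbb ?addbF //.
  rewrite ceq b2 (cup_cobd m_shhom (chom_shhom ph) (chom_shhom eh)) //; last first.
    by move=> w' g'; rewrite -(cobdT_sh _ _ ph).
  have mh : chom p (mulT phi (hpart p eta)).
    move=> w' g'; apply: contraNeq => odd_w.
    rewrite /mulT big_seq big1 // => t /split3P wt; rewrite big_seq big1 // => u /split3P tu.
    rewrite big1 // => h _; rewrite big1 // => k _.
    have [->|/ph d] := eqVneq (phi t.1.2 h) 0; first by rewrite !(mulr0, mul0r).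
    have [->|/eh d1] := eqVneq (hpart p eta u.1.2 k) 0; first by rewrite !(mulr0, mul0r).
    have [->|/m_deg d2] := eqVneq (m (t.1.1 ++ h :: u.1.1 ++ k :: u.2) g') 0.
      by rewrite !(mulr0, mul0r).
    case/eqP: odd_w; move: d d1 d2; rewrite wt tu /cdeg_at !(sh_cat, sh_cons) !oddD !oddb.
    move=> d <- ->; move: d; case: (par h); case: (par k); case: (odd _);
      case: (odd _); case: (odd _); case: (odd _); by case: (odd _).
  by rewrite (cobdT_sh _ _ mh) meq.
rewrite (mulTD phi (cobdTD (hpartE eta))) !hom.
by rewrite -(cobdTD (mulTD phi (hpartE eta))).
Qed.

End AinfAlgebra.

(** * The cyclic pairing of a cycle with coboundaries *)

Section CyclicPairing.
Variables (K : fieldType) (T : finType) (par : T -> bool).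
Local Notation sh := (shpar par).
Local Notation sx x := (nat_of_bool (~~ par x)).
Local Notation coch := (seq T -> T -> K).
Variables (m : coch) (cyc : T -> T -> K).
Implicit Types (w : seq T) (phi psi eta : coch).
Hypothesis m_deg : forall w g, m w g != 0 -> par g = odd (sh w).
Hypothesis m_nil : forall g, m [::] g = 0.
Hypothesis cyc_sym : forall g h, cyc g h = (-1) ^+ (1 + sx g * sx h) * cyc h g.
Hypothesis cyc_m : forall w x y, \sum_h m (rcons w x) h * cyc h y =
  (-1) ^+ (sx y * sh (rcons w x)) * \sum_h m (y :: w) h * cyc h x.

Lemma sh_rcons w x : sh (rcons w x) = (sx x + sh w)%N.
Proof. by rewrite -cats1 sh_cat addnC /shpar /= addn0. Qed.

(** Cyclic invariance rotates by one letter; rotating through all of w2 exchanges an arbitrary input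
    x with the output slot. *)
Lemma cyc_rot w1 w2 x y : \sum_g m (w1 ++ x :: w2) g * cyc g y =
  (-1) ^+ ((sh w2 + sx y) * (sh w1 + sx x)) * \sum_g m (w2 ++ y :: w1) g * cyc g x.
Proof.
elim/last_ind: w2 w1 y => [|w2 z IH] w1 y.
  by rewrite cats1 cyc_m sh_rcons; congr (_ * _); rewrite add0n [(sx x + _)%N]addnC.
rewrite -rcons_cons -rcons_cat cyc_m -cat_cons IH mulrA -exprD cat_rcons.
congr (_ * _); apply: sign_eq.
rewrite !(sh_rcons, sh_cat, sh_cons) !(oddM, oddD) !oddb.
by case: (par x); case: (par y); case: (par z); case: (odd _); case: (odd _).
Qed.

Variable N : nat.
Local Notation Z := (T * N.-bseq T)%type.
Variable c : T -> seq T -> K.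

Definition bdT_coef (x : T) (w : seq T) (x' : T) (w' : seq T) : K :=
  \sum_(t <- split3 w)
   (\sum_h (-1) ^+ (sx x + sh t.1.1) * m t.1.2 h *
      ((x', w') == (x, t.1.1 ++ h :: t.2))%:R +
    (-1) ^+ (sh t.2 * (sx x + sh t.1.1 + sh t.1.2)) *
      m (t.2 ++ x :: t.1.1) x' * (w' == t.1.2)%:R).

Hypothesis bd0 : forall x' w', \sum_(z : Z) c z.1 z.2 * bdT_coef z.1 z.2 x' w' = 0.

Definition hpairT phi : K :=
  \sum_(z : Z) c z.1 z.2 * (-1) ^+ (sx z.1 * sh z.2) * \sum_g phi z.2 g * cyc g z.1.

(** The vanishing boundary is tested against an arbitrary functional Phi, which turns the delta
    functions of [bdT_coef] into values of Phi. *)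
Lemma bdT_pair (Phi : T -> seq T -> K) :
  \sum_(z : Z) c z.1 z.2 * \sum_(t <- split3 (z.2 : seq T))
    (\sum_h (-1) ^+ (sx z.1 + sh t.1.1) * m t.1.2 h * Phi z.1 (t.1.1 ++ h :: t.2) +
     (-1) ^+ (sh t.2 * (sx z.1 + sh t.1.1 + sh t.1.2)) *
       \sum_g m (t.2 ++ z.1 :: t.1.1) g * Phi g t.1.2) = 0.
Proof.
transitivity (\sum_(z' : Z) Phi z'.1 z'.2 *
    \sum_(z : Z) c z.1 z.2 * bdT_coef z.1 z.2 z'.1 z'.2); last first.
  by rewrite big1 // => z' _; rewrite bd0 mulr0.
under [RHS]eq_bigr => z' _ do rewrite mulr_sumr.
rewrite exchange_big /=; apply: eq_bigr => -[x w] _ /=.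
under [RHS]eq_bigr => z' _ do rewrite mulrCA.
rewrite -mulr_sumr; congr (_ * _).
rewrite /bdT_coef; under [RHS]eq_bigr => z' _ do rewrite mulr_sumr.
rewrite exchange_big /= !big_seq; apply: eq_bigr => t /split3P wt.
under [RHS]eq_bigr => z' _ do rewrite mulrDr.
have wN : (size t.1.1 + (size t.1.2 + size t.2) <= N)%N.
  by rewrite -!size_cat -wt size_bseq.
rewrite big_split /=; congr (_ + _).
  under [RHS]eq_bigr => z' _ do rewrite mulr_sumr.
  rewrite exchange_big /=; apply: eq_bigr => h _.
  (* The length bound N is preserved: m vanishes on the empty word, so a non-zero operation consumes
     at least the letter that it puts back. *)
  have [m0|mn0] := eqVneq (m t.1.2 h) 0.
    by rewrite m0 mulr0 mul0r big1 // => z' _; rewrite mul0r mulr0.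
  have lenN : (size (t.1.1 ++ h :: t.2) <= N)%N.
    apply: leq_trans wN; rewrite size_cat /= leq_add2l.
    by case: t.1.2 mn0 => [|y w'] /=; rewrite ?m_nil ?eqxx // addSn ltnS leq_addl.
  rewrite (bigD1 (x, Bseq lenN)) //= eqxx big1 ?addr0 ?mulr1 1?mulrC // => -[x' w'] /=.
  rewrite -[(x', w') == (x, Bseq _)]/((x' == x) && (w' == Bseq lenN)) -val_eqE /=.
  by rewrite -[(x', val w') == _]/((x' == x) && (val w' == _)) => /negPf ->; rewrite !mulr0.
have lenN : (size t.1.2 <= N)%N by apply: leq_trans wN; rewrite addnCA leq_addr.
rewrite mulr_sumr -(pair_bigA _ (fun x' (w' : N.-bseq T) => Phi x' w' *
   ((-1) ^+ (sh t.2 * (sx x + sh t.1.1 + sh t.1.2)) *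
      m (t.2 ++ x :: t.1.1) x' * (val w' == t.1.2)%:R))) /=.
apply: eq_bigr => g _; rewrite (bigD1 (Bseq lenN)) //= eqxx big1 ?addr0; first by rewrite mulr1; ring.
by move=> u; rewrite -val_eqE /= => /negPf ->; rewrite !mulr0.
Qed.

(* <[m, eta], c> = <eta', bd c>, where eta' is eta up to signs. *)
Lemma hpairT_cobdT eta : hpairT (cobdT par m eta) = 0.
Proof.
pose Phi x w : K := (-1) ^+ (sx x * sh w) *
  \sum_g (-1) ^+ cdeg_at par w g * eta w g * cyc g x.
rewrite -(bdT_pair Phi); apply: eq_bigr => -[x w] _ /=; rewrite -mulrA; congr (_ * _).
rewrite /cobdT; under eq_bigr => g _ do rewrite mulr_suml.
rewrite exchange_big mulr_sumr !big_seq; apply: eq_bigr => t /split3P wt /=.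
under eq_bigr => g _ do rewrite mulr_suml.
rewrite exchange_big mulr_sumr /=.
have sw : sh w = (sh t.1.1 + (sh t.1.2 + sh t.2))%N by rewrite wt !sh_cat.
transitivity (\sum_h (-1) ^+ (sx x * sh w) *
   (((-1) ^+ ((cdeg_at par t.1.2 h).+1 * sh t.1.1) * eta t.1.2 h) *
     \sum_g m (t.1.1 ++ h :: t.2) g * cyc g x) +
  \sum_h (-1) ^+ (sx x * sh w) * - (m t.1.2 h *
     \sum_g (-1) ^+ ((cdeg_at par (t.1.1 ++ h :: t.2) g).+1 + sh t.1.1) *
        eta (t.1.1 ++ h :: t.2) g * cyc g x)).
  rewrite -big_split; apply: eq_bigr => h _ /=; rewrite -mulrDr; congr (_ * _).
  rewrite !mulr_sumr -sumrN -big_split; apply: eq_bigr => g _ /=; ring.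
rewrite addrC; congr (_ + _).
  apply: eq_bigr => h _; have [->|/m_deg d] := eqVneq (m t.1.2 h) 0.
    by rewrite !(mulr0, mul0r, oppr0).
  rewrite -mulrN -sumrN /Phi !mulr_sumr; apply: eq_bigr => g _.
  rewrite [LHS](_ : _ = (-1) ^+ (sx x * sh w +
     (1 + ((cdeg_at par (t.1.1 ++ h :: t.2) g).+1 + sh t.1.1))) *
     (m t.1.2 h * eta (t.1.1 ++ h :: t.2) g * cyc g x)); last by rewrite !exprD; ring.
  rewrite [RHS](_ : _ = (-1) ^+ (sx x + sh t.1.1 + (sx x * sh (t.1.1 ++ h :: t.2) +
     cdeg_at par (t.1.1 ++ h :: t.2) g)) *
     (m t.1.2 h * eta (t.1.1 ++ h :: t.2) g * cyc g x)); last by rewrite !exprD; ring.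
  congr (_ * _); apply: sign_eq; move: (cdeg_at _ _ _) => p.
  rewrite sw !(sh_cat, sh_cons) !(oddD, oddM) /= ?(oddD, oddM) !oddb d.
  move: (odd p) (odd (sh t.1.1)) (odd (sh t.1.2)) (odd (sh t.2)).
  by case: (par x) => -[] [] [] [].
rewrite mulr_sumr; transitivity (\sum_h \sum_g
   (-1) ^+ (sh t.2 * (sx x + sh t.1.1 + sh t.1.2)) * (m (t.2 ++ x :: t.1.1) g *
     ((-1) ^+ (sx g * sh t.1.2) *
       ((-1) ^+ cdeg_at par t.1.2 h * eta t.1.2 h * cyc h g)))); last first.
  rewrite exchange_big; apply: eq_bigr => g _.
  by rewrite /Phi !mulr_sumr.
(* These are the terms with eta inside m. Rotation puts the output of eta last, and they become the
   boundary terms in which m wraps around the letter x. *)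
apply: eq_bigr => h _; rewrite cyc_rot !mulr_sumr; apply: eq_bigr => g _.
have [->|/m_deg d] := eqVneq (m (t.2 ++ x :: t.1.1) g) 0; first by rewrite !(mulr0, mul0r).
rewrite [cyc h g]cyc_sym.
rewrite [RHS](_ : _ = (-1) ^+ (sh t.2 * (sx x + sh t.1.1 + sh t.1.2) +
  (sx g * sh t.1.2 + (cdeg_at par t.1.2 h + (1 + sx h * sx g)))) *
  (eta t.1.2 h * (m (t.2 ++ x :: t.1.1) g * cyc g h))); last by rewrite !exprD; ring.
rewrite [LHS](_ : _ = (-1) ^+ (sx x * sh w + ((cdeg_at par t.1.2 h).+1 * sh t.1.1 +
   (sh t.2 + sx x) * (sh t.1.1 + sx h))) *
  (eta t.1.2 h * (m (t.2 ++ x :: t.1.1) g * cyc g h))); last by rewrite !exprD; ring.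
congr (_ * _); apply: sign_eq; move: d.
rewrite /cdeg_at sw !(sh_cat, sh_cons) !(oddD, oddM) /= ?(oddD, oddM) !oddb => ->.
move: (odd (sh t.1.1)) (odd (sh t.1.2)) (odd (sh t.2)).
by case: (par x); case: (par h) => -[] [] [].
Qed.

End CyclicPairing.

(** * Restriction of the Fukaya category to one brane *)

Section Restriction.
Variables (R : realType) (n : nat) (F : floer_setting R n) (l : fI F).
Local Notation Lam := (nov R R[i]).
Local Notation L := (fL l).
Local Notation T := (cb (lH L)).
Local Notation G := (gen (fuk F)).
Variable b : mc L.
Local Notation P := (obj b).
Local Notation f := (fgen b b).
Local Notation parT := (@cpar R n (lH L)).
Implicit Types (w : seq T) (phi psi : cochain (fuk F)).

Lemma same_rhoW_refl (b0 : mc L) : same_rhoW b0 b0. Proof. by []. Qed.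

Lemma fgen_inj : injective f.
Proof.
move=> x y; have [_ + _] := fgen_hom (same_rhoW_refl b).
by move=> /(_ x y); rewrite !inE; apply.
Qed.

Lemma fgen_surj g : homset P P g -> exists i, g = f i.
Proof. by have [_ _ s] := fgen_hom (same_rhoW_refl b); move=> /s[i _ <-]; exists i. Qed.

Lemma fgen_homset i : homset P P (f i).
Proof. by have [s _ _] := fgen_hom (same_rhoW_refl b); apply: s. Qed.

Lemma fgen_src i : src (f i) = P. Proof. by case: (fgen_homset i). Qed.
Lemma fgen_tgt i : tgt (f i) = P. Proof. by case: (fgen_homset i). Qed.

Lemma sumG (X : G -> Lam) : (forall h, X h != 0 -> homset P P h) ->
  \sum_(h \in [set: G]) X h = \sum_i X (f i).
Proof.
move=> H; apply: fsbig_inj_fin fgen_inj _ => g gf; apply/eqP; apply: contraT => /H.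
by move=> /fgen_surj[i gi]; case: (gf i).
Qed.

Lemma composable_on w B : composable P (map f w) B <-> B = P.
Proof.
elim: w => [|x w IH] /=; first by split.
by rewrite fgen_src fgen_tgt IH; split=> [[]|].
Qed.

Lemma composable_cat (Q : quiver (fobj (@fL _ _ F))) A (w1 w2 : seq (gen Q)) B :
  composable A (w1 ++ w2) B <-> exists2 C, composable A w1 C & composable C w2 B.
Proof.
elim: w1 A => [|x w1 IH] A /=; first by split=> [H|[C -> //]]; exists A.
split=> [[e /IH[C H1 H2]]|[C [e H1] H2]]; first by exists C.
by split=> //; apply/IH; exists C.
Qed.

Lemma composable_ins w1 h (w2 : seq G) B : composable P (map f w1 ++ h :: w2) B ->
  src h = P /\ composable (tgt h) w2 B.
Proof. by move=> /composable_cat[C /composable_on -> /= []]. Qed.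

Lemma composable_end A w : composable A (map f w) P -> A = P.
Proof. by case: w => [//|x w] /= []; rewrite fgen_src. Qed.

Lemma composable_out A w B : composable A (map f w) B -> w != [::] -> A = P /\ B = P.
Proof.
by case: w => [//|x w] /= []; rewrite fgen_src fgen_tgt => <- /composable_on ->.
Qed.

Lemma mu_out w h : mu (map f w) h != 0 -> homset P P h.
Proof.
case: w => [|x w] mh; first by rewrite mu_nil eqxx in mh.
by have [] := composable_out (mu_hom mh).
Qed.

Lemma mu_ins w1 h w2 k : mu (map f w1 ++ h :: map f w2) (f k) != 0 -> homset P P h.
Proof.
move=> /mu_hom; rewrite fgen_src fgen_tgt => /composable_ins[s t]; split=> //.
exact: composable_end t.
Qed.

Definition mloc : seq T -> T -> Lam := fun w k => mu (map f w) (f k).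
Definition cloc phi : seq T -> T -> Lam := fun w k => phi (map f w) (f k).

Lemma shpar_map w : shpar (@par _ (fuk F)) (map f w) = shpar parT w.
Proof.
by rewrite /shpar count_map; apply: eq_count => i /=; rewrite (fgen_par (same_rhoW_refl b)).
Qed.

Lemma par_fgen i : par (f i) = parT i.
Proof. exact: (fgen_par (same_rhoW_refl b)). Qed.

Lemma mloc_deg w g : mloc w g != 0 -> parT g = odd (shpar parT w).
Proof. by move=> /mu_deg; rewrite shpar_map par_fgen. Qed.

Lemma mloc_nil g : mloc [::] g = 0.
Proof. exact: mu_nil. Qed.

Lemma big_split3_map (V : nmodType) (w : seq T) (X : seq G * seq G * seq G -> V) :
  \sum_(t <- split3 (map f w)) X t =
  \sum_(t <- split3 w) X (map f t.1.1, map f t.1.2, map f t.2).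
Proof.
elim: w X => [|x w IH] X; first by rewrite !big_split3_nil.
rewrite map_cons !big_split3_cons IH size_map; congr (_ + _).
by apply: eq_bigr => j _ /=; rewrite map_take map_drop.
Qed.

Lemma mloc_rel w g : \sum_(t <- split3 w) \sum_h
  (-1) ^+ shpar parT t.1.1 * mloc t.1.2 h * mloc (t.1.1 ++ h :: t.2) g = 0.
Proof.
rewrite -[RHS](mu_rel (map f w) (f g)) big_split3_map; apply: eq_bigr => t _ /=.
rewrite sumG => [|h]; last first.
  by rewrite -mulrA mulf_eq0 negb_or => /andP[_]; rewrite mulf_eq0 negb_or => /andP[/mu_out].
by apply: eq_bigr => h _; rewrite shpar_map /mloc map_cat.
Qed.

(** An intermediate generator with non-zero contribution is squeezed between words of endomorphisms
    of the brane, so it is one of them, and the sums over all generators restrict. *)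
Lemma cobd_loc phi w g : is_cochain phi ->
  cobd phi (map f w) (f g) = cobdT parT mloc (cloc phi) w g.
Proof.
move=> phiC; rewrite /cobd big_split3_map; apply: eq_bigr => t _ /=.
rewrite sumG => [|h].
  apply: eq_bigr => h _; rewrite /cpardeg /cdeg_at -[f h :: _]map_cons -map_cat !shpar_map.
  by rewrite !par_fgen.
have [->|/mu_ins//] := eqVneq (mu (map f t.1.1 ++ h :: map f t.2) (f g)) 0.
have [->|/mu_out//] := eqVneq (mu (map f t.1.2) h) 0.
by rewrite !(mulr0, mul0r) subrr eqxx.
Qed.

Lemma cochain_mul_loc phi psi w g : is_cochain phi -> is_cochain psi ->
  cochain_mul phi psi (map f w) (f g) = mulT parT mloc (cloc phi) (cloc psi) w g.
Proof.
move=> phiC psiC; rewrite /cochain_mul big_split3_map; apply: eq_bigr => t _ /=.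
rewrite big_split3_map; apply: eq_bigr => u _ /=.
have out h k : phi (map f t.1.2) h != 0 ->
  mu (map f t.1.1 ++ h :: map f u.1.1 ++ k :: map f u.2) (f g) != 0 ->
  homset P P h /\ homset P P k.
  move=> /phiC ph /mu_hom; rewrite fgen_src fgen_tgt => /composable_ins[sh].
  rewrite sh in ph; have th := (composable_on _ _).1 ph.
  by rewrite th => /composable_ins[sk /composable_end tk].
rewrite sumG => [|h].
  apply: eq_bigr => h _; rewrite sumG => [|k].
    apply: eq_bigr => k _; rewrite /cpardeg /cdeg_at -!(map_cons f) -map_cat -map_cons -map_cat.
    by rewrite !shpar_map !par_fgen.
  have [->|ph] := eqVneq (phi (map f t.1.2) (f h)) 0; first by rewrite !(mulr0, mul0r) eqxx.
  set m := mu _ _; have [->|mn] := eqVneq m 0; first by rewrite !(mulr0, mul0r) eqxx.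
  by have [] := out _ _ ph mn.
apply: contraNP => hN; rewrite fsbig1 // => k _.
have [->|ph] := eqVneq (phi (map f t.1.2) h) 0; first by rewrite !(mulr0, mul0r).
set m := mu _ _; have [->|mn] := eqVneq m 0; first by rewrite !(mulr0, mul0r).
by have [] := out _ _ ph mn.
Qed.

Definition cycT (g h : T) : Lam := nconst R (ccyc g h).

Lemma cycTE g h : cyc (f g) (f h) = cycT g h.
Proof. exact: (fuk_cyc (same_rhoW_refl b)). Qed.

Lemma cpair_sym (d : nat) (H : cohomology R d) (g h : cb H) :
  cpair g h = (-1) ^+ (cdeg g * cdeg h) * cpair h g.
Proof.
by rewrite /cpair mulr_sumr; apply: eq_bigr => k _; rewrite ccupC mulrA.
Qed.

Lemma cycT_sym g h : cycT g h = (-1) ^+ (1 + ~~ parT g * ~~ parT h) * cycT h g.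
Proof.
rewrite /cycT /ccyc cpair_sym -nconst_sign -nconstM; congr nconst.
rewrite !mulrA -!exprD; congr (_ * _); apply: sign_eq.
rewrite !(oddD, oddM) /cpar /= !oddb.
by case: (odd (cdeg g)); case: (odd (cdeg h)).
Qed.

Lemma cycT_m w x y : \sum_h mloc (rcons w x) h * cycT h y =
  (-1) ^+ (~~ parT y * shpar parT (rcons w x)) * \sum_h mloc (y :: w) h * cycT h x.
Proof.
have := cyc_mu (map f w) (f x) (f y); rewrite sumG => [|h]; last first.
  by rewrite mulf_eq0 negb_or -map_rcons => /andP[/mu_out].
rewrite sumG => [|h]; last by rewrite mulf_eq0 negb_or -map_cons => /andP[/mu_out].
rewrite -map_rcons -map_cons shpar_map {1}/shpar /= addn0 par_fgen => H.
under eq_bigr => h _ do rewrite -cycTE.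
by rewrite H; congr (_ * _); apply: eq_bigr => h _; rewrite -cycTE.
Qed.

End Restriction.

(** * Chains supported on one brane *)

Section ChainRestriction.
Variables (R : realType) (n : nat) (F : floer_setting R n) (l : fI F).
Local Notation Lam := (nov R R[i]).
Local Notation L := (fL l).
Local Notation T := (cb (lH L)).
Local Notation G := (gen (fuk F)).
Variable b : mc L.
Local Notation P := (obj b).
Local Notation f := (fgen b b).
Local Notation parT := (@cpar R n (lH L)).
Implicit Types (w : seq T) (phi psi : cochain (fuk F)).

Variable c : chain (fuk F).
Hypothesis c_on : chain_on P c.

Definition cres : T -> seq T -> Lam := fun i w => c (f i, map f w).

Lemma map_fgen_on (w : seq G) : (forall g, g \in w -> src g = P /\ tgt g = P) ->
  exists w', w = map f w'.
Proof.
elim: w => [|g w IH] H; first by exists [::].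
have [|w' ->] := IH; first by move=> h hw; apply: H; rewrite inE hw orbT.
by have [i ->] := fgen_surj (H g (mem_head _ _)); exists (i :: w').
Qed.

Lemma chain_onP z : c z != 0 -> exists i w, z = (f i, map f w).
Proof.
case: z => x w cz; have [|w' e] := @map_fgen_on (x :: w); first exact: c_on cz.
by case: w' e => [//|i w'] [-> ->]; exists i, w'.
Qed.

Lemma chain_bound : is_chain c -> exists N, forall z, c z != 0 -> (size z.2 <= N)%N.
Proof.
move=> [fin _]; exists (\max_(z <- fset_set [set z | c z != 0]) size z.2) => z cz.
have zS : z \in fset_set [set z | c z != 0] by rewrite in_fset_set // inE.
by rewrite (big_rem z) //= leq_maxl.
Qed.

Variable N : nat.
Hypothesis c_le : forall z, c z != 0 -> (size z.2 <= N)%N.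

Definition zloc (z : T * N.-bseq T) : G * seq G := (f z.1, map f z.2).

Lemma zloc_inj : injective zloc.
Proof.
move=> [x w] [y w'] [/(@fgen_inj _ _ _ _ b) -> /(inj_map (@fgen_inj _ _ _ _ b)) /val_inj ->].
by [].
Qed.

Lemma sum_chain (X : G * seq G -> Lam) : (forall z, c z = 0 -> X z = 0) ->
  \sum_(z \in [set: G * seq G]) X z = \sum_z X (zloc z).
Proof.
move=> H; apply: fsbig_inj_fin zloc_inj _ => z zN; apply: H; apply/eqP.
apply: contraT => cz; have [i [w zE]] := chain_onP cz.
have wN : (size w <= N)%N by have := c_le cz; rewrite zE /= size_map.
by case: (zN (i, Bseq wN)).
Qed.

Lemma hpair_loc phi : hpair phi c = hpairT parT (@cycT _ _ _ l) N cres (cloc b phi).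
Proof.
rewrite /hpair sum_chain => [|z ->]; last by rewrite !mul0r.
apply: eq_bigr => -[i w] _ /=; rewrite !shpar_map {1}/shpar /= addn0 par_fgen.
congr (_ * _); rewrite (sumG (b := b)) => [|h].
  by apply: eq_bigr => g _; rewrite cycTE.
rewrite mulf_eq0 negb_or => /andP[_ /cyc_hom]; rewrite fgen_src fgen_tgt.
by move=> [h1 h2]; split.
Qed.

Lemma bd_coef_loc i w i' w' : bd_coef (A := fuk F) (f i, map f w) (f i', map f w') =
  bdT_coef parT (mloc b) i w i' w'.
Proof.
have sh1 : shpar (@par _ (fuk F)) [:: f i] = ~~ parT i.
  by rewrite /shpar /= addn0 par_fgen.
rewrite /bd_coef /bdT_coef [X in split3 X]/= big_split3_map.
apply: eq_bigr => -[[t1 t2] t3] _; rewrite /fst /snd.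
rewrite sh1 !shpar_map; congr (_ + _).
  rewrite (sumG (b := b)) => [|h].
    apply: eq_bigr => h _; congr (_ * (nat_of_bool _)%:R); rewrite -map_cons -map_cat.
    rewrite -[LHS]/((f i' == f i) && (map f w' == map f (t1 ++ h :: t3))).
    by rewrite (inj_eq (@fgen_inj _ _ _ _ b)) (inj_eq (inj_map (@fgen_inj _ _ _ _ b))).
  have [->|/mu_out//] := eqVneq (mu (map f t2) h) 0.
  by rewrite mulr0 mul0r eqxx.
have e : (map f w' == map f t2) = (w' == t2) by exact/inj_eq/inj_map/fgen_inj.
by rewrite e /mloc map_cat.
Qed.

Lemma bd_loc : is_cycle c -> forall i' w',
  \sum_(z : T * N.-bseq T) cres z.1 z.2 * bdT_coef parT (mloc b) z.1 z.2 i' w' = 0.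
Proof.
move=> [_ bd0] i' w'; rewrite -[RHS](bd0 (f i', map f w')) /bd sum_chain.
  by apply: eq_bigr => -[i w] _; rewrite -bd_coef_loc.
by move=> z ->; rewrite mul0r.
Qed.

End ChainRestriction.

Section ChainPairing.
Variables (R : realType) (n : nat) (F : floer_setting R n) (l : fI F).
Local Notation Lam := (nov R R[i]).
Local Notation L := (fL l).
Local Notation T := (cb (lH L)).
Variable b : mc L.
Local Notation parT := (@cpar R n (lH L)).

(** All that is needed of a cycle at the brane: an additive functional on local cochains which kills
    coboundaries and sees words of bounded length only. *)
Lemma hpair_local (c : chain (fuk F)) : is_cycle c -> chain_on (obj b) c ->
  exists N (H : (seq T -> T -> Lam) -> Lam),
  [/\ forall phi, hpair phi c = H (cloc b phi),
      forall u v, H (fun w g => u w g + v w g) = H u + H v,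
      forall eta, H (cobdT parT (mloc b) eta) = 0 &
      forall u, (forall w g, (size w <= N)%N -> u w g = 0) -> H u = 0].
Proof.
move=> cc c_on; have [N cN] := chain_bound cc.1.
exists N, (hpairT parT (@cycT _ _ _ l) N (cres b c)); split.
- by move=> phi; exact: hpair_loc.
- move=> u v; rewrite /hpairT -big_split; apply: eq_bigr => z _ /=.
  by rewrite -mulrDr; congr (_ * _); rewrite -big_split; apply: eq_bigr => g _; rewrite mulrDl.
- move=> eta; apply: hpairT_cobdT.
  + exact: mloc_deg.
  + exact: mloc_nil.
  + exact: cycT_sym.
  + exact: cycT_m.
  + exact: bd_loc.
move=> u u0; rewrite /hpairT big1 // => z _; rewrite big1 ?mulr0 // => g _.
by rewrite u0 ?mul0r // size_bseq.
Qed.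

End ChainPairing.

(** * The quantum cohomology ring *)

Section FiniteLinear.
Variables (K : fieldType) (I J : finType) (A : I -> J -> K).

Let M := \matrix_(i < #|I|, j < #|J|) A (enum_val i) (enum_val j).

Lemma mulmx_enum (u : I -> K) j :
  (\row_i u (enum_val i) *m M) 0 j = \sum_i u i * A i (enum_val j).
Proof.
rewrite mxE [RHS](reindex (@enum_val I predT)) /=; last first.
  by exists enum_rank => x _; rewrite ?enum_valK ?enum_rankK.
by apply: eq_bigr => i _; rewrite !mxE.
Qed.

Lemma fin_row_free : (forall u : I -> K, (forall j, \sum_i u i * A i j = 0) ->
  forall i, u i = 0) -> row_free M.
Proof.
move=> H; apply: inj_row_free => v vM; apply/rowP => i; rewrite mxE.
pose u x := v 0 (enum_rank x).
have uv : \row_i u (enum_val i) = v.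
  by apply/rowP => k; rewrite mxE /u enum_valK.
have := H u; rewrite /u => /(_ _ (enum_val i)); rewrite enum_valK; apply=> j.
by have := mulmx_enum u (enum_rank j); rewrite uv vM mxE enum_rankK.
Qed.

Lemma fin_row_full : (forall v : J -> K, exists u : I -> K,
  forall j, \sum_i u i * A i j = v j) -> row_full M.
Proof.
move=> H; rewrite -sub1mx; apply/row_subP => j.
have [u uE] := H (fun x => (1%:M : 'M_#|J|) j (enum_rank x)).
apply/submxP; exists (\row_i u (enum_val i)); apply/rowP => k.
by rewrite mulmx_enum uE enum_valK mxE.
Qed.

Lemma fin_surj : #|I| = #|J| ->
  (forall u : I -> K, (forall j, \sum_i u i * A i j = 0) -> forall i, u i = 0) ->
  forall v : J -> K, exists u : I -> K, forall j, \sum_i u i * A i j = v j.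
Proof.
move=> IJ /fin_row_free; rewrite /row_free => /eqP rM v.
have fM : row_full M by rewrite /row_full rM IJ.
have /submxP[w wE] := submx_full (\row_j v (enum_val j)) fM.
exists (fun i => w 0 (enum_rank i)) => j.
have := mulmx_enum (fun i => w 0 (enum_rank i)) (enum_rank j).
rewrite enum_rankK => <-.
have -> : \row_i w 0 (enum_rank (enum_val i : I)) = w.
  by apply/rowP => k; rewrite mxE enum_valK.
by rewrite -wE mxE enum_rankK.
Qed.

Lemma fin_card :
  (forall u : I -> K, (forall j, \sum_i u i * A i j = 0) -> forall i, u i = 0) ->
  (forall v : J -> K, exists u : I -> K, forall j, \sum_i u i * A i j = v j) ->
  #|I| = #|J|.
Proof.
by move=> /fin_row_free /eqP rI /fin_row_full /eqP rJ; exact: etrans (esym rI) rJ.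
Qed.

End FiniteLinear.

(** * Frobenius property, associativity and unit of the quantum product *)

Section QuantumRing.
Variables (R : realType) (n : nat) (X : ambient R n).
Local Notation Lam := (nov R R[i]).
Local Notation B := (cb (aH X)).
Local Notation QHX := (QH X).
Implicit Types (x y z : QHX).

Lemma qmulPl (a : Lam) x y z : qmul (a *: x + y) z = a *: qmul x z + qmul y z.
Proof.
apply/ffunP => k; rewrite !ffunE /= scaler_sumr -big_split; apply: eq_bigr => i _.
rewrite scaler_sumr -big_split; apply: eq_bigr => j _; rewrite !ffunE /=.
change (((a * (x i : Lam) + (y i : Lam)) * (z j : Lam) * aqm i j k : Lam) =
  a * ((x i : Lam) * (z j : Lam) * aqm i j k) + (y i : Lam) * (z j : Lam) * aqm i j k).
by rewrite !mulrDl !mulrA.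
Qed.

Lemma qmulPr (a : Lam) x y z : qmul z (a *: x + y) = a *: qmul z x + qmul z y.
Proof.
apply/ffunP => k; rewrite !ffunE /= scaler_sumr -big_split; apply: eq_bigr => i _.
rewrite scaler_sumr -big_split; apply: eq_bigr => j _; rewrite !ffunE /=.
change (((z i : Lam) * (a * (x j : Lam) + (y j : Lam)) * aqm i j k : Lam) =
  a * ((z i : Lam) * (x j : Lam) * aqm i j k) + (z i : Lam) * (y j : Lam) * aqm i j k).
by rewrite mulrDr mulrDl !mulrA [z i * a]mulrC.
Qed.

Lemma qpairPl (a : Lam) x y z : qpair (a *: x + y) z = a * qpair x z + qpair y z.
Proof.
rewrite /qpair mulr_sumr -big_split; apply: eq_bigr => i _.
rewrite mulr_sumr -big_split; apply: eq_bigr => j _; rewrite !ffunE /=.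
change (((a * (x i : Lam) + (y i : Lam)) * (z j : Lam) * nconst R (cpair i j) : Lam) =
  a * ((x i : Lam) * (z j : Lam) * nconst R (cpair i j)) +
  (y i : Lam) * (z j : Lam) * nconst R (cpair i j)).
by rewrite !mulrDl !mulrA.
Qed.

Lemma qpairPr (a : Lam) x y z : qpair z (a *: x + y) = a * qpair z x + qpair z y.
Proof.
rewrite /qpair mulr_sumr -big_split; apply: eq_bigr => i _.
rewrite mulr_sumr -big_split; apply: eq_bigr => j _; rewrite !ffunE /=.
change (((z i : Lam) * (a * (x j : Lam) + (y j : Lam)) * nconst R (cpair i j) : Lam) =
  a * ((z i : Lam) * (x j : Lam) * nconst R (cpair i j)) +
  (z i : Lam) * (y j : Lam) * nconst R (cpair i j)).
by rewrite mulrDr mulrDl !mulrA [z i * a]mulrC.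
Qed.

(** Moving i past j and k in a three-point invariant costs (-1)^(|i|(|j|+|k|)). The degree axiom
    makes |i|+|j|+|k| even, so this is (-1)^|i|, the same sign as for the Poincare pairing, which
    lives in even total degree. *)
Lemma aqm_cyc i j k : \sum_m aqm i j m * nconst R (cpair m k) =
  \sum_m aqm j k m * nconst R (cpair (i : B) m) :> Lam.
Proof.
have cp m : cpair (i : B) m = (-1) ^+ cdeg i * cpair m i.
  rewrite cpair_sym; have [->|] := eqVneq (cpair m i) 0; first by rewrite !mulr0.
  move=> /eqP cp; congr (_ * _); apply: sign_eq; rewrite oddM.
  have [d /eqP cd] : exists d, ccup m i d * cint d != 0.
    apply: contrapT => H; apply: cp; rewrite /cpair big1 // => d _.
    by apply/eqP/negPn/negP => Hd; apply: H; exists d.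
  have c1 : ccup m i d != 0 by apply/eqP => e; apply: cd; rewrite e mul0r.
  have c2 : cint d != 0 by apply/eqP => e; apply: cd; rewrite e mulr0.
  have := congr1 odd (ccup_deg c1); rewrite (cint_deg c2) odd_double oddD.
  by case: (odd (cdeg m)); case: (odd (cdeg i)).
have gE alpha : gw alpha j k i = (-1) ^+ cdeg i * gw alpha i j k.
  rewrite gw_symm23 gw_symm12 mulrA -exprD.
  have [->|/gw_deg g] := eqVneq (gw alpha i j k) 0; first by rewrite !mulr0.
  congr (_ * _); apply: sign_eq; rewrite oddD !oddM.
  have : odd (cdeg i + cdeg j + cdeg k) = false by lia.
  by rewrite !oddD; case: (odd (cdeg i)); case: (odd (cdeg j)); case: (odd (cdeg k)).
have H1 := nsumsZ ((-1) ^+ cdeg i) (aqmE i j k).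
have H2 := aqmE j k i; rewrite -[LHS](signrMK (cdeg i)).
have -> : (-1) ^+ cdeg i * \sum_m aqm i j m * nconst R (cpair m k) =
    \sum_m aqm j k m * nconst R (cpair m i) :> Lam.
  apply: nsums_uniq H1 _; apply: nsums_ext H2 => alpha.
  by rewrite gE nconstM nconst_sign mulrCA.
rewrite mulr_sumr; apply: eq_bigr => m _.
by rewrite cp nconstM nconst_sign mulrCA.
Qed.

Lemma exchange_big3 (I J K : finType) (V : nmodType) (A : I -> J -> K -> V) :
  \sum_i \sum_j \sum_k A i j k = \sum_j \sum_k \sum_i A i j k.
Proof.
by rewrite exchange_big; apply: eq_bigr => j _; rewrite exchange_big.
Qed.

Lemma qpair_frob x y z : qpair (qmul x y) z = qpair x (qmul y z).
Proof.
transitivity (\sum_i \sum_j \sum_k (x i : Lam) * y j * z k *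
    \sum_m aqm i j m * nconst R (cpair m k)).
  rewrite /qpair.
  transitivity (\sum_m \sum_k \sum_i \sum_j (x i : Lam) * y j * z k *
    (aqm i j m * nconst R (cpair m k))).
    apply: eq_bigr => m _; apply: eq_bigr => k _; rewrite ffunE !mulr_suml.
    apply: eq_bigr => i _; rewrite !mulr_suml; apply: eq_bigr => j _; ring.
  under eq_bigr => m _ do rewrite exchange_big3.
  rewrite exchange_big; apply: eq_bigr => i _; rewrite exchange_big.
  apply: eq_bigr => j _; rewrite exchange_big; apply: eq_bigr => k _.
  by rewrite mulr_sumr.
transitivity (\sum_i \sum_j \sum_k (x i : Lam) * y j * z k *
    \sum_m aqm j k m * nconst R (cpair i m)).
  apply: eq_bigr => i _; apply: eq_bigr => j _; apply: eq_bigr => k _.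
  by rewrite aqm_cyc.
rewrite /qpair; apply: eq_bigr => i _.
transitivity (\sum_m \sum_j \sum_k (x i : Lam) * y j * z k *
    (aqm j k m * nconst R (cpair i m))).
  rewrite [RHS]exchange_big3; apply: eq_bigr => j _; apply: eq_bigr => k _.
  by rewrite mulr_sumr.
apply: eq_bigr => m _; rewrite ffunE mulr_sumr !mulr_suml; apply: eq_bigr => j _.
rewrite mulr_sumr !mulr_suml; apply: eq_bigr => k _; ring.
Qed.

(** The pairing matrix is constant in T, so each coefficient of v satisfies Poincare duality over
    C. *)
Lemma cpd_nov (v : B -> Lam) :
  (forall j, \sum_i v i * nconst R (cpair i j) = 0) -> forall i, v i = 0.
Proof.
move=> H i; apply: novP => l.
pose u : {ffun B -> R[i]} := [ffun i => v i l].
suff /ffunP/(_ i) : u = 0 by rewrite !ffunE.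
apply: cpd => j; have := congr1 (fun x : Lam => x l) (H j); rewrite nov_sumE => e.
rewrite -[RHS]e; apply: eq_bigr => k _.
by rewrite ffunE [in RHS]mulrC nconstE mulrC.
Qed.

Lemma qpair_surj (g : B -> Lam) : exists v : B -> Lam,
  forall j, \sum_i v i * nconst R (cpair i j) = g j.
Proof.
by apply: (fin_surj (A := fun i j => nconst R (cpair i j))) => //; exact: cpd_nov.
Qed.

Lemma cpd_nov_r (v : B -> Lam) :
  (forall i, \sum_j v j * nconst R (cpair i j) = 0) -> forall i, v i = 0.
Proof.
move=> H i; have [u uE] := qpair_surj (fun j => (j == i)%:R).
transitivity (\sum_j (j == i)%:R * v j).
  by rewrite (bigD1 i) //= eqxx mul1r big1 ?addr0 // => j /negPf ->; rewrite mul0r.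
under eq_bigr => j _ do rewrite -uE mulr_suml.
rewrite exchange_big big1 // => k _.
transitivity (u k * \sum_j v j * nconst R (cpair k j)); last by rewrite H mulr0.
by rewrite mulr_sumr; apply: eq_bigr => j _; ring.
Qed.

Definition qdelta (i : B) : QHX := [ffun j => (j == i)%:R].

Lemma qpair_delta i y : qpair (qdelta i) y = \sum_j (y j : Lam) * nconst R (cpair i j).
Proof.
rewrite /qpair (bigD1 i) //= [X in _ + X]big1 ?addr0 => [|k ki].
  by apply: eq_bigr => j _; rewrite ffunE eqxx mul1r.
by rewrite big1 // => j _; rewrite ffunE (negPf ki) !mul0r.
Qed.

Lemma qpair_inj y z : (forall x, qpair x y = qpair x z) -> y = z.
Proof.
move=> H; apply/ffunP => i; apply/eqP; rewrite -subr_eq0; apply/eqP.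
apply: (cpd_nov_r (v := fun i => (y i : Lam) - z i)) => j.
under eq_bigr => k _ do rewrite mulrBl.
by rewrite sumrB -!qpair_delta H subrr.
Qed.

Lemma qdelta_sum x : x = \sum_i (x i : Lam) *: qdelta i.
Proof.
apply/ffunP => j; rewrite sum_ffunE (bigD1 j) //= big1 => [|k kj].
  by rewrite !ffunE eqxx addr0; exact: (esym (mulr1 _)).
by rewrite !ffunE eq_sym (negPf kj); exact: mulr0.
Qed.

Lemma qpair_riesz (g : QHX -> Lam) :
  (forall (a : Lam) x y, g (a *: x + y) = a * g x + g y) ->
  exists z, forall x, qpair x z = g x.
Proof.
move=> gP; have [|v vE] := @fin_surj Lam B B (fun j i => nconst R (cpair i j)) erefl _
   (fun i => g (qdelta i)).
  by move=> u H; exact: cpd_nov_r.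
exists [ffun j => v j] => x.
have g0 : g 0 = 0 by have := gP (-1) 0 0; rewrite scaleN1r oppr0 addr0 mulN1r addNr.
have lin (h : QHX -> Lam) : (forall (a : Lam) x y, h (a *: x + y) = a * h x + h y) ->
    h x = \sum_i (x i : Lam) * h (qdelta i).
  move=> hP; have h0 : h 0 = 0 by have := hP (-1) 0 0; rewrite scaleN1r oppr0 addr0 mulN1r addNr.
  rewrite [in LHS](qdelta_sum x); elim: (index_enum _) => [|i s IH]; first by rewrite !big_nil.
  by rewrite !big_cons hP IH.
rewrite (lin g gP) (lin (fun x => qpair x _)) => [|a x' y']; last exact: qpairPl.
apply: eq_bigr => i _; congr (_ * _); rewrite qpair_delta -vE.
by apply: eq_bigr => j _; rewrite ffunE.
Qed.

Lemma qmulA x y z : qmul (qmul x y) z = qmul x (qmul y z).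
Proof.
apply/ffunP => p; rewrite !ffunE.
transitivity (\sum_i \sum_j \sum_k (x i : Lam) * y j * z k *
    \sum_m aqm i j m * aqm m k p).
  transitivity (\sum_m \sum_k \sum_i \sum_j (x i : Lam) * y j * z k *
    (aqm i j m * aqm m k p)).
    apply: eq_bigr => m _; apply: eq_bigr => k _; rewrite ffunE !mulr_suml.
    apply: eq_bigr => i _; rewrite !mulr_suml; apply: eq_bigr => j _; ring.
  under eq_bigr => m _ do rewrite exchange_big3.
  rewrite exchange_big; apply: eq_bigr => i _; rewrite exchange_big.
  apply: eq_bigr => j _; rewrite exchange_big; apply: eq_bigr => k _.
  by rewrite mulr_sumr.
transitivity (\sum_i \sum_j \sum_k (x i : Lam) * y j * z k *
    \sum_m aqm j k m * aqm i m p).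
  apply: eq_bigr => i _; apply: eq_bigr => j _; apply: eq_bigr => k _.
  by rewrite aqmA.
apply: eq_bigr => i _.
transitivity (\sum_m \sum_j \sum_k (x i : Lam) * y j * z k *
    (aqm j k m * aqm i m p)).
  rewrite [RHS]exchange_big3; apply: eq_bigr => j _; apply: eq_bigr => k _.
  by rewrite mulr_sumr.
apply: eq_bigr => m _; rewrite ffunE mulr_sumr !mulr_suml; apply: eq_bigr => j _.
rewrite mulr_sumr !mulr_suml; apply: eq_bigr => k _; ring.
Qed.

Lemma aqm_comm (i j m : B) : aqm i j m = (-1) ^+ (cdeg i * cdeg j) * aqm j i m :> Lam.
Proof.
apply/eqP; rewrite -subr_eq0; apply/eqP.
apply: (cpd_nov (v := fun m => aqm i j m - (-1) ^+ (cdeg i * cdeg j) * aqm j i m)) => k.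
under eq_bigr => p _ do rewrite mulrBl.
rewrite sumrB; apply/eqP; rewrite subr_eq0; apply/eqP.
apply: nsums_uniq (aqmE i j k) _.
have := nsumsZ ((-1) ^+ (cdeg i * cdeg j)) (aqmE j i k).
have -> : (-1) ^+ (cdeg i * cdeg j) * (\sum_p aqm j i p * nconst R (cpair p k)) =
    \sum_p (-1) ^+ (cdeg i * cdeg j) * aqm j i p * nconst R (cpair p k) :> Lam.
  by rewrite mulr_sumr; apply: eq_bigr => p _; rewrite mulrA.
apply: nsums_ext => alpha.
by rewrite [in RHS]gw_symm12 nconstM nconst_sign mulrCA.
Qed.

Lemma qmul_comm x y : qhomog false y -> qmul x y = qmul y x.
Proof.
move=> ye; apply/ffunP => m; rewrite !ffunE exchange_big; apply: eq_bigr => j _.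
apply: eq_bigr => i _; have [->|/ye yj] := eqVneq (y j) 0; first by rewrite !(mul0r, mulr0).
rewrite aqm_comm -[in RHS]mulrA [in RHS]mulrCA -!mulrA; congr (_ * (_ * _)).
by rewrite (@sign_eq _ _ 0) ?mul1r // oddM; move: yj; rewrite /cpar => ->; rewrite andbF.
Qed.

(** Paired with any class, the unit annihilates the contributions of all alpha other than 0, and
    alpha = 0 gives the cup product. *)
Lemma qone_mul x : qmul (qone X) x = x.
Proof.
have unitE j m : \sum_i nconst R (cone (aH X) i) * aqm i j m = (m == j)%:R :> Lam.
  apply/eqP; rewrite -subr_eq0; apply/eqP.
  apply: (cpd_nov (v := fun m => \sum_i nconst R (cone (aH X) i) * aqm i j m - (m == j)%:R)) => k.
  under eq_bigr => p _ do rewrite mulrBl.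
  rewrite sumrB; apply/eqP; rewrite subr_eq0; apply/eqP.
  transitivity (nconst R (cpair j k) : Lam); last first.
    rewrite (bigD1 j) //= eqxx mul1r big1 ?addr0 // => p /negPf ->.
    by rewrite mul0r.
  have H : nsums (fun alpha => \sum_i nconst R (cone (aH X) i) *
      (nTarea (aom X alpha) * nconst R (gw alpha i j k)))
     (\sum_i nconst R (cone (aH X) i) * \sum_m aqm i j m * nconst R (cpair m k)).
    by apply: nsums_sum => i; apply: nsumsZ; exact: aqmE.
  transitivity (\sum_i nconst R (cone (aH X) i) * \sum_m aqm i j m * nconst R (cpair m k) : Lam).
    under eq_bigr => p _ do rewrite mulr_suml.
    rewrite exchange_big; apply: eq_bigr => i _; rewrite mulr_sumr.
    by apply: eq_bigr => p _; rewrite mulrA.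
  apply: nsums_uniq H _.
  pose Fa alpha : Lam := \sum_i nconst R (cone (aH X) i) *
      (nTarea (aom X alpha) * nconst R (gw alpha i j k)).
  suff [S0 Sa] : Fa 0 = nconst R (cpair j k) /\ forall alpha, alpha != 0 -> Fa alpha = 0.
    rewrite -S0; have := @nsums_finT R _ _ unit (fun _ => 0 : aH2 X) Fa.
    rewrite big_const card_unit /= addr0; apply; first by move=> [] [].
    by move=> alpha a0; apply: Sa; apply/eqP => e; exact: (a0 tt).
  split=> [|alpha a0].
    rewrite /Fa raddf0 /nTarea mul0r.
    transitivity (nconst R (\sum_i cone (aH X) i * gw 0 i j k) : Lam).
      rewrite nconst_sum; apply: eq_bigr => i _.
      by rewrite nconstM; congr (_ * _); exact: mul1r.
    congr nconst; under eq_bigr => i _ do rewrite gw_classical mulr_sumr.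
    rewrite exchange_big.
    under eq_bigr => p _ do (under eq_bigr => i _ do rewrite mulrA).
    under eq_bigr => p _ do rewrite -mulr_suml ccup1.
    rewrite (bigD1 j) //= eqxx mul1r big1 ?addr0 // => p.
    by rewrite eq_sym => /negPf ->; rewrite mul0r.
  transitivity (nTarea (aom X alpha) * nconst R (\sum_i cone (aH X) i * gw alpha i j k) : Lam).
    rewrite nconst_sum mulr_sumr; apply: eq_bigr => i _.
    by rewrite nconstM mulrCA.
  by rewrite gw_unit // nconst0 mulr0.
apply/ffunP => m; rewrite ffunE exchange_big.
transitivity (\sum_j (x j : Lam) * (m == j)%:R).
  apply: eq_bigr => j _; rewrite -unitE mulr_sumr; apply: eq_bigr => i _.
  by rewrite ffunE mulrAC mulrC.
rewrite (bigD1 m) //= eqxx mulr1 big1 ?addr0 // => j.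
by rewrite eq_sym => /negPf ->; rewrite mulr0.
Qed.

End QuantumRing.

(** * The divisor axiom *)

Section Polarization.
Variables (A : comNzRingType) (I : finType).
Implicit Types (f : seq I -> A) (x z : I -> A) (xs ys : seq (I -> A)).

Lemma mlext_slot f xs z ys : mlext f (xs ++ z :: ys) =
  \sum_i z i * mlext f (xs ++ (fun j => (j == i)%:R) :: ys).
Proof.
elim: xs f => [|x xs IH] f /=.
  apply: eq_bigr => i _; congr (_ * _); rewrite (bigD1 i) //= eqxx mul1r.
  by rewrite big1 ?addr0 // => j /negPf ->; rewrite mul0r.
under eq_bigr => i _ do rewrite IH mulr_sumr.
rewrite exchange_big; apply: eq_bigr => j _; rewrite mulr_sumr.
by apply: eq_bigr => i _; rewrite mulrCA.
Qed.

Lemma mlext_slotP f xs a z z' ys : mlext f (xs ++ (fun i => a * z i + z' i) :: ys) =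
  a * mlext f (xs ++ z :: ys) + mlext f (xs ++ z' :: ys).
Proof.
rewrite [LHS]mlext_slot (mlext_slot f xs z ys) (mlext_slot f xs z' ys).
rewrite mulr_sumr -big_split; apply: eq_bigr => i _ /=.
by rewrite mulrDl mulrA.
Qed.

Lemma mlext0 f xs ys : mlext f (xs ++ (fun=> 0) :: ys) = 0.
Proof. by rewrite mlext_slot big1 // => i _; rewrite mul0r. Qed.

Lemma mlext_zero xs : mlext (fun _ : seq I => 0 : A) xs = 0.
Proof. by elim: xs => [|x xs IH] //=; rewrite big1 // => i _; rewrite IH mulr0. Qed.

(* One letter z, resp. z and then z', at all positions among letters x. *)
Fixpoint mlext_one f x z (s : nat) : A :=
  if s is s'.+1 then \sum_i z i * mlext (fun w => f (i :: w)) (nseq s' x) +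
    \sum_i x i * mlext_one (fun w => f (i :: w)) x z s' else 0.

Fixpoint mlext_two f x z z' (s : nat) : A :=
  if s is s'.+1 then \sum_i z i * mlext_one (fun w => f (i :: w)) x z' s' +
    \sum_i x i * mlext_two (fun w => f (i :: w)) x z z' s' else 0.

Lemma mlext_oneS f x z s : mlext_one f x z s.+1 =
  \sum_i z i * mlext (fun w => f (i :: w)) (nseq s x) +
    \sum_i x i * mlext_one (fun w => f (i :: w)) x z s.
Proof. by []. Qed.

Lemma mlext_twoS f x z z' s : mlext_two f x z z' s.+1 =
  \sum_i z i * mlext_one (fun w => f (i :: w)) x z' s +
    \sum_i x i * mlext_two (fun w => f (i :: w)) x z z' s.
Proof. by []. Qed.

Lemma mlext_oneE f x z s : mlext_one f x z s.+1 =
  \sum_(p < s.+1) mlext f (nseq p x ++ z :: nseq (s - p) x).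
Proof.
elim: s f => [|s IH] f; rewrite mlext_oneS big_ord_recl subn0; congr (_ + _).
  by rewrite big_ord0 big1 // => i _; rewrite mulr0.
under eq_bigr => i _ do rewrite IH mulr_sumr.
by rewrite exchange_big; apply: eq_bigr => p _.
Qed.

Lemma mlext_two1 f x z z' : mlext_two f x z z' 1 = 0.
Proof.
by rewrite mlext_twoS !big1 ?addr0 // => i _; rewrite mulr0.
Qed.

Lemma mlext_twoE f x z z' s : mlext_two f x z z' s.+2 =
  \sum_(p < s.+1) \sum_(q < s.+1) if (p + q <= s)%N then
    mlext f (nseq p x ++ z :: nseq q x ++ z' :: nseq (s - p - q) x) else 0.
Proof.
elim: s f => [|s IH] f; rewrite mlext_twoS big_ord_recl; congr (_ + _).
- rewrite big_ord_recl big_ord0 addr0 /=; apply: eq_bigr => i _; congr (_ * _).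
  by rewrite [X in _ + X]big1 ?addr0 // => j _; rewrite mulr0.
- by rewrite big_ord0 big1 // => i _; rewrite mlext_two1 mulr0.
- under eq_bigr => i _ do rewrite mlext_oneE mulr_sumr.
  rewrite exchange_big; apply: eq_bigr => q _.
  by rewrite add0n -ltnS ltn_ord !subn0.
under eq_bigr => i _ do rewrite IH mulr_sumr.
rewrite exchange_big; apply: eq_bigr => p _.
under eq_bigr => i _ do rewrite mulr_sumr.
rewrite exchange_big [RHS]big_ord_recr /= /bump /= add1n.
rewrite [(p.+1 + s.+1)%N]addSnnS leqNgt leq_addl addr0.
apply: eq_bigr => q _ /=; rewrite addSn ltnS subSS; case: ifP => // _.
by rewrite big1 // => i _; rewrite mulr0.
Qed.

Lemma mlext_oneP f x a z z' s : mlext_one f x (fun i => a * z i + z' i) s =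
  a * mlext_one f x z s + mlext_one f x z' s.
Proof.
elim: s f => [|s IH] f /=; first by rewrite mulr0 addr0.
rewrite mulrDr addrACA; congr (_ + _).
  by rewrite mulr_sumr -big_split; apply: eq_bigr => i _; rewrite mulrDl mulrA.
rewrite mulr_sumr -big_split; apply: eq_bigr => i _ /=.
by rewrite IH mulrDr mulrCA.
Qed.

Lemma mlext_twoPl f x a z z' y s : mlext_two f x (fun i => a * z i + z' i) y s =
  a * mlext_two f x z y s + mlext_two f x z' y s.
Proof.
elim: s f => [|s IH] f /=; first by rewrite mulr0 addr0.
rewrite mulrDr addrACA; congr (_ + _).
  by rewrite mulr_sumr -big_split; apply: eq_bigr => i _; rewrite mulrDl mulrA.
rewrite mulr_sumr -big_split; apply: eq_bigr => i _ /=.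
by rewrite IH mulrDr mulrCA.
Qed.

Lemma mlext_twoPr f x a z z' y s : mlext_two f x y (fun i => a * z i + z' i) s =
  a * mlext_two f x y z s + mlext_two f x y z' s.
Proof.
elim: s f => [|s IH] f /=; first by rewrite mulr0 addr0.
rewrite mulrDr addrACA; congr (_ + _).
  rewrite mulr_sumr -big_split; apply: eq_bigr => i _ /=.
  by rewrite mlext_oneP mulrDr mulrCA.
rewrite mulr_sumr -big_split; apply: eq_bigr => i _ /=.
by rewrite IH mulrDr mulrCA.
Qed.

(** The value on equal arguments x + X z, as a polynomial in X. Its coefficients of X and X^2 are
    the polarizations [mlext_one] and [mlext_two], so an identity on equal arguments yields one for
    these. *)
Definition mlpoly f x z s : {poly A} :=
  mlext (fun w => (f w)%:P) (nseq s (fun i => (x i)%:P + 'X * (z i)%:P)).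

Lemma mlpoly_horner f x z s c :
  (mlpoly f x z s).[c] = mlext f (nseq s (fun i => x i + c * z i)).
Proof.
rewrite /mlpoly; elim: s f => [|s IH] f /=; first by rewrite hornerC.
rewrite horner_sum; apply: eq_bigr => i _.
by rewrite hornerM IH hornerD hornerM hornerX !hornerC.
Qed.

Lemma mlpolyS f x z s j : (mlpoly f x z s.+1)`_j =
  \sum_i x i * (mlpoly (fun w => f (i :: w)) x z s)`_j +
  \sum_i z i * (if j is j'.+1 then (mlpoly (fun w => f (i :: w)) x z s)`_j' else 0).
Proof.
rewrite /mlpoly /= coef_sum -big_split; apply: eq_bigr => i _ /=.
rewrite mulrDl coefD coefCM; congr (_ + _); rewrite -mulrA coefXM coefCM.
by case: j => [|j] /=; rewrite ?mulr0.
Qed.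

Lemma mlpoly0 f x z s : (mlpoly f x z s)`_0 = mlext f (nseq s x).
Proof.
elim: s f => [|s IH] f; first by rewrite coefC.
rewrite mlpolyS [X in _ + X]big1 ?addr0 => [|i _]; last by rewrite mulr0.
by apply: eq_bigr => i _; rewrite IH.
Qed.

Lemma mlpoly1 f x z s : (mlpoly f x z s)`_1 = mlext_one f x z s.
Proof.
elim: s f => [|s IH] f; first by rewrite coefC.
rewrite mlpolyS addrC /=; congr (_ + _); apply: eq_bigr => i _; first by rewrite mlpoly0.
by rewrite IH.
Qed.

Lemma mlpoly2 f x z s : (mlpoly f x z s)`_2 = mlext_two f x z z s.
Proof.
elim: s f => [|s IH] f; first by rewrite coefC.
rewrite mlpolyS addrC /=; congr (_ + _); apply: eq_bigr => i _; first by rewrite mlpoly1.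
by rewrite IH.
Qed.

Lemma coef_affine_exp (a c : A) s j :
  ((a%:P + 'X * c%:P) ^+ s)`_j = 'C(s, j)%:R * a ^+ (s - j) * c ^+ j.
Proof.
rewrite exprDn coef_sum.
have E i : ((a%:P ^+ (s - i) * ('X * c%:P) ^+ i) *+ 'C(s, i))`_j =
    (if i == j then 'C(s, i)%:R * a ^+ (s - i) * c ^+ i else 0).
  rewrite coefMn exprMn -!polyC_exp mulrA coefMC coefCM coefXn mulrAC.
  by rewrite eq_sym; case: eqP => _; rewrite ?mulr1 ?mulr0 ?mul0rn // -[LHS]mulr_natl mulrA.
have [sj|js] := ltnP s j.
  rewrite bin_small // !mul0r big1 // => i _; rewrite E; case: eqP => // ij.
  by move: sj; rewrite -ij ltnNge -ltnS ltn_ord.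
rewrite (bigD1 (Ordinal (js : (j < s.+1)%N))) //= E eqxx big1 ?addr0 // => i.
by rewrite -val_eqE /= => /negPf ij; rewrite E ij.
Qed.

End Polarization.

Lemma poly_nat_eq0 (A : idomainType) (p : {poly A}) :
  (forall n, n.+1%:R != 0 :> A) -> (forall k : nat, p.[k%:R] = 0) -> p = 0.
Proof.
move=> char0 p0; apply: (@roots_geq_poly_eq0 _ p [seq k%:R | k <- iota 0 (size p)]).
- by apply/allP => x /mapP[k _ ->]; apply/rootP.
- rewrite map_inj_uniq ?iota_uniq // => i j.
  wlog ij : i j / (i <= j)%N.
    by move=> H; case: (leqP i j) => [|/ltnW] /H h e; [exact: h|exact/esym/h].
  rewrite -(subnK ij); case: (j - i)%N => [//|k] /eqP.
  rewrite natrD -subr_eq0 opprD addrCA subrr addr0 oppr_eq0.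
  by rewrite (negPf (char0 k)).
by rewrite size_map size_iota.
Qed.

(* Stated over an abstract field: with Novikov series, conversion would unfold
   the series. *)
Lemma divisor_aux1 (K : fieldType) (t a c p q r : K) : p != 0 -> q != 0 ->
  p * a * (t * c) * ((p * q)^-1 * r) = t * (c * a / q * r).
Proof. by move=> p0 q0; field; rewrite p0 q0. Qed.

Lemma divisor_aux2 (K : fieldType) (t a c p q r : K) : p != 0 -> q != 0 ->
  p * a * (t * c) ^+ 2 * (p^-1 / q * r) = t * (t * (c ^+ 2 * a / q * r)).
Proof. by move=> p0 q0; field; rewrite p0 q0. Qed.

Lemma divisor_aux3 (K : fieldType) (x y a d q r : K) : d != 0 -> q != 0 -> d = 1 + 1 ->
  (x + y) ^+ 2 * a / (d * q) * r - x ^+ 2 * a / (d * q) * r - y ^+ 2 * a / (d * q) * r =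
  x * y * a / q * r.
Proof. by move=> d0 q0 dE; field: dE; rewrite d0 q0. Qed.

Lemma split_aux (K : comNzRingType) (a b c d : K) : a + b = c + a + (b + d) - c - d.
Proof. by ring. Qed.

(** * Polarization of the divisor axiom *)

Section DivisorAxiom.
Variables (R : realType) (n : nat) (F : floer_setting R n) (l : fI F).
Local Notation Lam := (nov R R[i]).
Local Notation L := (fL l).
Local Notation T := (cb (lH L)).
Hypotheses (htorus : is_torus L) (hindex : index_condition L).
Variable b : {ffun T -> Lam}.
Hypotheses (b_H1 : in_H1 b) (b_pos : forall i, nval_gt0 (b i)).
Implicit Types (z : T -> Lam) (beta : lH2 L) (k : T).

(** Integrality is what the basis vectors of H^1 satisfy: they have valuation 0, whereas the divisor
    axiom requires Lambda_+. *)
Definition H1_int z := forall i, (z i != 0 -> cdeg i = 1%N) /\ nval_ge 0 (z i).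

Definition lev_fun (gamma : lH1 L) z : Lam := \sum_i nconst R (lev L gamma i) * z i.

Local Notation lmf beta k := (fun w : seq T => nconst R (lm (l := L) beta w k) : Lam).
Local Notation ev beta := (lev_fun (lbd L beta)).

Lemma lev_funP gamma a z z' :
  lev_fun gamma (fun i => a * z i + z' i) = a * lev_fun gamma z + lev_fun gamma z'.
Proof.
by rewrite /lev_fun mulr_sumr -big_split; apply: eq_bigr => i _; rewrite /= mulrDr mulrCA.
Qed.

(** The divisor axiom applies to b + c z for every natural number c, and a polynomial with all
    natural numbers as roots vanishes in characteristic 0. *)
Lemma mlpoly_divisor beta k z s : (forall i, (z i != 0 -> cdeg i = 1%N) /\ nval_gt0 (z i)) ->
  mlpoly (lmf beta k) b z s =
  ((ev beta b)%:P + 'X * (ev beta z)%:P) ^+ s * (s`!%:R^-1 * nconst R (lm beta [::] k))%:P.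
Proof.
move=> zP; apply/eqP; rewrite -subr_eq0; apply/eqP.
apply: poly_nat_eq0 => [m|c]; first exact: nov_natr_neq0.
rewrite hornerD hornerN mlpoly_horner hornerM horner_exp hornerD hornerM hornerX !hornerC.
pose bz : {ffun T -> Lam} := [ffun i => b i + c%:R * z i].
have bz1 : in_H1 bz.
  move=> i; rewrite ffunE; have [zi|/(zP i).1 //] := eqVneq (z i) 0.
  by rewrite zi mulr0 addr0; exact: b_H1.
have bz0 i : nval_gt0 (bz i).
  rewrite ffunE; apply: nval_gt0D => //; apply: nval_gt0M; last exact: (zP i).2.
  by rewrite -nconst_natr; exact: nconst_ge0.
have := f_divisor htorus hindex s beta k bz1 bz0.
have -> : (fun i => bz i) = (fun i => b i + c%:R * z i).
  by apply/funext => i; rewrite ffunE.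
move=> E; apply/eqP; rewrite subr_eq0; apply/eqP; apply: etrans E _.
have -> : ev1 (lbd L beta) bz = ev beta b + c%:R * ev beta z.
  rewrite /ev1 /lev_fun mulr_sumr -big_split; apply: eq_bigr => i _.
  by rewrite ffunE mulrDr [in LHS](mulrCA _ c%:R).
exact: esym (mulrA _ _ _).
Qed.

(** The factor T moves an integral class into Lambda_+, where the divisor axiom holds; by
    multilinearity it is cancelled afterwards. *)
Lemma H1_int_scale z : H1_int z -> forall i, ((nT R[i] 1 * z i : Lam) != 0 -> cdeg i = 1%N) /\
  nval_gt0 (nT R[i] 1 * z i : Lam).
Proof.
move=> zP i; have [z1 z0] := zP i; split.
  by apply: contraNeq => i1; apply/eqP; have [->|/z1 /eqP] := eqVneq (z i) 0;
    rewrite ?mulr0 // (negPf i1).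
rewrite mulrC; apply: nval_gt0M => // j j0 /=.
by case: eqP => // j1; move: j0; rewrite j1 ler10.
Qed.

Lemma divisor_one beta k z s : H1_int z ->
  mlext_one (lmf beta k) b z s.+1 =
  ev beta z * ev beta b ^+ s / s`!%:R * nconst R (lm beta [::] k).
Proof.
move=> zP; have := congr1 (fun p : {poly Lam} => p`_1)
  (mlpoly_divisor beta k s.+1 (H1_int_scale zP)).
rewrite mlpoly1 coefMC coef_affine_exp subSS subn0 expr1 bin1.
have Tz (y : T -> Lam) : (fun i => nT R[i] 1 * y i) = (fun i => nT R[i] 1 * y i + 0 * y i).
  by apply/funext => i; rewrite mul0r addr0.
rewrite Tz; have z0 : mlext_one (lmf beta k) b (fun i => 0 * z i) s.+1 = 0.
  have -> : (fun i => 0 * z i) = (fun i => 0 * z i + 0 : Lam).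
    by apply/funext => i; rewrite addr0.
  rewrite mlext_oneP mul0r add0r mlext_oneE big1 // => p _; exact: mlext0.
rewrite mlext_oneP z0 addr0 lev_funP.
have -> : ev beta (fun i => 0 * z i) = 0.
  by rewrite /lev_fun big1 // => i _; rewrite mul0r mulr0.
rewrite addr0 factS natrM => H; apply: (mulfI (@nT_neq0 R R[i] 1)); rewrite {}H.
by apply: divisor_aux1; [exact: nov_natr_neq0|exact: nov_fact_neq0].
Qed.

Lemma divisor_two_diag beta k z s : H1_int z ->
  mlext_two (lmf beta k) b z z s.+2 =
  ev beta z ^+ 2 * ev beta b ^+ s / (2%:R * s`!%:R) * nconst R (lm beta [::] k).
Proof.
move=> zP; have := congr1 (fun p : {poly Lam} => p`_2)
  (mlpoly_divisor beta k s.+2 (H1_int_scale zP)).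
rewrite mlpoly2 coefMC coef_affine_exp !subSS subn0.
have Tz (y : T -> Lam) : (fun i => nT R[i] 1 * y i) = (fun i => nT R[i] 1 * y i + 0).
  by apply/funext => i; rewrite addr0.
have z0l y : mlext_two (lmf beta k) b (fun=> 0) y s.+2 = 0.
  rewrite mlext_twoE big1 // => p _; rewrite big1 // => q _.
  by case: ifP => // _; exact: mlext0.
have z0r y : mlext_two (lmf beta k) b y (fun=> 0) s.+2 = 0.
  rewrite mlext_twoE big1 // => p _; rewrite big1 // => q _.
  case: ifP => // _; rewrite -cat_cons catA; exact: mlext0.
rewrite Tz mlext_twoPl mlext_twoPr z0l z0r !addr0 lev_funP.
have -> : ev beta (fun=> 0) = 0.
  by rewrite /lev_fun big1 // => i _; rewrite mulr0.
rewrite addr0 => H.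
have T0 := @nT_neq0 R R[i] 1; apply: (mulfI T0); apply: (mulfI T0); rewrite {}H.
have bf : 'C(s.+2, 2)%:R * (2%:R * s`!%:R) = s.+2`!%:R :> Lam.
  by rewrite -!natrM -(@bin_fact s.+2 2) // !subSS subn0.
have h1 := @nov_fact_neq0 R R[i] s; have h2 : 2%:R != 0 :> Lam := @nov_natr_neq0 R R[i] 1.
have h3 := @nov_fact_neq0 R R[i] s.+2.
have -> : (s.+2)`!%:R^-1 = 'C(s.+2, 2)%:R^-1 / (2%:R * s`!%:R) :> Lam by rewrite -bf invfM.
have h4 : 'C(s.+2, 2)%:R != 0 :> Lam.
  by apply: contraNneq h3; rewrite -bf => ->; rewrite mul0r.
by apply: divisor_aux2 => //; rewrite mulf_neq0.
Qed.

(** The diagonal identity at z + z' minus those at z and z'. The factor 2 of the mixed term cancels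
    the 2 in the denominator. *)
Lemma divisor_two beta k z z' s : H1_int z -> H1_int z' ->
  mlext_two (lmf beta k) b z z' s.+2 + mlext_two (lmf beta k) b z' z s.+2 =
  ev beta z * ev beta z' * ev beta b ^+ s / s`!%:R * nconst R (lm beta [::] k).
Proof.
move=> zP zP'; have sP : H1_int (fun i => 1 * z i + z' i).
  move=> i; rewrite mul1r; split; last by apply: nval_geD; [exact: (zP i).2|exact: (zP' i).2].
  have [->|/(zP i).1 //] := eqVneq (z i) 0; rewrite add0r; exact: (zP' i).1.
have := divisor_two_diag beta k s sP.
rewrite mlext_twoPl !mlext_twoPr !mul1r lev_funP mul1r !divisor_two_diag // => H.
have h1 := @nov_fact_neq0 R R[i] s; have h2 : 2%:R != 0 :> Lam := @nov_natr_neq0 R R[i] 1.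
move: H; set A := mlext_two _ _ _ _ _; set B := mlext_two _ _ _ _ _ => H.
transitivity ((ev beta z + ev beta z') ^+ 2 * ev beta b ^+ s / (2%:R * s`!%:R) *
    nconst R (lm beta [::] k) -
  ev beta z ^+ 2 * ev beta b ^+ s / (2%:R * s`!%:R) * nconst R (lm beta [::] k) -
  ev beta z' ^+ 2 * ev beta b ^+ s / (2%:R * s`!%:R) * nconst R (lm beta [::] k)).
  rewrite -H; exact: split_aux.
by apply: divisor_aux3.
Qed.

End DivisorAxiom.

Lemma divisor_aux4 (K : fieldType) (w e p q r : K) :
  w * (e * p / q * r) = w * r * e * (q^-1 * p).
Proof. by ring. Qed.

(** * The operations m_1 and m_2 deformed by a Maurer-Cartan element *)

Section DeformedSums.
Variables (R : realType) (n : nat) (F : floer_setting R n) (l : fI F).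
Local Notation Lam := (nov R R[i]).
Local Notation L := (fL l).
Local Notation T := (cb (lH L)).
Implicit Types (z : T -> Lam) (beta : lH2 L) (k : T).
Local Notation lmf beta k := (fun w : seq T => nconst R (lm (l := L) beta w k) : Lam).
Local Notation bb b := (fun i => mc_b b i : Lam).

Definition wt (b : mc L) beta : Lam :=
  nconst R (mc_rho b (lbd L beta)) * nTarea (lom L beta).

Definition term1 (b b' : mc L) z (k : T) (p : nat * nat * lH2 L) : Lam :=
  wt b p.2 * mlext (lmf p.2 k) (nseq p.1.1 (bb b) ++ z :: nseq p.1.2 (bb b')).

Definition term2 (b : mc L) z z' (k : T) (p : nat * nat * nat * lH2 L) : Lam :=
  wt b p.2 * mlext (lmf p.2 k)
    (nseq p.1.1.1 (bb b) ++ z :: nseq p.1.1.2 (bb b) ++ z' :: nseq p.1.2 (bb b)).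

Lemma hdelta_fun (i : T) : (fun j => hdelta_basis (L := L) i j) = (fun j => (j == i)%:R : Lam).
Proof. by apply/funext => j; rewrite ffunE. Qed.

Lemma mu1_sums (b b' : mc L) z k : same_rhoW b b' ->
  nsums (term1 b b' z k) (\sum_i z i * mu [:: fgen b b' i] (fgen b b' k)).
Proof.
move=> bb'.
have H : nsums (fun p => \sum_i z i * term1 b b' (fun j => (j == i)%:R) k p)
   (\sum_i z i * mu [:: fgen b b' i] (fgen b b' k)).
  apply: nsums_sum => i; apply: nsumsZ.
  have Fa : List.Forall (fun x => same_rhoW b x.1) [:: (b', i)] by repeat constructor; case: bb'.
  have := fuk_mu (b := b) (s := [:: (b', i)]) k isT Fa.
  pose h (p : nat * nat * lH2 L) : 2.-tuple nat * lH2 L := ([tuple p.1.1; p.1.2], p.2).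
  have hb : bijective h.
    exists (fun q : 2.-tuple nat * lH2 L => ((tnth q.1 ord0, tnth q.1 ord_max), q.2)).
      by move=> [[x y] be].
    by move=> [[[|x [|y [|u t]]] //= sz] be]; congr (_, _); apply/val_inj.
  move/(nsums_bij _ _ hb); apply: nsums_ext => -[[x y] be].
  rewrite /= /mterm_deformed /mterm /term1 /wt; congr (_ * mlext _ _) => /=.
  by rewrite map_cat /= cats0 !map_nseq hdelta_fun.
apply: nsums_ext H => p; rewrite /term1 mlext_slot mulr_sumr; apply: eq_bigr => i _.
by rewrite mulrCA.
Qed.

Lemma mu2_sums (b : mc L) z z' k :
  nsums (term2 b z z' k) (\sum_i \sum_j z i * z' j * mloc b [:: i; j] k).
Proof.
have H : nsums (fun p => \sum_i \sum_j z i * z' j *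
     term2 b (fun j' => (j' == i)%:R) (fun j' => (j' == j)%:R) k p)
   (\sum_i \sum_j z i * z' j * mloc b [:: i; j] k).
  apply: nsums_sum => i; apply: nsums_sum => j; apply: nsumsZ.
  have Fa : List.Forall (fun x => same_rhoW b x.1) [:: (b, i); (b, j)] by repeat constructor.
  have := fuk_mu (b := b) (s := [:: (b, i); (b, j)]) k isT Fa.
  pose h (p : nat * nat * nat * lH2 L) : 3.-tuple nat * lH2 L :=
    ([tuple p.1.1.1; p.1.1.2; p.1.2], p.2).
  have hb : bijective h.
    exists (fun q : 3.-tuple nat * lH2 L =>
      ((tnth q.1 ord0, tnth q.1 (inord 1), tnth q.1 ord_max), q.2)).
      by move=> [[[x y] u] be]; rewrite /h /= !(tnth_nth 0%N) /= inordK.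
    move=> [[[|x [|y [|u [|? ?]]]] //= sz] be]; congr (_, _); apply/val_inj => /=.
    by rewrite !(tnth_nth 0%N) /= inordK.
  move/(nsums_bij _ _ hb); apply: nsums_ext => -[[[x y] u] be].
  rewrite /= /mterm_deformed /mterm /term2 /wt; congr (_ * mlext _ _) => /=.
  by rewrite !map_cat /= map_cat /= cats0 !map_nseq !hdelta_fun.
apply: nsums_ext H => p; rewrite /term2 mlext_slot mulr_sumr; apply: eq_bigr => i _.
rewrite -cat_cons catA mlext_slot !mulr_sumr; apply: eq_bigr => j _.
by rewrite -catA -[LHS]mulrA [RHS]mulrCA; congr (_ * _); rewrite [RHS]mulrCA.
Qed.

Hypotheses (htorus : is_torus L) (hindex : index_condition L).
Variable b : mc L.
Hypothesis b_H1 : in_H1 (mc_b b).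
Local Notation ev beta := (lev_fun (lbd L beta)).

Lemma ev_b_pos gamma : nval_gt0 (lev_fun gamma (bb b)).
Proof.
apply: nval_gt0_sum => i _; apply: nval_gt0M; first exact: nconst_ge0.
exact: mc_b_pos.
Qed.

(** Summing over the number of insertions first turns the double series into a series over beta with
    exponential weights. *)
Lemma nsums_exp (G : lH2 L -> Lam) (a : lH2 L -> Lam) S :
  nsums (fun p : nat * lH2 L => G p.2 * ((p.1)`!%:R^-1 * a p.2 ^+ p.1)) S ->
  (forall beta, nval_gt0 (a beta)) ->
  nsums (fun beta => G beta * nexp (a beta)) S.
Proof.
move=> H a0; have [G' [GE HG]] := nsums_group (fun p : nat * lH2 L => p.2) H.
apply: nsums_ext HG => be; have := nsums_inj (h := fun s : nat => (s, be)) _ _ (GE be).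
move=> /(_ (fun x y e => congr1 fst e)) H1.
have {}H1 : nsums (fun s : nat => G be * (s`!%:R^-1 * a be ^+ s)) (G' be).
  apply: nsums_ext (H1 _) => [s|[s be'] H2] /=; first by rewrite eqxx.
  by case: eqP => // e; case: (H2 s); rewrite e.
by apply: nsums_uniq H1 _; apply: nsumsZ; exact: nexp_sums.
Qed.

(** For a fixed beta and a fixed total number s of insertions of b, the sum over the position of z
    is [mlext_one], which the divisor axiom evaluates; the sum over s is then an exponential. *)
Lemma mloc1_divisor z k : H1_int z ->
  nsums (fun beta => wt b beta * nconst R (lm beta [::] k) * ev beta z * nexp (ev beta (bb b)))
    (\sum_i z i * mloc b [:: i] k).
Proof.
move=> zP; apply: nsums_exp; last by move=> be; exact: ev_b_pos.
have [G [GE HG]] := nsums_group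
  (fun p : nat * nat * lH2 L => ((p.1.1 + p.1.2)%N, p.2)) (@mu1_sums b b z k (same_rhoW_refl b)).
apply: nsums_ext HG => -[s be].
pose h (i : 'I_s.+1) : nat * nat * lH2 L := (i : nat, (s - i)%N, be).
rewrite (nsums_uniq (GE (s, be)) (nsums_finT (h := h) _ _)).
- transitivity (wt b be * mlext_one (lmf be k) (bb b) z s.+1).
    rewrite mlext_oneE mulr_sumr; apply: eq_bigr => i _.
    have le_is : (i <= s)%N by rewrite -ltnS.
    by rewrite /h /= subnKC // eqxx.
  rewrite (divisor_one htorus hindex b_H1 (mc_b_pos b)) //=.
  exact: divisor_aux4.
- by move=> i j [/val_inj].
move=> [[x y] be'] /= H; case: eqP => // -[xy bebe'].
have xs : (x < s.+1)%N by rewrite ltnS -xy leq_addr.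
by case: (H (Ordinal xs)); rewrite /h /= -xy addKn bebe'.
Qed.

(** The divisor axiom sees symmetric insertions only, so it evaluates the sum of the two orders of z
    and z' and not each of them. *)
Lemma mloc2_divisor z z' k : H1_int z -> H1_int z' ->
  nsums (fun beta => wt b beta * nconst R (lm beta [::] k) * (ev beta z * ev beta z') *
     nexp (ev beta (bb b)))
    (\sum_i \sum_j z i * z' j * mloc b [:: i; j] k +
     \sum_i \sum_j z' i * z j * mloc b [:: i; j] k).
Proof.
move=> zP zP'; apply: nsums_exp; last by move=> be; exact: ev_b_pos.
have [G [GE HG]] := nsums_group
  (fun p : nat * nat * nat * lH2 L => ((p.1.1.1 + p.1.1.2 + p.1.2)%N, p.2))
  (nsumsD (@mu2_sums b z z' k) (@mu2_sums b z' z k)).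
apply: nsums_ext HG => -[s be].
pose h (i : 'I_s.+1 * 'I_s.+1) : nat * nat * nat * lH2 L :=
  (i.1 : nat, i.2 : nat, (s - i.1 - i.2)%N, be).
rewrite (nsums_uniq (GE (s, be)) (nsums_finT (h := h) _ _)).
- transitivity (wt b be * (mlext_two (lmf be k) (bb b) z z' s.+2 +
      mlext_two (lmf be k) (bb b) z' z s.+2)).
    rewrite !mlext_twoE mulrDr !pair_bigA !mulr_sumr -big_split.
    apply: eq_bigr => -[i j] _; rewrite /h /=.
    (* The index set of [h] is a full square. When i + j exceeds s, truncated subtraction makes the
       total differ from s and the term is zero on both sides. *)
    have [ijs|ijs] := leqP (i + j) s; first by rewrite -subnDA subnKC // eqxx.
    rewrite -subnDA !mulr0 addr0; case: eqP => // -[e].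
    by have := leq_addr (s - (i + j)) (i + j); rewrite e leqNgt ijs.
  by rewrite (divisor_two htorus hindex b_H1 (mc_b_pos b)) //= divisor_aux4.
- by move=> [i j] [i' j'] [/val_inj -> /val_inj ->].
move=> [[[x y] u] be'] /= H; case: eqP => // -[xyu bebe'].
have xs : (x < s.+1)%N by rewrite ltnS -xyu -addnA leq_addr.
have ys : (y < s.+1)%N by rewrite ltnS -xyu addnAC leq_addl.
case: (H (Ordinal xs, Ordinal ys)); rewrite /h /= bebe' -xyu.
by rewrite -addnA addKn addKn.
Qed.

End DeformedSums.

(** * Derivatives of the potential *)

Lemma ratr_nconst (R : realType) (K : numFieldType) (q : rat) :
  ratr q = nconst R (ratr q : K) :> nov R K.
Proof. by rewrite /ratr nconstM nconstV !nconst_int. Qed.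

Lemma pot_aux1 (K : comNzRingType) (r p c x e : K) : r * (p * c) * x * e = p * (r * e) * x * c.
Proof. by ring. Qed.

Lemma pot_aux2 (K : fieldType) (p x u v w c : K) : u != 0 -> c != 0 -> u * v = w ->
  p * x * v = (u * c)^-1 * (p * w * x * c).
Proof. by move=> u0 c0 <-; field; rewrite u0 c0. Qed.

Lemma pot_aux3 (K : comNzRingType) (p x u v w c : K) : u * v = w ->
  p * w * x * c = u * c * (p * x * v).
Proof. by move=> <-; ring. Qed.

Lemma pot_aux4 (K : fieldType) (p x x' d u u' v w c : K) : u != 0 -> u' != 0 -> c != 0 ->
  u * u' * v = w -> p * (x * (x' - d)) * v =
  (u * u' * c)^-1 * (p * w * (x * x') * c + - d * (p * w * x * c)).
Proof. by move=> u0 u'0 c0 <-; field; rewrite u0 u'0 c0. Qed.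

Lemma pot_aux5 (K : comNzRingType) (p x x' d u u' v w c : K) : u * u' * v = w ->
  p * w * (x * x') * c = u * u' * c * (p * (x * (x' - d)) * v) + d * (p * w * x * c).
Proof. by move=> <-; ring. Qed.

Section PotentialDerivatives.
Variables (R : realType) (n : nat) (F : floer_setting R n) (l : fI F).
Local Notation Lam := (nov R R[i]).
Local Notation L := (fL l).
Local Notation T := (cb (lH L)).
Implicit Types (z : T -> Lam) (beta : lH2 L) (k : T).
Hypotheses (htorus : is_torus L) (hindex : index_condition L).
Variable b : mc L.
Hypothesis b_H1 : in_H1 (mc_b b).
Local Notation ev beta := (lev_fun (lbd L beta)).
Local Notation nb := (f_nb (l := l)).
Local Notation y := (mc_point b).
Local Notation cone k := (nconst R (cone (lH L) k) : Lam).

Lemma mc_pointE gamma : y gamma = nconst R (mc_rho b gamma) * nexp (lev_fun gamma (fun i => mc_b b i)).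
Proof. by []. Qed.

Lemma lev_fun0 z : lev_fun 0 z = 0 :> Lam.
Proof. by rewrite /lev_fun big1 // => i _; rewrite raddf0 ffunE nconst0 mul0r. Qed.

Lemma lev_funD g g' z : lev_fun (g + g' : lH1 L) z = lev_fun g z + lev_fun g' z.
Proof.
rewrite /lev_fun -big_split; apply: eq_bigr => i _ /=.
by rewrite raddfD ffunE nconstD mulrDl.
Qed.

Lemma mc_pointD g g' : y (g + g') = y g * y g'.
Proof.
rewrite !mc_pointE lev_funD nexpD; try exact: ev_b_pos.
by rewrite (mc_rho_char b).2 nconstM mulrACA.
Qed.

Lemma mc_point0 : y 0 = 1.
Proof. by rewrite mc_pointE lev_fun0 nexp0 (mc_rho_char b).1 mulr1. Qed.

Lemma mc_point_neq0 g : y g != 0.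
Proof.
apply/eqP => y0; have := mc_pointD g (- g); rewrite subrr mc_point0 y0 mul0r.
by move/eqP; rewrite oner_eq0.
Qed.

(** The unit has degree 0, so the degree formula without inputs leaves only Maslov index 2, in
    agreement with the case distinction in [pot_coef]. *)
Lemma wt_pot beta k : wt b beta * nconst R (lm beta [::] k) =
  nconst R (mc_rho b (lbd L beta)) * (pot_coef nb beta * cone k).
Proof.
rewrite /wt /pot_coef -mulrA; congr (_ * _); rewrite (f_nbE htorus hindex).
case: eqP => [_|m2]; first by rewrite nconstM -ratr_nconst mulrCA mulrA.
rewrite mul0r; have [->|] := eqVneq (ratr (nb beta) * Defs.cone (lH L) k) 0.
  by rewrite nconst0 mulr0.
rewrite -(f_nbE htorus hindex) => lmn; case: m2.
have := lm_deg lmn; rewrite big_nil /= subr0 add0r.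
move: lmn; rewrite (f_nbE htorus hindex) => lmn.
have /cone_deg -> : Defs.cone (lH L) k != 0.
  by apply: contraNneq lmn => ->; rewrite mulr0.
by move/eqP; rewrite eq_sym subr_eq0 => /eqP.
Qed.

Lemma mloc1_pot z k : H1_int z ->
  nsums (fun beta => pot_coef nb beta * y (lbd L beta) * ev beta z * cone k)
    (\sum_i z i * mloc b [:: i] k).
Proof.
move=> zP; apply: nsums_ext (mloc1_divisor htorus hindex b_H1 k zP) => be.
by rewrite wt_pot mc_pointE pot_aux1.
Qed.

Lemma mloc2_pot z z' k : H1_int z -> H1_int z' ->
  nsums (fun beta => pot_coef nb beta * y (lbd L beta) * (ev beta z * ev beta z') * cone k)
    (\sum_i \sum_j z i * z' j * mloc b [:: i; j] k +
     \sum_i \sum_j z' i * z j * mloc b [:: i; j] k).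
Proof.
move=> zP zP'; apply: nsums_ext (mloc2_divisor htorus hindex b_H1 k zP zP') => be.
by rewrite wt_pot mc_pointE pot_aux1.
Qed.

Lemma cone_neq0 (k0 : T) : exists k, cone k != 0.
Proof.
apply: contrapT => H; have := ccup1 k0 k0; rewrite eqxx big1 => [|i _].
  by move/eqP; rewrite eq_sym oner_eq0.
have [->|ci] := eqVneq (Defs.cone (lH L) i) 0; first by rewrite mul0r.
by case: H; exists i; rewrite -nconst0 (inj_eq (@nconst_inj _ _)).
Qed.

Variable e : zbasis (lH1 L) n.
Variable X : 'I_n -> T -> Lam.
Hypothesis XP : forall i, H1_int (X i).
Hypothesis evX : forall i gamma, lev_fun gamma (X i) = (zcoord e gamma i)%:~R.
Variable k0 : T.

Let m1 i k : Lam := \sum_j X i j * mloc b [:: j] k.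
Let m2 i j k : Lam := \sum_p \sum_q X i p * X j q * mloc b [:: p; q] k.

(** [d_potential] is a total sum, meaningful once its family is known to be summable. Summability is
    inherited from the series of m_1, divided by y_i and by a non-zero coefficient of the unit. *)
Lemma nsums_d_potential i : nsums (fun beta => pot_coef nb beta * (zcoord e (lbd L beta) i)%:~R *
  y (lbd L beta - e i)) (d_potential nb e y i).
Proof.
have [k1 c1] := cone_neq0 k0.
have := nsumsZ (y (e i) * cone k1)^-1 (mloc1_pot k1 (XP i)).
set S := _^-1 * _ => H.
have {}H : nsums (fun beta => pot_coef nb beta * (zcoord e (lbd L beta) i)%:~R *
  y (lbd L beta - e i)) S.
  apply: nsums_ext H => be; rewrite evX; apply/esym/pot_aux2 => //; first exact: mc_point_neq0.
  by rewrite -mc_pointD subrKC.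
by rewrite /d_potential (nsumE H).
Qed.

Lemma mloc1_d_potential i k : m1 i k = y (e i) * cone k * d_potential nb e y i.
Proof.
apply: nsums_uniq (mloc1_pot k (XP i)) _.
apply: nsums_ext (nsumsZ _ (nsums_d_potential i)) => be.
by rewrite evX; apply/esym/pot_aux3; rewrite -mc_pointD subrKC.
Qed.

Let yy i j be : y (e i) * y (e j) * y (lbd L be - e i - e j) = y (lbd L be).
Proof.
by rewrite -!mc_pointD -[lbd L be - e i - e j]addrA -opprD subrKC.
Qed.

Let d2E i j be : (zcoord e (lbd L be) i * (zcoord e (lbd L be) j - (i == j)%:R))%:~R =
  (zcoord e (lbd L be) i)%:~R * ((zcoord e (lbd L be) j)%:~R - (i == j)%:R) :> Lam.
Proof. by rewrite rmorphM rmorphB /=; case: (i == j). Qed.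

Lemma nsums_d2_potential i j : nsums (fun beta => pot_coef nb beta *
    (zcoord e (lbd L beta) i * (zcoord e (lbd L beta) j - (i == j)%:R))%:~R *
    y (lbd L beta - e i - e j)) (d2_potential nb e y i j).
Proof.
have [k1 c1] := cone_neq0 k0.
have := nsumsZ (y (e i) * y (e j) * cone k1)^-1
  (nsumsD (mloc2_pot k1 (XP i) (XP j)) (nsumsZ (- (i == j)%:R) (mloc1_pot k1 (XP i)))).
set S := _^-1 * _ => H.
have {}H : nsums (fun beta => pot_coef nb beta *
    (zcoord e (lbd L beta) i * (zcoord e (lbd L beta) j - (i == j)%:R))%:~R *
    y (lbd L beta - e i - e j)) S.
  apply: nsums_ext H => be; rewrite !evX d2E; apply/esym/pot_aux4 => //; exact: mc_point_neq0.
by rewrite /d2_potential (nsumE H).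
Qed.

(** The symmetrized m_2 is the Hessian in the coordinates log y_i. It differs from y_i y_j times the
    second derivative by a diagonal term in the first derivatives, which vanishes at a critical
    point. *)
Lemma mloc2_d2_potential i j k : m2 i j k + m2 j i k =
  y (e i) * y (e j) * cone k * d2_potential nb e y i j + (i == j)%:R * m1 i k.
Proof.
apply: nsums_uniq (mloc2_pot k (XP i) (XP j)) _.
have H := nsumsD (nsumsZ (y (e i) * y (e j) * cone k) (nsums_d2_potential i j))
  (nsumsZ (i == j)%:R (mloc1_pot k (XP i))).
by apply: nsums_ext H => be; rewrite !evX d2E; apply/esym/pot_aux5.
Qed.

Hypothesis crit : critical_point nb e y.

Lemma mloc1_critical i k : m1 i k = 0.
Proof. by rewrite mloc1_d_potential mulrAC crit mul0r. Qed.

Lemma mloc2_critical i j k : m2 i j k + m2 j i k =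
  y (e i) * y (e j) * d2_potential nb e y i j * cone k.
Proof. by rewrite mloc2_d2_potential mloc1_critical mulr0 addr0 mulrAC. Qed.

End PotentialDerivatives.

(** * The basis of H^1 dual to a basis of H_1 *)

Section DualBasis.
Variables (R : realType) (n : nat) (X : ambient R n) (L : lagrangian X).
Variable e : zbasis (lH1 L) n.
Local Notation C := R[i].
Local Notation T := (cb (lH L)).

Lemma zcoordB x y i : zcoord e (x - y) i = zcoord e x i - zcoord e y i.
Proof.
have -> : x - y = \sum_j e j *~ (zcoord e x j - zcoord e y j).
  by rewrite {1}(zbK e x) {1}(zbK e y) -sumrB; apply: eq_bigr => j _; rewrite mulrzBr.
by rewrite zcoordK.
Qed.

Lemma lev_dual_fun (phi : lH1 L -> C) : (forall x y, phi (x - y) = phi x - phi y) ->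
  exists! x : {ffun T -> C}, (forall i, x i != 0 -> cdeg i = 1%N) /\
    forall gamma, phi gamma = \sum_i lev L gamma i * x i.
Proof.
move=> phiB; pose phiA : {additive lH1 L -> C} :=
  HB.pack phi (GRing.isZmodMorphism.Build _ _ phi phiB).
exact: (lev_dual phiA).
Qed.

Lemma dual_basis : exists xd : 'I_n -> {ffun T -> C}, forall i,
  (forall j, xd i j != 0 -> cdeg j = 1%N) /\
  forall gamma, (zcoord e gamma i)%:~R = \sum_j lev L gamma j * xd i j.
Proof.
have H i : exists x : {ffun T -> C}, (forall j, x j != 0 -> cdeg j = 1%N) /\
    forall gamma, (zcoord e gamma i)%:~R = \sum_j lev L gamma j * x j.
  have [|x [xP _]] := @lev_dual_fun (fun gamma => (zcoord e gamma i)%:~R).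
    by move=> x y; rewrite zcoordB rmorphB.
  by exists x.
by exists (fun i => projT1 (cid (H i))) => i; case: cid.
Qed.

Variable xd : 'I_n -> {ffun T -> C}.
Hypothesis xdP : forall i, (forall j, xd i j != 0 -> cdeg j = 1%N) /\
  forall gamma, (zcoord e gamma i)%:~R = \sum_j lev L gamma j * xd i j.

Lemma lev_zbasis gamma i : lev L gamma i = \sum_k (zcoord e gamma k)%:~R * lev L (e k) i.
Proof.
rewrite [in LHS](zbK e gamma) raddf_sum sum_ffunE; apply: eq_bigr => k _.
by rewrite raddfMz ffunMzE mulrzl.
Qed.

(** Both sides define the same homomorphism on H_1, and a class of degree one is determined by its
    homomorphism. *)
Lemma dual_basis_expand (v : {ffun T -> C}) : (forall j, v j != 0 -> cdeg j = 1%N) ->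
  forall j, v j = \sum_k (\sum_i lev L (e k) i * v i) * xd k j.
Proof.
move=> vP j; pose v' : {ffun T -> C} := [ffun j => \sum_k (\sum_i lev L (e k) i * v i) * xd k j].
have [|x [_ xu]] := @lev_dual_fun (fun gamma => \sum_i lev L gamma i * v i).
  move=> x y; rewrite -sumrB; apply: eq_bigr => i _.
  by rewrite raddfB !ffunE mulrBl.
suff : v = v' by move=> /ffunP/(_ j); rewrite ffunE.
apply: etrans (esym (xu v _)) (xu v' _); first by split.
split=> [i|gamma].
  rewrite ffunE => v'i; apply: contrapT => i1; case/eqP: v'i; rewrite big1 // => k _.
  have [->|/(xdP k).1 //] := eqVneq (xd k i) 0; exact: mulr0.
under eq_bigr => i _ do rewrite lev_zbasis mulr_suml.
rewrite exchange_big; under [RHS]eq_bigr => i _ do rewrite ffunE mulr_sumr.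
rewrite [RHS]exchange_big; apply: eq_bigr => k _.
under eq_bigr => i _ do rewrite -mulrA.
rewrite -mulr_sumr (xdP k).2 mulr_suml; apply: eq_bigr => i _.
by rewrite -mulrA [xd k i * _]mulrC.
Qed.

End DualBasis.

(** * Leading terms and the Floer product *)

Section IntegralMultilinear.
Variables (R : realType) (K : fieldType) (I : finType).
Local Notation Lam := (nov R K).
Implicit Types (f : seq I -> Lam) (xs : seq (I -> Lam)).

Definition fint (x : I -> Lam) := forall i, nval_ge 0 (x i).
Definition fpos (x : I -> Lam) := forall i, nval_gt0 (x i).

Lemma mlext_int f xs : (forall w, nval_ge 0 (f w)) -> List.Forall fint xs ->
  nval_ge 0 (mlext f xs).
Proof.
move=> f0 xs0; elim: xs0 f f0 => {xs} [|x xs x0 _ IH] f f0; first exact: f0.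
apply: nval_ge_sum => i _; apply: nval_geMl => //; exact: IH.
Qed.

Lemma mlext_pos f xs : (forall w, nval_ge 0 (f w)) -> List.Forall fint xs ->
  List.Exists fpos xs -> nval_gt0 (mlext f xs).
Proof.
move=> f0 xs0 xsp; elim: xsp f f0 xs0 => {xs} [x xs xp|x xs _ IH] f f0 /List.Forall_cons_iff[x0 xs0].
  apply: nval_gt0_sum => i _; rewrite mulrC; apply: nval_gt0M => //.
  exact: mlext_int.
by apply: nval_gt0_sum => i _; apply: nval_gt0M => //; exact: IH.
Qed.

Lemma Forall_nseq (P : (I -> Lam) -> Prop) x s : P x -> List.Forall P (nseq s x).
Proof. by move=> Px; elim: s => [|s IH] /=; constructor. Qed.

Lemma fpos_fint x : fpos x -> fint x.
Proof. by move=> xp i; apply: nval_gt0_ge0; exact: xp. Qed.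

End IntegralMultilinear.

(** * Residues of the Floer operations *)

Section EnergyResidue.
Variables (R : realType) (n : nat) (F : floer_setting R n) (l : fI F).
Local Notation Lam := (nov R R[i]).
Local Notation L := (fL l).
Local Notation T := (cb (lH L)).
Implicit Types (beta : lH2 L) (k : T).
Local Notation lmf beta k := (fun w : seq T => nconst R (lm (l := L) beta w k) : Lam).
Local Notation bb b := (fun i => mc_b b i : Lam).

Lemma lm_energy beta (w : seq T) : lm beta w != 0 -> beta = 0 \/ 0 < lom L beta.
Proof.
move=> /lm_eff[bs -> H].
suff : forall bs : seq (lH2 L), (forall x, x \in bs -> x = 0 \/ 0 < lom L x) ->
    \sum_(x <- bs) x = 0 \/ 0 < lom L (\sum_(x <- bs) x).
  by apply=> x xbs; apply: moduli_energy (H x xbs).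
elim=> [|x s IH] sP; first by left; rewrite big_nil.
rewrite big_cons raddfD /=.
have {}IH : \sum_(x <- s) x = 0 \/ 0 < lom L (\sum_(x <- s) x).
  by apply: IH => y ys; apply: sP; rewrite inE ys orbT.
have [->|x0] := sP x (mem_head _ _); first by rewrite raddf0 !add0r.
right; case: IH => [->|s0]; first by rewrite raddf0 addr0.
by rewrite addr_gt0.
Qed.

Lemma nTarea_gt0 (a : R) : 0 < a -> nval_gt0 (nTarea a : Lam).
Proof.
move=> a0 j j0 /=; case: eqP => // ja; move: j0; rewrite ja leNgt.
by rewrite divr_gt0 // mulr_gt0 // trigo.pi_gt0.
Qed.

Lemma wt0 (b : mc L) : wt b 0 = 1.
Proof.
by rewrite /wt !raddf0 (mc_rho_char b).1 nconst1 mul1r /nTarea mul0r.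
Qed.

(** A non-zero class of non-positive energy carries no operator by [lm_energy]; otherwise the factor
    [nTarea] lies in Lambda_+. *)
Lemma term_pos (b : mc L) beta k (xs : seq (T -> Lam)) : beta != 0 ->
  List.Forall (@fint _ _ _) xs -> nval_gt0 (wt b beta * mlext (lmf beta k) xs).
Proof.
move=> b0 xs0; have [ob|ob] := ltP 0 (lom L beta); last first.
  have -> : (fun w => nconst R (lm beta w k)) = fun _ => 0 :> Lam.
    apply/funext => w; rewrite -nconst0; congr nconst.
    have [->|/lm_energy[e|]] := eqVneq (lm beta w) 0; first by rewrite ffunE.
      by rewrite e eqxx in b0.
    by rewrite ltNge ob.
  by rewrite mlext_zero mulr0.
rewrite mulrC /wt mulrA; apply: nval_gt0M; last exact: nTarea_gt0.
apply: nval_geMl; last exact: nconst_ge0.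
by apply: mlext_int => // w; exact: nconst_ge0.
Qed.

Lemma term_int (b : mc L) beta k (xs : seq (T -> Lam)) :
  List.Forall (@fint _ _ _) xs -> nval_ge 0 (wt b beta * mlext (lmf beta k) xs).
Proof.
move=> xs0; have [->|b0] := eqVneq beta 0; last exact/nval_gt0_ge0/term_pos.
by rewrite wt0 mul1r; apply: mlext_int => // w; exact: nconst_ge0.
Qed.

Lemma mc_b_fpos (b : mc L) : fpos (bb b). Proof. by move=> i; exact: mc_b_pos. Qed.
Lemma mc_b_fint (b : mc L) : fint (bb b). Proof. exact/fpos_fint/mc_b_fpos. Qed.

(** Terms with beta <> 0 have positive energy and insertions of b lie in Lambda_+, so modulo
    Lambda_+ only m_{2,0} remains. *)
Lemma mloc2_res (b : mc L) (i j k : T) :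
  nval_ge 0 (mloc b [:: i; j] k) /\
  mloc b [:: i; j] k 0 = (-1) ^+ (cdeg i * cdeg j + cdeg i) * ccup i j k.
Proof.
pose d (p : T) : T -> Lam := fun q => (q == p)%:R.
have dint p : fint (d p).
  by move=> q; rewrite /d -nconst_natr; exact: nconst_ge0.
have H := @mu2_sums R n F l b (d i) (d j) k.
have HE : \sum_i0 \sum_j0 d i i0 * d j j0 * mloc b [:: i0; j0] k = mloc b [:: i; j] k.
  rewrite (bigD1 i) //= [X in _ + X]big1 ?addr0 => [|p /negPf pi]; last first.
    by rewrite big1 // => q _; rewrite /d pi !mul0r.
  rewrite (bigD1 j) //= [X in _ + X]big1 ?addr0 => [|p /negPf pj]; last first.
    by rewrite /d pj mulr0 mul0r.
  by rewrite /d !eqxx !mul1r.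
rewrite {}HE in H.
have Fa p : List.Forall (@fint _ _ _) (nseq p.1.1.1 (bb b) ++ d i :: nseq p.1.1.2 (bb b) ++
    d j :: nseq p.1.2 (bb b)) by apply/List.Forall_app; split;
  [exact/Forall_nseq/mc_b_fint|constructor => //; apply/List.Forall_app; split;
    [exact/Forall_nseq/mc_b_fint|constructor => //; exact/Forall_nseq/mc_b_fint]].
split; first by apply: nsums_ge H _ => p; apply: term_int; exact: Fa.
rewrite (nsums_val_single (i0 := (0%N, 0%N, 0%N, 0)) (l := 0) H) => [|p p0].
  have mE : mlext (lmf 0 k) [:: d i; d j] = nconst R (lm (l := L) 0 [:: i; j] k).
    rewrite /= (bigD1 i) //= [X in _ + X]big1 ?addr0 => [|q /negPf qi]; last by rewrite /d qi mul0r.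
    rewrite (bigD1 j) //= [X in _ + X]big1 ?addr0 => [|q /negPf qj]; last by rewrite /d qj mul0r.
    by rewrite /d !eqxx !mul1r.
  by rewrite /term2 wt0 mul1r mE res_nconst lm20.
suff /nval_gt0P[] : nval_gt0 (term2 b (d i) (d j) k p) by [].
rewrite /term2; have [be0|be0] := eqVneq p.2 0; last by apply: term_pos => //; exact: Fa.
rewrite be0 wt0 mul1r; apply: mlext_pos; [by move=> w; exact: nconst_ge0|exact: Fa|].
case: p p0 be0 {Fa} => [[[x y] u] be] /= p0 be0; rewrite {}be0 in p0.
apply/List.Exists_app; case: x p0 => [|x] p0; last by left; constructor; exact: mc_b_fpos.
right; apply: List.Exists_cons_tl; apply/List.Exists_app.
case: y p0 => [|y] p0; last by left; constructor; exact: mc_b_fpos.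
right; apply: List.Exists_cons_tl.
case: u p0 => [|u] p0; last by constructor; exact: mc_b_fpos.
by rewrite eqxx in p0.
Qed.

End EnergyResidue.

Lemma mul_auxl (K : comNzRingType) (s a x y z m : K) :
  s * (a * x + y) * z * m = a * (s * x * z * m) + s * y * z * m.
Proof. by ring. Qed.

Lemma mul_auxr (K : comNzRingType) (s a x y z m : K) :
  s * z * (a * x + y) * m = a * (s * z * x * m) + s * z * y * m.
Proof. by ring. Qed.

Lemma mul_auxs (K : comNzRingType) (s t u x y m : K) :
  t * u * (s * x * y * m) = s * (t * x) * (u * y) * m.
Proof. by ring. Qed.

Lemma mul_auxu (K : comNzRingType) (s x y m : K) : x * (s * (y * m)) = s * x * y * m.
Proof. by ring. Qed.

Lemma mulA_aux1 (K : comNzRingType) (s t x y z m m' : K) :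
  s * x * (t * y * z * m) * m' = s * t * (x * y * z * (m * m')).
Proof. by ring. Qed.

Lemma mulA_aux2 (K : comNzRingType) (s t x y z m m' : K) :
  s * t * (x * y * z * (m * m')) = s * (t * x * y * m) * z * m'.
Proof. by ring. Qed.

Lemma mulA_aux3 (K : comNzRingType) (s w e a : K) : s * (w * (e * a)) = s * e * (w * a).
Proof. by ring. Qed.

Lemma mulA_aux4 (K : comNzRingType) (t x y m m' : K) :
  t * x * y * (m * m') = t * x * (y * m) * m'.
Proof. by ring. Qed.

Lemma mulA_aux5 (K : comNzRingType) (t x y m m' : K) :
  t * x * y * (m * m') = t * y * (x * m) * m'.
Proof. by ring. Qed.

(** * The product defined by m_2 on one endomorphism space *)

Section FloerProduct.
Variables (Lam : fieldType) (T : finType) (parT : T -> bool).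
Local Notation V := (T -> Lam^o).
Local Notation sh := (shpar parT).
Variables (ml : seq T -> T -> Lam) (hone : V).
Hypothesis ml_deg : forall w g, ml w g != 0 -> parT g = odd (sh w).
Hypothesis ml_nil : forall g, ml [::] g = 0.
Hypothesis ml_rel : forall w g, \sum_(t <- split3 w) \sum_h
  (-1) ^+ sh t.1.1 * ml t.1.2 h * ml (t.1.1 ++ h :: t.2) g = 0.
Hypothesis hone_even : forall k, hone k != 0 -> parT k = false.
Hypothesis hone1 : forall k, \sum_h (hone h : Lam) * ml [:: h] k = 0.
Hypothesis honel : forall j k, \sum_h (hone h : Lam) * ml [:: h; j] k = (j == k)%:R.
Hypothesis honer : forall j k,
  \sum_h (hone h : Lam) * ml [:: j; h] k = (-1) ^+ parT j * (j == k)%:R.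
Implicit Types (x y z : V) (i j k : T).

Definition hd1 x : V := fun k => \sum_i (x i : Lam) * ml [:: i] k.

Definition hmul x y : V := fun k => \sum_i \sum_j
  (-1) ^+ (parT i * parT j + parT i) * (x i : Lam) * y j * ml [:: i; j] k.

Definition hsg x : V := fun i => (-1) ^+ parT i * (x i : Lam).

Lemma hfunPE (a : Lam) x y k : (a *: x + y) k = a * (x k : Lam) + y k :> Lam.
Proof. by []. Qed.

Lemma hd1P (a : Lam) x y : hd1 (a *: x + y) = a *: hd1 x + hd1 y.
Proof.
apply/funext => k; rewrite hfunPE /hd1 mulr_sumr -big_split; apply: eq_bigr => i _.
by rewrite hfunPE mulrDl mulrA.
Qed.

Lemma hmulPl (a : Lam) x y z : hmul (a *: x + y) z = a *: hmul x z + hmul y z.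
Proof.
apply/funext => k; rewrite hfunPE /hmul mulr_sumr -big_split; apply: eq_bigr => i _.
rewrite mulr_sumr -big_split; apply: eq_bigr => j _; rewrite hfunPE /=.
exact: mul_auxl.
Qed.

Lemma hmulPr (a : Lam) x y z : hmul z (a *: x + y) = a *: hmul z x + hmul z y.
Proof.
apply/funext => k; rewrite hfunPE /hmul mulr_sumr -big_split; apply: eq_bigr => i _.
rewrite mulr_sumr -big_split; apply: eq_bigr => j _; rewrite hfunPE /=.
exact: mul_auxr.
Qed.

Lemma hsgP (a : Lam) x y : hsg (a *: x + y) = a *: hsg x + hsg y.
Proof. by apply/funext => k; rewrite /hsg !hfunPE mulrDr mulrCA. Qed.

Lemma ml_par2 i j k : ml [:: i; j] k != 0 -> parT k = parT i (+) parT j.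
Proof.
by move=> /ml_deg ->; rewrite /shpar /= addn0 oddD !oddb; case: (parT i); case: (parT j).
Qed.

Lemma ml_par1 i k : ml [:: i] k != 0 -> parT k = ~~ parT i.
Proof. by move=> /ml_deg ->; rewrite /shpar /= addn0 oddb. Qed.

Lemma hsg_mul x y : hsg (hmul x y) = hmul (hsg x) (hsg y).
Proof.
apply/funext => k; rewrite /hsg /hmul mulr_sumr; apply: eq_bigr => i _.
rewrite mulr_sumr; apply: eq_bigr => j _.
have [->|/ml_par2 ->] := eqVneq (ml [:: i; j] k) 0; first by rewrite !mulr0.
rewrite signr_addb; exact: mul_auxs.
Qed.

Lemma hsgK x : hsg (hsg x) = x.
Proof. by apply/funext => k; rewrite /hsg signrMK. Qed.

Lemma hsg_one : hsg hone = hone.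
Proof.
apply/funext => k; rewrite /hsg; case: (eqVneq (hone k) 0) => [->|h]; first exact: mulr0.
by rewrite (hone_even h) mul1r.
Qed.

Lemma hd1_one : hd1 hone = 0.
Proof. by apply/funext => k; exact: hone1. Qed.

Lemma hmul1 x : hmul hone x = x.
Proof.
apply/funext => k; rewrite /hmul exchange_big.
transitivity (\sum_j (x j : Lam) * (j == k)%:R).
  apply: eq_bigr => j _; rewrite -honel mulr_sumr; apply: eq_bigr => i _.
  case: (eqVneq (hone i) 0) => [->|h]; first by rewrite !(mulr0, mul0r).
  rewrite (hone_even h).
  by rewrite mul1r mulrCA mulrA.
rewrite (bigD1 k) //= eqxx mulr1 big1 ?addr0 // => j /negPf ->.
by rewrite mulr0.
Qed.

Lemma hmulx1 x : hmul x hone = x.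
Proof.
apply/funext => k; rewrite /hmul.
transitivity (\sum_j (x j : Lam) * (j == k)%:R).
  apply: eq_bigr => j _.
  have -> : (j == k)%:R = (-1) ^+ parT j * \sum_i hone i * ml [:: j; i] k :> Lam.
    by rewrite honer signrMK.
  rewrite !mulr_sumr; apply: eq_bigr => i _.
  case: (eqVneq (hone i) 0) => [->|h]; first by rewrite !(mulr0, mul0r).
  rewrite (hone_even h).
  by rewrite muln0 add0n; exact/esym/mul_auxu.
rewrite (bigD1 k) //= eqxx mulr1 big1 ?addr0 // => j /negPf ->.
by rewrite mulr0.
Qed.

Lemma ml_rel2 i j k : \sum_h ml [:: i; j] h * ml [:: h] k +
  \sum_h ml [:: i] h * ml [:: h; j] k +
  (-1) ^+ (~~ parT i) * \sum_h ml [:: j] h * ml [:: i; h] k = 0.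
Proof.
have Z s (X : T -> Lam) : \sum_h s * ml [::] h * X h = 0.
  by rewrite big1 // => h _; rewrite ml_nil mulr0 mul0r.
have S s (X Y : T -> Lam) : \sum_h s * X h * Y h = s * \sum_h X h * Y h.
  by rewrite mulr_sumr; apply: eq_bigr => h _; rewrite mulrA.
have := ml_rel [:: i; j] k.
rewrite !big_split3_cons big_split3_nil !big_cons !big_nil.
rewrite /= ?cats0 ?addn0 !Z !S !(expr0, mul1r, addr0, add0r) => H.
by rewrite [X in X + _]addrC.
Qed.

Lemma ml_rel3 i j p k : (forall i k, ml [:: i] k = 0) ->
  \sum_h ml [:: i; j] h * ml [:: h; p] k =
  (-1) ^+ parT i * \sum_h ml [:: j; p] h * ml [:: i; h] k.
Proof.
move=> m0.
have Z s (X : T -> Lam) : \sum_h s * ml [::] h * X h = 0.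
  by rewrite big1 // => h _; rewrite ml_nil mulr0 mul0r.
have Z1 s q (X : T -> Lam) : \sum_h s * ml [:: q] h * X h = 0.
  by rewrite big1 // => h _; rewrite m0 mulr0 mul0r.
have Z2 s (X : T -> Lam) : \sum_h s * X h * ml [:: h] k = 0.
  by rewrite big1 // => h _; rewrite m0 mulr0.
have S s (X Y : T -> Lam) : \sum_h s * X h * Y h = s * \sum_h X h * Y h.
  by rewrite mulr_sumr; apply: eq_bigr => h _; rewrite mulrA.
have := ml_rel [:: i; j; p] k.
rewrite !big_split3_cons big_split3_nil !big_cons !big_nil.
rewrite /= ?cats0 ?addn0 !Z !Z1 !Z2 !S !(expr0, mul1r, addr0, add0r) => /eqP.
by rewrite addr_eq0 => /eqP ->; rewrite -mulNr; case: (parT i); rewrite ?expr0 ?expr1 ?opprK.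
Qed.

(** The Leibniz rule, restricted to an odd left factor, for which the signs depending on x are
    constant. This suffices for products of classes in H^1. *)
Lemma hd1_odd_mul x y : (forall i, x i != 0 -> parT i) -> hd1 x = 0 -> hd1 y = 0 ->
  hd1 (hmul x y) = 0.
Proof.
move=> xo x0 y0; apply/funext => k.
pose t j : Lam := (-1) ^+ (parT j).+1.
transitivity (\sum_i \sum_j t j * (x i : Lam) * y j * \sum_h ml [:: i; j] h * ml [:: h] k).
  transitivity (\sum_h \sum_i \sum_j t j * (x i : Lam) * y j * (ml [:: i; j] h * ml [:: h] k)).
    apply: eq_bigr => h _; rewrite mulr_suml; apply: eq_bigr => i _.
    rewrite mulr_suml; apply: eq_bigr => j _.
    case: (eqVneq (x i) 0) => [->|/xo xi]; first by rewrite !(mulr0, mul0r).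
    rewrite xi mul1n addn1; exact: esym (mulrA _ _ _).
  rewrite exchange_big3; apply: eq_bigr => i _; apply: eq_bigr => j _.
  by rewrite mulr_sumr.
transitivity (\sum_i \sum_j (- (t j * (x i : Lam) * y j * \sum_h ml [:: i] h * ml [:: h; j] k) -
   t j * (x i : Lam) * y j * \sum_h ml [:: j] h * ml [:: i; h] k)).
  apply: eq_bigr => i _; apply: eq_bigr => j _.
  case: (eqVneq (x i) 0) => [->|/xo xi]; first by rewrite !(mulr0, mul0r, oppr0, addr0).
  have /eqP := ml_rel2 i j k; rewrite xi expr0 mul1r -addrA addr_eq0 => /eqP ->.
  by rewrite mulrN mulrDr opprD.
under eq_bigr => i _ do rewrite big_split sumrN.
rewrite big_split sumrN /= exchange_big [X in - X + _]big1 ?oppr0 ?add0r => [|j _].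
  rewrite big1 // => i _; rewrite sumrN.
  transitivity (- \sum_h (-1) ^+ parT h * (x i : Lam) * (hd1 y h : Lam) * ml [:: i; h] k).
    congr (- _); transitivity (\sum_j \sum_h t j * (x i : Lam) * y j * (ml [:: j] h * ml [:: i; h] k)).
      by apply: eq_bigr => j _; rewrite mulr_sumr.
    rewrite exchange_big; apply: eq_bigr => h _; rewrite mulr_sumr mulr_suml.
    apply: eq_bigr => j _; case: (eqVneq (ml [:: j] h) 0) => [->|/ml_par1 ->].
      by rewrite !(mulr0, mul0r).
    have -> : (-1) ^+ (~~ parT j) = t j by rewrite /t; case: (parT j); rewrite ?expr0 // sqrrN expr1n.
    exact: mulA_aux4.
  by rewrite y0 big1 ?oppr0 // => h _; rewrite mulr0 mul0r.
transitivity (\sum_h t j * y j * (hd1 x h : Lam) * ml [:: h; j] k).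
  transitivity (\sum_i \sum_h t j * (x i : Lam) * y j * (ml [:: i] h * ml [:: h; j] k)).
    by apply: eq_bigr => i _; rewrite mulr_sumr.
  rewrite exchange_big; apply: eq_bigr => h _; rewrite mulr_sumr mulr_suml.
  by apply: eq_bigr => i _; exact: mulA_aux5.
by rewrite x0 big1 // => h _; rewrite mulr0 mul0r.
Qed.

Lemma hd1_prod (s : seq V) : (forall x, x \in s -> (forall i, x i != 0 -> parT i) /\ hd1 x = 0) ->
  hd1 (foldr hmul hone s) = 0.
Proof.
elim: s => [|x s IH] H /=; first exact: hd1_one.
have [xo x0] := H x (mem_head _ _); apply: hd1_odd_mul => //; apply: IH => y ys.
by apply: H; rewrite inE ys orbT.
Qed.

Hypothesis ml1 : forall i k, ml [:: i] k = 0.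

Lemma hmulA x y z : hmul x (hmul y z) = hmul (hmul x y) z.
Proof.
apply/funext => k; rewrite /hmul.
transitivity (\sum_i \sum_j \sum_p (-1) ^+ (parT i * (parT j + parT p) + parT i + parT j * parT p + parT j) *
  ((x i : Lam) * y j * z p * \sum_h ml [:: j; p] h * ml [:: i; h] k)).
  apply: eq_bigr => i _.
  transitivity (\sum_h \sum_j \sum_p (-1) ^+ (parT i * (parT j + parT p) + parT i + parT j * parT p + parT j) *
    ((x i : Lam) * y j * z p * (ml [:: j; p] h * ml [:: i; h] k))).
    apply: eq_bigr => h _; rewrite mulr_sumr mulr_suml; apply: eq_bigr => j _.
    rewrite mulr_sumr mulr_suml; apply: eq_bigr => p _.
    case: (eqVneq (ml [:: j; p] h) 0) => [->|/ml_par2 e]; first by rewrite !(mulr0, mul0r).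
    rewrite (@sign_eq _ (parT i * (parT j + parT p) + parT i + parT j * parT p + parT j)
      ((parT i * parT h + parT i) + (parT j * parT p + parT j))); last first.
      by rewrite e !(oddD, oddM) !oddb; case: (parT i); case: (parT j); case: (parT p).
    by rewrite [X in _ = X * _]exprD; exact: mulA_aux1.
  rewrite exchange_big3; apply: eq_bigr => j _; apply: eq_bigr => p _.
  by rewrite -!mulr_sumr.
transitivity (\sum_i \sum_j \sum_p (-1) ^+ (parT i * parT j + parT i + (parT i + parT j) * parT p + (parT i + parT j)) *
  ((x i : Lam) * y j * z p * \sum_h ml [:: i; j] h * ml [:: h; p] k)).
  apply: eq_bigr => i _; apply: eq_bigr => j _; apply: eq_bigr => p _.
  rewrite (ml_rel3 _ _ _ _ ml1) mulA_aux3 -exprD; congr (_ * _); apply: sign_eq.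
  rewrite !(oddD, oddM) !oddb.
  by case: (parT i); case: (parT j); case: (parT p).
transitivity (\sum_h \sum_p \sum_i \sum_j (-1) ^+ (parT i * parT j + parT i + (parT i + parT j) * parT p + (parT i + parT j)) *
  ((x i : Lam) * y j * z p * (ml [:: i; j] h * ml [:: h; p] k))); last first.
  apply: eq_bigr => h _; apply: eq_bigr => p _; rewrite mulr_sumr !mulr_suml; apply: eq_bigr => i _.
  rewrite mulr_sumr !mulr_suml; apply: eq_bigr => j _.
  case: (eqVneq (ml [:: i; j] h) 0) => [->|/ml_par2 e]; first by rewrite !(mulr0, mul0r).
  rewrite (@sign_eq _ (parT i * parT j + parT i + (parT i + parT j) * parT p + (parT i + parT j))
      ((parT h * parT p + parT h) + (parT i * parT j + parT i))); last first.
    by rewrite e !(oddD, oddM) !oddb; case: (parT i); case: (parT j); case: (parT p).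
  by rewrite [X in X * _ = _]exprD; exact: mulA_aux2.
under [RHS]eq_bigr => h _ do rewrite exchange_big3.
rewrite [RHS]exchange_big; apply: eq_bigr => i _; rewrite [RHS]exchange_big.
apply: eq_bigr => j _; rewrite [RHS]exchange_big; apply: eq_bigr => p _.
by rewrite -!mulr_sumr.
Qed.

End FloerProduct.

Lemma mulA_aux6 (K : comNzRingType) (s t x y c : K) : s * x * y * (t * c) = s * t * (x * y * c).
Proof. by ring. Qed.

(** * Floer monomials as a basis of the torus algebra *)

Section TorusBasis.
Variables (R : realType) (n : nat) (F : floer_setting R n) (l : fI F).
Local Notation C := R[i].
Local Notation Lam := (nov R R[i]).
Local Notation L := (fL l).
Local Notation T := (cb (lH L)).
Local Notation V := (T -> Lam^o).
Local Notation parT := (@cpar R n (lH L)).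
Implicit Types (x y : V).

Definition lone : V := fun k => nconst R (cone (lH L) k).

Section UnitFacts.
Variable b : mc L.
Local Notation ml := (mloc b).

Lemma lone_even k : lone k != 0 -> parT k = false.
Proof.
rewrite /lone => ck; rewrite /cpar cone_deg //.
by apply: contraNneq ck => ->; rewrite nconst0.
Qed.

Lemma sum_hunit (X : gen (fuk F) -> Lam) :
  \sum_(h \in [set: gen (fuk F)]) hunit (obj b) h * X h = \sum_i lone i * X (fgen b b i).
Proof.
rewrite (sumG (b := b)) => [|h]; first by apply: eq_bigr => i _; rewrite fuk_unit.
case: (eqVneq (hunit (obj b) h) 0) => [->|hh _]; first by rewrite mul0r eqxx.
exact: hunit_hom hh.
Qed.

Lemma fgen_eqE i j : (fgen b b i == fgen b b j) = (i == j).
Proof. exact/inj_eq/fgen_inj. Qed.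

Lemma lone1 k : \sum_h (lone h : Lam) * ml [:: h] k = 0.
Proof. by have := mu_unit1 (c := fuk F) (obj b) (fgen b b k); rewrite sum_hunit. Qed.

Lemma lonel j k : \sum_h (lone h : Lam) * ml [:: h; j] k = (j == k)%:R.
Proof.
have := mu_unitl (c := fuk F) (fgen b b j) (fgen b b k).
by rewrite fgen_src sum_hunit fgen_eqE.
Qed.

Lemma loner j k : \sum_h (lone h : Lam) * ml [:: j; h] k = (-1) ^+ parT j * (j == k)%:R.
Proof.
have := mu_unitr (c := fuk F) (fgen b b j) (fgen b b k).
by rewrite fgen_tgt sum_hunit fgen_eqE par_fgen.
Qed.

End UnitFacts.

Variable b : mc L.
Local Notation ml := (mloc b).
Local Notation mulb := (hmul parT ml).

Lemma lone_fint : fint lone.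
Proof. by move=> k; exact: nconst_ge0. Qed.

Lemma hmul_res x y : fint x -> fint y ->
  fint (mulb x y) /\ forall k, (mulb x y k : Lam) 0 =
    \sum_i \sum_j (x i : Lam) 0 * (y j : Lam) 0 * ccup i j k.
Proof.
move=> x0 y0.
have si (s : nat) : nval_ge 0 ((-1) ^+ s : Lam) by rewrite -nconst_sign; exact: nconst_ge0.
have i0 i j k : nval_ge 0 ((-1) ^+ (parT i * parT j + parT i) * (x i : Lam) * y j * ml [:: i; j] k).
  by do ?apply: nval_geMl => //; exact: (mloc2_res b i j k).1.
split=> [k|k]; first by apply: nval_ge_sum => i _; apply: nval_ge_sum => j _.
rewrite /hmul nov_sumE; apply: eq_bigr => i _; rewrite nov_sumE; apply: eq_bigr => j _.
have [m0 mE] := mloc2_res b i j k.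
rewrite res_mul //; last by do ?apply: nval_geMl.
rewrite res_mul //; last by do ?apply: nval_geMl.
rewrite res_mul // mE -nconst_sign res_nconst.
rewrite mulA_aux6 -exprD (@sign_eq _ _ 0) ?mul1r //.
by rewrite !(oddD, oddM) !oddb /cpar; case: (odd (cdeg i)); case: (odd (cdeg j)).
Qed.

Variable v : 'I_n -> {ffun T -> C}.
Hypothesis v_deg : forall j i, v j i != 0 -> cdeg i = 1%N.
Hypothesis v_basis : forall w : {ffun T -> C}, exists! c : {ffun {set 'I_n} -> C},
  forall i, w i = \sum_(J : {set 'I_n}) c J * cupprod [seq v j | j <- enum J] i.

Definition lvec (j : 'I_n) : V := fun i => nconst R (v j i).

Local Notation vJ := (vset mulb lone lvec).

Lemma lvec_fint j : fint (lvec j).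
Proof. by move=> k; exact: nconst_ge0. Qed.

Lemma vprod_res (s : seq 'I_n) : fint (vprod mulb lone lvec s) /\
  forall k, (vprod mulb lone lvec s k : Lam) 0 = cupprod [seq v j | j <- s] k.
Proof.
elim: s => [|j s [IH1 IH2]] /=.
  by split; [exact: lone_fint|move=> k; exact: res_nconst].
have [H1 H2] := hmul_res (lvec_fint j) IH1; split=> // k.
rewrite H2 ffunE; apply: eq_bigr => i _; apply: eq_bigr => p _.
by rewrite IH2; congr (_ * _ * _); exact: res_nconst.
Qed.

Lemma cup_indep (c : {set 'I_n} -> C) :
  (forall i, \sum_J c J * cupprod [seq v j | j <- enum J] i = 0) -> forall J, c J = 0.
Proof.
move=> H J; have [c0 [_ cu]] := v_basis 0.
have e1 := cu [ffun J => c J]; have e2 := cu [ffun=> 0].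
have : [ffun J => c J] = [ffun=> 0].
  apply: etrans (esym (e1 _)) (e2 _) => i; rewrite ffunE.
    by rewrite -[LHS](H i); apply: eq_bigr => J' _; rewrite ffunE.
  by rewrite big1 // => J' _; rewrite ffunE mul0r.
by move=> /ffunP/(_ J); rewrite !ffunE.
Qed.

(** A relation, scaled to be integral with a non-zero residue, reduces to a relation between the cup
    products of the [v j], which [v_basis] excludes. *)
Lemma vset_indep (u : {set 'I_n} -> Lam) :
  (forall i, \sum_J u J * vJ J i = 0) -> forall J, u J = 0.
Proof.
move=> H; apply: contrapT => /existsNP[J0 uJ0].
have [|a [u' [uE u'0 [J1 u'1]]]] := @nov_factor R C _ u; first by exists J0; apply/eqP.
case/eqP: u'1; apply: (@cup_indep (fun J => u' J 0)) => i.
have S0 : \sum_J u' J * vJ J i = 0 :> Lam.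
  apply: (mulfI (@nT_neq0 R C a)); rewrite mulr0 -[RHS](H i) mulr_sumr.
  by apply: eq_bigr => J _; rewrite uE mulrA.
have := congr1 (fun f : Lam => f 0) S0; rewrite nov_sumE => S1; rewrite -[RHS]S1.
apply: eq_bigr => J _; have [vi vr] := vprod_res (enum J).
by rewrite res_mul; [congr (_ * _); exact/esym/vr|exact: u'0|exact: vi].
Qed.

Lemma card_torus : #|{set 'I_n}| = #|T|.
Proof.
apply: (fin_card (A := fun J i => cupprod [seq v j | j <- enum (J : {set 'I_n})] i)).
  exact: cup_indep.
move=> w; have [c [cE _]] := v_basis [ffun i => w i].
by exists c => i; rewrite -cE ffunE.
Qed.

Lemma vset_span (x : V) : exists u : {set 'I_n} -> Lam, forall i, \sum_J u J * vJ J i = x i.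
Proof.
by apply: (fin_surj (A := fun J i => vJ J i : Lam)); [exact: card_torus|exact: vset_indep].
Qed.

Definition vco (J : {set 'I_n}) (x : V) : Lam := projT1 (cid (vset_span x)) J.

Lemma vco_uniq (x : V) (u : {set 'I_n} -> Lam) :
  (forall i, \sum_J u J * vJ J i = x i) -> forall J, vco J x = u J.
Proof.
move=> H J; apply/eqP; rewrite -subr_eq0; apply/eqP.
apply: (@vset_indep (fun J => vco J x - u J)) => i.
under eq_bigr => J' _ do rewrite mulrBl.
rewrite sumrB H /vco; case: cid => u' /= ->; exact: subrr.
Qed.

Lemma vcoE (x : V) i : \sum_J vco J x * vJ J i = x i.
Proof. by rewrite /vco; case: cid. Qed.

Lemma vcoP J (a : Lam) x y : vco J (a *: x + y) = a * vco J x + vco J y.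
Proof.
apply: (vco_uniq (u := fun J => a * vco J x + vco J y)) => i.
transitivity (a * (\sum_J vco J x * vJ J i) + \sum_J vco J y * vJ J i); last by rewrite !vcoE.
by rewrite mulr_sumr -big_split; apply: eq_bigr => J' _; rewrite mulrDl mulrA.
Qed.

Lemma vco_vset J J' : vco J (vJ J') = (J == J')%:R.
Proof.
apply: (vco_uniq (u := fun J => (J == J')%:R)) => i.
rewrite (bigD1 J') //= eqxx mul1r big1 ?addr0 // => J1 /negPf ->.
by rewrite mul0r.
Qed.

Lemma vco_sum (x : V) : x = \sum_J vco J x *: vJ J.
Proof.
apply/funext => i; rewrite -[LHS]vcoE.
by elim/big_rec2 : _ => // J y1 y2 _ ->.
Qed.

Lemma lvec_odd j i : lvec j i != 0 -> parT i.
Proof.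
move=> vi; rewrite /cpar (v_deg (j := j)) //.
by apply: contraNneq vi => e; rewrite /lvec e nconst0.
Qed.

Lemma hsg_lvec j : hsg parT (lvec j) = - lvec j.
Proof.
apply/funext => i; rewrite /hsg -[RHS]mulN1r.
case: (eqVneq (lvec j i) 0) => [->|/lvec_odd ->]; first by rewrite !mulr0.
by rewrite expr1.
Qed.

Hypothesis closed : forall j k, \sum_i (lvec j i : Lam) * ml [:: i] k = 0.

(** Products of the closed odd classes [lvec j] are closed by the Leibniz rule, and they span, so
    the whole differential vanishes. *)
Lemma mloc1_eq0 i k : ml [:: i] k = 0.
Proof.
have H J : hd1 ml (vJ J) = 0.
  rewrite /vset /vprod -(foldr_map lvec mulb) .
  apply: (hd1_prod (@mloc_deg _ _ _ _ b) (@mloc_nil _ _ _ _ b) (@mloc_rel _ _ _ _ b) (@lone1 b)).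
  move=> x /mapP[j _ ->]; split; first by move=> p; exact: lvec_odd.
  by apply/funext => p; exact: closed.
pose d : V := fun j => (j == i)%:R.
have : hd1 ml d = 0.
  have h0 : hd1 ml 0 = 0 by apply/funext => p; rewrite /hd1 big1 // => q _; exact: mul0r.
  rewrite (vco_sum d); elim: (index_enum _) => [|J s IH]; first by rewrite big_nil h0.
  by rewrite big_cons hd1P H IH scaler0 addr0.
move=> /(congr1 (fun x : V => x k)); rewrite /hd1 (bigD1 i) //= /d eqxx mul1r big1 ?addr0 //.
by move=> j /negPf ->; rewrite mul0r.
Qed.

End TorusBasis.

(** * The Clifford algebra of a non-degenerate critical point *)

Lemma mulA_aux7 (K : comNzRingType) (a x c y m : K) : a * x * (c * y) * m = a * c * (x * y * m).
Proof. by ring. Qed.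

Lemma mulA_aux8 (K : comNzRingType) (a c h o : K) : a * c * (h * o) = a * h * c * o.
Proof. by ring. Qed.

Lemma sum_sym_aux (K : comNzRingType) n (a b : 'I_n -> K) (M : 'I_n -> 'I_n -> K) :
  \sum_r \sum_s a r * b s * M r s + \sum_r \sum_s b r * a s * M r s =
  \sum_r \sum_s a r * b s * (M r s + M s r).
Proof.
rewrite [X in _ + X]exchange_big -big_split; apply: eq_bigr => r _.
by rewrite -big_split; apply: eq_bigr => s _ /=; rewrite [b s * _]mulrC -mulrDr.
Qed.

Lemma congr_mx_aux (K : comNzRingType) n (A B : 'M[K]_n) i j (o : K) :
  \sum_r \sum_s A i r * A j s * (B r s * o) = (A *m B *m A^T) i j * o.
Proof.
rewrite mxE mulr_suml exchange_big; apply: eq_bigr => s _.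
rewrite !mxE !mulr_suml; apply: eq_bigr => r _; exact: mulA_aux8.
Qed.

Section CriticalClifford.
Variables (R : realType) (n : nat) (F : floer_setting R n) (l : fI F).
Local Notation C := R[i].
Local Notation Lam := (nov R R[i]).
Local Notation L := (fL l).
Local Notation T := (cb (lH L)).
Local Notation V := (T -> Lam^o).
Local Notation parT := (@cpar R n (lH L)).
Implicit Types (x y : V).
Hypotheses (htorus : is_torus L) (hindex : index_condition L).
Variable e : zbasis (lH1 L) n.
Variable v : 'I_n -> {ffun T -> C}.
Hypothesis v_deg : forall j i, v j i != 0 -> cdeg i = 1%N.
Hypothesis v_basis : forall w : {ffun T -> C}, exists! c : {ffun {set 'I_n} -> C},
  forall i, w i = \sum_(J : {set 'I_n}) c J * cupprod [seq v j | j <- enum J] i.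

Lemma cupprod1 j i : cupprod [:: v j] i = v j i.
Proof.
rewrite /= ffunE (bigD1 i) //= [X in _ + X]big1 ?addr0 => [|p /negPf pi].
  have H : \sum_q cone (lH L) q * ccup i q i = 1.
    transitivity ((i == i)%:R : C); last by rewrite eqxx.
    rewrite -(ccup1 i i); apply: eq_bigr => q _.
    have [->|/cone_deg d] := eqVneq (cone (lH L) q) 0; first by rewrite !mul0r.
    by rewrite ccupC d muln0 mul1r.
  by under eq_bigr => q _ do rewrite -mulrA; rewrite -mulr_sumr H mulr1.
under eq_bigr => q _ do rewrite -mulrA.
rewrite -mulr_sumr; have H : \sum_q cone (lH L) q * ccup p q i = 0.
  transitivity ((p == i)%:R : C); last by rewrite pi.
  rewrite -(ccup1 p i); apply: eq_bigr => q _.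
  have [->|/cone_deg d] := eqVneq (cone (lH L) q) 0; first by rewrite !mul0r.
  by rewrite ccupC d muln0 mul1r.
by rewrite H mulr0.
Qed.

Lemma v_indep (u : 'I_n -> C) : (forall i, \sum_j u j * v j i = 0) -> forall j, u j = 0.
Proof.
move=> H j; pose c (J : {set 'I_n}) : C := \sum_(j | J == finset.set1 j) u j.
have cE j' : c (finset.set1 j') = u j'.
  rewrite /c (bigD1 j') //= big1 ?addr0 // => p /andP[/eqP/finset.set1_inj ->].
  by rewrite eqxx.
rewrite -cE; apply: (cup_indep v_basis) => i; rewrite -[RHS](H i).
transitivity (\sum_(J : {set 'I_n}) \sum_(j | J == finset.set1 j) u j * v j i).
  apply: eq_bigr => J _; rewrite mulr_suml; apply: eq_bigr => p /eqP ->.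
  by rewrite enum_set1 -cupprod1.
rewrite (exchange_big_dep xpredT) //=; apply: eq_bigr => p _.
by rewrite (eq_bigl (pred1 (finset.set1 p))) ?big_pred1_eq // => J; rewrite /= eq_sym.
Qed.

Variable xd : 'I_n -> {ffun T -> C}.
Hypothesis xdP : forall i, (forall j, xd i j != 0 -> cdeg j = 1%N) /\
  forall gamma, (zcoord e gamma i)%:~R = \sum_j lev L gamma j * xd i j.

(** Transition between two bases of H^1: [v], whose cup products form a basis of the cohomology, and
    [xd], dual to e, in which the derivatives of the potential are computed. *)
Definition trM : 'M[C]_n := \matrix_(j, k) \sum_i lev L (e k) i * v j i.

Lemma v_expand j i : v j i = \sum_k trM j k * xd k i.
Proof.
rewrite (dual_basis_expand xdP (v_deg (j := j))); apply: eq_bigr => k _.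
by rewrite mxE.
Qed.

Lemma trM_unit : trM \in unitmx.
Proof.
rewrite -row_free_unit; apply: inj_row_free => u uM; apply/rowP => j; rewrite mxE.
apply: (v_indep (u := fun j => u 0 j)) => i.
under eq_bigr => k _ do rewrite v_expand mulr_sumr.
rewrite exchange_big big1 // => k _.
transitivity ((u *m trM) 0 k * xd k i); last by rewrite uM mxE mul0r.
by rewrite mxE mulr_suml; apply: eq_bigr => p _; rewrite mulrA.
Qed.

Definition xL (k : 'I_n) : V := fun i => nconst R (xd k i).

Lemma xL_int k : H1_int (xL k).
Proof.
move=> i; split; last exact: nconst_ge0.
move=> xi; apply: (xdP k).1; apply: contraNneq xi => e0.
by rewrite /xL e0 nconst0.
Qed.

Lemma ev_xL i gamma : lev_fun gamma (xL i) = (zcoord e gamma i)%:~R.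
Proof.
rewrite -nconst_int (xdP i).2 nconst_sum; apply: eq_bigr => j _.
by rewrite nconstM.
Qed.

Definition trL : 'M[Lam]_n := map_mx (fun c : C => nconst R c : Lam) trM.

Lemma trL_unit : trL \in unitmx.
Proof.
have : trL *m map_mx (fun c : C => nconst R c : Lam) (invmx trM) = 1%:M.
  have -> : 1%:M = map_mx (fun c : C => nconst R c : Lam) (1%:M : 'M_n).
    by apply/matrixP => i j; rewrite !mxE; case: eqP => _; rewrite ?nconst0.
  rewrite -(mulmxV trM_unit); apply/matrixP => i j; rewrite !mxE nconst_sum.
  by apply: eq_bigr => k _; rewrite !mxE nconstM.
by move/mulmx1_unit => [].
Qed.

Lemma lvec_expand j i : lvec v j i = \sum_k trL j k * xL k i :> Lam.
Proof.
rewrite /lvec v_expand nconst_sum; apply: eq_bigr => k _.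
by rewrite [trL j k]mxE nconstM.
Qed.

Variable b : mc L.
Hypothesis hb : nondeg_critical (f_nb (l := l)) e b.
Local Notation ml := (mloc b).
Local Notation mulb := (hmul parT ml).
Local Notation y := (mc_point b).
Local Notation nb := (f_nb (l := l)).

Lemma crit_closed j k : \sum_i (lvec v j i : Lam) * ml [:: i] k = 0.
Proof.
have [b1 bc _] := hb; under eq_bigr => i _ do rewrite lvec_expand mulr_suml.
rewrite exchange_big big1 // => p _.
transitivity (trL j p * \sum_i xL p i * ml [:: i] k).
  by rewrite mulr_sumr; apply: eq_bigr => i _; rewrite mulrA.
by rewrite (mloc1_critical htorus hindex b1 xL_int ev_xL k bc) mulr0.
Qed.

Definition hessL : 'M[Lam]_n := \matrix_(i, j) (y (e i) * y (e j) * d2_potential nb e y i j).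

Definition critQ : 'M[Lam]_n := trL *m hessL *m trL^T.

Lemma critQ_unit : critQ \in unitmx.
Proof.
have [_ _ hd] := hb; rewrite !unitmx_mul unitmx_tr trL_unit andbT /= unitmxE.
by rewrite unitfE.
Qed.

Lemma lvec_mulE i j k : mulb (lvec v i) (lvec v j) k =
  \sum_p \sum_q (lvec v i p : Lam) * lvec v j q * ml [:: p; q] k.
Proof.
apply: eq_bigr => p _; apply: eq_bigr => q _.
case: (eqVneq (lvec v i p) 0) => [->|/(lvec_odd v_deg) ep]; first by rewrite !(mulr0, mul0r).
case: (eqVneq (lvec v j q) 0) => [->|/(lvec_odd v_deg) eq]; first by rewrite !(mulr0, mul0r).
by rewrite ep eq sqrrN expr1n mul1r.
Qed.

Lemma lvec_raw i j k : \sum_p \sum_q (lvec v i p : Lam) * lvec v j q * ml [:: p; q] k =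
  \sum_r \sum_s trL i r * trL j s * \sum_p \sum_q (xL r p : Lam) * xL s q * ml [:: p; q] k.
Proof.
transitivity (\sum_p \sum_q \sum_r \sum_s trL i r * trL j s * ((xL r p : Lam) * xL s q * ml [:: p; q] k)).
  apply: eq_bigr => p _; apply: eq_bigr => q _; rewrite !lvec_expand !mulr_suml.
  apply: eq_bigr => r _; rewrite mulr_sumr mulr_suml; apply: eq_bigr => s _.
  exact: mulA_aux7.
under eq_bigr => p _ do rewrite exchange_big.
rewrite exchange_big; apply: eq_bigr => r _.
under eq_bigr => p _ do rewrite exchange_big.
rewrite exchange_big; apply: eq_bigr => s _.
by rewrite mulr_sumr; apply: eq_bigr => p _; rewrite mulr_sumr.
Qed.

Lemma crit_clifford i j : mulb (lvec v i) (lvec v j) + mulb (lvec v j) (lvec v i) =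
  critQ i j *: (@lone _ _ _ l : V).
Proof.
have [b1 bc _] := hb; apply/funext => k.
change (mulb (lvec v i) (lvec v j) k + mulb (lvec v j) (lvec v i) k =
  critQ i j * @lone _ _ _ l k :> Lam).
rewrite (lvec_mulE i j k) (lvec_mulE j i k) (lvec_raw i j k) (lvec_raw j i k).
transitivity (\sum_r \sum_s trL i r * trL j s *
    (\sum_p \sum_q (xL r p : Lam) * xL s q * ml [:: p; q] k +
     \sum_p \sum_q (xL s p : Lam) * xL r q * ml [:: p; q] k)).
  exact: (sum_sym_aux (trL i) (trL j)).
transitivity (\sum_r \sum_s trL i r * trL j s * (hessL r s * @lone _ _ _ l k)).
  apply: eq_bigr => r _; apply: eq_bigr => s _; congr (_ * _).
  by rewrite (mloc2_critical htorus hindex b1 xL_int ev_xL k bc r s) mxE.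
exact: congr_mx_aux.
Qed.

End CriticalClifford.

Section CliffordInstance.
Variables (R : realType) (n : nat) (F : floer_setting R n) (l : fI F).
Local Notation C := R[i].
Local Notation Lam := (nov R R[i]).
Local Notation L := (fL l).
Local Notation T := (cb (lH L)).
Local Notation V := (T -> Lam^o).
Local Notation parT := (@cpar R n (lH L)).
Implicit Types (x y : V).
Hypotheses (htorus : is_torus L) (hindex : index_condition L).
Variable e : zbasis (lH1 L) n.
Variable v : 'I_n -> {ffun T -> C}.
Hypothesis v_deg : forall j i, v j i != 0 -> cdeg i = 1%N.
Hypothesis v_basis : forall w : {ffun T -> C}, exists! c : {ffun {set 'I_n} -> C},
  forall i, w i = \sum_(J : {set 'I_n}) c J * cupprod [seq v j | j <- enum J] i.
Variable xd : 'I_n -> {ffun T -> C}.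
Hypothesis xdP : forall i, (forall j, xd i j != 0 -> cdeg j = 1%N) /\
  forall gamma, (zcoord e gamma i)%:~R = \sum_j lev L gamma j * xd i j.
Variable b : mc L.
Hypothesis hb : nondeg_critical (f_nb (l := l)) e b.
Local Notation ml := (mloc b).
Local Notation mulb := (hmul parT ml).
Local Notation one := (@lone _ _ _ l : V).
Local Notation sg := (hsg parT : V -> V).
Local Notation cQ := (critQ e v b).
Local Notation vJ := (vset mulb one (lvec v)).
Local Notation co := (vco b v_basis).

Lemma crit_m1 i k : ml [:: i] k = 0.
Proof. exact: (mloc1_eq0 v_deg v_basis (crit_closed htorus hindex v_deg xdP hb)). Qed.

Lemma fprodA x y z : mulb x (mulb y z) = mulb (mulb x y) z.
Proof. exact: (hmulA (@mloc_deg _ _ _ _ b) (@mloc_nil _ _ _ _ b) (@mloc_rel _ _ _ _ b) crit_m1). Qed.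

Lemma fprod1 x : mulb one x = x.
Proof. exact: (hmul1 (@lone_even _ _ _ _) (@lonel _ _ _ _ b)). Qed.

Lemma fprodx1 x : mulb x one = x.
Proof. exact: (hmulx1 (@lone_even _ _ _ _) (@loner _ _ _ _ b)). Qed.

Lemma fsg_mul x y : sg (mulb x y) = mulb (sg x) (sg y).
Proof. exact: (hsg_mul (@mloc_deg _ _ _ _ b)). Qed.

Lemma fsg_one : sg one = one.
Proof. exact: (hsg_one (@lone_even _ _ _ _)). Qed.

Definition vuL (i : 'I_n) : V := \sum_p (invmx cQ) i p *: lvec v p.

Let mulbPl a x y z : mulb (a *: x + y) z = a *: mulb x z + mulb y z.
Proof. exact: hmulPl. Qed.
Let mulbPr a x y z : mulb z (a *: x + y) = a *: mulb z x + mulb z y.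
Proof. exact: hmulPr. Qed.
Let sgP a x y : sg (a *: x + y) = a *: sg x + sg y.
Proof. exact: hsgP. Qed.

Lemma sum_lin (I : finType) (f : V -> V) (a : I -> Lam) (w : I -> V) :
  (forall a x y, f (a *: x + y) = a *: f x + f y) ->
  f (\sum_i a i *: w i) = \sum_i a i *: f (w i).
Proof.
move=> fP; rewrite (big_morph f (linD fP) (lin0 fP)); apply: eq_bigr => i _.
exact: linZ.
Qed.

Lemma sg_vuL i : sg (vuL i) = - vuL i.
Proof.
rewrite /vuL (sum_lin _ _ sgP) -sumrN; apply: eq_bigr => p _.
by rewrite (hsg_lvec v_deg) scalerN.
Qed.

Lemma vuL_odd i k : vuL i k != 0 -> parT k.
Proof.
move=> h; apply: contraNT h => pk; apply/eqP.
have := congr1 (fun x : V => x k) (sg_vuL i); rewrite /hsg (negPf pk) mul1r => H.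
have : vuL i k *+ 2 = 0 :> Lam by rewrite mulr2n [X in X + _ = _]H; exact: addNr.
by move/eqP; rewrite -mulr_natr mulf_eq0 => /orP[/eqP//|]; rewrite (negPf (nov_natr_neq0 _ _ _)).
Qed.

Lemma vuL_v i j : mulb (vuL i) (lvec v j) + mulb (lvec v j) (vuL i) = (i == j)%:R *: one.
Proof.
rewrite /vuL (sum_lin _ _ (fun a x y => mulbPl a x y _)) (sum_lin _ _ (fun a x y => mulbPr a x y _)).
rewrite -big_split /=.
transitivity (\sum_p (invmx cQ i p * cQ p j) *: one).
  apply: eq_bigr => p _; rewrite -scalerDr.
  by rewrite (crit_clifford htorus hindex v_deg xdP hb) scalerA.
have := mulVmx (critQ_unit v_deg v_basis xdP hb).
move=> /matrixP/(_ i j); rewrite !mxE => QE.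
by rewrite -scaler_suml QE.
Qed.

Lemma crit_supercentral x : (forall i, mulb (vuL i) x = mulb (sg x) (vuL i)) ->
  exists a : Lam, x = a *: one.
Proof.
move=> H; exists (co finset.set0 x).
by apply: (supercentral_scalar mulbPl mulbPr fprodA fprod1 fprodx1 sgP fsg_mul fsg_one
  (hsg_lvec v_deg) vuL_v (@vcoP _ _ _ _ b v v_basis) (@vco_vset _ _ _ _ b v v_basis)
  (@vco_sum _ _ _ _ b v v_basis)).
Qed.

Lemma crit_supertrace : exists (p : bool) (a c : V),
  [/\ sg a = (-1) ^+ p *: a, sg c = (-1) ^+ p *: c &
   \sum_(J : {set 'I_n}) (-1) ^+ #|J| * co J ((-1) ^+ (p * #|J|) *: (mulb (mulb a (vJ J)) c)) != 0].
Proof.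
apply: contrapT => H.
apply: (supertrace_neq0 mulbPl mulbPr fprodA fprod1 fprodx1 sgP fsg_mul fsg_one
  (hsg_lvec v_deg) sg_vuL vuL_v (@vcoP _ _ _ _ b v v_basis) (@vco_vset _ _ _ _ b v v_basis)) => p a c sa sc.
by apply/eqP/negPn/negP => h; apply: H; exists p, a, c.
Qed.

End CliffordInstance.

(** * The character of a critical point *)

Lemma central_aux1 (K : comNzRingType) (x f m m' : K) :
  - 1 * x * f * m - f * x * m' = - 1 * x * (f * (m' + m)).
Proof. by ring. Qed.

Lemma central_aux2 (K : comNzRingType) (x f m m' : K) :
  x * f * m - (- 1 * f) * x * m' = x * (f * (m' + m)).
Proof. by ring. Qed.

Section LengthZero.
Variables (R : realType) (n : nat) (F : floer_setting R n) (l : fI F).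
Local Notation Lam := (nov R R[i]).
Local Notation L := (fL l).
Local Notation T := (cb (lH L)).
Local Notation V := (T -> Lam^o).
Local Notation parT := (@cpar R n (lH L)).
Variable b : mc L.
Local Notation P := (obj b).
Local Notation ml := (mloc b).
Local Notation mulb := (hmul parT ml).
Local Notation sg := (hsg parT : V -> V).
Hypothesis m1 : forall i k, ml [:: i] k = 0.
Implicit Types (phi psi : cochain (fuk F)).

Definition phi0 phi : V := cloc b phi [::].

Lemma mu1_eq0 x g : hvec P P x -> mu1 (A := fuk F) x g = 0.
Proof.
move=> xP; rewrite /mu1 (sumG (b := b)) => [|h].
  apply: big1 => i _; have [->|h] := eqVneq (mu [:: fgen b b i] g) 0; first by rewrite mulr0.
  have [k gk] := fgen_surj (@mu_out _ _ _ _ b [:: i] _ h).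
  by rewrite gk [mu _ _](m1 i k) mulr0.
case: (eqVneq (x h) 0) => [->|/xP //]; by rewrite mul0r eqxx.
Qed.

Lemma split3_nil : split3 [::] = [:: ([::], [::], [::])] :> seq (seq T * seq T * seq T).
Proof. by []. Qed.

Lemma cobdT_nil eta g : cobdT parT ml eta [::] g = 0.
Proof.
rewrite /cobdT split3_nil big_seq1 big1 // => h _ /=.
by rewrite m1 mloc_nil !(mulr0, mul0r) subrr.
Qed.

(** As m has no component of length 0 or 1, a coboundary has no length zero part, so this part
    depends on the Hochschild class alone. *)
Lemma phi0_cohomologous phi psi : cohomologous phi psi -> phi0 phi = phi0 psi.
Proof.
move=> [eta etaC H]; apply/funext => g; apply/eqP; rewrite -subr_eq0; apply/eqP.
rewrite /phi0 /cloc; have := H [::] (fgen b b g).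
by rewrite (cobd_loc b [::] g etaC) cobdT_nil.
Qed.

Lemma phi0_mul phi psi : is_cochain phi -> is_cochain psi ->
  phi0 (cochain_mul phi psi) = mulb (phi0 phi) (phi0 psi).
Proof.
move=> phiC psiC; apply/funext => g; rewrite /phi0 {1}/cloc -[X in cochain_mul _ _ X]/(map (fgen b b) [::]).
rewrite (cochain_mul_loc b [::] g phiC psiC) /mulT split3_nil big_seq1 /= split3_nil big_seq1 /=.
apply: eq_bigr => h _; apply: eq_bigr => k _.
by rewrite /cdeg_at /shpar /= !addn0 !muln0 !addn0.
Qed.

Lemma phi0_one : phi0 (@cochain1 _ _ _ (fuk F)) = @lone _ _ _ l.
Proof. by apply/funext => g; rewrite /phi0 /cloc /= fgen_src fuk_unit. Qed.

(** The cocycle equation on a word of length one: the length one part of phi occurs only together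
    with m_1, which is zero. The shifted degree of an odd letter is even, so no sign appears. *)
Lemma phi0_cocycle phi h g : is_cocycle phi -> parT h ->
  \sum_k (phi0 phi k : Lam) * (ml [:: k; h] g + ml [:: h; k] g) = 0.
Proof.
move=> [phiC phi0]; have := phi0 (map (fgen b b) [:: h]) (fgen b b g).
rewrite (cobd_loc b _ g phiC) => H ph; rewrite -[RHS]H /cobdT big_split3_cons /= split3_nil big_seq1 /=.
rewrite !big_cons big_nil addr0 -!big_split /=; apply: eq_bigr => k _ /=.
rewrite !m1 !mloc_nil /shpar /= ph /= !(muln0, mulr0, mul0r) !subr0 !mul1r addr0.
by rewrite mulrDr.
Qed.

Lemma phi0_supercentral phi (x : V) : is_cocycle phi -> (forall k, x k != 0 -> parT k) ->
  mulb x (phi0 phi) = mulb (sg (phi0 phi)) x.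
Proof.
move=> pc xo; apply/funext => g; rewrite /hmul [RHS]exchange_big.
apply: eq_bigr => h _ /=; case: (eqVneq (x h) 0) => [->|/xo ph].
  by rewrite !big1 // => k _; rewrite !(mulr0, mul0r).
apply/eqP; rewrite -subr_eq0 -sumrB; apply/eqP.
transitivity ((-1) ^+ parT g * (x h : Lam) * (\sum_k (phi0 phi k : Lam) * (ml [:: k; h] g + ml [:: h; k] g))); last first.
  by rewrite phi0_cocycle // mulr0.
rewrite mulr_sumr; apply: eq_bigr => k _; rewrite ph /hsg.
have [e|e] := boolP ((ml [:: h; k] g == 0) && (ml [:: k; h] g == 0)).
  by case/andP: e => /eqP -> /eqP ->; rewrite !(mulr0, addr0, subrr).
have -> : parT g = ~~ parT k.
  move: e; rewrite negb_and => /orP[] /mloc_deg ->; rewrite /shpar /= ph;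
  by case: (parT k).
case: (parT k) => /=.
  rewrite !muln1 addn1 sqrrN !expr1n ?expr1 ?expr0 ?mul1r; exact: central_aux2.
rewrite !(muln0, mul0n, addn0, add0n) !expr1 !expr0 !mul1r; exact: central_aux1.
Qed.

End LengthZero.

Section PairingScaling.
Variables (R : realType) (n : nat) (X : ambient R n).
Local Notation Lam := (nov R R[i]).
Implicit Types (x z : QH X) (a : Lam).

Lemma qpair0r z : qpair z 0 = 0.
Proof.
move: (qpairPr 1 0 0 z); rewrite scale1r addr0 mul1r => H.
by apply: (addrI (qpair z 0)); rewrite addr0; exact: esym H.
Qed.

Lemma qpairZr a z x : qpair z (a *: x) = a * qpair z x.
Proof. by have := qpairPr a x 0 z; rewrite addr0 qpair0r addr0. Qed.

End PairingScaling.

(** * The character of a brane and the open-closed map on chains of length zero *)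

Section LocalCharacter.
Variables (R : realType) (n : nat) (F : floer_setting R n) (l : fI F).
Local Notation Lam := (nov R R[i]).
Local Notation L := (fL l).
Local Notation T := (cb (lH L)).
Local Notation V := (T -> Lam^o).
Local Notation parT := (@cpar R n (lH L)).
Local Notation G := (gen (fuk F)).
Local Notation QHX := (QH (fX F)).
Variable b : mc L.
Local Notation P := (obj b).
Local Notation ml := (mloc b).
Local Notation mulb := (hmul parT ml).
Local Notation one := (@lone _ _ _ l : V).
Local Notation sg := (hsg parT : V -> V).
Hypothesis m1 : forall i k, ml [:: i] k = 0.
Hypothesis super : forall x : V,
  (forall y : V, (forall k, y k != 0 -> parT k) -> mulb y x = mulb (sg x) y) ->
  exists a : Lam, x = a *: one.
Hypothesis T_inh : inhabited T.

Lemma chi_ex (x : QHX) : exists a : Lam, phi0 b (fq x) = a *: one.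
Proof. by apply: super => y yo; apply: (phi0_supercentral m1 (fq_cocycle x) yo). Qed.

Definition chi (x : QHX) : Lam := projT1 (cid (chi_ex x)).

Lemma chiE x : phi0 b (fq x) = chi x *: one.
Proof. by rewrite /chi; case: cid. Qed.

Lemma lone_neq0 : exists k, (one k : Lam) != 0.
Proof.
by case: T_inh => k0; have [k ck] := cone_neq0 k0; exists k.
Qed.

Lemma chi_uniq (a : Lam) x : phi0 b (fq x) = a *: one -> chi x = a.
Proof.
rewrite chiE => H; have [k k0] := lone_neq0; apply: (mulIf k0).
exact: (congr1 (fun f : V => f k) H).
Qed.

Lemma chi_lin (a : Lam) x y : chi (a *: x + y) = a * chi x + chi y.
Proof.
apply: chi_uniq; rewrite (phi0_cohomologous m1 (fq_linear a x y)).
transitivity (a *: phi0 b (fq x) + phi0 b (fq y)); first by [].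
by rewrite !chiE scalerA -scalerDl.
Qed.

Lemma chi0 : chi 0 = 0.
Proof.
by have := chi_lin 1 0 0; rewrite scale1r addr0 mul1r => H; apply: (addrI (chi 0)); rewrite addr0 -H.
Qed.

Lemma chiZ (a : Lam) x : chi (a *: x) = a * chi x.
Proof. by have := chi_lin a x 0; rewrite addr0 chi0 addr0. Qed.

Lemma chi_one : chi (qone (fX F)) = 1.
Proof. by apply: chi_uniq; rewrite (phi0_cohomologous m1 (@fq_one _ _ F)) phi0_one scale1r. Qed.

Lemma chi_mul x y : chi (qmul x y) = chi x * chi y.
Proof.
apply: chi_uniq; rewrite (phi0_cohomologous m1 (fq_mul x y)).
rewrite (phi0_mul b (fq_cocycle x).1 (fq_cocycle y).1) !chiE.
have mulZl (a : Lam) (u w : V) : mulb (a *: u) w = a *: mulb u w.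
  by apply: (linZ (f := fun u => mulb u w)) => c u1 u2; exact: hmulPl.
have mulZr (a : Lam) (u w : V) : mulb w (a *: u) = a *: mulb w u.
  by apply: (linZ (f := mulb w)) => c u1 u2; exact: hmulPr.
rewrite mulZl mulZr scalerA.
by rewrite (hmul1 (@lone_even _ _ _ _) (@lonel _ _ _ _ b)).
Qed.

Lemma chi_odd x : qhomog true x -> chi x = 0.
Proof.
move=> xo; have [k k0] := lone_neq0; apply/eqP; apply: contraT => c0.
have : phi0 b (fq x) k != 0.
  by rewrite chiE; exact: mulf_neq0.
move=> /(fq_homog xo); rewrite /cpardeg /= addn0 oddb par_fgen.
by rewrite (lone_even k0).
Qed.

Definition zdual : QHX := projT1 (cid (qpair_riesz chi_lin)).

Lemma zdualP x : qpair x zdual = chi x.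
Proof. by rewrite /zdual; case: cid. Qed.

(** By the Frobenius property, pairing x with y * Z gives the character of x * y, which is
    multiplicative. *)
Lemma zdual_mul y : qmul y zdual = chi y *: zdual.
Proof.
apply: qpair_inj => x; rewrite -qpair_frob zdualP chi_mul.
by rewrite qpairZr zdualP [LHS]mulrC.
Qed.

Definition ext (a : V) (g : G) : Lam := \sum_i (a i : Lam) * (g == fgen b b i)%:R.

Lemma extE a i : ext a (fgen b b i) = a i.
Proof.
rewrite /ext (bigD1 i) //= eqxx mulr1 big1 ?addr0 // => j /negPf ji.
by rewrite fgen_eqE eq_sym ji mulr0.
Qed.

Lemma ext_hvec a : hvec P P (ext a).
Proof.
move=> g; rewrite /ext => h; have [i gi] : exists i, g = fgen b b i.
  apply: contrapT => H; case/eqP: h; rewrite big1 // => i _.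
  by case: eqP => [e|]; [case: H; exists i|rewrite mulr0].
by rewrite gi; exact: fgen_homset.
Qed.

Lemma ext_homog p a : (forall i, a i != 0 -> parT i = p) -> hhomog p (ext a).
Proof.
move=> ap g g0; have [i gi] := fgen_surj (ext_hvec g0).
by move: g0; rewrite gi extE par_fgen; exact: ap.
Qed.

Lemma ext_eq a g : (forall i, g = fgen b b i -> ext a g = 0) -> ext a g = 0.
Proof.
move=> H; apply/eqP; apply: contraT => h; have [i gi] := fgen_surj (ext_hvec h).
by rewrite (H i gi) eqxx in h.
Qed.

Lemma hvec_ext (x : G -> Lam) : hvec P P x -> x = ext (fun i => x (fgen b b i)).
Proof.
move=> xP; apply/funext => g; have [[i ->]|H] := pselect (exists i, g = fgen b b i).
  by rewrite extE.
transitivity (0 : Lam).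
  by apply/eqP; apply: contraT => /xP/fgen_surj /H.
by apply/esym/ext_eq => i gi; case: H; exists i.
Qed.

Lemma hprod_ext a c : hprod (A := fuk F) (ext a) (ext c) = ext (mulb a c).
Proof.
apply/funext => g; rewrite /hprod (sumG (b := b)) => [|h]; last first.
  case: (eqVneq (ext a h) 0) => [e|/ext_hvec //].
  by rewrite fsbig1 ?eqxx // => k _; rewrite e mulr0 !mul0r.
have [[k ->]|H] := pselect (exists k, g = fgen b b k).
  rewrite extE; apply: eq_bigr => i _; rewrite (sumG (b := b)) => [|h]; last first.
    case: (eqVneq (ext c h) 0) => [e|/ext_hvec //].
    by rewrite e mulr0 mul0r eqxx.
  by apply: eq_bigr => j _; rewrite !extE !par_fgen.
rewrite ext_eq; last by move=> i gi; case: H; exists i.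
apply: big1 => i _; rewrite (sumG (b := b)) => [|h]; last first.
  case: (eqVneq (ext c h) 0) => [e|/ext_hvec //].
  by rewrite e mulr0 mul0r eqxx.
apply: big1 => j _; apply/eqP; rewrite mulf_eq0; apply/orP; right; apply: contraT.
by move=> /(@mu_out _ _ _ _ b [:: i; j])/fgen_surj /H.
Qed.

Lemma chain0_on a : chain_on P (chain0 (ext a)).
Proof.
move=> [g [|h w]]; rewrite /chain0 /=; last by rewrite eqxx.
by move=> /ext_hvec gP h; rewrite inE => /eqP ->.
Qed.

Lemma chain0_cycle a : is_cycle (chain0 (ext a)).
Proof.
split; first split.
- apply: (@sub_finite_set _ _ ((fun g => (g, [::])) @` homset P P)).
    move=> [g [|h w]]; rewrite /chain0 /=; last by rewrite eqxx.
    by move=> /ext_hvec gP; exists g.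
  exact/finite_image/hom_fin.
- move=> [g [|h w]]; rewrite /chain0 /=; last by rewrite eqxx.
  by move=> /ext_hvec [-> ->].
move=> z'; rewrite /bd fsbig1 // => -[g [|h w]] _; rewrite /chain0 /=; last by rewrite mul0r.
case: (eqVneq (ext a g) 0) => [->|/ext_hvec gP]; first by rewrite mul0r.
rewrite /bd_coef /= [split3 _](_ : _ = [:: ([::], [::], [::])]) // big_seq1 /=.
rewrite fsbig1 => [|h _]; last by rewrite mu_nil mulr0 mul0r.
have [i gi] := fgen_surj gP.
have -> : mu [:: g] z'.1 = 0.
  rewrite gi; apply/eqP; apply: contraT => h.
  have [k kz] := fgen_surj (@mu_out _ _ _ _ b [:: i] _ h).
  by move: h; rewrite kz [mu _ _](m1 i k) eqxx.
by rewrite mulr0 mul0r addr0 mulr0.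
Qed.

Lemma hpair_chain0 phi a : hpair phi (chain0 (ext a)) =
  \sum_i \sum_k (a i : Lam) * ((phi0 b phi k : Lam) * @cycT _ _ _ l k i).
Proof.
rewrite /hpair (fsbig_inj_fin (f := fun i => (fgen b b i, [::] : seq G))).
- apply: eq_bigr => i _; rewrite /chain0 /= extE muln0 expr0 mulr1.
  rewrite (sumG (b := b)) => [|h]; last first.
    rewrite mulf_eq0 negb_or => /andP[_ /cyc_hom]; rewrite fgen_src fgen_tgt.
    by move=> [h1 h2]; split.
  by rewrite mulr_sumr; apply: eq_bigr => k _; rewrite cycTE.
- by move=> i j [] /fgen_inj.
move=> [g [|h w]] H; rewrite /chain0 /=; last by rewrite !mul0r.
rewrite ext_eq ?mul0r // => i gi; by case: (H i); rewrite gi.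
Qed.

(** The pairing of 1_L with a, with the sign (-1)^(n|a|) from the definition of p. It depends on L
    only, not on the Maurer-Cartan element. *)
Definition kap (a : V) : Lam := \sum_i \sum_k ((-1) ^+ (n * parT i) * (a i : Lam)) * ((one k : Lam) * @cycT _ _ _ l k i).

Lemma oc_mapE (c : chain (fuk F)) v : (forall x, qpair x v =
    hpair (fq x) (fun z => (-1) ^+ (n * chdeg z) * c z)) -> oc_map (@fq _ _ F) c = v.
Proof.
move=> H; rewrite /oc_map; case: xgetP => [w _ wP|/(_ v)//].
by apply: qpair_inj => x; rewrite H wP.
Qed.

Lemma kap_aux (K : comNzRingType) (a x o c : K) : a * (x * o * c) = x * (a * (o * c)).
Proof. by ring. Qed.

(** A chain of length zero pairs with the length zero part of q(x) only, and this part is the unit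
    times the character of x. *)
Lemma oc_chain0 a : oc_map (@fq _ _ F) (chain0 (ext a)) = kap a *: zdual.
Proof.
apply: oc_mapE => x.
rewrite [X in hpair _ X](_ : _ = chain0 (ext (fun i => (-1) ^+ (n * parT i) * (a i : Lam)))).
  rewrite hpair_chain0 qpairZr zdualP [LHS]mulrC /kap mulr_sumr; apply: eq_bigr => i _; rewrite mulr_sumr.
  by apply: eq_bigr => k _; rewrite chiE; exact/esym/kap_aux.
apply/funext => -[g [|h w]]; rewrite /chain0 /chdeg /=; last by rewrite mulr0.
have [[k ->]|H] := pselect (exists k, g = fgen b b k).
  by rewrite !extE par_fgen addn0.
have Z c : ext c g = 0 by apply: ext_eq => i gi; case: H; exists i.
by rewrite (Z a) (Z _) mulr0.
Qed.

End LocalCharacter.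

(** * Existence of the idempotent *)

Section CriticalIdempotent.
Variables (R : realType) (n : nat) (F : floer_setting R n) (l : fI F).
Local Notation C := R[i].
Local Notation Lam := (nov R R[i]).
Local Notation L := (fL l).
Local Notation T := (cb (lH L)).
Local Notation V := (T -> Lam^o).
Local Notation parT := (@cpar R n (lH L)).
Implicit Types (x y : V).
Hypotheses (htorus : is_torus L) (hindex : index_condition L).
Variable e : zbasis (lH1 L) n.
Variable v : 'I_n -> {ffun T -> C}.
Hypothesis v_deg : forall j i, v j i != 0 -> cdeg i = 1%N.
Hypothesis v_basis : forall w : {ffun T -> C}, exists! c : {ffun {set 'I_n} -> C},
  forall i, w i = \sum_(J : {set 'I_n}) c J * cupprod [seq v j | j <- enum J] i.
Variable xd : 'I_n -> {ffun T -> C}.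
Hypothesis xdP : forall i, (forall j, xd i j != 0 -> cdeg j = 1%N) /\
  forall gamma, (zcoord e gamma i)%:~R = \sum_j lev L gamma j * xd i j.
Variable b : mc L.
Hypothesis hb : nondeg_critical (f_nb (l := l)) e b.
Local Notation ml := (mloc b).
Local Notation mulb := (hmul parT ml).
Local Notation one := (@lone _ _ _ l : V).
Local Notation sg := (hsg parT : V -> V).
Local Notation cQ := (critQ e v b).
Local Notation vJ := (vset mulb one (lvec v)).
Local Notation co := (vco b v_basis).
Local Notation P := (obj b).

Lemma torus_inh : inhabited T.
Proof.
have : (0 < #|T|)%N.
  by rewrite -(card_torus v_basis); apply/card_gt0P; exists finset.set0.
by move=> /card_gt0P[k _]; split.
Qed.

Lemma crit_m1b i k : ml [:: i] k = 0.
Proof. exact: (crit_m1 htorus hindex v_deg v_basis xdP hb i k). Qed.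

Lemma crit_super (x : V) :
  (forall y : V, (forall k, y k != 0 -> parT k) -> mulb y x = mulb (sg x) y) ->
  exists a : Lam, x = a *: one.
Proof.
move=> H; apply: (crit_supercentral htorus hindex v_deg v_basis xdP hb) => i.
apply: H => k; exact: (vuL_odd v_deg).
Qed.

Local Notation chib := (chi crit_m1b crit_super).
Local Notation Zb := (zdual crit_m1b crit_super torus_inh).

Definition vbas (i : 'I_#|{set 'I_n}|) : V := vJ (enum_val i).

Lemma sg_hom (p : bool) (x : V) k : sg x = (-1) ^+ p *: x -> x k != 0 -> parT k = p.
Proof.
move=> /(congr1 (fun f : V => f k)) H x0; apply/eqP/negPn/negP => pk.
have : x k *+ 2 = 0 :> Lam.
  have : (-1) ^+ parT k * (x k : Lam) = (-1) ^+ p * (x k : Lam) by [].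
  move: pk; case: (parT k); case: (p) => // _; rewrite ?expr1 ?expr0 ?mul1r mulN1r => E.
    by rewrite mulr2n -[X in X + _ = _]E addNr.
  by rewrite mulr2n [X in X + _ = _]E addNr.
by move/eqP; rewrite -mulr_natr mulf_eq0 (negPf x0) (negPf (nov_natr_neq0 _ _ _)).
Qed.

Lemma sg_vJ J : sg (vJ J) = (-1) ^+ #|J| *: vJ J.
Proof.
apply: (sg_vset (mul := mulb) _ _ _ _ (hsg_lvec v_deg) J) => *; first exact: hmulPl.
- exact: hmulPr.
- exact: fsg_mul.
exact: fsg_one.
Qed.

Local Notation epsb := (fun i : 'I_#|{set 'I_n}| => odd #|(enum_val i : {set 'I_n})|).

Lemma ext_sum (I : finType) (c : I -> Lam) (w : I -> V) (g : gen (fuk F)) :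
  \sum_i c i * ext b (w i) g = ext b (fun k => \sum_i c i * (w i k : Lam)) g.
Proof.
rewrite /ext; under eq_bigr => i _ do rewrite mulr_sumr.
rewrite exchange_big; apply: eq_bigr => k _; rewrite mulr_suml.
by apply: eq_bigr => i _; rewrite mulrA.
Qed.

Lemma sum_vbas (u : {set 'I_n} -> Lam) k :
  \sum_i u (enum_val i) * (vbas i k : Lam) = \sum_J u J * (vJ J k : Lam).
Proof.
rewrite (reindex (enum_val : 'I_#|{set 'I_n}| -> _)) //=.
exact/onW_bij/enum_val_bij.
Qed.

Lemma ext_vco (w : V) g : \sum_i co (enum_val i) w * ext b (vbas i) g = ext b w g.
Proof.
rewrite (ext_sum (fun i => co (enum_val i) w)); congr (ext b _ g); apply/funext => k.
by rewrite (sum_vbas (fun J => co J w)) vcoE.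
Qed.

Lemma extZ (c : Lam) (w : V) g : ext b (c *: w) g = c * ext b w g.
Proof. by rewrite /ext mulr_sumr; apply: eq_bigr => i _; rewrite mulrA. Qed.

Lemma crit_coh_basis : coh_basis P P epsb (fun i => ext b (vbas i)).
Proof.
split=> [i|x xP _].
  split; first exact: ext_hvec.
    apply: ext_homog => k; apply: sg_hom; rewrite sg_vJ; congr (_ *: _).
    by apply: sign_eq; rewrite oddb.
  by move=> g; apply: (mu1_eq0 crit_m1b); exact: ext_hvec.
rewrite (hvec_ext xP); set a : V := fun i => x (fgen b b i).
exists [ffun i => co (enum_val i) a]; split.
  exists (fun=> 0) => [g|g]; first by rewrite eqxx.
  rewrite (mu1_eq0 crit_m1b (b := b)) ?addr0; last by move=> h; rewrite eqxx.
  under eq_bigr => i _ do rewrite ffunE.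
  exact/esym/ext_vco.
move=> c [y yP cE]; apply/ffunP => i; rewrite ffunE.
rewrite (vco_uniq v_basis (u := fun J => c (enum_rank J))) ?enum_valK // => k.
rewrite -(sum_vbas (fun J => c (enum_rank J))).
have := cE (fgen b b k); rewrite extE (mu1_eq0 crit_m1b) // addr0 ext_sum extE => ->.
by apply: eq_bigr => j _; rewrite enum_valK.
Qed.

(** The differential is zero, so the supertrace on cohomology is computed in the monomial basis
    itself. The factor (-1)^p is (-1)^(|x||x'|) for two classes of parity p. *)
Lemma muk_chain0 (p : bool) (a c : V) : sg a = (-1) ^+ p *: a -> sg c = (-1) ^+ p *: c ->
  muk (chain0 (ext b a)) (chain0 (ext b c)) = (-1) ^+ p *
   \sum_(J : {set 'I_n}) (-1) ^+ #|J| * co J ((-1) ^+ (p * #|J|) *: (mulb (mulb a (vJ J)) c)).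
Proof.
move=> sa sc.
pose M : 'M[Lam]_#|{set 'I_n}| := \matrix_(i, j) ((-1) ^+ p *
  co (enum_val j) ((-1) ^+ (p * #|(enum_val i : {set 'I_n})|) *: (mulb (mulb a (vbas i)) c))).
have hh x : sg x = (-1) ^+ p *: x -> hhomog p (ext b x).
  by move=> sx; apply: ext_homog => k; exact: sg_hom.
rewrite (muk_length0 (@ext_hvec _ _ _ _ b a) (hh a sa) _ (@ext_hvec _ _ _ _ b c) (hh c sc) _ (M := M) crit_coh_basis).
- rewrite (reindex (enum_val : 'I_#|{set 'I_n}| -> _)) /=; last exact/onW_bij/enum_val_bij.
  rewrite mulr_sumr; apply: eq_bigr => i _; rewrite [M i i]mxE.
  have -> : (-1) ^+ epsb i = (-1) ^+ #|(enum_val i : {set 'I_n})| :> Lam.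
    by apply: sign_eq; rewrite oddb.
  exact: mulrCA.
- by move=> g; apply: (mu1_eq0 crit_m1b); exact: ext_hvec.
- by move=> g; apply: (mu1_eq0 crit_m1b); exact: ext_hvec.
move=> i; exists (fun=> 0) => [g|g]; first by rewrite eqxx.
rewrite (mu1_eq0 crit_m1b (b := b)) ?addr0; last by move=> h; rewrite eqxx.
rewrite !hprod_ext.
under eq_bigr => j _ do rewrite mxE -mulrA.
rewrite -mulr_sumr ext_vco extZ mulrA -exprD; congr (_ * _).
by apply: sign_eq; rewrite !(oddD, oddM) !oddb andbb addbC.
Qed.

Lemma chhomog_chain0 (p : bool) (a : V) : sg a = (-1) ^+ p *: a -> chhomog p (chain0 (ext b a)).
Proof.
move=> sa [g [|h w]]; rewrite /chain0 /chdeg /= ?eqxx // => g0.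
rewrite addn0 oddb; apply: (ext_homog _ g0) => k; exact: sg_hom.
Qed.

(** For chains of length zero the Mukai pairing relation says that kap a times kap c times chi(Z)
    is, up to sign, a supertrace. Choosing a and c with non-zero supertrace, none of the three
    factors can vanish. *)
Lemma crit_zdual : exists2 a : V, kap a != 0 & chib Zb != 0.
Proof.
have [p [a [c [sa sc nz]]]] := crit_supertrace htorus hindex v_deg v_basis xdP hb.
have := fp_muk (chain0_cycle crit_m1b a) (chain0_cycle crit_m1b c) (chhomog_chain0 sa) (chhomog_chain0 sc).
rewrite (oc_chain0 crit_m1b crit_super torus_inh a) (oc_chain0 crit_m1b crit_super torus_inh c).
rewrite qpairZr (zdualP crit_m1b crit_super torus_inh) (chiZ crit_m1b crit_super torus_inh) (muk_chain0 sa sc) => H.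
exists a; apply: contraNneq nz => Z0; move: H; rewrite Z0 ?(mulr0, mul0r) => /esym/eqP;
by rewrite mulf_eq0 signr_eq0 mulf_eq0 signr_eq0.
Qed.

End CriticalIdempotent.

Lemma kapZ_aux (K : comNzRingType) (s c a o m : K) : s * (c * a) * (o * m) = c * (s * a * (o * m)).
Proof. by ring. Qed.

Lemma scale_linear (K : pzRingType) (V : lmodType K) (v : V) : linear (fun t : K^o => (t : K) *: v).
Proof. by move=> t x y; rewrite scalerDl -scalerA. Qed.

(** * The normalized idempotent *)

Section MainExistence.
Variables (R : realType) (n : nat) (F : floer_setting R n) (l : fI F).
Local Notation Lam := (nov R R[i]).
Local Notation L := (fL l).
Local Notation T := (cb (lH L)).
Local Notation V := (T -> Lam^o).
Local Notation parT := (@cpar R n (lH L)).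
Local Notation QHX := (QH (fX F)).

Definition supercentral_scalars (b : mc L) := forall x : V,
  (forall y : V, (forall k, y k != 0 -> parT k) ->
     hmul parT (mloc b) y x = hmul parT (mloc b) (hsg parT x : V) y) ->
  exists a : Lam, x = a *: (@lone _ _ _ l : V).

(** The auxiliary bases of H^1 are hidden here: the character itself depends only on m_1 = 0 and on
    supercentral elements being scalar. *)
Lemma crit_package (e : zbasis (lH1 L) n) (b : mc L) : is_torus L -> index_condition L ->
  nondeg_critical (f_nb (l := l)) e b ->
  exists (m1 : forall i k, mloc b [:: i] k = 0) (sup : supercentral_scalars b) (ti : inhabited T),
    (exists a : V, kap a != 0) /\ chi m1 sup (zdual m1 sup ti) != 0.
Proof.
move=> ht hi hb; have [v v_deg v_basis] := f_torus_cup ht.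
have [xd xdP] := dual_basis e.
have [a a0 c0] := crit_zdual ht hi v_deg v_basis xdP hb.
exists (crit_m1b ht hi v_deg v_basis xdP hb), (crit_super ht hi v_deg v_basis xdP hb), (torus_inh v_basis).
by split=> //; exists a.
Qed.

Variable b : mc L.
Hypothesis m1 : forall i k, mloc b [:: i] k = 0.
Hypothesis sup : supercentral_scalars b.
Hypothesis ti : inhabited T.
Local Notation chib := (chi m1 sup).
Local Notation Z := (zdual m1 sup ti).
Hypothesis Z0 : chib Z != 0.

Lemma qmulZl (a : Lam) (x y : QHX) : qmul (a *: x) y = a *: qmul x y.
Proof. by apply: (linZ (f := fun x => qmul x y)) => c u v; exact: qmulPl. Qed.

Lemma qmulZr (a : Lam) (x y : QHX) : qmul x (a *: y) = a *: qmul x y.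
Proof. by apply: (linZ (f := qmul x)) => c u v; exact: qmulPr. Qed.

Definition ecrit : QHX := (chib Z)^-1 *: Z.

Lemma chi_ecrit : chib ecrit = 1.
Proof. by rewrite chiZ // mulVf //; exact: Z0. Qed.

Lemma qmul_ecrit x : qmul x ecrit = chib x *: ecrit.
Proof. by rewrite qmulZr zdual_mul !scalerA mulrC. Qed.

Lemma ecrit_neq0 : ecrit != 0.
Proof.
apply/eqP => e0; have := chi_ecrit; rewrite e0 chi0 // => /esym/eqP.
by rewrite oner_eq0.
Qed.

Lemma kapZ (c : Lam) (a : V) : kap (c *: a) = c * kap a.
Proof.
rewrite /kap mulr_sumr; apply: eq_bigr => i _; rewrite mulr_sumr; apply: eq_bigr => k _.
exact: kapZ_aux.
Qed.

Lemma ecrit_image (a : V) : kap a != 0 -> in_oc_image b ecrit.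
Proof.
move=> a0; exists (chain0 (ext b (((chib Z)^-1 / kap a) *: a))); split.
- exact: chain0_cycle.
- exact: chain0_on.
by rewrite (oc_chain0 m1 sup ti) kapZ divfK.
Qed.

Let fe : Lam^o -> QHX := fun t => t *: ecrit.

Lemma chi_fe t : chib (fe t) = t.
Proof. by rewrite [LHS](chiZ m1 sup ti t ecrit) chi_ecrit mulr1. Qed.

Lemma fe_mul x y : fe (x * y) = qmul (fe x) (fe y).
Proof.
by rewrite [RHS](qmulZl x ecrit (fe y)) (qmulZr y ecrit ecrit) qmul_ecrit chi_ecrit scale1r [RHS]scalerA.
Qed.

Lemma fe_linear : linear fe.
Proof. exact: (scale_linear ecrit). Qed.

HB.instance Definition _ := GRing.isLinear.Build Lam Lam^o QHX _ fe fe_linear.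

Lemma ecrit_summand : summand_iso_Lambda ecrit.
Proof.
exists fe; split.
- by move=> x y /(congr1 chib); rewrite (chi_fe x) (chi_fe y).
- exact: fe_mul.
- exact: scale1r.
apply/seteqP; split=> [_ [t _ <-]|_ [x _ <-]].
  by exists (fe t) => //; rewrite qmul_ecrit chi_fe.
by exists (chib x) => //; rewrite qmul_ecrit.
Qed.

Lemma ecrit_idempotent (a : V) : kap a != 0 -> idempotent_of b ecrit.
Proof.
move=> a0; split; [exact: ecrit_neq0| |exact: ecrit_image a0].
by rewrite qmul_ecrit chi_ecrit scale1r.
Qed.

End MainExistence.

(** * Vanishing of Floer cohomology between distinct branes *)

Section MultilinearDifference.
Variables (A : comNzRingType) (I : finType).
Implicit Types (f : seq I -> A) (x y d : I -> A).

(** Telescoping: the letters x are replaced by y one slot at a time, and each replacement changes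
    the value by a term linear in a d. *)
Lemma mlext_nseq_diff f us x y d a m : (forall i, y i = x i + a * d i) ->
  mlext f (us ++ nseq m y) - mlext f (us ++ nseq m x) =
  a * \sum_(r < m) mlext f (us ++ nseq r x ++ d :: nseq (m - r.+1) y).
Proof.
move=> yE; pose B r := mlext f (us ++ nseq r x ++ nseq (m - r) y).
have -> : mlext f (us ++ nseq m y) = B 0%N by rewrite /B subn0.
have -> : mlext f (us ++ nseq m x) = B m by rewrite /B subnn cats0.
rewrite mulr_sumr -opprB -(telescope_sumr B (leq0n m)) big_mkord -sumrN.
apply: eq_bigr => r _; rewrite opprB /B.
have -> : nseq (m - r) y = (fun i => a * d i + x i) :: nseq (m - r.+1) y.
  rewrite -[(m - r)%N]prednK ?subn_gt0 // -subnS /=; congr cons.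
  by apply/funext => i; rewrite yE addrC.
rewrite [X in mlext f X - _]catA mlext_slotP -!catA.
rewrite (_ : nseq r.+1 x ++ nseq (m - r.+1) y = nseq r x ++ x :: nseq (m - r.+1) y) ?addrK //.
by rewrite -addn1 nseqD -catA.
Qed.

End MultilinearDifference.

(** * The differential between two branes with the same local system *)

Section Differential.
Variables (R : realType) (n : nat) (F : floer_setting R n) (l : fI F).
Local Notation C := R[i].
Local Notation Lam := (nov R R[i]).
Local Notation L := (fL l).
Local Notation T := (cb (lH L)).
Local Notation V := (T -> Lam^o).
Local Notation parT := (@cpar R n (lH L)).
Local Notation lmf beta k := (fun w : seq T => nconst R (lm (l := L) beta w k) : Lam).
Local Notation bb b := (fun i => mc_b b i : Lam).
Variables b b' : mc L.
Hypothesis bb' : same_rhoW b b'.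
Hypothesis m1 : forall i k, mloc b [:: i] k = 0.
Variables (la : R) (d : T -> Lam).
Hypothesis b'E : forall i, (mc_b b' i : Lam) = (mc_b b i : Lam) + nT C la * d i.
Hypothesis d_int : fint d.
Hypothesis d_deg : forall i, d i 0 != 0 -> cdeg i = 1%N.

(** The differential m_1 of hom(b, b') divided by T^la, the leading power of b' - b, so that it is
    integral with a non-trivial residue. *)
Definition mdiff (z : V) : V := fun k =>
  (nT C la)^-1 * \sum_i (z i : Lam) * mu [:: fgen b b' i] (fgen b b' k).

Definition term_diff (z : V) k (p : nat * nat * lH2 L) : Lam :=
  wt b p.2 * \sum_(r < p.1.2) mlext (lmf p.2 k)
    ((nseq p.1.1 (bb b) ++ [:: z : T -> Lam]) ++ nseq r (bb b) ++ d :: nseq (p.1.2 - r.+1) (bb b')).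

Lemma term_diffE z k p : term1 b b' z k p - term1 b b z k p = nT C la * term_diff z k p.
Proof.
rewrite /term1 /term_diff -mulrBr mulrCA; congr (_ * _).
by rewrite -(mlext_nseq_diff _ _ _ b'E) -!catA.
Qed.

(** The differential of hom(b, b) is zero and may be subtracted; every remaining term then contains
    b' - b, and the division by T^la is harmless. *)
Lemma mdiff_sums z k : nsums (term_diff z k) (mdiff z k).
Proof.
have H1 := mu1_sums z k bb'; have H2 := mu1_sums z k (same_rhoW_refl b).
rewrite big1 in H2 => [|i _]; last by rewrite [mu _ _](m1 i k) mulr0.
have := nsumsZ (nT C la)^-1 (nsumsD H1 (nsumsZ (-1) H2)).
rewrite mulr0 addr0; congr nsums; apply/funext => p.
by rewrite mulN1r term_diffE mulKf // nT_neq0.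
Qed.

Lemma Forall_term (z : V) (p q r : nat) : fint z ->
  List.Forall (@fint _ _ _) ((nseq p (bb b) ++ [:: z : T -> Lam]) ++ nseq q (bb b) ++ d :: nseq r (bb b')).
Proof.
move=> z0; apply/List.Forall_app; split.
  by apply/List.Forall_app; split; [exact/Forall_nseq/mc_b_fint|constructor].
apply/List.Forall_app; split; first exact/Forall_nseq/mc_b_fint.
by constructor => //; exact/Forall_nseq/mc_b_fint.
Qed.

(* At leading order only m_{2,0}(z, d) contributes. *)
Lemma term_diff_res z k p : fint z -> p != ((0%N, 1%N), 0) -> nval_gt0 (term_diff z k p).
Proof.
move=> z0 p0; rewrite /term_diff mulr_sumr; apply: nval_gt0_sum => r _.
have [be0|be0] := eqVneq p.2 0; last by apply: term_pos => //; exact: Forall_term.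
rewrite be0 wt0 mul1r; apply: mlext_pos; [by move=> w; exact: nconst_ge0|exact: Forall_term|].
case: p p0 be0 r => [[x y] be] /= p0 be0 r; rewrite {}be0 in p0.
case: x p0 => [|x] p0; last by left; exact: mc_b_fpos.
right; case: r => [[|r] /= ry]; last by left; exact: mc_b_fpos.
case: y p0 ry => [//|[|y]] p0 ry; last by right; rewrite subSS subn0; left; exact: mc_b_fpos.
by rewrite eqxx in p0.
Qed.

Lemma mdiff_int z : fint z -> fint (mdiff z : T -> Lam).
Proof.
move=> z0 k; apply: nsums_ge (mdiff_sums z k) _ => p.
rewrite /term_diff mulr_sumr; apply: nval_ge_sum => r _; apply: term_int; exact: Forall_term.
Qed.

Lemma mdiff_res z k : fint z -> (mdiff z k : Lam) 0 =
  \sum_i \sum_j (z i : Lam) 0 * d j 0 * ccup i j k.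
Proof.
move=> z0; rewrite (nsums_val_single (i0 := (0%N, 1%N, 0)) (l := 0) (mdiff_sums z k)).
  have -> : term_diff z k ((0%N, 1%N), 0) = mlext (lmf 0 k) [:: z : T -> Lam; d].
    by rewrite /term_diff [in wt b _]/= wt0 mul1r big_ord_recl big_ord0 addr0.
  rewrite [mlext _ _]/= nov_sumE.
  apply: eq_bigr => i _; rewrite res_mul //; last first.
    by apply: nval_ge_sum => j _; apply: nval_geMl => //; exact: nconst_ge0.
  rewrite nov_sumE mulr_sumr; apply: eq_bigr => j _; rewrite res_mul //; last exact: nconst_ge0.
  rewrite res_nconst lm20 mulrA; case: (eqVneq (d j 0) 0) => [->|/d_deg dj].
    by rewrite !(mulr0, mul0r).
  (* The residue of d has degree one, so the sign of m_{2,0}(z, d) is (-1)^(|z|+|z|). *)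
  by rewrite dj muln1 (@sign_eq _ _ 0) ?mul1r // oddD addbb.
by move=> p p0; have /nval_gt0P[] := term_diff_res k z0 p0.
Qed.

Lemma mdiffP (a : Lam) (x y : V) : mdiff (a *: x + y) = a *: mdiff x + mdiff y.
Proof.
apply/funext => k; rewrite /mdiff.
transitivity ((nT C la)^-1 * (a * (\sum_i (x i : Lam) * mu [:: fgen b b' i] (fgen b b' k)) +
   \sum_i (y i : Lam) * mu [:: fgen b b' i] (fgen b b' k))); last by rewrite mulrDr mulrCA.
congr (_ * _); rewrite mulr_sumr -big_split; apply: eq_bigr => i _.
by rewrite [X in X * _](_ : _ = a * (x i : Lam) + (y i : Lam)) // mulrDl mulrA.
Qed.

Lemma mdiff_sqr x : mdiff (mdiff x) = 0.
Proof.
have fgh i : homset (obj b) (obj b') (fgen b b' i).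
  by have [s _ _] := fgen_hom bb'; apply: s.
have fgi : injective (fgen b b').
  by move=> p q; have [_ + _] := fgen_hom bb'; move=> /(_ p q); rewrite !inE; apply.
have rel i k : \sum_h mu [:: fgen b b' i] (fgen b b' h) * mu [:: fgen b b' h] (fgen b b' k) = 0.
  have := mu_rel [:: fgen b b' i] (fgen b b' k).
  rewrite big_split3_cons /= big_split3_nil !big_cons big_nil /= addr0.
  rewrite [X in X + _ + _ = _]fsbig1 => [|h _]; last by rewrite mu_nil mulr0 mul0r.
  rewrite [X in _ + X = _]fsbig1 => [|h _]; last by rewrite mu_nil mulr0 mul0r.
  rewrite add0r addr0 /shpar /= => H; rewrite -[RHS]H.
  rewrite (fsbig_inj_fin (f := fgen b b')) // => [|h hN]; first by apply: eq_bigr => h _; rewrite mul1r.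
  apply/eqP; rewrite mul1r mulf_eq0; apply/orP; left; apply: contraT => /mu_hom /=.
  have [-> ->] := fgh i; move=> [/esym sh /esym th].
  by have [_ _ s] := fgen_hom bb'; have [j _ je] := s h (conj sh th); case: (hN j).
apply/funext => k; rewrite /mdiff.
transitivity ((nT C la)^-1 * (nT C la)^-1 * \sum_i (x i : Lam) *
  (\sum_h mu [:: fgen b b' i] (fgen b b' h) * mu [:: fgen b b' h] (fgen b b' k))); last first.
  by rewrite big1 ?mulr0 // => i _; rewrite rel mulr0.
rewrite -mulrA; congr (_ * _); rewrite mulr_sumr.
under eq_bigr => h _ do rewrite -mulrA mulr_suml.
under [RHS]eq_bigr => i _ do rewrite !mulr_sumr.
rewrite [RHS]exchange_big; apply: eq_bigr => h _; rewrite mulr_sumr.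
by apply: eq_bigr => i _; rewrite !mulrA.
Qed.

End Differential.

Lemma zmod_aux (M : zmodType) (a b c m : M) : a + b = c + ((a - m) + (b + (m - c))).
Proof. by rewrite addrACA addKr [RHS]addrC subrK. Qed.

(** * Operators whose residue is a non-zero scalar *)

Section ResidueScalar.
Variables (R : realType) (K : fieldType) (T : finType).
Local Notation Lam := (nov R K).
Local Notation V := (T -> Lam^o).
Implicit Types (x y : V).
Definition fdelta (i : T) : V := fun j => (j == i)%:R.

Lemma flin_expand (f : V -> V) : (forall (a : Lam) x y, f (a *: x + y) = a *: f x + f y) ->
  forall x k, f x k = \sum_i (x i : Lam) * f (fdelta i) k.
Proof.
move=> fP x k.
have E : x = \sum_i (x i : Lam) *: fdelta i.
  apply/funext => j; transitivity (\sum_i (x i : Lam) * fdelta i j).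
    rewrite (bigD1 j) //= /fdelta eqxx mulr1 big1 ?addr0 // => i /negPf ij.
    by rewrite eq_sym ij mulr0.
  by elim/big_rec2 : _ => // i y1 y2 _ ->.
have S (I : Type) (r : seq I) (a : I -> Lam) (w : I -> V) :
    (\sum_(i <- r) a i *: w i) k = \sum_(i <- r) a i * (w i k : Lam) :> Lam.
  by elim/big_rec2 : _ => // i y1 y2 _ <-.
rewrite [in LHS]E (big_morph f (linD fP) (lin0 fP)).
by rewrite (eq_bigr _ (fun i _ => linZ fP (x i : Lam) (fdelta i))); exact: S.
Qed.

Variable U : V -> V.
Hypothesis UP : forall (a : Lam) x y, U (a *: x + y) = a *: U x + U y.
Variable c : K.
Hypothesis c0 : c != 0.
Hypothesis Ures : forall x, fint x -> forall k, (U x k : Lam) 0 = c * (x k : Lam) 0.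

(** A non-zero kernel element could be scaled to be integral with a non-zero residue, on which U
    acts by the invertible scalar c. *)
Lemma residue_scalar_inj x : U x = 0 -> x = 0.
Proof.
move=> Ux; apply: contrapT => xN; have [|a [y [xE y0 [k yk]]]] := @nov_factor R K _ x.
  apply: contrapT => H; apply: xN; apply/funext => i; apply/eqP/negPn/negP => xi.
  by apply: H; exists i.
have xE' : x = nT K a *: (y : V) by apply/funext => i; exact: xE.
have : nT K a *: U y = 0 by rewrite -(linZ UP) -xE'.
move=> /(congr1 (fun f : V => f k)) => H.
have /eqP : nT K a * U y k = 0 :> Lam by exact: H.
rewrite mulf_eq0 (negPf (nT_neq0 _ _)) /= => /eqP Uy.
by have := Ures y0 k; rewrite Uy => /esym/eqP; rewrite mulf_eq0 (negPf c0) (negPf yk).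
Qed.

Lemma residue_scalar_surj y : exists x, U x = y.
Proof.
have [|u uE] := @fin_surj Lam T T (fun i j => U (fdelta i) j) erefl _ y.
  move=> u u0 i; have : U u = 0 by apply/funext => k; rewrite (flin_expand UP); exact: u0.
  by move=> /residue_scalar_inj /(congr1 (fun f : V => f i)).
by exists u; apply/funext => k; rewrite (flin_expand UP); exact: uE.
Qed.

Lemma residue_homotopy_exact (D h : V -> V) : (forall x, U x = D (h x) + h (D x)) ->
  (forall (a : Lam) x y, D (a *: x + y) = a *: D x + D y) ->
  (forall x, D (D x) = 0) -> h 0 = 0 -> forall x, D x = 0 -> exists y, x = D y.
Proof.
(* U is bijective and commutes with D, so a closed x is U z with z closed. *)
move=> UE DP DD h0 x Dx; have [z zE] := residue_scalar_surj x.
have Dz : D z = 0.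
  apply: residue_scalar_inj; rewrite UE DD h0 addr0.
  by rewrite -Dx -zE UE (linD DP) DD add0r.
by exists (h z); rewrite -zE UE Dz h0 addr0.
Qed.

End ResidueScalar.

(** * The contracting homotopy *)

Section Contraction.
Variables (R : realType) (n : nat) (F : floer_setting R n) (l : fI F).
Local Notation C := R[i].
Local Notation Lam := (nov R R[i]).
Local Notation L := (fL l).
Local Notation T := (cb (lH L)).
Local Notation V := (T -> Lam^o).
Local Notation parT := (@cpar R n (lH L)).
Implicit Types (x y : V).
Hypotheses (htorus : is_torus L) (hindex : index_condition L).
Variable e : zbasis (lH1 L) n.
Variable v : 'I_n -> {ffun T -> C}.
Hypothesis v_deg : forall j i, v j i != 0 -> cdeg i = 1%N.
Hypothesis v_basis : forall w : {ffun T -> C}, exists! c : {ffun {set 'I_n} -> C},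
  forall i, w i = \sum_(J : {set 'I_n}) c J * cupprod [seq v j | j <- enum J] i.
Variable xd : 'I_n -> {ffun T -> C}.
Hypothesis xdP : forall i, (forall j, xd i j != 0 -> cdeg j = 1%N) /\
  forall gamma, (zcoord e gamma i)%:~R = \sum_j lev L gamma j * xd i j.
Variable b : mc L.
Hypothesis hb : nondeg_critical (f_nb (l := l)) e b.
Local Notation ml := (mloc b).
Local Notation mulb := (hmul parT ml).
Local Notation one := (@lone _ _ _ l : V).
Local Notation sg := (hsg parT : V -> V).
Local Notation cQ := (critQ e v b).
Local Notation vJ := (vset mulb one (lvec v)).
Local Notation co := (vco b v_basis).
Local Notation kdel := (cdel mulb sg (vuL e v b)).

(** If the least valuation a of the coordinates were negative, T^(-a) x would have zero residue
    while its coordinates would not, against the independence of the cup products. *)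
Lemma vco_int (x : V) J : fint x -> nval_ge 0 (co J x).
Proof.
move=> x0; have [/existsP[J0 uJ0]|] := boolP [exists J, co J x != 0]; last first.
  by rewrite negb_exists => /forallP/(_ J)/negPn/eqP ->.
have [|a [u [uE u0 [J1 u1]]]] := @nov_factor R C _ (fun J => co J x); first by exists J0.
have [a0|a0] := lerP 0 a.
  by rewrite uE mulrC; apply: nval_geMl => //; apply: nval_geW a0 _; exact: nT_ge.
case/eqP: u1; apply: (@cup_indep _ _ _ _ _ v_basis (fun J => u J 0)) => i.
have S0 : \sum_J u J * (vJ J i : Lam) = nT C (- a) * x i.
  rewrite -[in RHS](vcoE b v_basis x i) mulr_sumr; apply: eq_bigr => J' _.
  by rewrite uE mulrA mulrA -nTD addNr mul1r.
have : nval_gt0 (nT C (- a) * x i).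
  rewrite mulrC; apply: nval_gt0M; first exact: x0.
  by move=> j j0 /=; case: eqP => // ja; move: j0; rewrite ja leNgt oppr_gt0 a0.
move=> /nval_gt0P[_]; rewrite -S0 nov_sumE => H; rewrite -[RHS]H.
apply: eq_bigr => J' _; have [vi vr] := vprod_res b v (enum J').
by rewrite res_mul; [congr (_ * _); exact/esym/vr|exact: u0|exact: vi].
Qed.

Let mulbPl a x y z : mulb (a *: x + y) z = a *: mulb x z + mulb y z.
Proof. exact: hmulPl. Qed.
Let mulbPr a x y z : mulb z (a *: x + y) = a *: mulb z x + mulb z y.
Proof. exact: hmulPr. Qed.
Let sgP a x y : sg (a *: x + y) = a *: sg x + sg y.
Proof. exact: hsgP. Qed.
Let mA x y z : mulb x (mulb y z) = mulb (mulb x y) z.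
Proof. exact: (fprodA htorus hindex v_deg v_basis xdP hb). Qed.
Let vu_v i j : mulb (vuL e v b i) (lvec v j) + mulb (lvec v j) (vuL e v b i) = (i == j)%:R *: one.
Proof. exact: (vuL_v htorus hindex v_deg v_basis xdP hb). Qed.

Lemma kdelP i a x y : kdel i (a *: x + y) = a *: kdel i x + kdel i y.
Proof. exact: (cdelP mulbPl mulbPr sgP). Qed.

Lemma vJ_int J : fint (vJ J).
Proof. by have [] := vprod_res b v (enum J). Qed.

Lemma kdel_vJ_int i J : fint (kdel i (vJ J)).
Proof.
have [iJ|iJ] := boolP (i \in J).
  have [k ->] := cdel_vset_in mulbPl mulbPr mA (fprod1 b) (fprodx1 b) (fsg_mul b) (@fsg_one _ _ _ _) (hsg_lvec v_deg) vu_v iJ.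
  move=> t; apply: nval_geMl; last exact: vJ_int.
  by rewrite -nconst_sign; exact: nconst_ge0.
by rewrite (cdel_vset_notin mulbPl mulbPr mA (fprod1 b) (fprodx1 b) (fsg_mul b) (@fsg_one _ _ _ _) (hsg_lvec v_deg) vu_v iJ).
Qed.

Lemma kdel_int i (x : V) : fint x -> fint (kdel i x).
Proof.
move=> x0 k; rewrite [in X in nval_ge 0 X](vco_sum b v_basis x).
rewrite (big_morph _ (linD (kdelP i)) (lin0 (kdelP i))).
have S (I : Type) (r : seq I) (w : I -> V) : (\sum_(i <- r) w i) k = \sum_(i <- r) (w i k : Lam) :> Lam.
  by elim/big_rec2 : _ => // i0 y1 y2 _ <-.
rewrite S; apply: nval_ge_sum => J _; rewrite (linZ (kdelP i)).
by apply: nval_geMl; [exact: vco_int|exact: kdel_vJ_int].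
Qed.

Variable b' : mc L.
Hypothesis bb' : same_rhoW b b'.
Variables (la : R) (d : T -> Lam).
Hypothesis b'E : forall i, (mc_b b' i : Lam) = (mc_b b i : Lam) + nT C la * d i.
Hypothesis d_int : fint d.
Hypothesis d_deg : forall i, d i 0 != 0 -> cdeg i = 1%N.
Hypothesis d_res : exists i, d i 0 != 0.
Local Notation D := (mdiff b b' la).

Let m1b i k : ml [:: i] k = 0.
Proof. exact: (crit_m1 htorus hindex v_deg v_basis xdP hb). Qed.

Let del : {ffun T -> C} := [ffun i => d i 0].

(* Coordinates, in the basis v, of the leading term of b' - b. *)
Definition dcoef (p : 'I_n) : C :=
  \sum_k (\sum_i lev L (e k) i * d i 0) * invmx (trM e v) k p.

Lemma del_expand i : d i 0 = \sum_p dcoef p * v p i.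
Proof.
have dd j : del j != 0 -> cdeg j = 1%N by rewrite ffunE; exact: d_deg.
have := dual_basis_expand xdP dd i; rewrite ffunE => ->.
under [RHS]eq_bigr => p _ do rewrite mulr_suml.
rewrite exchange_big; apply: eq_bigr => k _ /=.
under [RHS]eq_bigr => p _ do rewrite -mulrA.
rewrite -mulr_sumr; congr (_ * _); first by apply: eq_bigr => j _; rewrite ffunE.
under [RHS]eq_bigr => p _ do rewrite (v_expand v_deg xdP) mulr_sumr.
rewrite exchange_big.
transitivity (\sum_q (k == q)%:R * xd q i).
  by rewrite (bigD1 k) //= eqxx mul1r big1 ?addr0 // => q /negPf qk; rewrite eq_sym qk mul0r.
apply: eq_bigr => q _ /=; under [RHS]eq_bigr => p _ do rewrite mulrA.
rewrite -mulr_suml; congr (_ * _).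
by have := mulVmx (trM_unit v_deg v_basis xdP); move=> /matrixP/(_ k q); rewrite !mxE.
Qed.

Lemma dcoef_neq0 : exists p, dcoef p != 0.
Proof.
have [i di] := d_res; apply: contrapT => H; case/eqP: di; rewrite del_expand big1 // => p _.
have [->|h] := eqVneq (dcoef p) 0; first by rewrite mul0r.
by case: H; exists p.
Qed.

Definition delL : V := \sum_p (nconst R (dcoef p) : Lam) *: lvec v p.

Lemma sumVE (I : Type) (r : seq I) (w : I -> V) k :
  (\sum_(i <- r) w i) k = \sum_(i <- r) (w i k : Lam) :> Lam.
Proof. by elim/big_rec2 : _ => // i0 y1 y2 _ <-. Qed.

Lemma delLE i : delL i = nconst R (d i 0).
Proof.
rewrite /delL sumVE del_expand nconst_sum; apply: eq_bigr => p _.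
by rewrite nconstM.
Qed.

Lemma sg_delL : sg delL = - delL.
Proof.
rewrite /delL (sum_lin _ _ sgP) -sumrN; apply: eq_bigr => p _.
by rewrite (hsg_lvec v_deg) scalerN.
Qed.

Lemma kdel_delL j : kdel j delL = (nconst R (dcoef j) : Lam) *: one.
Proof.
rewrite /delL (sum_lin _ _ (kdelP j)) (bigD1 j) //= big1 => [|p /negPf pj].
  by rewrite addr0 (cdel_v mulbPl (hsg_lvec v_deg) vu_v) eqxx scale1r.
by rewrite (cdel_v mulbPl (hsg_lvec v_deg) vu_v) eq_sym pj scale0r scaler0.
Qed.

Variable j : 'I_n.
(** At leading order the differential is multiplication by [delL] on the right. Composing the
    contraction with [sg] makes it anticommute with this multiplication up to the scalar
    [dcoef j]. *)
Definition hom_op (x : V) : V := sg (kdel j x).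

Lemma hom_opP a x y : hom_op (a *: x + y) = a *: hom_op x + hom_op y.
Proof. by rewrite /hom_op kdelP sgP. Qed.

Lemma sg_int (x : V) : fint x -> fint (sg x).
Proof.
move=> x0 k; rewrite /hsg; apply: nval_geMl => //.
by rewrite -nconst_sign; exact: nconst_ge0.
Qed.

Lemma hom_op_int (x : V) : fint x -> fint (hom_op x).
Proof. by move=> x0; apply: sg_int; exact: kdel_int. Qed.

Lemma hom_op_pos (x : V) : fpos x -> fpos (hom_op x).
Proof.
move=> xp k; rewrite (flin_expand hom_opP); apply: nval_gt0_sum => i _; rewrite mulrC.
apply: nval_gt0M; last exact: xp.
by apply: hom_op_int => q; rewrite /fdelta -nconst_natr; exact: nconst_ge0.
Qed.

Lemma hom_op_mul x : hom_op (mulb x delL) =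
  - mulb (hom_op x) delL + (nconst R (dcoef j) : Lam) *: x.
Proof.
rewrite /hom_op (cdelM mulbPl mulbPr mA (fsg_mul b)) kdel_delL.
have rP (z : V) : forall (a : Lam) u w, mulb z (a *: u + w) = a *: mulb z u + mulb z w.
  by move=> a u w; exact: mulbPr.
rewrite (linD sgP) (fsg_mul b) sg_delL (linN (rP _)) (linZ (rP _)) (linZ sgP).
by rewrite (fprodx1 b) hsgK.
Qed.

Lemma mdiff_delL (x : V) : fint x -> fpos (D x - mulb x delL : V).
Proof.
move=> x0 k; apply/nval_gt0P.
have di : fint delL by move=> i; rewrite delLE; exact: nconst_ge0.
have [mi mr] := hmul_res b x0 di.
split; first by apply: nval_geB; [exact: (mdiff_int bb' m1b b'E d_int x0)|exact: mi].
rewrite [LHS](_ : _ = (D x k : Lam) 0 - (mulb x delL k : Lam) 0) // mr.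
rewrite (mdiff_res bb' m1b b'E d_int d_deg k x0).
apply/eqP; rewrite subr_eq0; apply/eqP; apply: eq_bigr => p _; apply: eq_bigr => q _.
by rewrite delLE res_nconst.
Qed.

Definition hom_lap (x : V) : V := D (hom_op x) + hom_op (D x).

Lemma hom_lapP (a : Lam) x y : hom_lap (a *: x + y) = a *: hom_lap x + hom_lap y.
Proof. by rewrite /hom_lap mdiffP !hom_opP mdiffP addrACA -scalerDr. Qed.

(** Modulo Lambda_+ the differential may be replaced by multiplication by [delL]; the two resulting
    products cancel by [hom_op_mul] and leave the scalar. *)
Lemma hom_lap_res (x : V) : fint x -> forall k, (hom_lap x k : Lam) 0 = dcoef j * (x k : Lam) 0.
Proof.
move=> x0 k.
have E : hom_lap x = (nconst R (dcoef j) : Lam) *: x +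
   ((D (hom_op x) - mulb (hom_op x) delL) + hom_op (D x - mulb x delL)).
  rewrite /hom_lap (linD hom_opP) (linN hom_opP) hom_op_mul opprD opprK.
  exact: zmod_aux.
have /nval_gt0P[_ r1] := mdiff_delL (hom_op_int x0) k.
have /nval_gt0P[_ r2] := hom_op_pos (mdiff_delL x0) k.
rewrite E.
rewrite [LHS](_ : _ = ((nconst R (dcoef j) : Lam) * (x k : Lam)) 0 + (((D (hom_op x) - mulb (hom_op x) delL) k : Lam) 0 + (hom_op (D x - mulb x delL) k : Lam) 0)) // r1 r2 !addr0 res_mul ?res_nconst //; exact: nconst_ge0.
Qed.

Hypothesis dj : dcoef j != 0.

Lemma mdiff_exact x : D x = 0 -> exists y, x = D y.
Proof.
apply: (residue_homotopy_exact hom_lapP dj hom_lap_res (fun x => erefl)).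
- exact: mdiffP.
- exact: (mdiff_sqr bb').
exact: (lin0 hom_opP).
Qed.

End Contraction.

(** * Acyclicity of the morphisms between distinct branes *)

Section DistinctBranes.
Variables (R : realType) (n : nat) (F : floer_setting R n) (l : fI F).
Local Notation C := R[i].
Local Notation Lam := (nov R R[i]).
Local Notation L := (fL l).
Local Notation T := (cb (lH L)).
Local Notation V := (T -> Lam^o).
Local Notation parT := (@cpar R n (lH L)).
Local Notation G := (gen (fuk F)).
Hypotheses (htorus : is_torus L) (hindex : index_condition L).

Definition acyclic_pair (P Q : fobj (fL (f := F))) := forall x : G -> Lam, hvec P Q x ->
  (forall g, mu1 x g = 0) -> exists2 y : G -> Lam, hvec P Q y & forall g, x g = mu1 y g.

Lemma empty_acyclic (P Q : fobj (fL (f := F))) :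
  (forall g : G, ~ homset P Q g) -> acyclic_pair P Q.
Proof.
move=> H x xPQ _; have x0 g : x g = 0 by apply/eqP; apply: contraT => /xPQ /H.
exists x => // g; rewrite x0 /mu1 fsbig1 // => h _.
by rewrite x0 mul0r.
Qed.

Lemma mc_ext (b b' : mc L) : inhabited T -> same_rhoW b b' -> mc_b b = mc_b b' -> b = b'.
Proof.
case: b b' => [r rc B Bo Bp W We] [r' rc' B' Bo' Bp' W' We'] ti [/= er eW] eB.
move: rc' Bo' Bp' We'; rewrite -er -eW -eB => rc' Bo' Bp' We'.
by rewrite (Prop_irrelevance rc rc') (Prop_irrelevance Bo Bo') (Prop_irrelevance Bp Bp') (Prop_irrelevance We We').
Qed.

Lemma mc_rho_neq0 (b : mc L) gamma : mc_rho b gamma != 0.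
Proof.
have [r0 rD] := mc_rho_char b; apply/eqP => h.
have := rD gamma (- gamma); rewrite subrr r0 h mul0r => /eqP.
by rewrite oner_eq0.
Qed.

(** The quotient of the two characters is a non-trivial local system on a torus, so the hom space
    has no generators. *)
Lemma rho_neq_acyclic (b b' : mc L) : mc_W b = mc_W b' -> mc_rho b <> mc_rho b' ->
  acyclic_pair (obj b) (obj b').
Proof.
move=> eW rN; pose ch gamma := mc_rho b' gamma / mc_rho b gamma.
have chc : character ch.
  have [r0 rD] := mc_rho_char b; have [r0' rD'] := mc_rho_char b'.
  split=> [|x y]; first by rewrite /ch r0 r0' divr1.
  by rewrite /ch rD rD' invfM mulrACA.
have [gam gamN] : exists gamma, ch gamma != 1.
  apply: contrapT => H; apply: rN; apply/funext => gam; apply/eqP; rewrite eq_sym.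
  apply: contraT => h; case: H; exists gam.
  by apply: contraNneq h => /(canRL (mulfVK (mc_rho_neq0 b gam))); rewrite mul1r => ->.
have c0 := f_torus_loc htorus chc (ex_intro _ gam gamN).
have [f [_ _ fs] _] := fuk_loc eW.
apply: empty_acyclic => g /fs[i _ _]; have := c0.
by rewrite (cardD1 i).
Qed.

Variable e : zbasis (lH1 L) n.

Lemma rho_eq_acyclic (b b' : mc L) : same_rhoW b b' -> b' <> b ->
  nondeg_critical (f_nb (l := l)) e b -> in_H1 (mc_b b') -> acyclic_pair (obj b) (obj b').
Proof.
move=> bb' bN hb b1'; have [v v_deg v_basis] := f_torus_cup htorus.
have [xd xdP] := dual_basis e; have [b1 _ _] := hb.
(* Since rho and W agree, b' <> b means b'_+ <> b_+ by [mc_ext]; the leading power of T of the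
   difference is split off. *)
have [|la [d [dE d0 dN]]] := @nov_factor R C _ (fun i => (mc_b b' i : Lam) - mc_b b i).
  apply: contrapT => H; apply: bN; apply/esym/mc_ext => //; first exact: torus_inh v_basis.
  apply/ffunP => i; apply/eqP; rewrite eq_sym -subr_eq0; apply: contraT => h.
  by case: H; exists i.
have b'E i : (mc_b b' i : Lam) = (mc_b b i : Lam) + nT C la * d i by rewrite -dE addrC subrK.
have d_deg i : d i 0 != 0 -> cdeg i = 1%N.
  move=> di; have [bi|/b1//] := eqVneq (mc_b b i) 0.
  have [bi'|/b1'//] := eqVneq (mc_b b' i) 0.
  have /esym/eqP := dE i; rewrite bi bi' subrr mulf_eq0 (negPf (nT_neq0 _ _)) /= => /eqP dz.
  by rewrite dz eqxx in di.
have [j dj] := dcoef_neq0 v_deg v_basis xdP d_deg dN.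
have fgh i : homset (obj b) (obj b') (fgen b b' i).
  by have [s _ _] := fgen_hom bb'; apply: s.
have fgi : injective (fgen b b').
  by move=> p q; have [_ + _] := fgen_hom bb'; move=> /(_ p q); rewrite !inE; apply.
have fgs g : homset (obj b) (obj b') g -> exists i, g = fgen b b' i.
  by have [_ _ s] := fgen_hom bb' => /s[i _ <-]; exists i.
have mu1E (z : G -> Lam) g : hvec (obj b) (obj b') z ->
    mu1 z g = \sum_i z (fgen b b' i) * mu [:: fgen b b' i] g.
  move=> zP; rewrite /mu1 (fsbig_inj_fin (f := fgen b b')) // => h hN.
  case: (eqVneq (z h) 0) => [->|/zP/fgs[i hi]]; first by rewrite mul0r.
  by case: (hN i).
move=> x xP x0; pose x' : V := fun i => x (fgen b b' i).
have Dx : mdiff b b' la x' = 0.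
  by apply/funext => k; rewrite /mdiff -(mu1E x) // x0 mulr0.
have [y yE] := mdiff_exact htorus hindex v_deg v_basis xdP hb bb' b'E d0 d_deg dj Dx.
(* [mdiff] is m_1 divided by T^la, so a primitive for m_1 is the one for [mdiff] divided by T^la. *)
pose z (g : G) : Lam := (nT C la)^-1 * \sum_i (y i : Lam) * (g == fgen b b' i)%:R.
have zE i : z (fgen b b' i) = (nT C la)^-1 * y i.
  rewrite /z (bigD1 i) //= eqxx mulr1 big1 ?addr0 // => p /negPf pi.
  by rewrite (inj_eq fgi) eq_sym pi mulr0.
have zP : hvec (obj b) (obj b') z.
  move=> g zg; have [i ->] : exists i, g = fgen b b' i; last exact: fgh.
  apply: contrapT => H; case/eqP: zg; rewrite /z big1 ?mulr0 // => i _.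
  by case: eqP => [gi|]; [case: H; exists i|rewrite mulr0].
exists z => // g; rewrite mu1E //.
have [[k ->]|gN] := pselect (exists k, g = fgen b b' k).
  have := congr1 (fun f : V => f k) yE; rewrite /x' /mdiff mulr_sumr => ->.
  by apply: eq_bigr => i _; rewrite zE mulrA.
transitivity (0 : Lam); first by apply/eqP; apply: contraT => /xP/fgs/gN.
apply/esym/big1 => i _; apply/eqP; rewrite mulf_eq0; apply/orP; right; apply: contraT.
move=> /mu_hom /=; have [-> ->] := fgh i; move=> [/esym sg /esym tg].
by case: gN; apply: fgs.
Qed.

Lemma acyclic_distinct (b b' : mc L) : b' <> b ->
  nondeg_critical (f_nb (l := l)) e b -> in_H1 (mc_b b') -> acyclic_pair (obj b) (obj b').
Proof.
move=> bN hb b1'; have [eW|WN] := pselect (mc_W b = mc_W b'); last first.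
  by apply: empty_acyclic => g [sg tg]; apply: WN; have := fuk_W g; rewrite sg tg.
have [er|rN] := pselect (mc_rho b = mc_rho b'); last exact: rho_neq_acyclic.
exact: rho_eq_acyclic.
Qed.

End DistinctBranes.

(** * Separation of the characters *)

Lemma kap_delta_aux (K : comNzRingType) (s a x : K) : s * a * x = a * (s * x).
Proof. by ring. Qed.

Section Separation.
Variables (R : realType) (n : nat) (F : floer_setting R n) (l : fI F).
Local Notation C := R[i].
Local Notation Lam := (nov R R[i]).
Local Notation L := (fL l).
Local Notation T := (cb (lH L)).
Local Notation V := (T -> Lam^o).
Local Notation parT := (@cpar R n (lH L)).
Local Notation G := (gen (fuk F)).
Local Notation QHX := (QH (fX F)).
Local Notation fd := (@fdelta R R[i] T).
Variables (b b' : mc L).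
Hypothesis m1 : forall i k, mloc b [:: i] k = 0.
Hypothesis m1' : forall i k, mloc b' [:: i] k = 0.
Hypothesis sup : supercentral_scalars b.
Hypothesis sup' : supercentral_scalars b'.
Hypothesis ti : inhabited T.

Lemma kap_deltaE i : kap (fd i) =
  \sum_k (-1) ^+ (n * parT i) * ((@lone _ _ _ l k : Lam) * @cycT _ _ _ l k i).
Proof.
rewrite /kap (bigD1 i) //= [X in _ + X]big1 ?addr0 => [|j /negPf ji].
  by apply: eq_bigr => k _; rewrite /fdelta eqxx mulr1.
by rewrite big1 // => k _; rewrite /fdelta ji mulr0 mul0r.
Qed.

(** The Mukai pairing is computed on homogeneous chains, so a is replaced by a basis vector. *)
Lemma kap_delta (a : V) : kap a != 0 -> exists i, kap (fd i) != 0.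
Proof.
move=> a0; apply: contrapT => H; case/eqP: a0; rewrite /kap big1 // => i _.
have [h|h] := eqVneq (kap (fd i)) 0; last by case: H; exists i.
transitivity ((a i : Lam) * kap (fd i)); last by rewrite h mulr0.
rewrite kap_deltaE mulr_sumr; apply: eq_bigr => k _.
exact: kap_delta_aux.
Qed.

Lemma ext_delta_homog (b0 : mc L) i : hhomog (parT i) (ext b0 (fd i)).
Proof.
apply: ext_homog => k; rewrite /fdelta; case: (eqVneq k i) => [->//|_]; by rewrite eqxx.
Qed.

Lemma chain0_delta_homog (b0 : mc L) i : chhomog (parT i) (chain0 (ext b0 (fd i))).
Proof.
move=> [g [|h w]]; rewrite /chain0 /chdeg /= ?eqxx // => g0.
by rewrite addn0 oddb; exact: (ext_delta_homog g0).
Qed.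

(** An acyclic complex has the empty family as a basis of its cohomology, and the supertrace is an
    empty sum. *)
Lemma muk_acyclic i j : acyclic_pair (obj b) (obj b') ->
  muk (chain0 (ext b (fd i))) (chain0 (ext b' (fd j))) = 0.
Proof.
move=> ac.
rewrite (muk_length0 (@ext_hvec _ _ _ _ b (fd i)) (@ext_delta_homog b i) _
  (@ext_hvec _ _ _ _ b' (fd j)) (@ext_delta_homog b' j) _ (r := 0)
  (eps := fun _ => false) (k := fun _ _ => 0) (M := 0)).
- by rewrite big_ord0.
- by move=> g; apply: (mu1_eq0 m1); exact: ext_hvec.
- by move=> g; apply: (mu1_eq0 m1'); exact: ext_hvec.
- split=> [[]//|x xP x0]; have [y yP yE] := ac x xP x0.
  exists [ffun=> 0]; split; first by exists y => // g; rewrite big_ord0 add0r.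
  by move=> c _; apply/ffunP => -[].
by case.
Qed.

Local Notation Z := (zdual m1 sup ti).
Local Notation Z' := (zdual m1' sup' ti).

(** As [kap] does not depend on the Maurer-Cartan element, one basis vector yields a non-zero
    multiple of Z at b and of Z' at b'. Their pairing vanishes with the Mukai pairing. *)
Lemma zdual_orth (a : V) : kap a != 0 -> acyclic_pair (obj b) (obj b') -> chi m1' sup' Z = 0.
Proof.
move=> /kap_delta[i ki] ac; have := fp_muk (chain0_cycle m1 (fd i)) (chain0_cycle m1' (fd i))
  (@chain0_delta_homog b i) (@chain0_delta_homog b' i).
rewrite (oc_chain0 m1 sup ti) (oc_chain0 m1' sup' ti) muk_acyclic // mulr0.
rewrite qpairZr (zdualP m1' sup' ti) (chiZ m1' sup' ti) => /eqP.
by rewrite !mulf_eq0 (negPf ki) /= => /eqP.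
Qed.

(** Z separates the characters, and so does its even part, since characters vanish on odd classes.
    Evenness is what makes the later multiplications commute and q(y) an even cocycle. *)
Lemma separating_even (a : V) : kap a != 0 -> acyclic_pair (obj b) (obj b') -> chi m1 sup Z != 0 ->
  exists2 y : QHX, qhomog false y & chi m1 sup y != chi m1' sup' y.
Proof.
move=> a0 ac Z0.
pose y : QHX := [ffun i => if cpar i then 0 else Z i].
pose o : QHX := [ffun i => if cpar i then Z i else 0].
have ye : qhomog false y by move=> i; rewrite ffunE; case: (cpar i) => //; rewrite eqxx.
have oo : qhomog true o by move=> i; rewrite ffunE; case: (cpar i) => //; rewrite eqxx.
have E : Z = (1 : Lam) *: y + o.
  by rewrite scale1r; apply/ffunP => i; rewrite !ffunE; case: (cpar i); rewrite ?add0r ?addr0.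
exists y => //; have := zdual_orth a0 ac; move: Z0.
rewrite E (chi_lin m1 sup ti) (chi_lin m1' sup' ti) (chi_odd m1 sup ti oo) (chi_odd m1' sup' ti oo) !mul1r !addr0.
by move=> h ->.
Qed.

End Separation.

(** * Orthogonality of the idempotents *)

Section QuantumDegree.
Variables (R : realType) (n : nat) (X : ambient R n).
Local Notation Lam := (nov R R[i]).
Local Notation B := (cb (aH X)).

Lemma cpair_par (i j : B) : cpair i j != 0 -> cpar i = cpar j.
Proof.
move=> h; have [k ck] : exists k, ccup i j k * cint k != 0.
  apply: contrapT => H; case/eqP: h; rewrite /cpair big1 // => k _; apply/eqP/negPn/negP => hk.
  by apply: H; exists k.
move: ck; rewrite mulf_eq0 negb_or => /andP[/ccup_deg dk /cint_deg]; rewrite dk => /(congr1 odd).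
by rewrite oddD odd_double /cpar; case: (odd (cdeg i)); case: (odd (cdeg j)).
Qed.

Lemma aqm_par (i j m : B) : aqm i j m != 0 -> cpar m = cpar i (+) cpar j.
Proof.
move=> h; apply/eqP/negPn/negP => pm; case/eqP: h.
(* The part of the product of the wrong parity. The degree axiom and the parity of the pairing make
   it orthogonal to every basis class. *)
pose w m := if cpar m == cpar i (+) cpar j then 0 else aqm i j m : Lam.
have : w m = 0; last by rewrite /w (negPf pm).
apply: cpd_nov => k; have [pk|pk] := eqVneq (cpar k) (cpar i (+) cpar j).
  apply: big1 => p _; have [->|/cpair_par pp] := eqVneq (cpair p k) 0; first by rewrite nconst0 mulr0.
  by rewrite /w pp pk eqxx mul0r.
transitivity (\sum_p aqm i j p * nconst R (cpair p k) : Lam).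
  apply: eq_bigr => p _; have [->|/cpair_par pp] := eqVneq (cpair p k) 0; first by rewrite nconst0 !mulr0.
  by rewrite /w pp (negPf pk).
apply: (nsums_uniq (aqmE i j k)).
suff -> : (fun alpha => nTarea (aom X alpha) * nconst R (gw alpha i j k)) = (fun=> 0 : Lam).
  by split=> [E|r]; [apply: sub_finite_set (finite_set0 _) => a; apply|rewrite fsbig1].
apply/funext => al; have [->|/gw_deg d] := eqVneq (gw al i j k) 0; first by rewrite nconst0 mulr0.
case/eqP: pk; move: d; rewrite /cpar => d.
have : odd (cdeg i + cdeg j + cdeg k) = false by lia.
by rewrite !oddD; case: (odd (cdeg i)); case: (odd (cdeg j)); case: (odd (cdeg k)).
Qed.

Lemma qmul_homog p (x y : QH X) : qhomog false x -> qhomog p y -> qhomog p (qmul x y).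
Proof.
move=> xe yp k; rewrite ffunE => h; apply/eqP/negPn/negP => pk; case/eqP: h.
apply: big1 => i _; have [->|/xe pi] := eqVneq (x i) 0.
  by apply: big1 => j _; rewrite !mul0r.
apply: big1 => j _; have [->|/yp pj] := eqVneq (y j) 0; first by rewrite mulr0 mul0r.
have [->|/aqm_par pm] := eqVneq (aqm i j k) 0; first by rewrite mulr0.
by rewrite pm pi pj addFb eqxx in pk.
Qed.

Lemma qone_even : qhomog false (qone X).
Proof.
move=> i; rewrite ffunE => h; rewrite /cpar cone_deg //.
by apply: contraNneq h => ->; rewrite nconst0.
Qed.

Lemma qdelta_homog (i : B) : qhomog (cpar i) (qdelta i).
Proof. by move=> j; rewrite ffunE; case: (eqVneq j i) => [->//|_]; rewrite eqxx. Qed.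

End QuantumDegree.

(** * Generalized eigenspaces for distinct eigenvalues *)

Section GeneralizedEigenvalues.
Variables (K : fieldType) (V : lmodType K) (A A' : V -> V) (c : K).
Hypothesis AP : forall a x y, A (a *: x + y) = a *: A x + A y.
Hypothesis c0 : c != 0.
Hypothesis A'E : forall x, A' x = A x + c *: x.

Lemma iter_comm k x : iter k A' (A x) = A (iter k A' x).
Proof.
elim: k => //= k ->; rewrite !A'E (linD AP) (linZ AP) //.
Qed.

(** Induction on k brings x into the kernel of A, where A' is multiplication by the non-zero scalar
    c and cannot be nilpotent unless x = 0. *)
Lemma generalized_eigen_disjoint k k' x : iter k A x = 0 -> iter k' A' x = 0 -> x = 0.
Proof.
elim: k x => [//|k IH] x; rewrite iterSr => Ax A'x.
have {IH}x1 : A x = 0 by apply: IH => //; rewrite iter_comm A'x; exact: lin0.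
have E j : iter j A' x = c ^+ j *: x.
  elim: j => [|j IHj] /=; first by rewrite scale1r.
  by rewrite IHj A'E (linZ AP) x1 scaler0 add0r scalerA exprS.
move: A'x; rewrite E => /eqP; rewrite scaler_eq0 expf_eq0 (negPf c0) andbF /=.
by move/eqP.
Qed.

End GeneralizedEigenvalues.

Lemma hpair_signed_aux (K : comNzRingType) (s c t x : K) : s * c * t * x = s * (c * t * x).
Proof. by ring. Qed.

(** * Nilpotent action on the image of the open-closed map *)

Section Nilpotency.
Variables (R : realType) (n : nat) (F : floer_setting R n) (l : fI F).
Local Notation C := R[i].
Local Notation Lam := (nov R R[i]).
Local Notation L := (fL l).
Local Notation T := (cb (lH L)).
Local Notation V := (T -> Lam^o).
Local Notation parT := (@cpar R n (lH L)).
Local Notation G := (gen (fuk F)).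
Local Notation QHX := (QH (fX F)).
Variable b : mc L.
Hypothesis m1 : forall i k, mloc b [:: i] k = 0.
Hypothesis sup : supercentral_scalars b.
Hypothesis ti : inhabited T.
Local Notation chib := (chi m1 sup).
Local Notation ml := (mloc b).

Section Filtration.
Variable y : QHX.
Hypothesis y_even : qhomog false y.
Hypothesis y0 : chib y = 0.
Let phi := cloc b (fq y).

Let phi_even : chom parT false phi.
Proof.
move=> w g /(fq_homog y_even); rewrite /cpardeg /cdeg_at par_fgen shpar_map; exact.
Qed.

Let phi_closed w g : cobdT parT ml phi w g = 0.
Proof. by have [pc p0] := fq_cocycle y; rewrite /phi -(cobd_loc b w g pc) p0. Qed.

Let phi_nil g : phi [::] g = 0.
Proof.
have := congr1 (fun f : V => f g) (chiE m1 sup y); rewrite y0 scale0r; exact.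
Qed.

(** The length zero part of phi is zero because the character vanishes on y, so phi uses at least
    one letter in addition to the k letters needed by psi. *)
Lemma mulT_vanish psi k : (forall w g, (size w < k)%N -> psi w g = 0) ->
  forall w g, (size w < k.+1)%N -> mulT parT ml phi psi w g = 0.
Proof.
move=> H w g wk; rewrite /mulT big_seq big1 // => t /split3P wt.
rewrite big_seq big1 // => u /split3P ut; apply: big1 => h _; apply: big1 => p _.
have [t0|t0] := eqVneq t.1.2 [::]; first by rewrite t0 phi_nil !(mulr0, mul0r).
rewrite (H u.1.2) ?mulr0 ?mul0r //.
move: wk; rewrite wt ut !size_cat; move: t0; case: (t.1.2) => //= q s _; lia.
Qed.

(** One more factor y multiplies psi by phi, which raises the length; the coboundary stays a
    coboundary by [mulT_cobdT], and [fq_mul] adds another one. *)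
Lemma fq_filtration k x : exists psi eta,
  (forall w g, cloc b (fq (iter k (qmul y) x)) w g = psi w g + cobdT parT ml eta w g) /\
  forall w g, (size w < k)%N -> psi w g = 0.
Proof.
elim: k => [|k [psi [eta [E psi0]]]].
  exists (cloc b (fq x)), (fun _ _ => 0); split=> // w g.
  rewrite /cobdT big1 ?addr0 // => t _; rewrite big1 // => h _.
  by rewrite !(mulr0, mul0r) subrr.
have [zeta zC zE] := fq_mul y (iter k (qmul y) x).
exists (mulT parT ml phi psi), (fun w g => mulT parT ml phi eta w g + cloc b zeta w g).
split; last exact: mulT_vanish.
move=> w g; rewrite (cobdTD parT ml (fun _ _ => erefl)).
rewrite -(mulT_cobdT (@mloc_deg _ _ _ _ b) (@mloc_rel _ _ _ _ b)) // addrA.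
rewrite -(mulTD parT ml phi E) -(cochain_mul_loc b w g (fq_cocycle y).1 (fq_cocycle _).1).
by rewrite -(cobd_loc b w g zC) -zE addrC subrK.
Qed.

(** The chain c need not be homogeneous. In a non-zero term the degrees of q(x) and of the cyclic
    pairing force |z| = p + n modulo 2, so the sign in the definition of p is constant. *)
Lemma hpair_signed p x c : qhomog p x ->
  hpair (fq x) (fun z => (-1) ^+ (n * chdeg z) * c z) = (-1) ^+ (n * (p + n)) * hpair (A := fuk F) (fq x) c.
Proof.
move=> xp; rewrite /hpair mulr_fsumr; apply: eq_fsbigr => z _.
have [->|cz] := eqVneq (\sum_(g \in [set: G]) fq x z.2 g * cyc g z.1) 0.
  by rewrite !mulr0.
have [g] : exists g, fq x z.2 g * cyc g z.1 != 0.
  apply: contrapT => H; case/eqP: cz; apply: fsbig1 => g _; apply/eqP/negPn/negP => h.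
  by apply: H; exists g.
rewrite mulf_eq0 negb_or => /andP[/(fq_homog xp) dg /cyc_deg pg].
have -> : (-1) ^+ (n * chdeg z) = (-1) ^+ (n * (p + n)) :> Lam; last exact: hpair_signed_aux.
apply: sign_eq; rewrite !oddM -dg /chdeg /cpardeg !oddD !oddb -pg.
by case: (par g); case: (par z.1); case: (odd (shpar _ _)); rewrite ?andbF ?andbT.
Qed.

Lemma qpair_iter k x e : qpair (iter k (qmul y) x) e = qpair x (iter k (qmul y) e).
Proof.
elim: k e => // k IH e.
by rewrite iterS -qmul_comm // qpair_frob IH -iterSr.
Qed.

(** Pairing x with y^k * e is pairing the chain with q(y^k * x), up to a sign for homogeneous x.
    This is a coboundary plus a cochain vanishing on words shorter than k, and k = N + 1 exceeds
    every word of the chain. *)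
Lemma oc_image_nilpotent e : e != 0 -> in_oc_image b e -> exists k, iter k (qmul y) e = 0.
Proof.
move=> e0 [c [cc c_on ce]].
(* [oc_map] takes the default value 0 when no class represents the functional. As e is non-zero, it
   satisfies the defining relation. *)
have eP x : qpair x e = hpair (fq x) (fun z => (-1) ^+ (n * chdeg z) * c z).
  move: ce e0; rewrite /oc_map; case: xgetP => [v _ vP <- _|_ <-]; first exact: vP.
  by rewrite eqxx.
have [N [H [HE HD Hb H0]]] := hpair_local cc c_on.
exists N.+1; apply: qpair_inj => x; rewrite qpair0r.
have lin (g : QHX -> Lam) : (forall (a : Lam) u v, g (a *: u + v) = a * g u + g v) ->
    (forall i, g (qdelta i) = 0) -> g x = 0.
  move=> gP g0; have gz : g 0 = 0.
    have := gP 1 0 0; rewrite scale1r addr0 mul1r => gz.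
    by apply: (addrI (g 0)); rewrite addr0 -gz.
  rewrite [x]qdelta_sum; elim/big_ind : _ => // [u v u0 v0|i _].
    by rewrite -[u]scale1r gP u0 v0 mulr0 addr0.
  by rewrite -[_ *: _]addr0 gP g0 gz mulr0 addr0.
(* Testing on the classes [qdelta i] suffices, and their homogeneity is what [hpair_signed]
   requires. *)
apply: (lin (fun x => qpair x (iter N.+1 (qmul y) e))) => [a u v|i]; first exact: qpairPl.
rewrite -qpair_iter.
have hom k : qhomog (cpar i) (iter k (qmul y) (qdelta i)).
  by elim: k => [|k IH] /=; [exact: qdelta_homog|exact: qmul_homog].
rewrite eP (hpair_signed _ (hom _)) HE.
have [psi [eta [E psi0]]] := fq_filtration N.+1 (qdelta i).
rewrite (_ : cloc b _ = fun w g => psi w g + cobdT parT ml eta w g); last first.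
  by apply/funext => w; apply/funext => g; exact: E.
by rewrite HD Hb H0 ?addr0 ?mulr0 // => w g wN; apply: psi0.
Qed.

End Filtration.

End Nilpotency.

Lemma shift_aux (K : pzRingType) (V : lmodType K) (a a' : K) (u w : V) :
  - a' *: u + w = (- a *: u + w) + (a - a') *: u.
Proof. by rewrite addrAC -scalerDl addrA addNr add0r. Qed.

(** * Products of elements with distinct generalized eigenvalues *)

Section Orthogonality.
Variables (R : realType) (n : nat) (F : floer_setting R n) (l : fI F).
Local Notation Lam := (nov R R[i]).
Local Notation L := (fL l).
Local Notation QHX := (QH (fX F)).
Local Notation one := (qone (fX F)).

Lemma qmul_iterl (y x w : QHX) k : iter k (qmul y) (qmul x w) = qmul (iter k (qmul y) x) w.
Proof. by elim: k => //= k ->; rewrite qmulA. Qed.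

Lemma qmul_iterr (y x w : QHX) k : qhomog false y ->
  iter k (qmul y) (qmul x w) = qmul x (iter k (qmul y) w).
Proof. by move=> ye; elim: k => //= k ->; rewrite -!qmulA (@qmul_comm _ _ _ x y ye). Qed.

Lemma qmul0l (x : QHX) : qmul 0 x = 0.
Proof. by apply: (lin0 (f := fun y => qmul y x)) => a u v; exact: qmulPl. Qed.

Lemma qmul0r (x : QHX) : qmul x 0 = 0.
Proof. by apply: (lin0 (f := qmul x)) => a u v; exact: qmulPr. Qed.

Lemma qshift_even (y : QHX) (a : Lam) : qhomog false y -> qhomog false (a *: one + y).
Proof.
move=> ye i; case: (boolP (cpar i)) => // pi.
have -> : (a *: one + y) i = (a * (one i : Lam) + (y i : Lam) : Lam) by rewrite !ffunE.
have [->|/ye] := eqVneq (y i) 0; last by rewrite pi.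
have [->|/(@qone_even _ _ _ _)] := eqVneq (one i) 0; last by rewrite pi.
by rewrite mulr0 addr0 eqxx.
Qed.

(** Multiplication by an even class can be moved onto either factor of e * e', so the product is a
    generalized eigenvector of y for both a and a'. *)
Lemma nilpotent_orthogonal (y e e' : QHX) (a a' : Lam) k k' : qhomog false y -> a != a' ->
  iter k (qmul (- a *: one + y)) e = 0 -> iter k' (qmul (- a' *: one + y)) e' = 0 ->
  qmul e e' = 0.
Proof.
move=> ye aN he he'; pose A := qmul (- a *: one + y); pose A' := qmul (- a' *: one + y).
have AP (c : Lam) u v : A (c *: u + v) = c *: A u + A v by exact: qmulPr.
have A'E u : A' u = A u + (a - a') *: u.
  rewrite [LHS](qmulPl (- a') one y u) [A u](qmulPl (- a) one y u) qone_mul; exact: shift_aux.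
apply: (generalized_eigen_disjoint AP _ A'E (k := k) (k' := k')).
- by rewrite subr_eq0.
- by rewrite qmul_iterl he qmul0l.
by rewrite [LHS](qmul_iterr e e' k' (@qshift_even y (- a') ye)) he' qmul0r.
Qed.

End Orthogonality.

Theorem proposition1p3 (R : realType) (n : nat) (F : floer_setting R n)
    (l : fI F)
    (htorus : is_torus (fL l))
    (hindex : index_condition (fL l))
    (e : zbasis (lH1 (fL l)) n)
    (b : mc (fL l)) (hb : nondeg_critical (f_nb (l := l)) e b) :
  (exists eb : QH (fX F), idempotent_of b eb /\ summand_iso_Lambda eb) /\
  (forall b' : mc (fL l), nondeg_critical (f_nb (l := l)) e b' -> b' <> b ->
   forall eb eb' : QH (fX F), idempotent_of b eb -> idempotent_of b' eb' ->
   qmul eb eb' = 0).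
Proof.
have [m1 [sup [ti [[a a0] Z0]]]] := crit_package htorus hindex hb.
split.
  exists (ecrit m1 sup ti); split; first exact: ecrit_idempotent a0.
  exact: ecrit_summand.
move=> b' hb' bN eb eb' [eb0 _ ebI] [eb'0 _ eb'I].
have [m1' [sup' [_ _]]] := crit_package htorus hindex hb'.
have ac := acyclic_distinct htorus hindex bN hb (let: And3 h _ _ := hb' in h).
have [y ye yN] := separating_even m1' sup' a0 ac Z0.
(* Subtracting the scalar chi(y) keeps y even and places it in the kernel of the character, as the
   filtration argument demands. *)
have nil (b0 : mc (fL l)) (n1 : forall i k, mloc b0 [:: i] k = 0) (s : supercentral_scalars b0) e0 :
    e0 != 0 -> in_oc_image b0 e0 -> exists k, iter k (qmul (- chi n1 s y *: qone (fX F) + y)) e0 = 0.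
  move=> e00 e0I; apply: (oc_image_nilpotent (m1 := n1) (sup := s)) => //.
    exact: qshift_even.
  by rewrite (chi_lin n1 s ti) (chi_one n1 s ti) mulr1 addNr.
have [k hk] := nil b m1 sup eb eb0 ebI.
have [k' hk'] := nil b' m1' sup' eb' eb'0 eb'I.
exact: nilpotent_orthogonal ye yN hk hk'.
Qed.
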